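(* Let $n\ge 1$, $c\ge 1$ and $0\le c'\le c$ be integers. Let $\Theta=(\theta_1,\theta_2,\theta_3,\theta_4)\in\mathbb R^4$ be a stability parameter such that $$\theta_1>0,\quad -\theta_1<\theta_2<-\tfrac{c-1}{c}\,\theta_1,\quad \theta_3<0,\quad \theta_4<0,\quad \theta_1+\theta_2+(\theta_3+\theta_4)(c-c')>0 .$$ Let $\mathcal M^{n\heartsuit s}_{\mathbf v,\Theta}$ be the moduli space of $\Theta$-stable framed representations of the $n$-th enhanced Hirzebruch quiver $\bar{\mathbf Q}^n$ (with its relations) with dimension vector $\mathbf v=(c,c,c-c',c-c',1)$ (vertices ordered $1,2,3,4,\infty$). Then $\mathcal M^{n\heartsuit s}_{\mathbf v,\Theta}$ is isomorphic, as a scheme, to the nested Hilbert scheme $\operatorname{Hilb}^{c',c}(\Xi_n)$.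
   Context: Schemes are connected and of finite type over $\mathbb C$. $\Xi_n$ is the total space of the line bundle $\mathcal O_{\mathbb P^1}(-n)$. $\operatorname{Hilb}^{c',c}(\Xi_n)$ is the scheme representing the functor which sends a scheme $T$ to the set of pairs $(Z',Z)$ of closed subschemes of $T\times\Xi_n$, flat over $T$, with $Z'\subset Z$ and with the projections $Z'\to T$, $Z\to T$ finite of degree $c'$ and $c$ respectively. A framed representation of the enhanced Hirzebruch quiver $\bar{\mathbf Q}^n$ with dimension vector $(c,c,c-c',c-c',1)$ consists of $\mathbb C$-vector spaces $V_1,V_2,V_3,V_4$ of dimensions $c,c,c-c',c-c'$ at the vertices $1,2,3,4$, a fixed one-dimensional vector space $W$ at the framing vertex $\infty$, and linear maps $A_1,A_2\in\operatorname{Hom}(V_1,V_2)$; $C_1,\dots,C_n\in\operatorname{Hom}(V_2,V_1)$; $A_1',A_2'\in\operatorname{Hom}(V_3,V_4)$; $C_1',\dots,C_n'\in\operatorname{Hom}(V_4,V_3)$; $\ell\in\operatorname{Hom}(V_1,W)$; $h_1,\dots,h_{n-1}\in\operatorname{Hom}(W,V_1)$ (none if $n=1$); $F_1\in\operatorname{Hom}(V_1,V_3)$; $F_2\in\operatorname{Hom}(V_2,V_4)$, satisfying the relations: - if $n=1$: $A_1C_1A_2=A_2C_1A_1$, $A_1'C_1'A_2'=A_2'C_1'A_1'$, $F_1C_1=C_1'F_2$, $F_2A_1=A_1'F_1$, $F_2A_2=A_2'F_1$; - if $n\ge2$, for $q=1,\dots,n-1$, $p=1,2$, $t=1,\dots,n$: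 $A_1C_q=A_2C_{q+1}$, $C_qA_1+h_q\ell=C_{q+1}A_2$, $A_1'C_q'=A_2'C_{q+1}'$, $C_q'A_1'=C_{q+1}'A_2'$, $F_1h_q=0$, $F_2A_p=A_p'F_1$, $F_1C_t=C_t'F_2$. Stability: for a 4-tuple of subspaces $S=(S_1,S_2,S_1',S_2')$ of $(V_1,V_2,V_3,V_4)$ preserved by all maps $A_p,C_t,A'_p,C'_t,F_1,F_2$, put $\Theta\cdot\dim S=\theta_1\dim S_1+\theta_2\dim S_2+\theta_3\dim S_1'+\theta_4\dim S_2'$. The representation $X$ is $\Theta$-semistable if (1) $\Theta\cdot\dim S\le 0$ for all such $S$ with $S_1\subseteq\ker\ell$, and (2) $\Theta\cdot\dim S\le\Theta\cdot\dim X=\theta_1c+\theta_2c+(\theta_3+\theta_4)(c-c')$ for all such $S$ with $S_1\supseteq\operatorname{Im}h_i$ for all $i$. It is $\Theta$-stable if moreover the inequality in (1) is strict whenever $S\neq0$ and that in (2) is strict whenever $S\ne(V_1,V_2,V_3,V_4)$. The moduli space $\mathcal M^{n\heartsuit s}_{\mathbf v,\Theta}$ is the GIT quotient of the space of $\Theta$-stable framed representations by $\mathrm{GL}(V_1)\times\mathrm{GL}(V_2)\times\mathrm{GL}(V_3)\times\mathrm{GL}(V_4)$ acting by change of basis (trivially on $W$). *)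

(* Defs.v *)
From HB Require Import structures.
From mathcomp Require Import all_boot all_order all_algebra.
From mathcomp Require Import boolp reals.
From mathcomp Require Import complex.
Set Implicit Arguments.
Unset Strict Implicit.
Unset Printing Implicit Defensive.
Import Order.TTheory GRing.Theory Num.Theory.
Local Open Scope ring_scope.

(* Schemes of finite type over an algebraically closed field K are treated    *)
(* through their functors of points on the finitely generated commutative     *)
(* K-algebras (Demazure-Gabriel): a scheme is a Zariski sheaf with a finite   *)
(* open cover by affine schemes, and by Yoneda a scheme represents a functor  *)
(* exactly when its functor of points is isomorphic to that functor.          *)

(* The zero algebra is allowed (hence comPzRingType rather than comAlgType):  *)
(* it is the coordinate ring of the empty scheme.                             *)
Record calg (K : closedFieldType) := CAlg {
  calg_ring :> comPzRingType;
  calg_str : {rmorphism K -> calg_ring};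
  calg_fg : exists s : seq calg_ring, forall P : calg_ring -> Prop,
    (forall a, P (calg_str a)) -> (forall x, x \in s -> P x) ->
    (forall x y, P x -> P y -> P (x + y)) ->
    (forall x y, P x -> P y -> P (x * y)) -> forall x, P x
}.

Record hom (K : closedFieldType) (A B : calg K) := Hom {
  hom_fun :> {rmorphism A -> B};
  homK : forall a : K, hom_fun (calg_str A a) = calg_str B a
}.

Lemma rmorph_ext (A B : pzRingType) (f g : {rmorphism A -> B}) :
  f =1 g -> f = g.
Proof.
case: f => f [[f1] [f2]]; case: g => g [[g1] [g2]] /= /funext fg.
by subst g; rewrite (Prop_irrelevance f1 g1) (Prop_irrelevance f2 g2).
Qed.

Lemma hom_ext (K : closedFieldType) (A B : calg K) (f g : hom A B) :
  f =1 g -> f = g.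
Proof.
case: f => f hf; case: g => g hg /= /rmorph_ext fg; subst g.
by rewrite (Prop_irrelevance hf hg).
Qed.

Lemma hom_id_subproof (K : closedFieldType) (A : calg K) (a : K) :
  (idfun : {rmorphism A -> A}) (calg_str A a) = calg_str A a.
Proof. by []. Qed.

Definition hom_id (K : closedFieldType) (A : calg K) : hom A A :=
  Hom (@hom_id_subproof K A).

Lemma hom_comp_subproof (K : closedFieldType) (A B D : calg K)
    (v : hom B D) (u : hom A B) (a : K) :
  (v \o u : {rmorphism A -> D}) (calg_str A a) = calg_str D a.
Proof. by rewrite /= !homK. Qed.

Definition hom_comp (K : closedFieldType) (A B D : calg K)
    (v : hom B D) (u : hom A B) : hom A D :=
  Hom (hom_comp_subproof v u).

Lemma base_fg (K : closedFieldType) : exists s : seq K, forall P : K -> Prop,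
  (forall a, P ((idfun : {rmorphism K -> K}) a)) ->
  (forall x, x \in s -> P x) ->
  (forall x y, P x -> P y -> P (x + y)) ->
  (forall x y, P x -> P y -> P (x * y)) -> forall x, P x.
Proof. by exists [::]. Qed.

Definition base (K : closedFieldType) : calg K :=
  @CAlg K K (idfun : {rmorphism K -> K}) (base_fg K).

Record functor (K : closedFieldType) := Functor {
  pts :> calg K -> Type;
  res : forall A B : calg K, hom A B -> pts A -> pts B;
  res_id : forall A (x : pts A), res (hom_id A) x = x;
  res_comp : forall A B D (v : hom B D) (u : hom A B) (x : pts A),
    res (hom_comp v u) x = res v (res u x)
}.

Record mor (K : closedFieldType) (X Y : functor K) := Mor {
  mor_fun :> forall A : calg K, X A -> Y A;
  mor_nat : forall A B (u : hom A B) (x : X A),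
    mor_fun (res u x) = res u (mor_fun x)
}.

Definition iso (K : closedFieldType) (X Y : functor K) : Prop :=
  exists (f : mor X Y) (g : mor Y X),
    (forall A (x : X A), g A (f A x) = x) /\
    (forall A (y : Y A), f A (g A y) = y).

Record sub (K : closedFieldType) (X : functor K) := Sub {
  mem_sub :> forall A : calg K, X A -> Prop;
  mem_res : forall A B (u : hom A B) (x : X A),
    mem_sub x -> mem_sub (res u x)
}.

Lemma sub_ext (K : closedFieldType) (X : functor K) (Z Z' : sub X) :
  (forall A (x : X A), Z A x <-> Z' A x) -> Z = Z'.
Proof.
case: Z => Z hZ; case: Z' => Z' hZ' /= e.
have {}e : Z = Z'.
  by apply: functional_extensionality_dep => A; apply/funext => x; apply/propext.
by subst Z'; rewrite (Prop_irrelevance hZ hZ').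
Qed.

Lemma exist_eq (T : Type) (P : T -> Prop) (x y : {x : T | P x}) :
  proj1_sig x = proj1_sig y -> x = y.
Proof.
by case: x => x hx; case: y => y hy /= e; subst y; rewrite (Prop_irrelevance hx hy).
Qed.

Definition sub_pts (K : closedFieldType) (X : functor K) (Z : sub X)
    (A : calg K) : Type := {x : X A | Z A x}.

Definition sub_res (K : closedFieldType) (X : functor K) (Z : sub X)
    (A B : calg K) (u : hom A B) (x : sub_pts Z A) : sub_pts Z B :=
  exist _ (res u (proj1_sig x)) (mem_res u (proj2_sig x)).

Lemma sub_res_id (K : closedFieldType) (X : functor K) (Z : sub X)
    (A : calg K) (x : sub_pts Z A) : sub_res (hom_id A) x = x.
Proof. by apply: exist_eq; rewrite /= res_id. Qed.

Lemma sub_res_comp (K : closedFieldType) (X : functor K) (Z : sub X)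
    (A B D : calg K) (v : hom B D) (u : hom A B) (x : sub_pts Z A) :
  sub_res (hom_comp v u) x = sub_res v (sub_res u x).
Proof. by apply: exist_eq; rewrite /= res_comp. Qed.

Definition sub_functor (K : closedFieldType) (X : functor K) (Z : sub X) :
  functor K := Functor (@sub_res_id K X Z) (@sub_res_comp K X Z).

Lemma preim_res (K : closedFieldType) (X Y : functor K) (f : mor X Y)
    (Z : sub Y) (A B : calg K) (u : hom A B) (x : X A) :
  Z A (f A x) -> Z B (f B (res u x)).
Proof. by rewrite mor_nat; exact: mem_res. Qed.

Definition preim (K : closedFieldType) (X Y : functor K) (f : mor X Y)
    (Z : sub Y) : sub X := @Sub K X (fun A x => Z A (f A x)) (@preim_res K X Y f Z).

Lemma spec_res_id (K : closedFieldType) (A B : calg K) (u : hom A B) :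
  hom_comp (hom_id B) u = u.
Proof. exact: hom_ext. Qed.

Lemma spec_res_comp (K : closedFieldType) (A B D E : calg K) (w : hom D E)
    (v : hom B D) (u : hom A B) :
  hom_comp (hom_comp w v) u = hom_comp w (hom_comp v u).
Proof. exact: hom_ext. Qed.

Definition Spec (K : closedFieldType) (A : calg K) : functor K :=
  @Functor K (hom A) (fun B D (v : hom B D) (u : hom A B) => hom_comp v u)
    (@spec_res_id K A)
    (fun B D E w v u => @spec_res_comp K A B D E w v u).

Definition affine_line (K : closedFieldType) : functor K :=
  @Functor K (fun A => A) (fun A B (u : hom A B) (x : A) => u x)
    (fun _ _ => erefl) (fun _ _ _ _ _ _ => erefl).

Lemma prod_res_id (K : closedFieldType) (X Y : functor K) (A : calg K)
    (x : X A * Y A) : (res (hom_id A) x.1, res (hom_id A) x.2) = x.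
Proof. by case: x => x y /=; rewrite !res_id. Qed.

Lemma prod_res_comp (K : closedFieldType) (X Y : functor K) (A B D : calg K)
    (v : hom B D) (u : hom A B) (x : X A * Y A) :
  (res (hom_comp v u) x.1, res (hom_comp v u) x.2) =
  (res v (res u x.1), res v (res u x.2)).
Proof. by rewrite !res_comp. Qed.

Definition prod_functor (K : closedFieldType) (X Y : functor K) : functor K :=
  @Functor K (fun A => X A * Y A)%type
    (fun A B (u : hom A B) x => (res u x.1, res u x.2))
    (@prod_res_id K X Y) (@prod_res_comp K X Y).

Definition unit_ideal (A : comPzRingType) (I : A -> Prop) : Prop :=
  exists (k : nat) (f a : 'I_k -> A),
    (forall i, I (f i)) /\ \sum_(i < k) a i * f i = 1.

Definition invertible (A : comPzRingType) (x : A) : Prop :=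
  exists y : A, x * y = 1.

(* P holds on the members of a Zariski cover of Spec A by principal opens     *)
(* D(f); an algebra map u : A -> B factors through A_f iff u f is invertible. *)
Definition locally (K : closedFieldType) (A : calg K)
    (P : forall B : calg K, hom A B -> Prop) : Prop :=
  unit_ideal (fun f : A =>
    forall (B : calg K) (u : hom A B), invertible (u f) -> P B u).

Definition is_open (K : closedFieldType) (X : functor K) (U : sub X) : Prop :=
  forall (A : calg K) (x : X A), exists I : A -> Prop,
  forall (B : calg K) (u : hom A B),
    U B (res u x) <-> unit_ideal (fun b : B => exists2 f, I f & b = u f).

Definition is_closed (K : closedFieldType) (X : functor K) (Z : sub X) : Prop :=
  forall (A : calg K) (x : X A), exists I : A -> Prop,
  forall (B : calg K) (u : hom A B),
    Z B (res u x) <-> (forall f, I f -> u f = 0).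

Definition is_sheaf (K : closedFieldType) (X : functor K) : Prop :=
  forall (A : calg K) (S : forall B : calg K, hom A B -> Prop)
    (s : forall (B : calg K) (u : hom A B), S B u -> X B),
  (forall B D (v : hom B D) (u : hom A B), S B u -> S D (hom_comp v u)) ->
  locally S ->
  (forall B D (v : hom B D) (u : hom A B) (hu : S B u)
     (hvu : S D (hom_comp v u)), s D (hom_comp v u) hvu = res v (s B u hu)) ->
  exists! x : X A, forall B (u : hom A B) (hu : S B u), res u x = s B u hu.

Definition is_scheme (K : closedFieldType) (X : functor K) : Prop :=
  is_sheaf X /\
  exists (k : nat) (U : 'I_k -> sub X) (A : 'I_k -> calg K),
    [/\ forall i, is_open (U i),
        forall i, iso (sub_functor (U i)) (Spec (A i)) &
        forall (B : calg K) (x : X B),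
          locally (fun D (u : hom B D) => exists i, U i D (res u x))].

Definition zariski_open (K : closedFieldType) (X : functor K)
    (V : X (base K) -> Prop) : Prop :=
  exists2 U : sub X, is_open U & forall x, V x <-> U (base K) x.

(* Geometric quotient in the sense of Mumford (GIT, Definition 0.6), for the  *)
(* orbit relation E of a group action.  As K is algebraically closed and      *)
(* everything is of finite type, the topological conditions are stated on     *)
(* K-points: pi is onto with the orbits as fibres, and submersive.  The last  *)
(* clause is O_M = (pi_* O_X)^G.                                              *)
Record geometric_quotient (K : closedFieldType) (X M : functor K)
    (E : forall A : calg K, X A -> X A -> Prop) (pi : mor X M) : Prop := {
  gq_invariant : forall (A : calg K) (x y : X A), E A x y -> pi A x = pi A y;
  gq_surjective : forall m : M (base K), exists x, pi (base K) x = m;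
  gq_orbits : forall x y : X (base K),
    pi (base K) x = pi (base K) y -> E (base K) x y;
  gq_submersive : forall V : M (base K) -> Prop,
    zariski_open V <-> zariski_open (fun x => V (pi (base K) x));
  gq_functions : forall V : sub M, is_open V ->
    forall f : mor (sub_functor (preim pi V)) (affine_line K),
    (forall (A : calg K) (x y : sub_functor (preim pi V) A),
       E A (proj1_sig x) (proj1_sig y) -> f A x = f A y) ->
    exists! g : mor (sub_functor V) (affine_line K),
    forall (A : calg K) (x : X A) (hx : V A (pi A x)),
      f A (exist _ x hx) = g A (exist _ (pi A x) hx)
}.

(* inl and inr are the two charts of the total space of O_{P^1}(-n), with     *)
(* base coordinate x and fibre coordinate y; they are glued along x x' = 1    *)
(* by y' = x^n y.                                                             *)
Definition chart (A : Type) : Type := (A * A + A * A)%type.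

Definition chart_map (A B : Type) (u : A -> B) (p : chart A) : chart B :=
  match p with
  | inl q => inl (u q.1, u q.2)
  | inr q => inr (u q.1, u q.2)
  end.

Definition glued (n : nat) (A : comPzRingType) (p q : chart A) : Prop :=
  match p, q with
  | inl a, inl b => a = b
  | inr a, inr b => a = b
  | inl a, inr b | inr b, inl a => a.1 * b.1 = 1 /\ b.2 = a.1 ^+ n * a.2
  end.

(* The glued scheme is the Zariski sheafification of A |-> chart A / glued.   *)
(* A point of it over A is encoded by the relation xi_rel u p, which says     *)
(* that p represents the restriction of the point along u.                    *)
Record Xi_pt (K : closedFieldType) (n : nat) (A : calg K) := XiPt {
  xi_rel :> forall B : calg K, hom A B -> chart B -> Prop;
  xi_res : forall (B D : calg K) (v : hom B D) (u : hom A B) (p : chart B),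
    xi_rel u p -> xi_rel (hom_comp v u) (chart_map v p);
  xi_glued : forall (B : calg K) (u : hom A B) (p q : chart B),
    xi_rel u p -> (xi_rel u q <-> glued n p q);
  xi_local : forall (B : calg K) (u : hom A B) (p : chart B),
    locally (fun D (v : hom B D) => xi_rel (hom_comp v u) (chart_map v p)) ->
    xi_rel u p;
  xi_cover : locally (fun B (u : hom A B) => exists p, xi_rel u p)
}.

Lemma Xi_ext (K : closedFieldType) (n : nat) (A : calg K) (x y : Xi_pt n A) :
  (forall B (u : hom A B) p, x B u p <-> y B u p) -> x = y.
Proof.
case: x => x x1 x2 x3 x4; case: y => y y1 y2 y3 y4 /= e.
have {}e : x = y.
  apply: functional_extensionality_dep => B.
  by apply/funext => u; apply/funext => p; apply/propext.
subst y; rewrite (Prop_irrelevance x1 y1) (Prop_irrelevance x2 y2).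
by rewrite (Prop_irrelevance x3 y3) (Prop_irrelevance x4 y4).
Qed.

Lemma hom_compA (K : closedFieldType) (A B D E : calg K) (w : hom D E)
    (v : hom B D) (u : hom A B) :
  hom_comp w (hom_comp v u) = hom_comp (hom_comp w v) u.
Proof. exact: hom_ext. Qed.

Lemma hom_compu1 (K : closedFieldType) (A B : calg K) (u : hom A B) :
  hom_comp u (hom_id A) = u.
Proof. exact: hom_ext. Qed.

Lemma locally_res (K : closedFieldType) (A A' : calg K) (w : hom A A')
    (P : forall B : calg K, hom A B -> Prop) :
  locally P -> locally (fun B (u : hom A' B) => P B (hom_comp u w)).
Proof.
move=> [k [f [a [hf hs]]]]; exists k, (w \o f), (w \o a); split=> [i B u hu|].
  exact: (hf i B (hom_comp u w) hu).
by rewrite -(rmorph1 w) -hs rmorph_sum; apply: eq_bigr => i _; rewrite rmorphM.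
Qed.

Definition Xi_res (K : closedFieldType) (n : nat) (A A' : calg K)
    (w : hom A A') (x : Xi_pt n A) : Xi_pt n A'.
Proof.
refine (@XiPt K n A' (fun B u p => x B (hom_comp u w) p) _ _ _ _).
- by move=> B D v u p /(xi_res v); rewrite hom_compA.
- by move=> B u p q; exact: xi_glued.
- move=> B u p h; apply: xi_local; case: h => k [f [a [hf hs]]].
  exists k, f, a; split=> // i D v /hf.
  by rewrite hom_compA.
- exact: locally_res (xi_cover x).
Defined.

Lemma Xi_res_id (K : closedFieldType) (n : nat) (A : calg K) (x : Xi_pt n A) :
  Xi_res (hom_id A) x = x.
Proof. by apply: Xi_ext => B u p /=; rewrite hom_compu1. Qed.

Lemma Xi_res_comp (K : closedFieldType) (n : nat) (A B D : calg K)
    (v : hom B D) (u : hom A B) (x : Xi_pt n A) :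
  Xi_res (hom_comp v u) x = Xi_res v (Xi_res u x).
Proof. by apply: Xi_ext => E w p /=; rewrite hom_compA. Qed.

Definition Xi (K : closedFieldType) (n : nat) : functor K :=
  Functor (@Xi_res_id K n) (@Xi_res_comp K n).

Definition module_finite (A B : comPzRingType) (e : {rmorphism A -> B}) : Prop :=
  exists (k : nat) (b : 'I_k -> B),
  forall x : B, exists a : 'I_k -> A, x = \sum_(i < k) e (a i) * b i.

Definition free_of_rank (d : nat) (A B : comPzRingType)
    (e : {rmorphism A -> B}) : Prop :=
  exists b : 'I_d -> B,
  forall x : B, exists! a : {ffun 'I_d -> A}, x = \sum_(i < d) e (a i) * b i.

Definition is_bilinear (A B : comPzRingType) (e : {rmorphism A -> B})
    (N P : lmodType A) (beta : N -> B -> P) : Prop :=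
  [/\ forall x y b, beta (x + y) b = beta x b + beta y b,
      forall x b b', beta x (b + b') = beta x b + beta x b',
      forall a x b, beta (a *: x) b = a *: beta x b &
      forall a x b, beta x (e a * b) = a *: beta x b].

(* The element \sum_i x_i (x) b_i of the tensor product of N and B over A     *)
(* vanishes, expressed by the universal property of the tensor product.       *)
Definition tensor_zero (A B : comPzRingType) (e : {rmorphism A -> B})
    (N : lmodType A) (k : nat) (x : 'I_k -> N) (b : 'I_k -> B) : Prop :=
  forall (P : lmodType A) (beta : N -> B -> P), is_bilinear e beta ->
    \sum_(i < k) beta (x i) (b i) = 0.

Definition flat (A B : comPzRingType) (e : {rmorphism A -> B}) : Prop :=
  forall (N N' : lmodType A) (j : {linear N -> N'}), injective j ->
  forall (k : nat) (x : 'I_k -> N) (b : 'I_k -> B),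
    tensor_zero e (fun i => j (x i)) b -> tensor_zero e x b.

(* For Z in Spec A x X: the pull-back of Z along u : A -> A' is, over         *)
(* Spec A', isomorphic to Spec of the A'-algebra e : A' -> B; x is the        *)
(* X-component of the tautological B-point.                                   *)
Definition pullback_is_Spec (K : closedFieldType) (X : functor K) (A : calg K)
    (Z : sub (prod_functor (Spec A) X)) (A' : calg K) (u : hom A A')
    (B : calg K) (e : hom A' B) : Prop :=
  exists2 x : X B, Z B (hom_comp e u, x) &
  forall (D : calg K) (v : hom A' D) (y : X D), Z D (hom_comp v u, y) ->
  exists! t : hom B D, hom_comp t e = v /\ res t x = y.

(* Finiteness and flatness of Z -> Spec A are asked after every base change   *)
(* A -> A' (they are stable under base change), which makes functoriality in  *)
(* A immediate; the degree is the length of the fibres at closed points.      *)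
Definition finite_flat_of_degree (K : closedFieldType) (X : functor K) (d : nat)
    (A : calg K) (Z : sub (prod_functor (Spec A) X)) : Prop :=
  (forall (A' : calg K) (u : hom A A'), exists (B : calg K) (e : hom A' B),
     [/\ pullback_is_Spec Z u e, module_finite e & flat e]) /\
  (forall u : hom A (base K), exists (B : calg K) (e : hom (base K) B),
     pullback_is_Spec Z u e /\ free_of_rank d e).

Lemma basechange_nat (K : closedFieldType) (X : functor K) (A A' : calg K)
    (w : hom A A') (B D : calg K) (u : hom B D)
    (x : prod_functor (Spec A') X B) :
  ((hom_comp (res u x).1 w, (res u x).2) : prod_functor (Spec A) X D) =
  res u ((hom_comp x.1 w, x.2) : prod_functor (Spec A) X B).
Proof. by rewrite /= hom_compA. Qed.

Definition basechange (K : closedFieldType) (X : functor K) (A A' : calg K)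
    (w : hom A A') :
    mor (prod_functor (Spec A') X) (prod_functor (Spec A) X) :=
  @Mor K (prod_functor (Spec A') X) (prod_functor (Spec A) X)
    (fun B x => (hom_comp x.1 w, x.2)) (@basechange_nat K X A A' w).

Definition nested_family (K : closedFieldType) (X : functor K) (c' c : nat)
    (A : calg K) (Z' Z : sub (prod_functor (Spec A) X)) : Prop :=
  [/\ is_closed Z', is_closed Z, forall B x, Z' B x -> Z B x,
      finite_flat_of_degree c' Z' & finite_flat_of_degree c Z].

Definition Hilb_pts (K : closedFieldType) (X : functor K) (c' c : nat)
    (A : calg K) : Type :=
  {Z : sub (prod_functor (Spec A) X) * sub (prod_functor (Spec A) X) |
    nested_family c' c Z.1 Z.2}.

Lemma closed_preim (K : closedFieldType) (X Y : functor K) (f : mor X Y)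
    (Z : sub Y) : is_closed Z -> is_closed (preim f Z).
Proof.
move=> hZ A x; have [I hI] := hZ A (f A x); exists I => B u /=.
by rewrite mor_nat.
Qed.

Lemma finite_flat_basechange (K : closedFieldType) (X : functor K) (d : nat)
    (A A' : calg K) (w : hom A A') (Z : sub (prod_functor (Spec A) X)) :
  finite_flat_of_degree d Z ->
  finite_flat_of_degree d (preim (basechange X w) Z).
Proof.
have pb (A2 : calg K) (u : hom A' A2) (B : calg K) (e : hom A2 B) :
    pullback_is_Spec Z (hom_comp u w) e ->
    pullback_is_Spec (preim (basechange X w) Z) u e.
  case=> x hx hu; exists x; first by rewrite /= -hom_compA.
  by move=> D v y /=; rewrite -hom_compA; exact: hu.
case=> h1 h2; split=> [A2 u|u].
  by have [B [e [/pb h hm hf]]] := h1 A2 (hom_comp u w); exists B, e.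
by have [B [e [/pb h hm]]] := h2 (hom_comp u w); exists B, e.
Qed.

Lemma nested_basechange (K : closedFieldType) (X : functor K) (c' c : nat)
    (A A' : calg K) (w : hom A A') (Z : Hilb_pts X c' c A) :
  nested_family c' c (preim (basechange X w) (proj1_sig Z).1)
    (preim (basechange X w) (proj1_sig Z).2).
Proof.
case: Z => -[Z' Z] [/= h1 h2 h3 h4 h5]; split.
- exact: closed_preim.
- exact: closed_preim.
- by move=> B x /=; exact: h3.
- exact: finite_flat_basechange.
- exact: finite_flat_basechange.
Qed.

Definition Hilb_res (K : closedFieldType) (X : functor K) (c' c : nat)
    (A A' : calg K) (w : hom A A') (Z : Hilb_pts X c' c A) :
    Hilb_pts X c' c A' :=
  exist (fun Z => nested_family c' c Z.1 Z.2) (_, _) (nested_basechange w Z).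

Lemma Hilb_res_id (K : closedFieldType) (X : functor K) (c' c : nat)
    (A : calg K) (Z : Hilb_pts X c' c A) : Hilb_res (hom_id A) Z = Z.
Proof.
case: Z => -[Z' Z] hZ; apply: exist_eq => /=.
by congr pair; apply: sub_ext => B [u x] /=; rewrite hom_compu1.
Qed.

Lemma Hilb_res_comp (K : closedFieldType) (X : functor K) (c' c : nat)
    (A B D : calg K) (v : hom B D) (u : hom A B) (Z : Hilb_pts X c' c A) :
  Hilb_res (hom_comp v u) Z = Hilb_res v (Hilb_res u Z).
Proof.
apply: exist_eq => /=.
by congr pair; apply: sub_ext => E [w x] /=; rewrite hom_compA.
Qed.

Definition nested_Hilb (K : closedFieldType) (X : functor K) (c' c : nat) :
  functor K := Functor (@Hilb_res_id K X c' c) (@Hilb_res_comp K X c' c).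

(* Matrices act on column vectors; d is the common dimension of V_3 and V_4,  *)
(* and W is the base ring.  Indices start from 0.                             *)
Record frep (n c d : nat) (A : Type) := FRep {
  fA1 : 'M[A]_c; fA2 : 'M[A]_c; fC : 'I_n -> 'M[A]_c;
  fA1' : 'M[A]_d; fA2' : 'M[A]_d; fC' : 'I_n -> 'M[A]_d;
  fl : 'rV[A]_c; fh : 'I_n.-1 -> 'cV[A]_c;
  fF1 : 'M[A]_(d, c); fF2 : 'M[A]_(d, c)
}.

Definition frep_map (n c d : nat) (A B : Type) (u : A -> B)
    (x : frep n c d A) : frep n c d B :=
  {| fA1 := map_mx u (fA1 x); fA2 := map_mx u (fA2 x);
     fC := fun i => map_mx u (fC x i);
     fA1' := map_mx u (fA1' x); fA2' := map_mx u (fA2' x);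
     fC' := fun i => map_mx u (fC' x i);
     fl := map_mx u (fl x); fh := fun i => map_mx u (fh x i);
     fF1 := map_mx u (fF1 x); fF2 := map_mx u (fF2 x) |}.

Definition relations1 (n c d : nat) (A : pzRingType) (x : frep n c d A) : Prop :=
  (forall t : 'I_n,
    [/\ fA1 x *m fC x t *m fA2 x = fA2 x *m fC x t *m fA1 x,
        fA1' x *m fC' x t *m fA2' x = fA2' x *m fC' x t *m fA1' x &
        fF1 x *m fC x t = fC' x t *m fF2 x]) /\
  (fF2 x *m fA1 x = fA1' x *m fF1 x /\ fF2 x *m fA2 x = fA2' x *m fF1 x).

Definition relations2 (n c d : nat) (A : pzRingType) (x : frep n c d A) : Prop :=
  [/\ forall (q : 'I_n.-1) (i j : 'I_n), i = q :> nat -> j = q.+1 :> nat ->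
        [/\ fA1 x *m fC x i = fA2 x *m fC x j,
            fC x i *m fA1 x + fh x q *m fl x = fC x j *m fA2 x,
            fA1' x *m fC' x i = fA2' x *m fC' x j &
            fC' x i *m fA1' x = fC' x j *m fA2' x],
      forall q : 'I_n.-1, fF1 x *m fh x q = 0,
      fF2 x *m fA1 x = fA1' x *m fF1 x /\ fF2 x *m fA2 x = fA2' x *m fF1 x &
      forall t : 'I_n, fF1 x *m fC x t = fC' x t *m fF2 x].

Definition relations (n c d : nat) (A : pzRingType) (x : frep n c d A) : Prop :=
  if n == 1%N then relations1 x else relations2 x.

Lemma relations_map (n c d : nat) (A B : pzRingType) (u : {rmorphism A -> B})
    (x : frep n c d A) : relations x -> relations (frep_map u x).
Proof.
rewrite /relations; case: (n == 1%N).
  case=> h [h1 h2]; split=> [t|] /=; last by rewrite -!map_mxM h1 h2.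
  by have [e1 e2 e3] := h t; rewrite -!map_mxM e1 e2 e3.
case=> h1 h2 [h3 h3'] h4; split=> /= [q i j hi hj|q||t].
- have [e1 e2 e3 e4] := h1 q i j hi hj.
  by rewrite -!map_mxM -map_mxD e1 e2 e3 e4.
- by rewrite -map_mxM h2 map_mx0.
- by rewrite -!map_mxM h3 h3'.
- by rewrite -!map_mxM h4.
Qed.

Definition Rep_pts (K : closedFieldType) (n c d : nat) (A : calg K) : Type :=
  {x : frep n c d A | relations x}.

Definition Rep_res (K : closedFieldType) (n c d : nat) (A B : calg K)
    (u : hom A B) (x : Rep_pts n c d A) : Rep_pts n c d B :=
  exist _ (frep_map u (proj1_sig x)) (relations_map u (proj2_sig x)).

Lemma Rep_res_id (K : closedFieldType) (n c d : nat) (A : calg K)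
    (x : Rep_pts n c d A) : Rep_res (hom_id A) x = x.
Proof.
have e (k l : nat) (a : 'M[A]_(k, l)) : map_mx (hom_id A) a = a.
  by apply/matrixP => i j; rewrite mxE.
apply: exist_eq; case: x => -[a1 a2 C a1' a2' C' l h F1 F2] hx.
by rewrite /= /frep_map /= !e; congr FRep; apply/funext => i; rewrite e.
Qed.

Lemma Rep_res_comp (K : closedFieldType) (n c d : nat) (A B D : calg K)
    (v : hom B D) (u : hom A B) (x : Rep_pts n c d A) :
  Rep_res (hom_comp v u) x = Rep_res v (Rep_res u x).
Proof.
have e (k l : nat) (a : 'M[A]_(k, l)) :
    map_mx (hom_comp v u) a = map_mx v (map_mx u a).
  by apply/matrixP => i j; rewrite !mxE.
apply: exist_eq; case: x => -[a1 a2 C a1' a2' C' l h F1 F2] hx.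
by rewrite /= /frep_map /= !e; congr FRep; apply/funext => i; rewrite e.
Qed.

Definition Rep (K : closedFieldType) (n c d : nat) : functor K :=
  Functor (@Rep_res_id K n c d) (@Rep_res_comp K n c d).

Definition preserved (K : fieldType) (n c d : nat) (x : frep n c d K)
    (S1 S2 : {vspace 'cV[K]_c}) (S1' S2' : {vspace 'cV[K]_d}) : Prop :=
  [/\ forall v, v \in S1 -> fA1 x *m v \in S2 /\ fA2 x *m v \in S2,
      forall (t : 'I_n) v, v \in S2 -> fC x t *m v \in S1,
      forall v, v \in S1' -> fA1' x *m v \in S2' /\ fA2' x *m v \in S2',
      forall (t : 'I_n) v, v \in S2' -> fC' x t *m v \in S1' &
      (forall v, v \in S1 -> fF1 x *m v \in S1') /\
      (forall v, v \in S2 -> fF2 x *m v \in S2')].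

Definition slope (R : realType) (th1 th2 th3 th4 : R) (d1 d2 d3 d4 : nat) : R :=
  th1 * d1%:R + th2 * d2%:R + th3 * d3%:R + th4 * d4%:R.

Definition semistable (R : realType) (K : fieldType) (th1 th2 th3 th4 : R)
    (n c d : nat) (x : frep n c d K) : Prop :=
  forall (S1 S2 : {vspace 'cV[K]_c}) (S1' S2' : {vspace 'cV[K]_d}),
  preserved x S1 S2 S1' S2' ->
  ((forall v, v \in S1 -> fl x *m v = 0) ->
   slope th1 th2 th3 th4 (\dim S1) (\dim S2) (\dim S1') (\dim S2') <= 0) /\
  ((forall q, fh x q \in S1) ->
   slope th1 th2 th3 th4 (\dim S1) (\dim S2) (\dim S1') (\dim S2')
     <= slope th1 th2 th3 th4 c c d d).

Definition stable (R : realType) (K : fieldType) (th1 th2 th3 th4 : R)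
    (n c d : nat) (x : frep n c d K) : Prop :=
  semistable th1 th2 th3 th4 x /\
  forall (S1 S2 : {vspace 'cV[K]_c}) (S1' S2' : {vspace 'cV[K]_d}),
  preserved x S1 S2 S1' S2' ->
  ((forall v, v \in S1 -> fl x *m v = 0) ->
   ~ [/\ S1 = 0%VS, S2 = 0%VS, S1' = 0%VS & S2' = 0%VS] ->
   slope th1 th2 th3 th4 (\dim S1) (\dim S2) (\dim S1') (\dim S2') < 0) /\
  ((forall q, fh x q \in S1) ->
   ~ [/\ S1 = fullv, S2 = fullv, S1' = fullv & S2' = fullv] ->
   slope th1 th2 th3 th4 (\dim S1) (\dim S2) (\dim S1') (\dim S2')
     < slope th1 th2 th3 th4 c c d d).

Lemma stable_locus_res (R : realType) (K : closedFieldType)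
    (th1 th2 th3 th4 : R) (n c d : nat) (A B : calg K) (u : hom A B)
    (x : Rep K n c d A) :
  (forall v : hom A (base K),
     stable th1 th2 th3 th4 (proj1_sig (res v x) : frep n c d K)) ->
  forall v : hom B (base K),
    stable th1 th2 th3 th4 (proj1_sig (res v (res u x)) : frep n c d K).
Proof. by move=> h v; rewrite -res_comp. Qed.

(* The open subscheme of Rep whose closed points are the stable               *)
(* representations: Spec A -> Rep factors through it iff every closed point   *)
(* of Spec A is sent to a stable representation.                              *)
Definition stable_locus (R : realType) (K : closedFieldType)
    (th1 th2 th3 th4 : R) (n c d : nat) : sub (Rep K n c d) :=
  @Sub K (Rep K n c d) (fun A x => forall v : hom A (base K),
    stable th1 th2 th3 th4 (proj1_sig (res v x) : frep n c d K))
    (@stable_locus_res R K th1 th2 th3 th4 n c d).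

Definition is_GL (A : pzRingType) (k : nat) (g : 'M[A]_k) : Prop :=
  exists g' : 'M[A]_k, g *m g' = 1%:M /\ g' *m g = 1%:M.

(* y = (g1, g2, g3, g4) . x, e.g. y.A1 = g2 x.A1 g1^-1. *)
Definition same_orbit (n c d : nat) (A : pzRingType) (x y : frep n c d A) : Prop :=
  exists (g1 g2 : 'M[A]_c) (g3 g4 : 'M[A]_d),
  [/\ is_GL g1, is_GL g2, is_GL g3 & is_GL g4] /\
  [/\ fA1 y *m g1 = g2 *m fA1 x, fA2 y *m g1 = g2 *m fA2 x &
      forall t, fC y t *m g2 = g1 *m fC x t] /\
  [/\ fA1' y *m g3 = g4 *m fA1' x, fA2' y *m g3 = g4 *m fA2' x &
      forall t, fC' y t *m g4 = g3 *m fC' x t] /\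
  [/\ fl y *m g1 = fl x, forall q, fh y q = g1 *m fh x q,
      fF1 y *m g1 = g3 *m fF1 x & fF2 y *m g2 = g4 *m fF2 x].

Definition stable_reps (R : realType) (th1 th2 th3 th4 : R) (n c d : nat) :
  functor R[i] := sub_functor (stable_locus R[i] th1 th2 th3 th4 n c d).

(* The GIT quotient of the stable locus: a scheme M together with a geometric *)
(* quotient map onto M, which determines M up to unique isomorphism.          *)
Definition is_moduli_space (R : realType) (th1 th2 th3 th4 : R) (n c d : nat)
    (M : functor R[i]) (pi : mor (stable_reps th1 th2 th3 th4 n c d) M) : Prop :=
  is_scheme M /\
  geometric_quotient
    (fun (A : calg R[i]) (x y : stable_reps th1 th2 th3 th4 n c d A) =>
       same_orbit (proj1_sig (proj1_sig x)) (proj1_sig (proj1_sig y))) pi.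

(* Main.v *)
(* Locally on the base, a finite flat family Z in Xi_n of degree c lies in    *)
(* the chart where x + k y is invertible for some constant k.  That chart is  *)
(* a plane with coordinates a = y / (x + k y) and b, so Z amounts to          *)
(* commuting c x c matrices D, E and a covector l that is cocyclic: the       *)
(* vectors l D^i E^j span.  Points of Z are joint eigenvectors w of D and E   *)
(* with l w = 1.  A smaller family Z' amounts to an intertwiner F onto        *)
(* another pair (D', E'), Z' being cut out by F w = 0.                        *)
(* Given a stable representation, a kernel vector of minimal degree of the    *)
(* pencil A1 + t A2, on either side, would destabilize, so g = A1 + k A2 is   *)
(* invertible for some k.  Put D = g^-1 A2 and let E be a binomial            *)
(* combination of the C_q g; the relations give C_q g =                       *)
(* (1 - k D)^q D^(n-1-q) E and [E, D] = h l.  Stability makes l cyclic, and   *)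
(* a trace argument then gives h = 0.  So stable representations are, locally *)
(* and up to the group, the data (D, E, l, F): the map to the nested Hilbert  *)
(* functor has local lifts and its fibres are orbits, which makes it a        *)
(* geometric quotient.  Fixing c monomials whose images under l are the       *)
(* standard basis and d columns of F forming the identity kills the group     *)
(* action and gives affine charts.  Finally geometric quotients that are      *)
(* schemes are unique.                                                        *)

From HB Require Import structures.
From mathcomp Require Import all_boot all_order all_algebra.
From mathcomp Require Import boolp classical_sets reals.
From mathcomp Require Import complex.
From mathcomp Require Import ring.
Require Import Defs.
Set Implicit Arguments.
Unset Strict Implicit.
Unset Printing Implicit Defensive.
Import Order.TTheory GRing.Theory Num.Theory.
Local Open Scope ring_scope.

(** The nested Hilbert functor is shown to be a scheme and a geometric quotient of the stable locus.
    Any other quotient that is a scheme is then isomorphic to it, because geometric quotients are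
    categorical ([gq_unique]).

    Geometric side. The chart of [Xi] where x + k y is invertible is a plane. A closed family in it
    that is free of rank m over the base amounts to a cocyclic triple (D, E, l): the commuting
    matrices of multiplication by the two coordinates and the coordinates of 1 in a basis. Its
    points are the joint eigenvectors w with l w = 1 ([Zt]). Every closed finite flat family has
    this shape near each closed point of the base ([chart_near], [triple_near]): a point is missed
    by at most one of the charts k = 0, ..., m, so one chart contains the whole fibre, then the
    nearby fibres; Nakayama's lemma and flatness provide a basis. Conversely, a family locally given
    by triples is closed, finite and flat ([loc_triple_closed], [loc_triple_finite_flat]). An
    inclusion of families is dual to a split injection compatible with the triples, and F is its
    cokernel ([Zt_sub_intertwines], [nested_triples_lift]).

    Representation side. Semistability makes the pencil A1 + t A2 regular ([pencil_neq0]) and F1, F2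
    surjective ([semistable_surj]). Once V1 and V2 are identified through an invertible A1 + k A2,
    the relations say that C_q = (1 - k D)^q D^(n-1-q) E with [E, D] = h l. Stability makes l
    cyclic, and a trace argument then gives h = 0 ([cyclic_commute]). So near each closed point a
    stable representation is conjugate to some [Phi] of data (D, E, l, F) ([normal_form_near]), and
    every such [Phi] is stable ([Phi_stable]).

    Comparison. [hilb_map] sends a representation to the schemes of its normalised eigenvectors,
    with F w = 0 added for the smaller one. It has local lifts ([hilb_lift_chart]), and
    representations with the same image are locally conjugate ([stable_orbit]); these two facts
    already make it a geometric quotient ([quotient_of_local]). That the target is a scheme
    ([hilb_scheme]) follows from the local description by triples, which makes it a sheaf, and from
    slices: asking c chosen rows l D^a E^b to be the standard basis and d chosen columns of F to be
    the identity removes the group and leaves polynomial equations, hence affine charts.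

    Throughout, the Nullstellensatz reduces local statements on Spec A to neighbourhoods of closed
    points ([locally_nbhd], [open_crit]). *)

Definition mk_rmorph (A B : pzRingType) (f : A -> B)
  (fB : zmod_morphism f) (fM : monoid_morphism f) : {rmorphism A -> B} :=
  HB.pack f (GRing.isZmodMorphism.Build A B f fB)
            (GRing.isMonoidMorphism.Build A B f fM).

Section MkHom.
Context (K : closedFieldType) (A B : calg K) (f : A -> B)
  (fD : forall x y, f (x + y) = f x + f y)
  (fM : forall x y, f (x * y) = f x * f y)
  (fK : forall a, f (calg_str A a) = calg_str B a).

Lemma mk_homB : zmod_morphism f.
Proof.
move=> x y; apply: (addIr (f y)).
by rewrite -fD !subrK.
Qed.

Lemma mk_homM : monoid_morphism f.
Proof. by split=> //; rewrite -(rmorph1 (calg_str A)) fK rmorph1. Qed.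

Definition mk_hom : hom A B := @Hom K A B (mk_rmorph mk_homB mk_homM) fK.

Lemma mk_homE x : mk_hom x = f x. Proof. by []. Qed.
End MkHom.

(** * Quotients *)

(** Commutative ring axioms up to an equivalence relation. Localizations, quotients, rings of global
    functions and coordinate rings are all presented by such data and made into rings by [qring]. *)
Record pre_ring := PreRing {
  pr_sort :> Type;
  pr_eq : pr_sort -> pr_sort -> Prop;
  pr_zero : pr_sort; pr_one : pr_sort;
  pr_opp : pr_sort -> pr_sort;
  pr_add : pr_sort -> pr_sort -> pr_sort;
  pr_mul : pr_sort -> pr_sort -> pr_sort;
  pr_refl : forall x, pr_eq x x;
  pr_sym : forall x y, pr_eq x y -> pr_eq y x;
  pr_trans : forall y x z, pr_eq x y -> pr_eq y z -> pr_eq x z;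
  pr_congN : forall x y, pr_eq x y -> pr_eq (pr_opp x) (pr_opp y);
  pr_congD : forall x x' y y', pr_eq x x' -> pr_eq y y' ->
    pr_eq (pr_add x y) (pr_add x' y');
  pr_congM : forall x x' y y', pr_eq x x' -> pr_eq y y' ->
    pr_eq (pr_mul x y) (pr_mul x' y');
  pr_addA : forall x y z, pr_eq (pr_add x (pr_add y z)) (pr_add (pr_add x y) z);
  pr_addC : forall x y, pr_eq (pr_add x y) (pr_add y x);
  pr_add0 : forall x, pr_eq (pr_add pr_zero x) x;
  pr_addN : forall x, pr_eq (pr_add (pr_opp x) x) pr_zero;
  pr_mulA : forall x y z, pr_eq (pr_mul x (pr_mul y z)) (pr_mul (pr_mul x y) z);
  pr_mulC : forall x y, pr_eq (pr_mul x y) (pr_mul y x);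
  pr_mul1 : forall x, pr_eq (pr_mul pr_one x) x;
  pr_mulD : forall x y z,
    pr_eq (pr_mul (pr_add x y) z) (pr_add (pr_mul x z) (pr_mul y z))
}.

Definition quo (T : Type) (E : T -> T -> Prop) :=
  {C : T -> Prop | exists x, C = E x}.
Definition quo_pi (T : Type) (E : T -> T -> Prop) (x : T) : quo E :=
  exist _ (E x) (ex_intro _ x erefl).
Definition quo_repr (T : Type) (E : T -> T -> Prop) (q : quo E) : T :=
  sval (cid (svalP q)).

Lemma quo_reprK (T : Type) (E : T -> T -> Prop) (q : quo E) :
  quo_pi E (quo_repr q) = q.
Proof. by apply: exist_eq; rewrite /= /quo_repr; case: cid => x /= ->. Qed.

Lemma quo_ind (T : Type) (E : T -> T -> Prop) (P : quo E -> Prop) :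
  (forall x, P (quo_pi E x)) -> forall q, P q.
Proof. by move=> h q; rewrite -(quo_reprK q). Qed.

Lemma quo_eqP (T : Type) (E : T -> T -> Prop) (x y : T) :
  (forall x, E x x) -> (forall x y, E x y -> E y x) ->
  (forall y x z, E x y -> E y z -> E x z) ->
  quo_pi E x = quo_pi E y <-> E x y.
Proof.
move=> hr hs ht; split=> [[] e|e].
  by rewrite e; exact: hr.
apply: exist_eq => /=; apply/funext => z; apply/propext.
by split; apply: ht => //; exact: hs.
Qed.

Definition qring (P : pre_ring) := quo (@pr_eq P).

HB.instance Definition _ (P : pre_ring) := gen_eqMixin (qring P).
HB.instance Definition _ (P : pre_ring) := gen_choiceMixin (qring P).

Section Qring.
Context (P : pre_ring).
Implicit Types x y z : P.

Definition qpi x : qring P := quo_pi (@pr_eq P) x.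
Definition qrepr (q : qring P) : P := quo_repr q.

Lemma qpiP x y : qpi x = qpi y <-> pr_eq x y.
Proof. apply: quo_eqP; [exact: pr_refl|exact: pr_sym|exact: pr_trans]. Qed.

Lemma qring_ind (Q : qring P -> Prop) : (forall x, Q (qpi x)) -> forall q, Q q.
Proof. exact: quo_ind. Qed.

Lemma qreprK q : qpi (qrepr q) = q. Proof. exact: quo_reprK. Qed.

Lemma qrepr_pi x : pr_eq (qrepr (qpi x)) x.
Proof. by apply/qpiP; rewrite qreprK. Qed.

Definition q0 := qpi (pr_zero P).
Definition q1 := qpi (pr_one P).
Definition qopp q := qpi (pr_opp (qrepr q)).
Definition qadd q r := qpi (pr_add (qrepr q) (qrepr r)).
Definition qmul q r := qpi (pr_mul (qrepr q) (qrepr r)).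

Lemma qoppE x : qopp (qpi x) = qpi (pr_opp x).
Proof. by apply/qpiP/pr_congN/qrepr_pi. Qed.
Lemma qaddE x y : qadd (qpi x) (qpi y) = qpi (pr_add x y).
Proof. by apply/qpiP/pr_congD; exact: qrepr_pi. Qed.
Lemma qmulE x y : qmul (qpi x) (qpi y) = qpi (pr_mul x y).
Proof. by apply/qpiP/pr_congM; exact: qrepr_pi. Qed.

Lemma qaddA : associative qadd.
Proof.
elim/qring_ind=> x; elim/qring_ind=> y; elim/qring_ind=> z.
by rewrite !qaddE; apply/qpiP/pr_addA.
Qed.
Lemma qaddC : commutative qadd.
Proof.
by elim/qring_ind=> x; elim/qring_ind=> y; rewrite !qaddE; apply/qpiP/pr_addC.
Qed.
Lemma qadd0 : left_id q0 qadd.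
Proof. by elim/qring_ind=> x; rewrite !qaddE; apply/qpiP/pr_add0. Qed.
Lemma qaddN : left_inverse q0 qopp qadd.
Proof. by elim/qring_ind=> x; rewrite qoppE qaddE; apply/qpiP/pr_addN. Qed.
Lemma qmulA : associative qmul.
Proof.
elim/qring_ind=> x; elim/qring_ind=> y; elim/qring_ind=> z.
by rewrite !qmulE; apply/qpiP/pr_mulA.
Qed.
Lemma qmulC : commutative qmul.
Proof.
by elim/qring_ind=> x; elim/qring_ind=> y; rewrite !qmulE; apply/qpiP/pr_mulC.
Qed.
Lemma qmul1 : left_id q1 qmul.
Proof. by elim/qring_ind=> x; rewrite !qmulE; apply/qpiP/pr_mul1. Qed.
Lemma qmulD : left_distributive qmul qadd.
Proof.
elim/qring_ind=> x; elim/qring_ind=> y; elim/qring_ind=> z.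
by rewrite !(qmulE, qaddE); apply/qpiP/pr_mulD.
Qed.
End Qring.

HB.instance Definition _ (P : pre_ring) :=
  GRing.isZmodule.Build (qring P) (@qaddA P) (@qaddC P) (@qadd0 P) (@qaddN P).
HB.instance Definition _ (P : pre_ring) :=
  GRing.Zmodule_isComPzRing.Build (qring P)
    (@qmulA P) (@qmulC P) (@qmul1 P) (@qmulD P).

Section QringTheory.
Context (P : pre_ring).
Implicit Types x y : P.
Lemma qpiN x : qpi (pr_opp x) = - qpi x. Proof. by rewrite -qoppE. Qed.
Lemma qpiD x y : qpi (pr_add x y) = qpi x + qpi y. Proof. by rewrite -qaddE. Qed.
Lemma qpiM x y : qpi (pr_mul x y) = qpi x * qpi y. Proof. by rewrite -qmulE. Qed.
End QringTheory.

(* The ring of the elements of T up to equality under a jointly tested family *)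
(* of evaluations into rings.                                                 *)
Definition family_ring (T J : Type) (R : J -> comPzRingType)
    (ev : forall j, T -> R j) (t0 t1 : T) (tN : T -> T) (tD tM : T -> T -> T)
    (e0 : forall j, ev j t0 = 0) (e1 : forall j, ev j t1 = 1)
    (eN : forall j x, ev j (tN x) = - ev j x)
    (eD : forall j x y, ev j (tD x y) = ev j x + ev j y)
    (eM : forall j x y, ev j (tM x y) = ev j x * ev j y) : pre_ring.
Proof.
apply: (@PreRing T (fun x y => forall j, ev j x = ev j y) t0 t1 tN tD tM) => //.
- by move=> y x z h h' j; rewrite h.
- by move=> x y h j; rewrite !eN h.
- by move=> x x' y y' h h' j; rewrite !eD h h'.
- by move=> x x' y y' h h' j; rewrite !eM h h'.
- by move=> x y z j; rewrite !eD addrA.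
- by move=> x y j; rewrite !eD addrC.
- by move=> x j; rewrite !eD e0 add0r.
- by move=> x j; rewrite !eD eN addNr e0.
- by move=> x y z j; rewrite !eM mulrA.
- by move=> x y j; rewrite !eM mulrC.
- by move=> x j; rewrite !eM e1 mul1r.
- by move=> x y z j; rewrite !(eD, eM) mulrDl.
Defined.

(** * Localization at an element *)

Section Localization.
Context (A : comPzRingType) (f : A).

(** The pair (x, m) stands for x / f^m; the extra power of f allows for zero divisors. *)
Definition loc_eq (x y : A * nat) : Prop :=
  exists N, f ^+ N * (f ^+ y.2 * x.1 - f ^+ x.2 * y.1) = 0.

Lemma loc_eq0 (x y : A * nat) : f ^+ y.2 * x.1 = f ^+ x.2 * y.1 -> loc_eq x y.
Proof. by move=> e; exists 0%N; rewrite e subrr mulr0. Qed.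

Definition loc_pre : pre_ring.
Proof.
apply: (@PreRing (A * nat) loc_eq (0, 0%N) (1, 0%N) (fun x => (- x.1, x.2))
    (fun x y => (f ^+ y.2 * x.1 + f ^+ x.2 * y.1, (x.2 + y.2)%N))
    (fun x y => (x.1 * y.1, (x.2 + y.2)%N))).
- by move=> x; exact: loc_eq0.
- by move=> x y [N e]; exists N; rewrite -opprB mulrN e oppr0.
- move=> [y n] [x m] [z p] [/= N e] [/= M e']; exists (N + M + n)%N => /=.
  transitivity (f ^+ (M + p) * (f ^+ N * (f ^+ n * x - f ^+ m * y)) +
    f ^+ (N + m) * (f ^+ M * (f ^+ p * y - f ^+ n * z))).
    by rewrite !exprD; ring.
  by rewrite e e' !mulr0 addr0.
- by move=> x y [N e]; exists N => /=; rewrite !mulrN -opprD mulrN e oppr0.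
- move=> [x m] [x' m'] [y n] [y' n'] [/= N e] [/= M e']; exists (N + M)%N => /=.
  transitivity (f ^+ (M + n + n') * (f ^+ N * (f ^+ m' * x - f ^+ m * x')) +
    f ^+ (N + m + m') * (f ^+ M * (f ^+ n' * y - f ^+ n * y'))).
    by rewrite !exprD; ring.
  by rewrite e e' !mulr0 addr0.
- move=> [x m] [x' m'] [y n] [y' n'] [/= N e] [/= M e']; exists (N + M)%N => /=.
  transitivity (f ^+ (M + n') * y * (f ^+ N * (f ^+ m' * x - f ^+ m * x')) +
    f ^+ (N + m) * x' * (f ^+ M * (f ^+ n' * y - f ^+ n * y'))).
    by rewrite !exprD; ring.
  by rewrite e e' !mulr0 addr0.
all: by move=> *; apply: loc_eq0; rewrite /= ?exprD; ring.
Defined.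
End Localization.

(** * Ideals generated by a set, and unit ideals *)

Section IdealGenerated.
Context (A : comPzRingType) (I : A -> Prop).

(** Shaped so that [unit_ideal I] is convertible to [ideal I 1]. *)
Definition ideal (x : A) : Prop := exists (k : nat) (f a : 'I_k -> A),
  (forall i, I (f i)) /\ \sum_(i < k) a i * f i = x.

Lemma ideal_gen x : I x -> ideal x.
Proof.
by move=> h; exists 1%N, (fun=> x), (fun=> 1); rewrite big_ord1 mul1r.
Qed.

Lemma ideal0 : ideal 0.
Proof. by exists 0%N, (fun=> 0), (fun=> 0); rewrite big_ord0; split=> // -[]. Qed.

Lemma idealM a x : ideal x -> ideal (a * x).
Proof.
case=> k [f [b [h <-]]]; exists k, f, (fun i => a * b i); split=> //.
by rewrite mulr_sumr; apply: eq_bigr => i _; rewrite mulrA.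
Qed.

Lemma idealMr a x : ideal x -> ideal (x * a).
Proof. by rewrite mulrC; exact: idealM. Qed.

Lemma idealD x y : ideal x -> ideal y -> ideal (x + y).
Proof.
move=> [k [f [a [hf <-]]]] [l [g [b [hg <-]]]].
exists (k + l)%N, (fun i => match fintype.split i with inl j => f j | inr j => g j end),
  (fun i => match fintype.split i with inl j => a j | inr j => b j end); split.
  by move=> i; case: (fintype.split i).
rewrite big_split_ord /=; congr (_ + _); apply: eq_bigr => i _.
  by rewrite (unsplitK (inl i)).
by rewrite (unsplitK (inr i)).
Qed.

Lemma idealN x : ideal x -> ideal (- x).
Proof. by move=> h; rewrite -mulN1r; exact: idealM. Qed.

Lemma idealB x y : ideal x -> ideal y -> ideal (x - y).
Proof. by move=> hx hy; apply/idealD => //; exact: idealN. Qed.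

Lemma ideal_sum (T : Type) (r : seq T) (P : pred T) (F : T -> A) :
  (forall i, P i -> ideal (F i)) -> ideal (\sum_(i <- r | P i) F i).
Proof. by move=> h; apply: (big_ind ideal) => //; [exact: ideal0|exact: idealD]. Qed.

Lemma unit_idealP : unit_ideal I <-> ideal 1. Proof. by []. Qed.
End IdealGenerated.

(** Induction over a generated ideal. Most covering arguments are instances: P is checked to be an
    ideal containing the generators, and then applied to 1. *)
Lemma ideal_min (A : comPzRingType) (I : A -> Prop) (P : A -> Prop) :
  P 0 -> (forall x y, P x -> P y -> P (x + y)) ->
  (forall a x, P x -> P (a * x)) -> (forall x, I x -> P x) ->
  forall x, ideal I x -> P x.
Proof.
move=> P0 PD PM PI x [k [f [a [hf <-]]]].
by apply: (big_ind P) => // i _; apply/PM/PI.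
Qed.

Lemma ideal_sub (A : comPzRingType) (I J : A -> Prop) :
  (forall x, I x -> ideal J x) -> forall x, ideal I x -> ideal J x.
Proof.
move=> h; apply: ideal_min => //; first exact: ideal0.
- exact: idealD.
- exact: idealM.
Qed.

Lemma ideal_map (A B : comPzRingType) (u : {rmorphism A -> B}) (I : A -> Prop)
  (J : B -> Prop) : (forall x, I x -> ideal J (u x)) ->
  forall x, ideal I x -> ideal J (u x).
Proof.
move=> h; apply: ideal_min => //=.
- by rewrite rmorph0; exact: ideal0.
- by move=> x y; rewrite rmorphD; exact: idealD.
- by move=> a x; rewrite rmorphM; exact: idealM.
Qed.

(* The generators are replaced by their powers one at a time. *)
Lemma unit_ideal_pow (A : comPzRingType) (k : nat) (f : 'I_k -> A) (N : nat) :
  unit_ideal (fun x => exists i, x = f i) ->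
  unit_ideal (fun x => exists i, x = f i ^+ N).
Proof.
move=> h.
suff H (s : seq 'I_k) :
    ideal (fun x => (exists2 i, i \in s & x = f i) \/ exists i, x = f i ^+ N) 1 ->
    ideal (fun x => exists i, x = f i ^+ N) 1.
  apply: (H (enum 'I_k)); apply: (ideal_sub _ h) => x [i ->].
  by apply: ideal_gen; left; exists i => //; exact: mem_enum.
elim: s => [|i s IH] hs.
  by apply: (ideal_sub _ hs) => x [[i //]|hi]; exact: ideal_gen.
apply: IH; set L := fun x : A => _.
have H0 : exists a y, ideal L y /\ 1 = a * f i + y.
  have : ideal (fun x => x = f i \/ L x) 1.
    apply: (ideal_sub _ hs) => x [[j]|hx]; last by apply: ideal_gen; right; right.
    rewrite inE => /orP[/eqP-> ->|hj ->]; first by apply: ideal_gen; left.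
    by apply: ideal_gen; right; left; exists j.
  apply: (ideal_min (P := fun x => exists a y, ideal L y /\ x = a * f i + y)).
  - by exists 0, 0; split; [exact: ideal0|rewrite mul0r addr0].
  - move=> x y [a [x' [hx ->]]] [b [y' [hy ->]]]; exists (a + b), (x' + y').
    by split; [exact: idealD|rewrite mulrDl addrACA].
  - move=> c x [a [x' [hx ->]]]; exists (c * a), (c * x').
    by split; [exact: idealM|rewrite mulrDr mulrA].
  - move=> x [->|hx]; first by exists 1, 0; rewrite mul1r addr0; split=> //; exact: ideal0.
    by exists 0, x; rewrite mul0r add0r; split=> //; exact: ideal_gen.
case: H0 => a [y [hy e]].
have -> : 1 = a ^+ N * f i ^+ N + (1 - (a * f i) ^+ N) by rewrite exprMn addrC subrK.
apply: idealD; first by apply/idealM/ideal_gen; right; exists i.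
(* Geometric sum: 1 - (a f)^N is a multiple of 1 - a f = y. *)
have -> : 1 - (a * f i) ^+ N = (\sum_(j < N) (a * f i) ^+ j) * y.
  rewrite -{1}(expr1n _ N) subrXX mulrC; congr (_ * _).
    by apply: eq_bigr => j _; rewrite expr1n mul1r.
  by rewrite {1}e addrC addKr.
exact: idealM.
Qed.

(** * The localized algebra and its universal property *)

Section LocalizationAlgebra.
Context (K : closedFieldType) (A : calg K) (f : A).
Let L := qring (loc_pre f).

Definition loc_elt (x : A) (n : nat) : L := @qpi (loc_pre f) (x, n).

Lemma loc_elt_eq x m y n :
  loc_elt x m = loc_elt y n <-> exists N, f ^+ N * (f ^+ n * x - f ^+ m * y) = 0.
Proof. exact: qpiP. Qed.

Lemma loc_eltD x m y n :
  loc_elt x m + loc_elt y n = loc_elt (f ^+ n * x + f ^+ m * y) (m + n).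
Proof. by rewrite /loc_elt -qpiD. Qed.

Lemma loc_eltM x m y n : loc_elt x m * loc_elt y n = loc_elt (x * y) (m + n).
Proof. by rewrite /loc_elt -qpiM. Qed.

Lemma loc_ind (P : L -> Prop) : (forall x n, P (loc_elt x n)) -> forall y, P y.
Proof. by move=> h; elim/qring_ind=> -[]. Qed.

Lemma loc_inB : zmod_morphism (fun x : A => loc_elt x 0).
Proof.
move=> x y; apply: (addIr (loc_elt y 0)).
by rewrite subrK loc_eltD /= !expr0 !mul1r subrK.
Qed.

Lemma loc_inM : monoid_morphism (fun x : A => loc_elt x 0).
Proof. by split=> // x y; rewrite loc_eltM. Qed.

Definition loc_str : {rmorphism K -> L} := mk_rmorph loc_inB loc_inM \o calg_str A.

Lemma loc_fg : exists s : seq L, forall P : L -> Prop,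
  (forall a, P (loc_str a)) -> (forall x, x \in s -> P x) ->
  (forall x y, P x -> P y -> P (x + y)) ->
  (forall x y, P x -> P y -> P (x * y)) -> forall x, P x.
Proof.
have [s hs] := calg_fg A.
exists (loc_elt 1 1 :: [seq loc_elt x 0 | x <- s]) => P hK hP hD hM.
have h0 x : P (loc_elt x 0).
  apply: (hs (fun x => P (loc_elt x 0))) => //.
  - by move=> y hy; apply: hP; rewrite inE; apply/orP; right; exact: (map_f (fun x => loc_elt x 0)).
  - by move=> y z hy hz; have := hD _ _ hy hz; rewrite -(raddfD (mk_rmorph loc_inB loc_inM)).
  - by move=> y z hy hz; have := hM _ _ hy hz; rewrite -(rmorphM (mk_rmorph loc_inB loc_inM)).
apply: loc_ind => x n; elim: n x => // n IH x.
have -> : loc_elt x n.+1 = loc_elt x n * loc_elt 1 1 by rewrite loc_eltM mulr1 addn1.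
by apply: hM => //; apply: hP; rewrite inE eqxx.
Qed.

Definition loc : calg K := @CAlg K L loc_str loc_fg.

Definition loc_in : hom A loc :=
  @Hom K A loc (mk_rmorph loc_inB loc_inM) (fun=> erefl).

Lemma loc_inE x : loc_in x = loc_elt x 0. Proof. by []. Qed.

Lemma loc_inv : invertible (loc_in f).
Proof.
exists (loc_elt 1 1); rewrite loc_inE loc_eltM; apply/loc_elt_eq; exists 0%N.
by rewrite add0n !expr0 !expr1; ring.
Qed.

Lemma loc_eltE x n : loc_in f ^+ n * loc_elt x n = loc_in x.
Proof.
rewrite -rmorphXn loc_inE loc_eltM; apply/loc_elt_eq; exists 0%N.
by rewrite add0n !expr0 !mul1r subrr.
Qed.

Lemma loc_surj (y : loc) : exists n x, loc_in f ^+ n * y = loc_in x.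
Proof. by elim/loc_ind: y => x n; exists n, x; rewrite loc_eltE. Qed.

Lemma loc_in0 x : loc_in x = 0 <-> exists N, f ^+ N * x = 0.
Proof.
split=> [/loc_elt_eq[N]|[N e]].
  by rewrite !expr0 !mul1r subr0; exists N.
by apply/loc_elt_eq; exists N; rewrite !expr0 !mul1r subr0.
Qed.
End LocalizationAlgebra.

Lemma invertible_can (A : comPzRingType) (x y z : A) :
  invertible x -> x * y = x * z -> y = z.
Proof.
move=> [t e] h; rewrite -(mul1r y) -(mul1r z) -e -!mulrA ![t * _]mulrC !mulrA h.
by [].
Qed.

Lemma invertibleM (A : comPzRingType) (x y : A) :
  invertible (x * y) <-> invertible x /\ invertible y.
Proof.
split=> [[z e]|[[z e] [t e']]].
  by split; [exists (y * z)|exists (x * z)]; rewrite -e; ring.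
by exists (z * t); rewrite mulrACA e e' mulr1.
Qed.

Lemma invertibleX (A : comPzRingType) (x : A) n :
  invertible x -> invertible (x ^+ n).
Proof. by case=> y e; exists (y ^+ n); rewrite -exprMn e expr1n. Qed.

Lemma invertible_map (A B : comPzRingType) (u : {rmorphism A -> B}) x :
  invertible x -> invertible (u x).
Proof. by case=> y e; exists (u y); rewrite -rmorphM e rmorph1. Qed.

Section LocalizationLift.
Context (K : closedFieldType) (A B : calg K) (f : A) (u : hom A B)
  (hf : invertible (u f)).

Let g : B := sval (cid hf).
Let gE : u f * g = 1. Proof. by rewrite /g; case: cid. Qed.

Definition loc_lift_fun (y : loc f) : B :=
  u (qrepr (P := loc_pre f) y).1 * g ^+ (qrepr (P := loc_pre f) y).2.

Let uM (x y : A) : u (x * y) = u x * u y. Proof. exact: rmorphM. Qed.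

Lemma loc_lift_elt x n : u f ^+ n * loc_lift_fun (loc_elt f x n) = u x.
Proof.
rewrite /loc_lift_fun; set q := qrepr _.
have [N e] : pr_eq q (x, n : nat) by exact: qrepr_pi.
have /(congr1 u) := e; rewrite rmorph0 !(uM, rmorphXn, rmorphB) /= => {}e.
apply: (@invertible_can _ (u f ^+ N * u f ^+ q.2)).
  by apply/invertibleM; split; apply: invertibleX.
apply/subr0_eq; rewrite -[RHS]e.
have h : u f ^+ q.2 * g ^+ q.2 = 1 by rewrite -exprMn gE expr1n.
rewrite mulrBr.
transitivity (u f ^+ N * (u f ^+ n * u q.1 * (u f ^+ q.2 * g ^+ q.2) - u f ^+ q.2 * u x)).
  by ring.
by rewrite h mulr1 mulrBr.
Qed.

Lemma loc_lift_eq (y z : B) n : u f ^+ n * y = u f ^+ n * z -> y = z.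
Proof. by apply: invertible_can; apply: invertibleX. Qed.

Definition loc_lift : hom (loc f) B.
Proof.
apply: (@mk_hom K (loc f) B loc_lift_fun).
- elim/loc_ind=> x m; elim/loc_ind=> y n.
  apply: (@loc_lift_eq _ _ (m + n)); rewrite mulrDr [LHS]/= loc_eltD loc_lift_elt.
  rewrite rmorphD !rmorphM !rmorphXn exprD -!mulrA -(loc_lift_elt x m) -(loc_lift_elt y n).
  by ring.
- elim/loc_ind=> x m; elim/loc_ind=> y n.
  apply: (@loc_lift_eq _ _ (m + n)); rewrite [X in _ * loc_lift_fun X]loc_eltM loc_lift_elt.
  by rewrite rmorphM exprD mulrACA !loc_lift_elt.
- by move=> a; rewrite -[LHS]mul1r -(expr0 (u f)) loc_lift_elt homK.
Defined.

Lemma loc_liftE x : loc_lift (loc_in f x) = u x.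
Proof. by rewrite -[LHS]mul1r -(expr0 (u f)) loc_lift_elt. Qed.

Lemma loc_liftK : hom_comp loc_lift (loc_in f) = u.
Proof. by apply: hom_ext => x; exact: loc_liftE. Qed.
End LocalizationLift.

Lemma loc_hom_ext (K : closedFieldType) (A B : calg K) (f : A)
  (v w : hom (loc f) B) :
  hom_comp v (loc_in f) = hom_comp w (loc_in f) -> v = w.
Proof.
move=> e; apply: hom_ext; elim/loc_ind=> x n.
have E z : v (loc_in f z) = w (loc_in f z) by rewrite -[LHS]/(hom_comp v _ z) e.
apply: (@invertible_can _ (v (loc_in f f) ^+ n)).
  exact/invertibleX/invertible_map/loc_inv.
have Ev (t : hom (loc f) B) :
    t (loc_in f f) ^+ n * t (loc_elt f x n) = t (loc_in f x).
  by rewrite -(loc_eltE f x n) rmorphM rmorphXn.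
by rewrite Ev !E Ev.
Qed.

(** * Quotient by an ideal *)

Section QuotientAlgebra.
Context (K : closedFieldType) (A : calg K) (I : A -> Prop).

Definition quot_pre : pre_ring.
Proof.
apply: (@PreRing A (fun x y => ideal I (x - y)) 0 1 -%R +%R *%R).
- by move=> x; rewrite subrr; exact: ideal0.
- by move=> x y h; rewrite -opprB; exact: idealN.
- by move=> y x z h h'; rewrite -(subrK y x) -addrA; exact: idealD.
- by move=> x y h; rewrite -opprD; exact: idealN.
- by move=> x x' y y' h h'; rewrite opprD addrACA; exact: idealD.
- move=> x x' y y' h h'.
  have -> : x * y - x' * y' = y * (x - x') + x' * (y - y') by ring.
  by apply: idealD; exact: idealM.
all: move=> *; match goal with |- ideal I ?a => (have -> : a = 0 by ring) end;
  exact: ideal0.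
Defined.

Let Q := qring quot_pre.
Let pi (x : A) : Q := @qpi quot_pre x.

Lemma quot_inB : zmod_morphism pi.
Proof.
move=> x y; apply: (addIr (pi y)).
by rewrite subrK -qpiD /= subrK.
Qed.

Lemma quot_inM : monoid_morphism pi.
Proof. by split=> // x y; rewrite -qpiM. Qed.

Definition quot_str : {rmorphism K -> Q} := mk_rmorph quot_inB quot_inM \o calg_str A.

Lemma quot_fg : exists s : seq Q, forall P : Q -> Prop,
  (forall a, P (quot_str a)) -> (forall x, x \in s -> P x) ->
  (forall x y, P x -> P y -> P (x + y)) ->
  (forall x y, P x -> P y -> P (x * y)) -> forall x, P x.
Proof.
have [s hs] := calg_fg A; exists [seq pi x | x <- s] => P hK hP hD hM.
elim/qring_ind; apply: (hs (fun x => P (pi x))) => //.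
- by move=> y hy; apply: hP; exact: (map_f pi).
- by move=> y z hy hz; have := hD _ _ hy hz; rewrite -(raddfD (mk_rmorph quot_inB quot_inM)).
- by move=> y z hy hz; have := hM _ _ hy hz; rewrite -(rmorphM (mk_rmorph quot_inB quot_inM)).
Qed.

Definition quot : calg K := @CAlg K Q quot_str quot_fg.

Definition quot_in : hom A quot :=
  @Hom K A quot (mk_rmorph quot_inB quot_inM) (fun=> erefl).

Lemma quot_surj (y : quot) : exists x, quot_in x = y.
Proof. by elim/qring_ind: y => x; exists x. Qed.

Lemma quot_in0 x : quot_in x = 0 <-> ideal I x.
Proof.
rewrite -[ideal I x]/(ideal I x); split=> [|h].
  by rewrite -[0]/(pi 0) => /qpiP /=; rewrite subr0.
by apply/(@qpiP quot_pre); rewrite /= subr0.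
Qed.

Lemma quot_gen x : I x -> quot_in x = 0.
Proof. by move=> h; apply/quot_in0/ideal_gen. Qed.
End QuotientAlgebra.

Section QuotientLift.
Context (K : closedFieldType) (A B : calg K) (I : A -> Prop) (u : hom A B)
  (hI : forall x, I x -> u x = 0).

Lemma hom_ideal x : ideal I x -> u x = 0.
Proof.
apply: (ideal_min (P := fun x => u x = 0)) => //.
- exact: rmorph0.
- by move=> y z hy hz; rewrite rmorphD hy hz addr0.
- by move=> a y hy; rewrite rmorphM hy mulr0.
Qed.

Definition quot_lift_fun (y : quot I) : B := u (qrepr (P := quot_pre I) y).

Lemma quot_lift_elt x : quot_lift_fun (quot_in I x) = u x.
Proof.
apply/subr0_eq; rewrite -rmorphB; apply: hom_ideal.
exact: (@qrepr_pi (quot_pre I)).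
Qed.

Definition quot_lift : hom (quot I) B.
Proof.
apply: (@mk_hom K (quot I) B quot_lift_fun).
- move=> x y; have [{}x <-] := quot_surj x; have [{}y <-] := quot_surj y.
  by rewrite -rmorphD !quot_lift_elt rmorphD.
- move=> x y; have [{}x <-] := quot_surj x; have [{}y <-] := quot_surj y.
  by rewrite -rmorphM !quot_lift_elt rmorphM.
- by move=> a; rewrite -(homK (quot_in I)) quot_lift_elt homK.
Defined.

Lemma quot_liftE x : quot_lift (quot_in I x) = u x.
Proof. exact: quot_lift_elt. Qed.

Lemma quot_liftK : hom_comp quot_lift (quot_in I) = u.
Proof. by apply: hom_ext => x; exact: quot_liftE. Qed.
End QuotientLift.

(** * The Nullstellensatz over the complex numbers *)

(** One step of the nested interval proof that the reals are uncountable. *)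
Lemma real_interval_avoid (R : realType) (s : seq R) (a b : R) : a < b ->
  exists a' b', [/\ a <= a', a' < b', b' <= b & forall x, x \in s -> ~~ (a' <= x <= b')].
Proof.
elim: s a b => [|x s IH] a b ab; first by exists a, b.
have [m [ma mb]] : exists m, a < m /\ m < b.
  by exists ((a + b) / 2); rewrite midf_lt // midf_lt.
have [a1 [b1 [h1 h2 h3 h4]]] : exists a1 b1, [/\ a <= a1, a1 < b1, b1 <= b &
    ~~ (a1 <= x <= b1)].
  have [xm|mx] := lerP x m.
    exists ((m + b) / 2), b; split=> //.
    - by apply: ltW; apply: (lt_trans ma); rewrite (midf_lt mb).
    - by rewrite (midf_lt mb).
    - by rewrite negb_and -ltNge (le_lt_trans xm) // (midf_lt mb).
  exists a, m; split=> //; first exact: ltW.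
  by rewrite negb_and orbC -ltNge mx.
have [a' [b' [k1 k2 k3 k4]]] := IH _ _ h2.
exists a', b'; split=> //; [exact: (le_trans h1)|exact: (le_trans k3)|].
move=> y; rewrite inE => /orP[/eqP->|]; last exact: k4.
apply: contra h4 => /andP[k5 k6].
by rewrite (le_trans k1 k5) (le_trans k6 k3).
Qed.

(** Nested intervals: the i-th step leaves the i-th list behind, and the supremum of the left
    endpoints lies in every interval. *)
Lemma real_not_countable_union (R : realType) (s : nat -> seq R) :
  exists x, forall i, x \notin s i.
Proof.
pose T := {p : R * R | p.1 < p.2}.
have step (i : nat) (p : T) : {q : T | [/\ (sval p).1 <= (sval q).1,
    (sval q).2 <= (sval p).2 &
    forall x, x \in s i -> ~~ ((sval q).1 <= x <= (sval q).2)]}.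
  case: p => -[a b] /= ab; apply: cid.
  have [a' [b' [h1 h2 h3 h4]]] := real_interval_avoid (s i) ab.
  by exists (exist (fun p : R * R => p.1 < p.2) (a', b') h2).
pose I := fix I n : T := if n is m.+1 then sval (step m (I m))
  else exist _ (0, 1) ltr01.
pose l n := (sval (I n)).1; pose u n := (sval (I n)).2.
have lu n : l n < u n by exact: (svalP (I n)).
have mono n m : (n <= m)%N -> l n <= l m /\ u m <= u n.
  move/subnK <-; elim: (m - n)%N => [|k [h1 h2]]; first by rewrite add0n.
  rewrite addSn /l /u /=; have [h3 h4 _] := svalP (step (k + n)%N (I (k + n)%N)).
  by split; [exact: le_trans h1 h3|exact: le_trans h4 h2].
have lun n m : l n <= u m.
  have [nm|/ltnW mn] := leqP n m.
    exact: le_trans (mono _ _ nm).1 (ltW (lu m)).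
  exact: le_trans (ltW (lu n)) (mono _ _ mn).2.
pose E : set R := fun x => exists n, x = l n.
have hE : has_sup E.
  split; first by exists (l 0%N), 0%N.
  by exists (u 0%N) => x [n ->].
exists (sup E) => i; apply/negP => hi.
have [_ _ /(_ _ hi)/negP] := svalP (step i (I i)); apply.
apply/andP; split; first by apply: (ub_le_sup hE.2); exists i.+1.
by apply: ge_sup => [|x [n ->]]; [exact: hE.1|exact: (lun n i.+1)].
Qed.

(** If all fibres were finite, the reals would be a countable union of finite sets. *)
Lemma real_infinite_fiber (R : realType) (N : R -> nat) :
  exists i, forall m, exists s : seq R,
    [/\ uniq s, size s = m & forall x, x \in s -> N x = i].
Proof.
apply: contrapT => /forallNP h.
have fin i : {s : seq R | forall x, N x = i -> x \in s}.
  apply: cid; apply: contrapT => /forallNP hs; apply: (h i).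
  elim=> [|m [s [su sm sN]]]; first by exists [::].
  have [x [hx /negP xs]] : exists x, N x = i /\ ~ (x \in s).
    apply: contrapT => hx; apply: (hs s) => x Nx.
    by apply: contrapT => xs; apply: hx; exists x.
  exists (x :: s); split; rewrite /= ?xs ?sm // => y.
  by rewrite inE => /orP[/eqP->|/sN].
have [x hx] := real_not_countable_union (fun i => sval (fin i)).
by have /negP := hx (N x); apply; exact: (svalP (fin (N x))).
Qed.

Section Span.
Context (K : closedFieldType) (A : calg K).

Definition in_span (L : seq A) (x : A) : Prop :=
  exists c : 'I_(size L) -> K, x = \sum_i calg_str A (c i) * tnth (in_tuple L) i.

Lemma in_span_cons y L x :
  in_span (y :: L) x <-> exists a z, in_span L z /\ x = calg_str A a * y + z.
Proof.
split=> [[c ->]|[a [z [[c ->] ->]]]].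
  exists (c ord0), (\sum_i calg_str A (c (lift ord0 i)) * tnth (in_tuple L) i).
  split; first by exists (fun i => c (lift ord0 i)).
  rewrite big_ord_recl; congr (_ * _ + _); apply: eq_bigr => i _.
  by congr (_ * _); rewrite !(tnth_nth 0).
exists (fun i : 'I_(size L).+1 => if unlift ord0 i is Some j then c j else a).
rewrite [RHS]big_ord_recl unlift_none; congr (_ * _ + _); apply: eq_bigr => i _.
by rewrite liftK; congr (_ * _); rewrite !(tnth_nth 0).
Qed.

Lemma in_spanP L x : in_span L x <->
  forall P : A -> Prop, P 0 -> (forall y z, P y -> P z -> P (y + z)) ->
   (forall a y, P y -> P (calg_str A a * y)) -> (forall y, y \in L -> P y) -> P x.
Proof.
split=> [[c ->] P P0 PD PZ PL|].
  by apply: (big_ind P) => // i _; apply/PZ/PL/mem_tnth.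
apply.
- by exists (fun=> 0); rewrite big1 // => i _; rewrite rmorph0 mul0r.
- move=> y z [c ->] [d ->]; exists (fun i => c i + d i).
  by rewrite -big_split; apply: eq_bigr => i _; rewrite rmorphD mulrDl.
- move=> a y [c ->]; exists (fun i => a * c i).
  by rewrite mulr_sumr; apply: eq_bigr => i _; rewrite rmorphM mulrA.
- elim: L => // y L IH z; rewrite inE => /orP[/eqP->|/IH hz]; apply/in_span_cons.
    exists 1, 0; rewrite rmorph1 mul1r addr0; split=> //.
    by exists (fun=> 0); rewrite big1 // => i _; rewrite rmorph0 mul0r.
  by exists 0, z; rewrite rmorph0 mul0r add0r.
Qed.

Lemma in_span_gen L x : x \in L -> in_span L x.
Proof. by move=> hx; apply/in_spanP => P _ _ _; apply. Qed.

Lemma in_span_sub L L' x : {subset L <= L'} -> in_span L x -> in_span L' x.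
Proof.
move=> h /in_spanP hx; apply/in_spanP => P P0 PD PZ PL; apply: hx => //.
by move=> y /h; exact: PL.
Qed.

Lemma in_spanD L x y : in_span L x -> in_span L y -> in_span L (x + y).
Proof.
move=> /in_spanP hx /in_spanP hy; apply/in_spanP => P P0 PD PZ PL.
exact: PD (hx P P0 PD PZ PL) (hy P P0 PD PZ PL).
Qed.

Lemma in_spanM L L' L'' x y :
  (forall a b, a \in L -> b \in L' -> a * b \in L'') ->
  in_span L x -> in_span L' y -> in_span L'' (x * y).
Proof.
move=> h /in_spanP hx /in_spanP hy; apply/in_spanP => P P0 PD PZ PL.
apply: (hx (fun x => P (x * y))).
- by rewrite mul0r.
- by move=> a b ha hb; rewrite mulrDl; exact: PD.
- by move=> a b hb; rewrite -mulrA; exact: PZ.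
move=> a ha; apply: (hy (fun y => P (a * y))).
- by rewrite mulr0.
- by move=> b c hb hc; rewrite mulrDr; exact: PD.
- by move=> c b hb; rewrite mulrCA; exact: PZ.
by move=> b hb; apply/PL/h.
Qed.

(** A finitely generated algebra has countable dimension: [L n] lists the products of at most n
    generators. *)
Lemma calg_countable_span :
  exists L : nat -> seq A, forall x, exists n, in_span (L n) x.
Proof.
have [s hs] := calg_fg A.
pose L := fix L n := if n is m.+1 then L m ++ [seq x * y | x <- s, y <- L m]
  else [:: 1].
have Lmono n m : (n <= m)%N -> {subset L n <= L m}.
  move/subnK <-; elim: (m - n)%N => [|k IH] x; first by rewrite add0n.
  by move/IH; rewrite addSn /= mem_cat => ->.
have LM n m x y : x \in L n -> y \in L m -> x * y \in L (n + m)%N.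
  elim: n x => [|n IH] x /=; first by rewrite inE => /eqP-> ?; rewrite mul1r.
  rewrite !mem_cat => /orP[hx hy|/allpairsP[[a b] /= [ha hb ->]] hy].
    by rewrite IH.
  apply/orP; right; rewrite -mulrA; apply: (allpairs_f (fun x y => x * y)) => //.
  exact: IH.
exists L; apply: hs.
- move=> a; exists 0%N; rewrite -[calg_str A a]mulr1.
  by apply/in_spanP => P _ _ PZ PL; apply/PZ/PL; rewrite inE.
- move=> x hx; exists 1%N; apply: in_span_gen; rewrite /L mem_cat; apply/orP; right.
  by rewrite -[x]mulr1; apply: (allpairs_f (fun x y => x * y)) => //; exact: mem_head.
- move=> x y [n hx] [m hy]; exists (n + m)%N; apply: in_spanD.
    by apply: in_span_sub hx; apply: Lmono; exact: leq_addr.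
  by apply: in_span_sub hy; apply: Lmono; exact: leq_addl.
- move=> x y [n hx] [m hy]; exists (n + m)%N; apply: in_spanM hx hy.
  exact: LM.
Qed.
End Span.

Lemma left_kernel_nonzero (F : fieldType) (m n : nat) (C : 'M[F]_(m, n)) :
  (n < m)%N -> exists2 v : 'rV_m, v != 0 & v *m C = 0.
Proof.
move=> nm; have /rowV0Pn[v /sub_kermxP vC v0] : kermx C != 0.
  rewrite -mxrank_eq0 mxrank_ker -lt0n subn_gt0.
  exact: leq_ltn_trans (rank_leq_col C) nm.
by exists v.
Qed.

Lemma in_span_dependent (K : closedFieldType) (A : calg K) (L : seq A)
    (m : nat) (y : 'I_m -> A) :
  (size L < m)%N -> (forall i, in_span L (y i)) ->
  exists c : 'I_m -> K, (exists i, c i != 0) /\ \sum_i calg_str A (c i) * y i = 0.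
Proof.
move=> lt /choice[C hC].
have [v v0 vC] := left_kernel_nonzero (\matrix_(i, j) C i j) lt.
exists (fun i => v 0 i); split.
  apply: contrapT => /forallNP h; move/eqP: v0; apply; apply/rowP => i.
  by rewrite mxE; apply/eqP; apply: contrapT => /negP; exact: h.
transitivity (\sum_j calg_str A (\sum_i v 0 i * C i j) * tnth (in_tuple L) j).
  under [RHS]eq_bigr => j _ do rewrite rmorph_sum mulr_suml.
  rewrite exchange_big /=; apply: eq_bigr => i _.
  by rewrite hC mulr_sumr; apply: eq_bigr => j _; rewrite rmorphM mulrA.
apply: big1 => j _; have /rowP/(_ j) := vC.
rewrite !mxE => e; rewrite (_ : \sum_i _ = 0) ?rmorph0 ?mul0r //.
by rewrite -[RHS]e; apply: eq_bigr => i _; rewrite mxE.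
Qed.

Section MaximalIdeal.
Context (A : comPzRingType) (I : A -> Prop) (I1 : ~ ideal I 1).

Lemma maximal_ideal : exists M : A -> Prop,
  [/\ forall x, I x -> M x, forall x, ideal M x -> M x, ~ M 1 &
      forall x, ~ M x -> exists y, M (y * x - 1)].
Proof.
(* Zorn's lemma is applied to sets J that together with I do not generate 1; the maximal ideal is
   the one generated by I and a maximal such J. *)
pose P (J : set A) := ~ ideal (fun x => I x \/ J x) 1.
have [|J [PJ Jmax]] := @Zorn_bigcup A P.
  move=> F FP Ftot h.
  suff H x : ideal (fun x => I x \/ (\bigcup_(X in F) X)%classic x) x ->
      ideal I x \/ exists2 X, F X & ideal (fun x => I x \/ X x) x.
    by case: (H _ h) => // -[X /FP].
  have sub X Y z : (forall x, X x -> Y x) ->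
      ideal (fun x => I x \/ X x) z -> ideal (fun x => I x \/ Y x) z.
    move=> XY; apply: ideal_sub => y [hy|/XY hy]; apply: ideal_gen; [left|right] => //.
  have subI X z : ideal I z -> ideal (fun x => I x \/ X x) z.
    by apply: ideal_sub => y hy; apply: ideal_gen; left.
  apply: (ideal_min (P := fun x =>
    ideal I x \/ exists2 X, F X & ideal (fun x => I x \/ X x) x)).
  - by left; exact: ideal0.
  - move=> y z [hy|[X FX hy]] [hz|[Y FY hz]].
    + by left; exact: idealD.
    + by right; exists Y => //; apply: idealD => //; exact: subI.
    + by right; exists X => //; apply: idealD => //; exact: subI.
    + right; case: (Ftot X Y FX FY) => XY.
        by exists Y => //; apply: idealD => //; apply: sub hy.
      by exists X => //; apply: idealD => //; apply: sub hz.
  - move=> a y [hy|[X FX hy]]; [left|right; exists X => //]; exact: idealM.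
  - by move=> y [hy|[X FX hy]]; [left|right; exists X => //]; apply: ideal_gen => //; right.
pose M x := ideal (fun x => I x \/ J x) x.
exists M; split=> //.
- by move=> x hx; apply: ideal_gen; left.
- by move=> x; apply: ideal_sub.
move=> x Mx; pose J' y := J y \/ y = x.
have : ideal (fun y => I y \/ J' y) 1.
  apply: contrapT; apply: (Jmax J'); split; first by move=> y; left.
  by move=> /(_ x) h; apply: Mx; apply: ideal_gen; right; apply: h; right.
have H y : ideal (fun y => I y \/ J' y) y -> exists a, M (a * x - y).
  apply: (ideal_min (P := fun y => exists a, M (a * x - y))).
  - by exists 0; rewrite mul0r subr0; exact: ideal0.
  - move=> z t [a ha] [b hb]; exists (a + b).
    by rewrite mulrDl opprD addrACA; exact: idealD.
  - move=> c z [a ha]; exists (c * a); rewrite -mulrA -mulrBr; exact: idealM.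
  - move=> z [hz|[hz|->]].
    + by exists 0; rewrite mul0r sub0r; apply/idealN/ideal_gen; left.
    + by exists 0; rewrite mul0r sub0r; apply/idealN/ideal_gen; right.
    + by exists 1; rewrite mul1r subrr; exact: ideal0.
exact: H.
Qed.
End MaximalIdeal.

Section Nullstellensatz.
Context (R : realType) (A : calg R[i]) (I : A -> Prop) (I1 : ~ ideal I 1).
Local Notation str := (calg_str A).

(** The uncountability proof of the Nullstellensatz. If no x - a lay in M, each would have an
    inverse y(a) modulo M. For infinitely many real a these lie in one finite-dimensional span,
    hence satisfy a linear relation. Clearing denominators gives a nonzero polynomial with value at
    x in M; it splits into linear factors, and M is prime. *)
Lemma maximal_ideal_residue (M : A -> Prop) :
  (forall x, ideal M x -> M x) -> ~ M 1 ->
  (forall x, ~ M x -> exists y, M (y * x - 1)) ->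
  forall x, exists a, M (x - str a).
Proof.
move=> Mid M1 Mmax x; apply: contrapT => /forallNP h.
have M0 : M 0 by apply/Mid/ideal0.
have MD y z : M y -> M z -> M (y + z).
  by move=> hy hz; apply/Mid/idealD; exact: ideal_gen.
have MM y z : M z -> M (y * z) by move=> hz; apply/Mid/idealM/ideal_gen.
have Mprime y z : M (y * z) -> M y \/ M z.
  move=> hyz; case: (pselect (M y)); [by left|right].
  case: (Mmax _ b) => t ht.
  have -> : z = t * (y * z) + (- z) * (t * y - 1) by ring.
  by apply: MD; exact: MM.
have [y hy] := choice (fun a => Mmax _ (h a)).
have [L hL] := calg_countable_span A.
have [N hN] := choice (fun r : R => hL (y (r%:C)%C)).
have [i /(_ (size (L i)).+1)[s [su ss sN]]] := real_infinite_fiber N.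
pose m := (size (L i)).+1; rewrite -/m in ss.
pose a (j : 'I_m) := ((s`_j)%:C)%C.
have ainj : injective a.
  move=> j k [/eqP]; rewrite nth_uniq ?ss // => /eqP; exact: val_inj.
have [||c [[j0 cj0] hc]] := @in_span_dependent _ _ (L i) m (fun j => y (a j)).
- exact: ltnSn.
- by move=> j; rewrite -(sN s`_j) //; apply: mem_nth; rewrite ss.
have A1 : (1 : A) != 0 by apply/eqP => e; apply: M1; rewrite e.
(* A is nonzero because 1 is not in M; [A'] records this so that polynomials can be evaluated in
   it. *)
pose A' : comNzRingType := HB.pack (calg_ring A) (GRing.PzSemiRing_isNonZero.Build A A1).
pose str' : {rmorphism R[i] -> A'} := str.
pose ev (p : {poly R[i]}) : A := (map_poly str' p).[x : A'].
(* The numerator of the sum of c_j / (x - a_j). Its value at a_j0 is nonzero because the a_k are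
   distinct and c_j0 is nonzero. *)
pose p := \sum_j c j *: \prod_(k | k != j) ('X - (a k)%:P).
have evX r : ev ('X - r%:P) = x - str r.
  by rewrite /ev rmorphB /= map_polyX map_polyC /= !hornerE.
have evprod (T : Type) (r : seq T) (P : pred T) (F : T -> {poly R[i]}) :
    ev (\prod_(t <- r | P t) F t) = \prod_(t <- r | P t) ev (F t).
  by rewrite /ev rmorph_prod /= horner_prod.
have evZ b q : ev (b *: q) = str b * ev q.
  by rewrite /ev linearZ /= hornerZ.
have hor j : (c j *: \prod_(k | k != j) ('X - (a k)%:P)).[a j0] =
    c j * \prod_(k | k != j) (a j0 - a k).
  by rewrite hornerZ horner_prod; under eq_bigr => k _ do rewrite !hornerE.
have pj0 : p.[a j0] = c j0 * \prod_(k | k != j0) (a j0 - a k).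
  rewrite /p horner_sum (bigD1 j0) //= hor [X in _ + X]big1 ?addr0 // => j jj0.
  by rewrite hor (bigD1 j0) 1?eq_sym //= subrr mul0r mulr0.
have p0 : p != 0.
  apply/eqP => e; have /eqP : p.[a j0] = 0 by rewrite e horner0.
  rewrite pj0 mulf_eq0 (negPf cj0) /= prodf_seq_eq0 => /hasP[k _ /andP[kj]].
  by rewrite subr_eq0 => /eqP/ainj e'; rewrite e' eqxx in kj.
have evp : ev p = \sum_j str (c j) * \prod_(k | k != j) (x - str (a k)).
  rewrite /p /ev rmorph_sum horner_sum; apply: eq_bigr => j _.
  rewrite -[LHS]/(ev (c j *: _)) evZ evprod; congr (_ * _).
  by apply: eq_bigr => k _; exact: evX.
have Mp : M (ev p).
  (* Modulo M the factor x - a_j is inverse to y(a_j), so p(x) is congruent to the relation [hc]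
     times the full product. *)
  have -> : ev p = - \sum_j (str (c j) * (\prod_(k | k != j) (x - str (a k)))) *
      (y (a j) * (x - str (a j)) - 1).
    under eq_bigr => j _ do rewrite mulrBr mulr1.
    rewrite sumrB -evp opprB -[LHS]subr0; congr (_ - _); symmetry.
    transitivity ((\prod_k (x - str (a k))) * \sum_j str (c j) * y (a j)); last first.
      by rewrite hc mulr0.
    rewrite [RHS]mulr_sumr; apply: eq_bigr => j _.
    by rewrite [in RHS](bigD1 j) //=; ring.
  rewrite -sumrN; apply: (big_ind M) => // j _; rewrite -mulNr.
  by apply: MM; exact: hy.
have [r pE] := closed_field_poly_normal p.
have lead_unit b : b != 0 -> ~ M (str b).
  move=> b0 hb; apply: M1.
  by rewrite -(rmorph1 str) -(mulVf b0) rmorphM; exact: MM.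
move: Mp; rewrite pE evZ evprod => /Mprime[]; first by apply: lead_unit; rewrite lead_coef_eq0.
elim: r {pE} => [|z r IH]; first by rewrite big_nil.
by rewrite big_cons evX => /Mprime[/h|/IH].
Qed.

Lemma nullstellensatz : exists u : hom A (base R[i]), forall x, I x -> u x = 0.
Proof.
have [M [MI Mid M1 Mmax]] := maximal_ideal I1.
have [phi hphi] := choice (maximal_ideal_residue Mid M1 Mmax).
have uniq_phi x a : M (x - str a) -> phi x = a.
  move=> h; apply/eqP; rewrite -subr_eq0; apply/eqP; apply: contrapT => /eqP b0.
  apply: M1; rewrite -(rmorph1 str) -(mulVf b0) rmorphM; apply/Mid/idealM.
  rewrite rmorphB; have -> : str (phi x) - str a = (x - str a) - (x - str (phi x)) by ring.
  by apply: idealB; exact: ideal_gen.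
have phiK a : phi (str a) = a.
  by apply: uniq_phi; rewrite subrr; apply/Mid/ideal0.
unshelve eexists.
  apply: (@mk_hom _ A (base R[i]) phi) => //.
  - move=> x y; apply: uniq_phi; rewrite rmorphD opprD addrACA.
    by apply/Mid/idealD; apply: ideal_gen.
  - move=> x y; apply: uniq_phi; rewrite rmorphM.
    have -> : x * y - str (phi x) * str (phi y) =
      y * (x - str (phi x)) + str (phi x) * (y - str (phi y)) by ring.
    by apply/Mid/idealD; apply/idealM/ideal_gen.
move=> x /MI hx; rewrite mk_homE; apply: uniq_phi.
by rewrite rmorph0 subr0.
Qed.
End Nullstellensatz.

(** * Zariski covers and closed points *)

Lemma idealP (A : comPzRingType) (k : nat) (f : 'I_k -> A) (y : A) :
  ideal (fun x => exists i, x = f i) y <-> exists c, \sum_i c i * f i = y.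
Proof.
split=> [|[c <-]]; last by exists k, f, c; split=> // i; exists i.
apply: (ideal_min (P := fun y => exists c, \sum_i c i * f i = y)).
- by exists (fun=> 0); rewrite big1 // => i _; rewrite mul0r.
- move=> _ _ [c <-] [d <-]; exists (fun i => c i + d i).
  by rewrite -big_split; apply: eq_bigr => i _; rewrite mulrDl.
- move=> a _ [c <-]; exists (fun i => a * c i).
  by rewrite mulr_sumr; apply: eq_bigr => i _; rewrite mulrA.
- move=> _ [i ->]; exists (fun j => (j == i)%:R).
  rewrite (bigD1 i) //= eqxx mul1r big1 ?addr0 // => j /negPf->.
  by rewrite mul0r.
Qed.

Lemma unit_ideal_map (A B : comPzRingType) (u : {rmorphism A -> B}) (k : nat)
    (f : 'I_k -> A) : unit_ideal (fun x => exists i, x = f i) ->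
  unit_ideal (fun x => exists i, x = u (f i)).
Proof.
move=> /idealP[c hc]; apply/idealP; exists (u \o c).
by rewrite -(rmorph1 u) -hc rmorph_sum; apply: eq_bigr => i _; rewrite rmorphM.
Qed.

Lemma ex_max (k : nat) (P : 'I_k -> nat -> Prop) :
  (forall i m n, (m <= n)%N -> P i m -> P i n) ->
  (forall i, exists n, P i n) -> exists n, forall i, P i n.
Proof.
move=> mono /choice[N hN]; exists (\max_i N i)%N => i.
exact: mono (leq_bigmax i) (hN i).
Qed.

Section Locally.
Context (K : closedFieldType).

Lemma locallyP (A : calg K) (P : forall B : calg K, hom A B -> Prop) :
  locally P -> exists (k : nat) (f : 'I_k -> A),
   unit_ideal (fun x => exists i, x = f i) /\
   forall i B (u : hom A B), invertible (u (f i)) -> P B u.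
Proof.
case=> k [f [a [hf hs]]]; exists k, f; split; last by move=> i B u; exact: hf.
by apply/idealP; exists a.
Qed.

Lemma locally_cover (A : calg K) (P : forall B : calg K, hom A B -> Prop)
    (k : nat) (f : 'I_k -> A) :
  unit_ideal (fun x => exists i, x = f i) ->
  (forall i B (u : hom A B), invertible (u (f i)) -> P B u) -> locally P.
Proof. by move=> /idealP[a ha] h; exists k, f, a; split. Qed.

Lemma locally_sub (A : calg K) (P Q : forall B : calg K, hom A B -> Prop) :
  (forall B u, P B u -> Q B u) -> locally P -> locally Q.
Proof.
move=> h; apply: ideal_sub => f hf; apply: ideal_gen => B u hu.
exact/h/hf.
Qed.

Lemma locallyT (A : calg K) (P : forall B : calg K, hom A B -> Prop) :
  (forall B u, P B u) -> locally P.
Proof. by move=> h; exact: ideal_gen. Qed.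

Lemma locally_and (A : calg K) (P Q : forall B : calg K, hom A B -> Prop) :
  locally P -> locally Q -> locally (fun B u => P B u /\ Q B u).
Proof.
move=> hP hQ; rewrite /locally.
set J := fun f : A => _.
suff H x y : ideal (fun f => forall B (u : hom A B), invertible (u f) -> P B u) x ->
    ideal (fun f => forall B (u : hom A B), invertible (u f) -> Q B u) y ->
    ideal J (x * y).
  by apply/unit_idealP; rewrite -[1]mulr1; exact: H.
move=> hx hy; move: hx; apply: (ideal_min (P := fun x => ideal J (x * y))).
- by rewrite mul0r; exact: ideal0.
- by move=> ? ? ? ?; rewrite mulrDl; exact: idealD.
- by move=> ? ? ?; rewrite -mulrA; exact: idealM.
move=> {}x hx; move: hy; apply: (ideal_min (P := fun y => ideal J (x * y))).
- by rewrite mulr0; exact: ideal0.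
- by move=> ? ? ? ?; rewrite mulrDr; exact: idealD.
- by move=> ? ? ?; rewrite mulrCA; exact: idealM.
move=> {}y hy; apply: ideal_gen => B u; rewrite rmorphM => /invertibleM[hux huy].
by split; [exact: hx|exact: hy].
Qed.

Lemma invertible_loc_mul (A B : calg K) (f x : A) (n : nat) (u : hom A B)
    (v : hom (loc f) B) (y : loc f) :
  hom_comp v (loc_in f) = u -> loc_in f f ^+ n * y = loc_in f x ->
  invertible (u (f * x)) -> invertible (v y).
Proof.
move=> <- /(congr1 v); rewrite rmorphM rmorphXn => e.
rewrite rmorphM => /invertibleM[_ /=]; rewrite -e => /invertibleM[] //.
Qed.

(** Covers of the D(f_i) are brought back to A by clearing denominators: a power of each f_i lies in
    the ideal of good elements, and these powers still generate 1. *)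
Lemma locally_trans (A : calg K) (P : forall B : calg K, hom A B -> Prop) :
  locally (fun B u => locally (fun D v => P D (hom_comp v u))) -> locally P.
Proof.
move=> /locallyP[k [f [hf hP]]]; rewrite /locally.
set J := fun f : A => _.
have H i : exists N, ideal J (f i ^+ N).
  have /= := hP i _ (loc_in (f i)) (loc_inv _).
  have Hy (y : loc (f i)) : ideal (fun g => forall (B : calg K) (u : hom (loc (f i)) B),
       invertible (u g) -> P B (hom_comp u (loc_in (f i)))) y ->
     exists N x, loc_in (f i) (f i) ^+ N * y = loc_in (f i) x /\ ideal J x.
    apply: (ideal_min (P := fun y => exists N x,
        loc_in (f i) (f i) ^+ N * y = loc_in (f i) x /\ ideal J x)).
    - by exists 0%N, 0; rewrite mulr0 rmorph0; split=> //; exact: ideal0.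
    - move=> y1 y2 [N1 [x1 [e1 h1]]] [N2 [x2 [e2 h2]]].
      exists (N1 + N2)%N, (f i ^+ N2 * x1 + f i ^+ N1 * x2).
      split; last by apply: idealD; exact: idealM.
      by rewrite rmorphD !rmorphM !rmorphXn -e1 -e2 exprD; ring.
    - move=> a y1 [N1 [x1 [e1 h1]]]; have [N2 [b e2]] := loc_surj a.
      exists (N1 + N2)%N, (b * x1); split; last exact: idealM.
      by rewrite rmorphM -e1 -e2 exprD; ring.
    - move=> y1 h1; have [N [x e]] := loc_surj y1.
      exists N.+1, (f i * x); split; first by rewrite rmorphM -e exprS mulrA.
      apply: ideal_gen => B u hu.
      have hfi : invertible (u (f i)) by move: hu; rewrite rmorphM => /invertibleM[].
      rewrite -(loc_liftK hfi); apply: h1.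
      exact: (invertible_loc_mul (loc_liftK hfi) e hu).
  move/Hy => [N [x [+ hx]]]; rewrite mulr1 -rmorphXn => /eqP.
  rewrite -subr_eq0 -rmorphB => /eqP/loc_in0[M e]; exists (M + N)%N.
  move: e; rewrite mulrBr -exprD => /subr0_eq ->; exact: idealM.
have [N hN] : exists N, forall i, ideal J (f i ^+ N).
  apply: ex_max H => i m n mn; rewrite -(subnK mn) exprD; exact: idealM.
apply: (ideal_sub _ (unit_ideal_pow N hf)) => x [i ->]; exact: hN.
Qed.

Lemma eq_locally (A : calg K) (x y : A) :
  locally (fun B (u : hom A B) => u x = u y) -> x = y.
Proof.
move=> /locallyP[k [f [hf hP]]].
have [N hN] : exists N, forall i, f i ^+ N * (x - y) = 0.
  apply: (@ex_max _ (fun i N => f i ^+ N * (x - y) = 0)).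
    by move=> i m n mn e; rewrite -(subnK mn) exprD -mulrA e mulr0.
  move=> i; apply/loc_in0; rewrite rmorphB; apply/eqP.
  rewrite subr_eq0; apply/eqP/hP; exact: loc_inv.
have /idealP[c hc] := unit_ideal_pow N hf.
apply/subr0_eq; rewrite -[LHS]mul1r -hc mulr_suml big1 // => i _.
by rewrite -mulrA hN mulr0.
Qed.

(** The affine line is a Zariski sheaf. Sections on a finite cover get a common denominator exponent
    N, agreement on overlaps holds after a further power M, and a partition of unity for the powers
    N + M assembles x. *)
Lemma glue_elements (A : calg K) (S : forall B : calg K, hom A B -> Prop)
    (s : forall (B : calg K) (u : hom A B), S B u -> B) :
  (forall B D (v : hom B D) (u : hom A B), S B u -> S D (hom_comp v u)) ->
  locally S ->
  (forall B D (v : hom B D) (u : hom A B) (hu : S B u)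
     (hvu : S D (hom_comp v u)), s D (hom_comp v u) hvu = v (s B u hu)) ->
  exists! x : A, forall B (u : hom A B) (hu : S B u), u x = s B u hu.
Proof.
move=> Sres Sloc scomp.
have sE B (u u' : hom A B) (h : S B u) (h' : S B u') : u = u' -> s B u h = s B u' h'.
  by move=> e; subst u'; rewrite (Prop_irrelevance h h').
have [k [f [hf hS]]] := locallyP Sloc.
have hi i : S _ (loc_in (f i)) by apply: hS; exact: loc_inv.
pose si i := s _ _ (hi i).
have [N hN] : exists N, forall i, exists x,
    loc_in (f i) (f i) ^+ N * si i = loc_in (f i) x.
  apply: (@ex_max _ (fun i N => exists x, loc_in (f i) (f i) ^+ N * si i = loc_in (f i) x)).
    move=> i m n mn [x e]; exists (f i ^+ (n - m) * x).
    by rewrite -{1}(subnK mn) exprD -mulrA e rmorphM rmorphXn.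
  by move=> i; exact: loc_surj.
have [a ha] := choice hN.
have inv1 (i j : 'I_k) (B : calg K) (u : hom A B) : invertible (u (f i * f j)) -> invertible (u (f i)).
  by rewrite rmorphM => /invertibleM[].
have inv2 (i j : 'I_k) (B : calg K) (u : hom A B) : invertible (u (f i * f j)) -> invertible (u (f j)).
  by rewrite rmorphM => /invertibleM[].
have aE B (u : hom A B) (hu : S B u) i : invertible (u (f i)) ->
    u (a i) = u (f i) ^+ N * s B u hu.
  move=> hfi; have /(congr1 (loc_lift hfi)) := ha i.
  rewrite rmorphM rmorphXn !loc_liftE => <-; congr (_ * _).
  rewrite /si -(scomp _ _ (loc_lift hfi) _ (hi i) (Sres _ _ _ _ (hi i))).
  by apply: sE; rewrite loc_liftK.
have [M hM] : exists M, forall ij : 'I_k * 'I_k,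
    (f ij.1 * f ij.2) ^+ M * (f ij.2 ^+ N * a ij.1 - f ij.1 ^+ N * a ij.2) = 0.
  have H (i j : 'I_k) : exists M, (f i * f j) ^+ M * (f j ^+ N * a i - f i ^+ N * a j) = 0.
    apply/loc_in0; set u := loc_in _.
    have hu := loc_inv (f i * f j); rewrite -/u in hu.
    have h1 := inv1 _ _ _ _ hu; have h2 := inv2 _ _ _ _ hu.
    have hSu := hS _ _ _ h1.
    rewrite rmorphB !rmorphM !rmorphXn (aE _ u hSu i h1) (aE _ u hSu j h2).
    by ring.
  have [M hM] : exists M : 'I_k -> 'I_k -> nat, forall i j,
      (f i * f j) ^+ M i j * (f j ^+ N * a i - f i ^+ N * a j) = 0.
    exists (fun i => projT1 (choice (H i))) => i j.
    by case: choice => M /= hM; exact: hM.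
  exists (\max_i \max_j M i j)%N => -[i j] /=.
  have le : (M i j <= \max_i \max_j M i j)%N.
    by apply: leq_trans (leq_bigmax i); exact: leq_bigmax.
  by rewrite -(subnK le) exprD -mulrA hM mulr0.
pose b i := f i ^+ M * a i.
have bE i j : f j ^+ (N + M) * b i = f i ^+ (N + M) * b j.
  apply/subr0_eq; rewrite -[RHS](hM (i, j)) /b /= !exprMn !exprD; ring.
have /idealP[c hc] := unit_ideal_pow (N + M) hf.
pose x := \sum_j c j * b j.
have xE i : f i ^+ (N + M) * x = b i.
  rewrite -[RHS]mul1r -hc mulr_suml mulr_sumr; apply: eq_bigr => j _.
  by rewrite mulrCA -bE mulrA.
have xS B (u : hom A B) (hu : S B u) : u x = s B u hu.
  apply: eq_locally; apply: (locally_cover (f := fun i => u (f i))).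
    exact: unit_ideal_map.
  move=> i D v hv; have hv' : invertible (hom_comp v u (f i)) by [].
  have hvu := Sres _ _ v _ hu.
  rewrite -(scomp _ _ v _ hu hvu) -[LHS]/(hom_comp v u x).
  apply: (invertible_can (invertibleX (N + M) hv')).
  rewrite -rmorphXn -rmorphM xE /b rmorphM rmorphXn (aE _ _ hvu i hv') mulrA.
  by rewrite addnC exprD rmorphM !rmorphXn.
exists x; split=> // y hy; apply: eq_locally; apply: locally_sub Sloc => B u hu.
by rewrite hy xS.
Qed.
End Locally.

Section ClosedPoints.
Context (R : realType).
Local Notation K := R[i].
Local Notation pt A := (hom A (base K)).

Lemma base_invertible (x : base K) : x != 0 -> invertible x.
Proof. by move=> x0; exists (x^-1 : K); exact: mulfV. Qed.

Lemma invertible_neq0 (x : base K) : invertible x -> x != 0.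
Proof.
case=> y e; apply/eqP => x0; have := oner_neq0 K.
by rewrite -[1]e x0 mul0r eqxx.
Qed.

(** The form in which the Nullstellensatz is used: covers are recognised on closed points. *)
Lemma unit_ideal_pt (A : calg K) (I : A -> Prop) :
  (forall p : pt A, exists2 x, I x & p x != 0) -> unit_ideal I.
Proof.
move=> h; apply: contrapT => /nullstellensatz[p hp].
by have [x /hp ->] := h p; rewrite eqxx.
Qed.

Lemma locally_pt (A : calg K) (P : forall B : calg K, hom A B -> Prop) :
  (forall p : pt A, exists2 g, p g != 0 &
     forall B (u : hom A B), invertible (u g) -> P B u) -> locally P.
Proof. by move=> h; apply: unit_ideal_pt => p; have [g pg hg] := h p; exists g. Qed.

Lemma locally_at_pt (A : calg K) (P : forall B : calg K, hom A B -> Prop) (p : pt A) :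
  locally P -> exists2 g, p g != 0 & forall B (u : hom A B), invertible (u g) -> P B u.
Proof.
move=> h; apply: contrapT => hn; have := oner_neq0 K.
rewrite -(rmorph1 p) (@hom_ideal _ _ _ _ p _ 1 h) ?eqxx // => x hx.
by apply: contrapT => /eqP px; apply: hn; exists x.
Qed.

(* Rabinowitsch trick. *)
Lemma ideal_power_pt (A : calg K) (I : A -> Prop) (g : A) :
  (forall p : pt A, p g != 0 -> exists2 s, ideal I s & p s != 0) ->
  exists N, ideal I (g ^+ N).
Proof.
move=> h; have H : ideal (fun y => exists2 s, ideal I s & y = loc_in g s) 1.
  apply: unit_ideal_pt => p.
  have pg : hom_comp p (loc_in g) g != 0.
    by apply: invertible_neq0; apply: (invertible_map p); exact: loc_inv.
  by have [s hs ps] := h _ pg; exists (loc_in g s) => //; exists s.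
have : exists N s, loc_in g g ^+ N * 1 = loc_in g s /\ ideal I s.
  move: H; apply: (ideal_min (P := fun y => exists N s,
      loc_in g g ^+ N * y = loc_in g s /\ ideal I s)).
  - by exists 0%N, 0; rewrite mulr0 rmorph0; split=> //; exact: ideal0.
  - move=> y1 y2 [N1 [x1 [e1 h1]]] [N2 [x2 [e2 h2]]].
    exists (N1 + N2)%N, (g ^+ N2 * x1 + g ^+ N1 * x2).
    split; last by apply: idealD; exact: idealM.
    by rewrite rmorphD !rmorphM !rmorphXn -e1 -e2 exprD; ring.
  - move=> a y1 [N1 [x1 [e1 h1]]]; have [N2 [b e2]] := loc_surj a.
    exists (N1 + N2)%N, (b * x1); split; last exact: idealM.
    by rewrite rmorphM -e1 -e2 exprD; ring.
  - by move=> y [s hs ->]; exists 0%N, s; rewrite expr0 mul1r.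
case=> N [s []]; rewrite mulr1 -rmorphXn => /eqP.
rewrite -subr_eq0 -rmorphB => /eqP/loc_in0[M e] hs; exists (M + N)%N.
by move: e; rewrite mulrBr -exprD => /subr0_eq ->; exact: idealM.
Qed.
End ClosedPoints.

(** * Open subfunctors *)

Lemma mor_ext (K : closedFieldType) (X Y : functor K) (f g : mor X Y) :
  (forall A x, f A x = g A x) -> f = g.
Proof.
case: f => f hf; case: g => g hg /= e.
have {}e : f = g.
  by apply: functional_extensionality_dep => A; apply/funext => x; exact: e.
by subst g; rewrite (Prop_irrelevance hf hg).
Qed.

Section Mor.
Context (K : closedFieldType).

Definition mor_comp (X Y Z : functor K) (g : mor Y Z) (f : mor X Y) : mor X Z.
Proof.
refine (@Mor K X Z (fun A x => g A (f A x)) _).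
by move=> A B u x; rewrite !mor_nat.
Defined.

Definition incl (X : functor K) (U : sub X) : mor (sub_functor U) X :=
  @Mor K (sub_functor U) X (fun A x => sval x) (fun _ _ _ _ => erefl).

Definition sub_incl (X : functor K) (U V : sub X) (h : forall A x, U A x -> V A x) :
  mor (sub_functor U) (sub_functor V).
Proof.
refine (@Mor K (sub_functor U) (sub_functor V) (fun A x => exist _ _ (h A _ (svalP x))) _).
by move=> A B u x; exact: exist_eq.
Defined.

Definition mor_restr (X Y : functor K) (f : mor X Y) (V : sub Y) :
  mor (sub_functor (preim f V)) (sub_functor V).
Proof.
refine (@Mor K (sub_functor (preim f V)) (sub_functor V)
  (fun A x => exist _ (f A (sval x)) (svalP x)) _).
by move=> A B u x; apply: exist_eq; rewrite /= mor_nat.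
Defined.

Definition sub_cap (X : functor K) (U V : sub X) : sub X.
Proof.
refine (@Sub K X (fun A x => U A x /\ V A x) _).
by move=> A B u x [hU hV]; split; exact: mem_res.
Defined.

Definition is_local (X : functor K) (U : sub X) :=
  forall (A : calg K) (x : X A), locally (fun B (u : hom A B) => U B (res u x)) -> U A x.

Lemma sheaf_separated (X : functor K) : is_sheaf X ->
  forall (A : calg K) (x y : X A),
  locally (fun B (u : hom A B) => res u x = res u y) -> x = y.
Proof.
move=> hX A x y hl.
have [||z [_ zu]] := hX A (fun B u => res u x = res u y) (fun B u _ => res u x) _ hl.
- by move=> B D v u e; rewrite !res_comp e.
- by move=> *; rewrite res_comp.
by rewrite -(zu x) // -(zu y).
Qed.

Lemma is_open_preim (X Y : functor K) (f : mor X Y) (U : sub Y) :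
  is_open U -> is_open (preim f U).
Proof.
move=> hU A x; have [I hI] := hU A (f A x); exists I => B u.
by rewrite -hI /= mor_nat.
Qed.
End Mor.

Section Nbhd.
Context (R : realType).
Local Notation K := R[i].
Local Notation pt A := (hom A (base K)).

(** P holds on a principal open neighbourhood of the closed point q. By the Nullstellensatz,
    neighbourhoods of all closed points form a cover ([locally_nbhd]). *)
Definition nbhd (A : calg K) (q : pt A) (P : forall B : calg K, hom A B -> Prop) :=
  exists2 g : A, q g != 0 & forall B (u : hom A B), invertible (u g) -> P B u.

Lemma nbhd_sub (A : calg K) (q : pt A) (P Q : forall B : calg K, hom A B -> Prop) :
  (forall B u, P B u -> Q B u) -> nbhd q P -> nbhd q Q.
Proof. by move=> h [g gq hg]; exists g => // B u hu; exact/h/hg. Qed.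

Lemma nbhdT (A : calg K) (q : pt A) (P : forall B : calg K, hom A B -> Prop) :
  (forall B u, P B u) -> nbhd q P.
Proof. by move=> h; exists 1; rewrite ?rmorph1 ?oner_neq0. Qed.

Lemma nbhd_and (A : calg K) (q : pt A) (P Q : forall B : calg K, hom A B -> Prop) :
  nbhd q P -> nbhd q Q -> nbhd q (fun B u => P B u /\ Q B u).
Proof.
move=> [f fq hf] [g gq hg]; exists (f * g); first by rewrite rmorphM mulf_neq0.
by move=> B u; rewrite rmorphM => /invertibleM[hx hy]; split; [exact: hf|exact: hg].
Qed.

Lemma nbhd_neq0 (A : calg K) (q : pt A) (g : A) :
  q g != 0 -> nbhd q (fun B u => invertible (u g)).
Proof. by move=> h; exists g. Qed.

(** The smaller neighbourhood is found on D(g), at a point over q, and brought back to A by clearing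
    denominators. This lets one property be arranged first and a second one, depending on its
    witnesses, afterwards. *)
Lemma nbhd_trans (A : calg K) (q : pt A) (P : forall B : calg K, hom A B -> Prop) :
  nbhd q (fun B u => forall q' : pt B, hom_comp q' u = q ->
    nbhd q' (fun D v => P D (hom_comp v u))) -> nbhd q P.
Proof.
move=> [g gq hg].
have iq : invertible (q g) by exact: base_invertible.
have [h hq hh] := hg _ _ (loc_inv g) (loc_lift iq) (loc_liftK iq).
have [n [x e]] := loc_surj h; exists (g * x).
  rewrite rmorphM mulf_neq0 //; have /(congr1 (loc_lift iq)) := e.
  by rewrite rmorphM rmorphXn !loc_liftE => <-; rewrite mulf_neq0 // expf_neq0.
move=> B u hu; have hug : invertible (u g).
  by move: hu; rewrite rmorphM => /invertibleM[].
rewrite -(loc_liftK hug); apply: hh.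
exact: (invertible_loc_mul (loc_liftK hug) e hu).
Qed.

Lemma locally_nbhd (A : calg K) (P : forall B : calg K, hom A B -> Prop) :
  (forall q : pt A, nbhd q P) -> locally P.
Proof. exact: locally_pt. Qed.

Lemma nbhd_locally (A : calg K) (q : pt A) (P : forall B : calg K, hom A B -> Prop) :
  locally P -> nbhd q P.
Proof. exact: locally_at_pt. Qed.

Lemma nbhd_pt (A : calg K) (q : pt A) (P : forall B : calg K, hom A B -> Prop) :
  nbhd q P -> P _ q.
Proof. by case=> g gq; apply; exact: base_invertible. Qed.

Section Open.
Context (X : functor K).
Implicit Types U V : sub X.

(** The ideal defining the complement is the unit ideal as soon as it vanishes at no closed
    point. *)
Lemma openP U : is_open U -> forall (A : calg K) (x : X A),
  (forall q : pt A, U _ (res q x)) -> U A x.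
Proof.
move=> hU A x h; have [I hI] := hU A x.
rewrite -[x]res_id; apply/hI/unit_ideal_pt => p.
have /hI := h p; case=> k [f [a [hf hs]]].
have [i fi] : exists i, f i != 0.
  apply: contrapT => /forallNP hn; have := oner_neq0 K.
  rewrite -[1]hs big1 ?eqxx // => i _.
  by have /negP := hn i; rewrite negbK => /eqP->; rewrite mulr0.
by have [g Ig e] := hf i; exists g; [exists g|rewrite -e].
Qed.

Lemma open_local U : is_open U -> is_local U.
Proof.
move=> hU A x hl; apply: openP => // q.
exact: (nbhd_pt (nbhd_locally q hl)).
Qed.

Lemma open_nbhd U : is_open U -> forall (A : calg K) (x : X A) (q : pt A),
  U _ (res q x) -> nbhd q (fun B u => U B (res u x)).
Proof.
move=> hU A x q hq; have [I hI] := hU A x.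
have : unit_ideal (fun b : base K => exists2 f, I f & b = q f) by apply/hI.
case=> k [f [a [hf hs]]].
have [i fi] : exists i, f i != 0.
  apply: contrapT => /forallNP hn; have := oner_neq0 K.
  rewrite -[1]hs big1 ?eqxx // => i _.
  by have /negP := hn i; rewrite negbK => /eqP->; rewrite mulr0.
have [g Ig e] := hf i; exists g; first by rewrite -e.
move=> B u [b hb]; apply/hI; exists 1%N, (fun=> u g), (fun=> b); split.
  by move=> _; exists g.
by rewrite big_ord1 mulrC.
Qed.

(** The ideal required by [is_open] consists of the g such that U holds on D(g); openness thus
    becomes a question about neighbourhoods of closed points. *)
Lemma open_crit U : is_local U ->
  (forall (A : calg K) (x : X A) (q : pt A),
    U _ (res q x) -> nbhd q (fun B u => U B (res u x))) -> is_open U.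
Proof.
move=> Uloc h A x.
exists (fun g => forall B (u : hom A B), invertible (u g) -> U B (res u x)).
move=> B u; split=> [hu|hu].
  apply: unit_ideal_pt => p; have [|g gp hg] := h A x (hom_comp p u).
    by rewrite res_comp; exact: mem_res.
  by exists (u g) => //; exists g.
apply: Uloc; apply: (ideal_sub _ hu) => _ [g hg ->]; apply: ideal_gen => D v hv.
by rewrite -res_comp; exact: hg.
Qed.

Lemma open_ext U V : is_open U -> is_open V ->
  (forall x, U (base K) x <-> V (base K) x) -> forall A x, U A x <-> V A x.
Proof.
move=> hU hV h A x; split=> hx; apply: openP => // q; apply/h; exact: mem_res.
Qed.

Lemma open_cap U V : is_open U -> is_open V -> is_open (sub_cap U V).
Proof.
move=> hU hV; apply: open_crit => [A x h|A x q [hq hq']].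
  split; apply: open_local => //; apply: locally_sub h => B u []//.
by apply: nbhd_and; exact: open_nbhd.
Qed.

End Open.

Lemma sub_irrel (X : functor K) (U : sub X) (T : sub (sub_functor U)) (A : calg K)
  (x y : sub_functor U A) : sval x = sval y -> T A x -> T A y.
Proof. by move=> /exist_eq ->. Qed.

Definition sub_image (X : functor K) (U : sub X) (T : sub (sub_functor U)) : sub X.
Proof.
refine (@Sub K X (fun A x => exists hx : U A x, T A (exist _ x hx)) _).
move=> A B u x [hx /(mem_res u) hT]; exists (mem_res u hx); exact: hT.
Defined.

Lemma open_image (X : functor K) (U : sub X) (T : sub (sub_functor U)) :
  is_open U -> is_open T -> is_open (sub_image T).
Proof.
move=> hU hT; apply: open_crit => [A x hl|A x q [hq hTq]].
  have hx : U A x by apply: open_local => //; apply: locally_sub hl => B u [].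
  exists hx; apply: (open_local hT); apply: locally_sub hl => B u [hx'].
  exact: sub_irrel.
apply: nbhd_trans; apply: nbhd_sub (open_nbhd hU hq) => B u hx q' e.
have := @open_nbhd _ T hT B (exist _ (res u x) hx) q' => h.
have {}h := h _; apply: nbhd_sub (h _).
  move=> D v hv; exists (eq_ind_r (U D) (mem_res v hx) (res_comp v u x)).
  by apply: sub_irrel hv; rewrite /= res_comp.
by apply: sub_irrel hTq; rewrite /= -res_comp e.
Qed.
End Nbhd.

(** * Geometric quotients are categorical quotients *)

Section GeometricQuotient.
Context (R : realType).
Local Notation K := R[i].
Context (X M : functor K) (E : forall A : calg K, X A -> X A -> Prop)
  (pi : mor X M) (gq : geometric_quotient E pi) (N : functor K)
  (schN : is_scheme N).

(** The two maps agree on closed points, since pi is onto there; hence locally they land in a common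
    affine chart of N. There each is a family of functions, and the uniqueness in [gq_functions]
    identifies these. *)
Lemma gq_mor_eq (V : sub M) (h1 h2 : mor (sub_functor V) N) :
  is_open V ->
  (forall A (x : X A) (hx : V A (pi A x)), h1 A (exist _ _ hx) = h2 A (exist _ _ hx)) ->
  forall A m, h1 A m = h2 A m.
Proof.
case: schN => shN [k [U [C [Uo Uiso Ucov]]]] Vo h12 A m.
have h12K (y : sub_functor V (base K)) : h1 _ y = h2 _ y.
  case: y => y hy; have [x e] := gq_surjective gq y.
  by move: hy; rewrite -e => hy; exact: h12.
have hcap i : is_open (sub_cap (preim h1 (U i)) (preim h2 (U i))).
  by apply: open_cap; exact: is_open_preim.
apply: sheaf_separated => //; apply: locally_sub (Ucov _ (h1 A m)) => B u [i hi].
have hm : sub_cap (preim h1 (U i)) (preim h2 (U i)) B (res u m).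
  have h1i : preim h1 (U i) B (res u m) by rewrite /= mor_nat.
  apply: (iffLR (@open_ext _ _ (preim h1 (U i)) _ _ (hcap i) _ _ _) h1i).
    exact: is_open_preim.
  by move=> y /=; rewrite h12K; split=> [|[]].
rewrite -!mor_nat; move: (res u m) hm => {u hi}m hm.
have [phi [psi [phiK _]]] := Uiso i.
(* The part of V that both maps send into the affine chart [U i], seen as an open of M. *)
pose W := sub_image (sub_cap (preim h1 (U i)) (preim h2 (U i))).
have Wo : is_open W by exact: open_image.
have wV (D : calg K) (y : sub_functor W D) : V D (sval y) by case: y => y [].
pose toV D (y : sub_functor W D) : sub_functor V D := exist _ (sval y) (wV D y).
have w1 (D : calg K) (y : sub_functor W D) : U i D (h1 D (toV D y)).
  case: (svalP y) => hx [h _]; move: h => /=; congr (U i D (h1 D _)); exact: exist_eq.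
have w2 (D : calg K) (y : sub_functor W D) : U i D (h2 D (toV D y)).
  case: (svalP y) => hx [_ h]; move: h => /=; congr (U i D (h2 D _)); exact: exist_eq.
have func (h : mor (sub_functor V) N)
    (w : forall (D : calg K) (y : sub_functor W D), U i D (h D (toV D y))) (a : C i) :
    exists F : mor (sub_functor W) (affine_line K),
    forall D (y : sub_functor W D), F D y = (phi D (exist _ _ (w D y))) a.
  unshelve eexists.
    refine (@Mor K (sub_functor W) (affine_line K)
      (fun D y => (phi D (exist _ _ (w D y))) a) _).
    move=> D D' v y /=; rewrite -[RHS]/((res v (phi D (exist _ _ (w D y)))) a).
    rewrite -mor_nat; congr ((phi D' _) a); apply: exist_eq => /=.
    by rewrite -mor_nat; congr (h D' _); exact: exist_eq.
  by [].
have eqF a : forall D (y : sub_functor W D),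
    (phi D (exist _ _ (w1 D y))) a = (phi D (exist _ _ (w2 D y))) a.
  have [F1 F1E] := func h1 w1 a; have [F2 F2E] := func h2 w2 a.
  pose f := mor_comp F1 (mor_restr pi W).
  have [|g [_ guniq]] := @gq_functions _ _ _ _ _ gq W Wo f.
    move=> D x y /(gq_invariant gq) e; rewrite /f /=; congr (F1 D _); apply: exist_eq; exact: e.
  have : F1 = F2.
    have <- : g = F1.
      by apply: guniq => D x hx; rewrite /f /=; congr (F1 D _); exact: exist_eq.
    apply: guniq => D x hx; rewrite /f /= F1E F2E.
    congr ((phi D _) a); apply: exist_eq => /=.
    rewrite (_ : toV D _ = exist _ _ (wV D (exist _ (pi D x) hx))); last exact: exist_eq.
    exact: h12.
  by move=> e D y; rewrite -F1E -F2E e.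
have mW : W B (sval m) by exists (svalP m); move: hm; apply: sub_irrel.
pose y : sub_functor W B := exist _ (sval m) mW.
have em : toV B y = m by exact: exist_eq.
have := congr1 (fun t => sval (psi B t)) (hom_ext (fun a => eqF a B y)).
by rewrite /= !phiK /= em.
Qed.

Section Descend.
Context (phi : mor X N) (phi_inv : forall A x y, E x y -> phi A x = phi A y).

(** Coordinates of the affine chart pull back to invariant functions, which descend by
    [gq_functions]; uniqueness of the descents makes them an algebra map out of C, that is a
    morphism to U. *)
Lemma gq_descend_open (U : sub N) (C : calg K) :
  is_open U -> iso (sub_functor U) (Spec C) ->
  exists V : sub M, is_open V /\ (forall A x, V A (pi A x) <-> U A (phi A x)) /\
   exists f : mor (sub_functor V) N,
     forall A x (hx : V A (pi A x)), f A (exist _ _ hx) = phi A x.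
Proof.
move=> Uo [th [ps [thK psK]]].
(* The preimage of U is a union of orbits, so submersiveness makes its image open. *)
have [V Vo hV] : zariski_open (fun m : M (base K) => exists2 x, U _ (phi _ x) & m = pi _ x).
  apply/(gq_submersive gq); exists (preim phi U); first exact: is_open_preim.
  move=> x /=; split=> [[y hy]|h]; last by exists x.
  by move=> /(gq_orbits gq)/phi_inv => ->.
exists V; have VU A x : V A (pi A x) <-> U A (phi A x).
  apply: (@open_ext _ _ (preim pi V) (preim phi U)); try exact: is_open_preim.
  move=> {}x /=; rewrite -hV; split=> [[y hy]|h]; last by exists x.
  by move=> /(gq_orbits gq)/phi_inv => ->.
split=> //; split=> //.
have func (a : C) : exists g : mor (sub_functor V) (affine_line K),
    (forall (A : calg K) (x : X A) (hx : V A (pi A x)),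
      g A (exist _ _ hx) = (th A (exist _ (phi A x) (iffLR (VU A x) hx))) a) /\
    forall g' : mor (sub_functor V) (affine_line K),
    (forall (A : calg K) (x : X A) (hx : V A (pi A x)),
      g' A (exist _ _ hx) = (th A (exist _ (phi A x) (iffLR (VU A x) hx))) a) -> g' = g.
  have hw (A : calg K) (x : sub_functor (preim pi V) A) : U A (phi A (sval x)).
    by apply/VU; exact: (svalP x).
  have nat (A B : calg K) (u : hom A B) (x : sub_functor (preim pi V) A) :
      (th B (exist _ (phi B (sval (res u x))) (hw B (res u x)))) a =
      u ((th A (exist _ (phi A (sval x)) (hw A x))) a).
    rewrite -[RHS]/((res u (th A (exist _ (phi A (sval x)) (hw A x)))) a) -mor_nat.
    by congr ((th B _) a); apply: exist_eq; rewrite /= mor_nat.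
  pose f := @Mor K (sub_functor (preim pi V)) (affine_line K)
     (fun A x => (th A (exist _ (phi A (sval x)) (hw A x))) a) nat.
  have [|g [hg guniq]] := @gq_functions _ _ _ _ _ gq V Vo f.
    move=> A x y /phi_inv e; rewrite /f /=; congr ((th A _) a); apply: exist_eq; exact: e.
  exists g; split=> [A x hx|g' hg'].
    by rewrite -hg /f /=; congr ((th A _) a); exact: exist_eq.
  symmetry; apply: guniq => A x hx; rewrite hg' /f /=.
  by congr ((th A _) a); exact: exist_eq.
pose g a := sval (cid (func a)).
have gE a (A : calg K) (x : X A) (hx : V A (pi A x)) :
  g a A (exist _ _ hx) = (th A (exist _ (phi A x) (iffLR (VU A x) hx))) a.
  exact: (proj2_sig (cid (func a))).1.
have guniq a (g' : mor (sub_functor V) (affine_line K)) : (forall (A : calg K) (x : X A) (hx : V A (pi A x)),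
      g' A (exist _ _ hx) = (th A (exist _ (phi A x) (iffLR (VU A x) hx))) a) -> g' = g a.
  exact: (proj2_sig (cid (func a))).2.
have gD a b A m : g (a + b) A m = g a A m + g b A m.
  have nat B D (u : hom B D) (y : sub_functor V B) :
      g a D (res u y) + g b D (res u y) = u (g a B y + g b B y).
    by rewrite rmorphD !mor_nat.
  rewrite -(guniq (a + b) (@Mor K (sub_functor V) (affine_line K) _ nat)) //.
  by move=> B x hx /=; rewrite !gE rmorphD.
have gM a b A m : g (a * b) A m = g a A m * g b A m.
  have nat B D (u : hom B D) (y : sub_functor V B) :
      g a D (res u y) * g b D (res u y) = u (g a B y * g b B y).
    by rewrite rmorphM !mor_nat.
  rewrite -(guniq (a * b) (@Mor K (sub_functor V) (affine_line K) _ nat)) //.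
  by move=> B x hx /=; rewrite !gE rmorphM.
have gK a A m : g (calg_str C a) A m = calg_str A a.
  have nat B D (u : hom B D) (y : sub_functor V B) : calg_str D a = u (calg_str B a).
    by rewrite homK.
  rewrite -(guniq _ (@Mor K (sub_functor V) (affine_line K) _ nat)) //.
  by move=> B x hx /=; rewrite homK.
pose G A m : Spec C A := @mk_hom K C A (fun a => g a A m) (fun a b => gD a b A m)
  (fun a b => gM a b A m) (fun a => gK a A m).
have nat A B (u : hom A B) (m : sub_functor V A) :
    sval (ps B (G B (res u m))) = res u (sval (ps A (G A m))).
  rewrite -[RHS]/(sval (res u (ps A (G A m)))) -mor_nat; congr (sval (ps B _)).
  by apply: hom_ext => a /=; rewrite mor_nat.
exists (@Mor K (sub_functor V) N (fun A m => sval (ps A (G A m))) nat).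
move=> A x hx /=; rewrite (_ : G A _ = th A (exist _ (phi A x) (iffLR (VU A x) hx))).
  by rewrite thK.
by apply: hom_ext => a /=; rewrite gE.
Qed.

(** The local factorisations agree on overlaps by [gq_mor_eq] and glue because N is a sheaf. *)
Lemma gq_descend : exists f : mor M N, forall A x, f A (pi A x) = phi A x.
Proof.
case: (schN) => shN [k [U [C [Uo Uiso Ucov]]]].
pose V i := sval (cid (gq_descend_open (Uo i) (Uiso i))).
have Vo i : is_open (V i) := (proj2_sig (cid (gq_descend_open (Uo i) (Uiso i)))).1.
have VU i A x : V i A (pi A x) <-> U i A (phi A x).
  exact: (proj2_sig (cid (gq_descend_open (Uo i) (Uiso i)))).2.1.
have hf i : exists f : mor (sub_functor (V i)) N,
     forall A x (hx : V i A (pi A x)), f A (exist _ _ hx) = phi A x.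
  exact: (proj2_sig (cid (gq_descend_open (Uo i) (Uiso i)))).2.2.
pose f i := sval (cid (hf i)).
have fE i A x (hx : V i A (pi A x)) : f i A (exist _ _ hx) = phi A x.
  exact: (proj2_sig (cid (hf i))).
have fcompat i j A m (hi : V i A m) (hj : V j A m) :
    f i A (exist _ m hi) = f j A (exist _ m hj).
  pose W := sub_cap (V i) (V j).
  pose p1 := @sub_incl K M W (V i) (fun A x h => h.1).
  pose p2 := @sub_incl K M W (V j) (fun A x h => h.2).
  have := @gq_mor_eq W (mor_comp (f i) p1) (mor_comp (f j) p2) (open_cap (Vo i) (Vo j)).
  have h A' (x : X A') (hx : W A' (pi A' x)) : mor_comp (f i) p1 A' (exist _ _ hx) =
      mor_comp (f j) p2 A' (exist _ _ hx) by rewrite /= !fE.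
  move=> /(_ h A (exist _ m (conj hi hj))) e.
  transitivity (mor_comp (f i) p1 A (exist _ m (conj hi hj))).
    by congr (f i A _); exact: exist_eq.
  by rewrite e; congr (f j A _); exact: exist_eq.
pose S A m B (u : hom A B) := exists i, V i B (res u m).
have Scov A m : locally (S A m).
  apply: locally_nbhd => q; have [x hx] := gq_surjective gq (res q m).
  have [i hi] := nbhd_pt (nbhd_locally (hom_id (base K)) (Ucov _ (phi _ x))).
  have hi' : V i _ (res q m) by rewrite -hx; apply/VU; rewrite res_id in hi.
  by apply: nbhd_sub (open_nbhd (Vo i) hi') => B u h; exists i.
pose s A m B (u : hom A B) (h : S A m B u) : N B :=
  f (sval (cid h)) B (exist (V (sval (cid h)) B) (res u m) (svalP (cid h))).
have sE A m B (u : hom A B) (h : S A m B u) i (hi : V i B (res u m)) :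
    s A m B u h = f i B (exist _ _ hi) by exact: fcompat.
have glue A m : exists! y : N A, forall B (u : hom A B) (h : S A m B u), res u y = s A m B u h.
  apply: shN (Scov A m) _.
    by move=> B D v u [i hi]; exists i; rewrite res_comp; exact: mem_res.
  move=> B D v u [i hi] hvu; rewrite (sE _ _ _ _ _ _ hi).
  have hi' : V i D (res (hom_comp v u) m) by rewrite res_comp; exact: mem_res.
  by rewrite (sE _ _ _ _ _ _ hi') -mor_nat; congr (f i D _); apply: exist_eq; rewrite /= res_comp.
pose F A m := sval (cid (glue A m)).
have FE A m B (u : hom A B) i (hi : V i B (res u m)) : res u (F A m) = f i B (exist _ _ hi).
  rewrite /F; case: cid => y [/= hy _]; rewrite (hy _ _ (ex_intro _ i hi)).
  exact: sE.
have Fnat A B (u : hom A B) (m : M A) : F B (res u m) = res u (F A m).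
  apply: sheaf_separated => //; apply: locally_sub (Scov B (res u m)) => D v [i hi].
  rewrite (FE _ _ _ _ _ hi) -[RHS]res_comp.
  have hi' : V i D (res (hom_comp v u) m) by rewrite res_comp.
  by rewrite (FE _ _ _ _ _ hi'); congr (f i D _); apply: exist_eq; rewrite /= res_comp.
exists (@Mor K M N F Fnat) => A x /=.
apply: sheaf_separated => //; apply: locally_sub (Scov A (pi A x)) => B u [i hi].
have hi' : V i B (pi B (res u x)) by rewrite mor_nat.
rewrite (FE _ _ _ _ _ hi) -[RHS]mor_nat -(fE i B _ hi'); congr (f i B _).
by apply: exist_eq; rewrite /= mor_nat.
Qed.
End Descend.
End GeometricQuotient.

(** Each quotient map factors through the other; the composites are compatible with the quotient
    maps, hence are identities by [gq_mor_eq]. *)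
Lemma gq_unique (R : realType) (X M M' : functor R[i])
    (E : forall A : calg R[i], X A -> X A -> Prop) (pi : mor X M) (pi' : mor X M') :
  is_scheme M -> is_scheme M' ->
  geometric_quotient E pi -> geometric_quotient E pi' -> iso M M'.
Proof.
move=> sM sM' gq gq'.
have [f hf] := gq_descend gq sM' (gq_invariant gq').
have [g hg] := gq_descend gq' sM (gq_invariant gq).
have rig (N : functor R[i]) (p : mor X N) (h : mor N N) : is_scheme N ->
    geometric_quotient E p -> (forall A x, h A (p A x) = p A x) ->
    forall A m, h A m = m.
  move=> sN gqN hh A m.
  pose T : sub N := @Sub _ N (fun _ _ => True) (fun _ _ _ _ _ => I).
  have To : is_open T.
    by apply: open_crit => // A' x q _; exact: nbhdT.
  have := @gq_mor_eq _ _ _ _ _ gqN N sN T (mor_comp h (incl T)) (incl T) To _ A (exist _ m I).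
  by apply=> A' x hx /=.
exists f, g; split=> A x.
  by apply: (rig M pi (mor_comp g f)) => // A' y /=; rewrite hf hg.
by apply: (rig M' pi' (mor_comp f g)) => // A' y /=; rewrite hg hf.
Qed.

(** * Commuting matrices with a cocyclic covector *)

(** Polynomial expressions in two letters, kept as syntax so that they can also be evaluated at
    matrices not yet known to commute. *)
Inductive bterm (A : Type) : Type :=
  | BC of A | BX | BY | BD of bterm A & bterm A | BM of bterm A & bterm A.
Arguments BX {A}. Arguments BY {A}.

Fixpoint bmap (A B : Type) (u : A -> B) (t : bterm A) : bterm B :=
  match t with
  | BC a => BC (u a) | BX => BX | BY => BY
  | BD s t => BD (bmap u s) (bmap u t) | BM s t => BM (bmap u s) (bmap u t)
  end.

Fixpoint beval (A : comPzRingType) (x y : A) (t : bterm A) : A :=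
  match t with
  | BC a => a | BX => x | BY => y
  | BD s t => beval x y s + beval x y t | BM s t => beval x y s * beval x y t
  end.

Fixpoint bmx (A : comPzRingType) (m : nat) (X Y : 'M[A]_m) (t : bterm A) : 'M[A]_m :=
  match t with
  | BC a => a%:M | BX => X | BY => Y
  | BD s t => bmx X Y s + bmx X Y t | BM s t => bmx X Y s *m bmx X Y t
  end.

Lemma beval_map (A B : comPzRingType) (u : {rmorphism A -> B}) x y t :
  beval (u x) (u y) (bmap u t) = u (beval x y t).
Proof.
by elim: t => //= [s -> t ->|s -> t ->]; rewrite ?rmorphD ?rmorphM.
Qed.

Lemma bmx_map (A B : comPzRingType) (u : {rmorphism A -> B}) m (X Y : 'M[A]_m) t :
  bmx (map_mx u X) (map_mx u Y) (bmap u t) = map_mx u (bmx X Y t).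
Proof.
by elim: t => //= [a|s -> t ->|s -> t ->]; rewrite ?map_scalar_mx ?map_mxD ?map_mxM.
Qed.

Lemma bmx_comm (A : comPzRingType) m (X Y Z : 'M[A]_m) t :
  X *m Z = Z *m X -> Y *m Z = Z *m Y -> bmx X Y t *m Z = Z *m bmx X Y t.
Proof.
move=> hX hY; elim: t => //= [a|s hs t ht|s hs t ht].
- by rewrite scalar_mxC.
- by rewrite mulmxDl mulmxDr hs ht.
- by rewrite -mulmxA ht mulmxA hs mulmxA.
Qed.

Lemma bmxC (A : comPzRingType) m (X Y : 'M[A]_m) s t :
  X *m Y = Y *m X -> bmx X Y s *m bmx X Y t = bmx X Y t *m bmx X Y s.
Proof. by move=> h; apply: bmx_comm; symmetry; apply: bmx_comm. Qed.

Record triple (m : nat) (A : Type) := Triple {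
  tD : 'M[A]_m; tE : 'M[A]_m; tl : 'rV[A]_m }.

Definition tmap m (A B : Type) (u : A -> B) (T : triple m A) : triple m B :=
  {| tD := map_mx u (tD T); tE := map_mx u (tE T); tl := map_mx u (tl T) |}.

Lemma tmap_comp m (A B D : Type) (v : B -> D) (u : A -> B) (T : triple m A) :
  tmap v (tmap u T) = tmap (v \o u) T.
Proof. by rewrite /tmap -!map_mx_comp. Qed.

Definition tmx m (A : comPzRingType) (T : triple m A) := bmx (tD T) (tE T).

Definition bcomb (A : comPzRingType) m (c : 'I_m -> A) (f : 'I_m -> bterm A) : bterm A :=
  \big[@BD A/BC 0]_j BM (BC (c j)) (f j).

Lemma tmx_bcomb m k (A : comPzRingType) (T : triple m A) (c : 'I_k -> A) f :
  tmx T (bcomb c f) = \sum_j c j *: tmx T (f j).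
Proof.
rewrite /bcomb; elim: (index_enum _) => [|i s IH].
  by rewrite !big_nil /tmx /= raddf0.
by rewrite !big_cons -IH /tmx /= mul_scalar_mx.
Qed.

(** The map sending t to l t(D, E) is onto the row vectors; commutation makes its kernel an ideal,
    so the quotient algebra is free of rank m. *)
Definition cocyclic m (A : comPzRingType) (T : triple m A) : Prop :=
  tD T *m tE T = tE T *m tD T /\
  forall j, exists t, tl T *m tmx T t = delta_mx 0 j.

Lemma cocyclic_map m (A B : comPzRingType) (u : {rmorphism A -> B}) (T : triple m A) :
  cocyclic T -> cocyclic (tmap u T).
Proof.
case=> h1 h2; split=> [|j] /=; first by rewrite -!map_mxM h1.
have [t e] := h2 j; exists (bmap u t).
by rewrite /tmx bmx_map -map_mxM -/(tmx T t) e map_delta_mx.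
Qed.

(** A B-point (a, b) of the subscheme: w collects the values at that point of the basis elements of
    the quotient algebra, and l w = 1 is the value of the function 1. *)
Definition eig m (B : comPzRingType) (T : triple m B) (a b : B) (w : 'cV[B]_m) : Prop :=
  [/\ tl T *m w = 1%:M, tD T *m w = a *: w & tE T *m w = b *: w].

Lemma eig_map m (A B : comPzRingType) (u : {rmorphism A -> B}) (T : triple m A) a b w :
  eig T a b w -> eig (tmap u T) (u a) (u b) (map_mx u w).
Proof.
by case=> h1 h2 h3; split; rewrite -map_mxM ?h1 ?h2 ?h3 ?map_scalar_mx ?rmorph1 ?map_mxZ.
Qed.

Lemma eig_tmx m (B : comPzRingType) (T : triple m B) a b w t :
  eig T a b w -> tmx T t *m w = beval a b t *: w.
Proof.
case=> _ h2 h3; elim: t => //= [c|s hs t ht|s hs t ht].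
- by rewrite /tmx /= mul_scalar_mx.
- by rewrite /tmx /= mulmxDl -!/(tmx _ _) hs ht scalerDl.
- by rewrite /tmx /= -mulmxA -!/(tmx _ _) ht -scalemxAr hs scalerA mulrC.
Qed.

Lemma eig_ltmx m (B : comPzRingType) (T : triple m B) a b w t :
  eig T a b w -> (tl T *m tmx T t) *m w = (beval a b t)%:M.
Proof.
move=> h; rewrite -mulmxA (eig_tmx _ h) -scalemxAr; case: h => -> _ _.
by rewrite scale_scalar_mx mulr1.
Qed.

Lemma row_mxE m (A : comPzRingType) (r : 'rV[A]_m) :
  r = \sum_j r 0 j *: delta_mx 0 j.
Proof. exact: row_sum_delta. Qed.

Section Cocyclic.
Context (m : nat) (A : comPzRingType) (T : triple m A) (hT : cocyclic T).

Lemma tmxC s t : tmx T s *m tmx T t = tmx T t *m tmx T s.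
Proof. by apply: bmxC; case: hT. Qed.

(* Row j of X is e_j X = l t_j X. *)
Lemma cocyclic_inj (X Y : 'M[A]_m) :
  (forall t, X *m tmx T t = tmx T t *m X) -> (forall t, Y *m tmx T t = tmx T t *m Y) ->
  tl T *m X = tl T *m Y -> X = Y.
Proof.
move=> hX hY e; apply/row_matrixP => j; rewrite !rowE.
have [t <-] := hT.2 j.
by rewrite -!mulmxA -hX -hY !mulmxA e.
Qed.

Lemma cocyclic_row (r : 'rV[A]_m) : exists t, tl T *m tmx T t = r.
Proof.
have [f hf] := choice hT.2.
exists (bcomb (r 0) f); rewrite [RHS]row_mxE tmx_bcomb mulmx_sumr.
by apply: eq_bigr => j _; rewrite -scalemxAr hf.
Qed.

End Cocyclic.

Section CocyclicAlgebra.
Context (K : closedFieldType) (m : nat) (A : calg K) (T : triple m A) (hT : cocyclic T).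

(* A[X, Y] modulo the kernel of its action on A^m through D and E. *)
Definition alg_pre : pre_ring.
Proof.
apply: (@PreRing (bterm A) (fun s t => tmx T s = tmx T t) (BC 0) (BC 1)
  (BM (BC (-1))) (@BD A) (@BM A)) => //; rewrite /tmx /=.
- by move=> s t r ->.
- by move=> s t ->.
- by move=> s s' t t' -> ->.
- by move=> s s' t t' -> ->.
- by move=> s t r; rewrite addrA.
- by move=> s t; rewrite addrC.
- by move=> s; rewrite raddf0 add0r.
- by move=> s; rewrite mul_scalar_mx scaleN1r addNr raddf0.
- by move=> s t r; rewrite mulmxA.
- by move=> s t; exact: tmxC.
- by move=> s; rewrite mul1mx.
- by move=> s t r; rewrite mulmxDl.
Defined.

Let Q := qring alg_pre.
Definition alg_pi (t : bterm A) : Q := @qpi alg_pre t.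

Lemma alg_piP s t : alg_pi s = alg_pi t <-> tmx T s = tmx T t.
Proof. exact: (@qpiP alg_pre). Qed.

Lemma alg_piD s t : alg_pi (BD s t) = alg_pi s + alg_pi t.
Proof. exact: (@qpiD alg_pre). Qed.
Lemma alg_piM s t : alg_pi (BM s t) = alg_pi s * alg_pi t.
Proof. exact: (@qpiM alg_pre). Qed.

Lemma alg_inB : zmod_morphism (fun a : A => alg_pi (BC a)).
Proof.
move=> x y; apply: (addIr (alg_pi (BC y))); rewrite subrK -alg_piD.
by apply/alg_piP; rewrite /tmx /= -raddfD subrK.
Qed.

Lemma alg_inM : monoid_morphism (fun a : A => alg_pi (BC a)).
Proof.
split=> // x y; rewrite -alg_piM; apply/alg_piP.
by rewrite /tmx /= scalar_mxM.
Qed.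

Definition alg_str : {rmorphism K -> Q} := mk_rmorph alg_inB alg_inM \o calg_str A.

Lemma alg_fg : exists s : seq Q, forall P : Q -> Prop,
  (forall a, P (alg_str a)) -> (forall x, x \in s -> P x) ->
  (forall x y, P x -> P y -> P (x + y)) ->
  (forall x y, P x -> P y -> P (x * y)) -> forall x, P x.
Proof.
have [s hs] := calg_fg A.
exists [:: alg_pi BX, alg_pi BY & [seq alg_pi (BC x) | x <- s]] => P hK hP hD hM.
suff h (t : bterm A) : P (alg_pi t) by apply: (@qring_ind alg_pre P) => t; exact: h.
elim: t => [a| | |t1 h1 t2 h2|t1 h1 t2 h2].
- apply: (hs (fun x => P (alg_pi (BC x)))) => //.
  + move=> y hy; apply: hP; rewrite !inE; apply/orP; right; apply/orP; right.
    exact: (map_f (fun x => alg_pi (BC x))).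
  + by move=> y z hy hz; have := hD _ _ hy hz; rewrite -(raddfD (mk_rmorph alg_inB alg_inM)).
  + by move=> y z hy hz; have := hM _ _ hy hz; rewrite -(rmorphM (mk_rmorph alg_inB alg_inM)).
- by apply: hP; rewrite inE eqxx.
- by apply: hP; rewrite !inE eqxx orbT.
- by rewrite alg_piD; exact: hD.
- by rewrite alg_piM; exact: hM.
Qed.

Definition alg : calg K := @CAlg K Q alg_str alg_fg.

Definition alg_in : hom A alg := @Hom K A alg (mk_rmorph alg_inB alg_inM) (fun=> erefl).

Lemma alg_ind (P : alg -> Prop) : (forall t, P (alg_pi t)) -> forall x, P x.
Proof. exact: (@qring_ind alg_pre P). Qed.

Definition algX : alg := alg_pi BX.
Definition algY : alg := alg_pi BY.

Lemma alg_hom_ext (B : calg K) (v w : hom alg B) :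
  hom_comp v alg_in = hom_comp w alg_in -> v algX = w algX -> v algY = w algY -> v = w.
Proof.
move=> e eX eY; apply: hom_ext; apply: alg_ind.
elim=> [a| | |s hs t ht|s hs t ht] //.
- by have := congr1 (fun f : hom A B => f a) e.
- by rewrite alg_piD !rmorphD hs ht.
- by rewrite alg_piM !rmorphM hs ht.
Qed.

Definition alg_basis (j : 'I_m) : alg := alg_pi (sval (cid (hT.2 j))).

Lemma alg_basis_term : exists f, forall j, alg_basis j = alg_pi (f j) /\
  tl T *m tmx T (f j) = delta_mx 0 j.
Proof. by exists (fun j => sval (cid (hT.2 j))) => j; split=> //; case: cid. Qed.

Lemma alg_bcomb k (c : 'I_k -> A) f :
  alg_pi (bcomb c f) = \sum_j alg_in (c j) * alg_pi (f j).
Proof.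
rewrite /bcomb; elim: (index_enum _) => [|i s IH]; first by rewrite !big_nil.
by rewrite !big_cons alg_piD alg_piM IH.
Qed.

Lemma alg_basisE t : alg_pi t = \sum_j alg_in ((tl T *m tmx T t) 0 j) * alg_basis j.
Proof.
have [f hf] := alg_basis_term.
under eq_bigr => j _ do rewrite (hf j).1.
rewrite -alg_bcomb; apply/alg_piP; apply: (cocyclic_inj hT); try by move=> s; exact: tmxC.
rewrite tmx_bcomb mulmx_sumr {1}(row_mxE (_ *m _)); apply: eq_bigr => j _.
by rewrite -scalemxAr (hf j).2.
Qed.

Lemma alg_lin_free (c : 'I_m -> A) :
  \sum_j alg_in (c j) * alg_basis j = 0 -> forall j, c j = 0.
Proof.
have [f hf] := alg_basis_term.
under eq_bigr => j _ do rewrite (hf j).1.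
rewrite -alg_bcomb -[0]/(alg_pi (BC 0)) => /alg_piP /(congr1 (mulmx (tl T))).
rewrite tmx_bcomb {2}/tmx /= raddf0 mulmx0 mulmx_sumr => e j.
have := congr1 (fun r : 'rV[A]_m => r 0 j) e; rewrite mxE => <-.
under eq_bigr => i _ do rewrite -scalemxAr (hf i).2.
transitivity ((\sum_i (\row_i c i) 0 i *: delta_mx 0 i : 'rV[A]_m) 0 j).
  by rewrite -row_mxE mxE.
by congr (fun_of_matrix _ _ _); apply: eq_bigr => i _; rewrite mxE.
Qed.

End CocyclicAlgebra.

Section AlgLift.
Context (K : closedFieldType) (m : nat) (A B : calg K) (T : triple m A)
  (hT : cocyclic T) (v : hom A B) (a b : B) (w : 'cV[B]_m)
  (hw : eig (tmap v T) a b w).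

Lemma tmx_tmap (n : nat) (C D : comPzRingType) (u : {rmorphism C -> D}) (S : triple n C) t :
  tmx (tmap u S) (bmap u t) = map_mx u (tmx S t).
Proof. exact: bmx_map. Qed.

(** Because l t(D, E) w = t(a, b), the value of t at the point depends only on the action of t. *)
Lemma alg_lift_wd s t : tmx T s = tmx T t -> beval a b (bmap v s) = beval a b (bmap v t).
Proof.
move=> e; have E r : (map_mx v (tl T *m tmx T r)) *m w = (beval a b (bmap v r))%:M.
  by rewrite -(eig_ltmx _ hw) tmx_tmap -map_mxM.
have := E s; rewrite e E => /matrixP/(_ 0 0); rewrite !mxE eqxx !mulr1n.
by move=> ->.
Qed.

Definition alg_lift_fun (x : alg hT) : B :=
  beval a b (bmap v (qrepr (P := alg_pre hT) x)).

Lemma alg_lift_pi t : alg_lift_fun (alg_pi hT t) = beval a b (bmap v t).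
Proof. by apply: alg_lift_wd; exact: (@qrepr_pi (alg_pre hT)). Qed.

Definition alg_lift : hom (alg hT) B.
Proof.
apply: (@mk_hom K (alg hT) B alg_lift_fun).
- apply: (@alg_ind _ _ _ _ hT) => s; apply: (@alg_ind _ _ _ _ hT) => t.
  by rewrite -alg_piD !alg_lift_pi.
- apply: (@alg_ind _ _ _ _ hT) => s; apply: (@alg_ind _ _ _ _ hT) => t.
  by rewrite -alg_piM !alg_lift_pi.
- by move=> c; rewrite [LHS]alg_lift_pi /= homK.
Defined.

Lemma alg_liftE t : alg_lift (alg_pi hT t) = beval a b (bmap v t).
Proof. exact: alg_lift_pi. Qed.

Lemma alg_liftK : hom_comp alg_lift (alg_in hT) = v.
Proof. by apply: hom_ext => x; exact: alg_lift_pi. Qed.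

Lemma alg_liftX : alg_lift (algX hT) = a. Proof. exact: alg_liftE. Qed.
Lemma alg_liftY : alg_lift (algY hT) = b. Proof. exact: alg_liftE. Qed.
End AlgLift.

(** The universal point: the column of basis elements is an eigenvector, since l t(D, E) lists the
    coordinates of t in that basis. *)
Lemma alg_eig (K : closedFieldType) (m : nat) (A : calg K) (T : triple m A)
    (hT : cocyclic T) :
  eig (tmap (alg_in hT) T) (algX hT) (algY hT) (\col_j alg_basis hT j).
Proof.
have [f hf] := alg_basis_term hT.
have E (r : 'rV[A]_m) t : tl T *m tmx T t = r ->
    \sum_j alg_in hT (r 0 j) * alg_basis hT j = alg_pi hT t.
  by move=> <-; rewrite -alg_basisE.
split; apply/matrixP => i k; rewrite !ord1 !mxE.
- transitivity (\sum_j alg_in hT (tl T 0 j) * alg_basis hT j).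
    by apply: eq_bigr => j _; rewrite !mxE.
  by rewrite (E _ (BC 1)) // /tmx /= mulmx1.
- transitivity (\sum_j alg_in hT ((row i (tD T)) 0 j) * alg_basis hT j).
    by apply: eq_bigr => j _; rewrite !mxE.
  rewrite (E _ (BM BX (f i))); first by rewrite alg_piM (hf i).1.
  by rewrite rowE -(hf i).2 -mulmxA (tmxC hT (f i) BX).
- transitivity (\sum_j alg_in hT ((row i (tE T)) 0 j) * alg_basis hT j).
    by apply: eq_bigr => j _; rewrite !mxE.
  rewrite (E _ (BM BY (f i))); first by rewrite alg_piM (hf i).1.
  by rewrite rowE -(hf i).2 -mulmxA (tmxC hT (f i) BY).
Qed.

(** * Homogeneous coordinates on Xi *)

(* [hx : hy] are homogeneous coordinates on the base; the fibre coordinate hz *)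
(* has weight -n, and the charts are [x : 1] and [1 : x].                     *)
Record hpt (A : comPzRingType) := HPt {
  hx : A; hy : A; hz : A;
  hpt_unim : exists b1 b2, b1 * hx + b2 * hy = 1
}.

Lemma hpt_ext (A : comPzRingType) (h h' : hpt A) :
  hx h = hx h' -> hy h = hy h' -> hz h = hz h' -> h = h'.
Proof.
case: h => x y z e; case: h' => x' y' z' e' /= hx hy hz; subst.
by rewrite (Prop_irrelevance e e').
Qed.

Lemma hmap_unim (A B : comPzRingType) (u : {rmorphism A -> B}) (h : hpt A) :
  exists b1 b2, b1 * u (hx h) + b2 * u (hy h) = 1.
Proof.
have [b1 [b2 e]] := hpt_unim h; exists (u b1), (u b2).
by rewrite -!rmorphM -rmorphD e rmorph1.
Qed.

Definition hmap (A B : comPzRingType) (u : {rmorphism A -> B}) (h : hpt A) : hpt B :=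
  {| hx := u (hx h); hy := u (hy h); hz := u (hz h); hpt_unim := hmap_unim u h |}.

Definition hrel (n : nat) (A : comPzRingType) (h : hpt A) (p : chart A) : Prop :=
  match p with
  | inl (x, t) => hx h = x * hy h /\ t = hy h ^+ n * hz h
  | inr (x, t) => hy h = x * hx h /\ t = hx h ^+ n * hz h
  end.

Lemma hrel_inl n (A : comPzRingType) (h : hpt A) x t :
  hrel n h (inl (x, t)) -> invertible (hy h).
Proof.
case=> e _; have [b1 [b2 e']] := hpt_unim h; exists (b1 * x + b2).
by rewrite -e' e; ring.
Qed.

Lemma hrel_inr n (A : comPzRingType) (h : hpt A) x t :
  hrel n h (inr (x, t)) -> invertible (hx h).
Proof.
case=> e _; have [b1 [b2 e']] := hpt_unim h; exists (b1 + b2 * x).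
by rewrite -e' e; ring.
Qed.

Lemma invertible_inj (A : comPzRingType) (x y z : A) :
  invertible x -> y * x = z * x -> y = z.
Proof. by move=> h; rewrite ![_ * x]mulrC; exact: invertible_can. Qed.

Lemma hrel_glued n (A : comPzRingType) (h : hpt A) (p q : chart A) :
  hrel n h p -> (hrel n h q <-> glued n p q).
Proof.
case: p => -[x t]; case: q => -[x' t'] hp /=.
- have i := hrel_inl hp; case: hp => e1 e2; split=> [[e3 e4]|[<- <-]]; last by split.
  by rewrite e4 -e2; congr (_, _); apply: (invertible_inj i); rewrite -e1.
- have i := hrel_inl hp; case: hp => e1 e2; split=> [[e3 e4]|[e3 e4]].
    split; last by rewrite e4 e2 mulrA -exprMn -e1.
    by apply: (invertible_inj i); rewrite mul1r {2}e3 e1; ring.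
  split; first by rewrite e1 mulrA [x' * x]mulrC e3 mul1r.
  by rewrite e4 e2 mulrA -exprMn -e1.
- have i := hrel_inr hp; case: hp => e1 e2; split=> [[e3 e4]|[e3 e4]].
    have e5 : x' * x = 1 by apply: (invertible_inj i); rewrite mul1r {2}e3 e1; ring.
    by split=> //; rewrite e4 e2 mulrA -exprMn -e3.
  have e5 : hx h = x' * hy h by rewrite e1 mulrA e3 mul1r.
  split=> //; have ix : invertible x' by exists x.
  apply: (invertible_can (invertibleX n ix)).
  by rewrite -e4 e2 mulrA -exprMn -e5.
- have i := hrel_inr hp; case: hp => e1 e2; split=> [[e3 e4]|[<- <-]]; last by split.
  by rewrite e4 -e2; congr (_, _); apply: (invertible_inj i); rewrite -e1.
Qed.

Lemma hrel_map n (A B : comPzRingType) (u : {rmorphism A -> B}) (h : hpt A) p :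
  hrel n h p -> hrel n (hmap u h) (chart_map u p).
Proof.
by case: p => -[x t] /= [e1 e2]; split; rewrite ?e1 ?e2 ?rmorphM ?rmorphXn.
Qed.

Lemma hrel_inl_ex n (A : comPzRingType) (h : hpt A) :
  invertible (hy h) -> exists p, hrel n h p.
Proof.
case=> g e; exists (inl (hx h * g, hy h ^+ n * hz h)); split=> //.
by rewrite -mulrA [g * _]mulrC e mulr1.
Qed.

Lemma hrel_inr_ex n (A : comPzRingType) (h : hpt A) :
  invertible (hx h) -> exists p, hrel n h p.
Proof.
case=> g e; exists (inr (hy h * g, hx h ^+ n * hz h)); split=> //.
by rewrite -mulrA [g * _]mulrC e mulr1.
Qed.

Section MkXi.
Context (K : closedFieldType) (n : nat).

Lemma hmap_comp (A B D : calg K) (v : hom B D) (u : hom A B) (h : hpt A) :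
  hmap (hom_comp v u) h = hmap v (hmap u h).
Proof. exact: hpt_ext. Qed.

Lemma hpt_locally (A : calg K) (h : hpt A) :
  locally (fun B (u : hom A B) => exists p, hrel n (hmap u h) p).
Proof.
have [b1 [b2 e]] := hpt_unim h.
rewrite /locally; apply/unit_idealP; rewrite -e.
apply: idealD; apply: idealM; apply: ideal_gen => B u hu.
  exact: hrel_inr_ex.
exact: hrel_inl_ex.
Qed.

Definition mkXi (A : calg K) (h : hpt A) : Xi K n A.
Proof.
refine (@XiPt K n A (fun B u p => hrel n (hmap u h) p) _ _ _ _).
- by move=> B D v u p hp; rewrite (hmap_comp v u); exact: hrel_map.
- by move=> B u p q; exact: hrel_glued.
- move=> B u p hl.
  case: p hl => -[x t] hl; split; apply: eq_locally; apply: locally_sub hl => D v;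
    rewrite (hmap_comp v u) => -[/= e1 e2]; rewrite ?rmorphM ?rmorphXn //.
- exact: hpt_locally.
Defined.

Lemma mkXi_res (A B : calg K) (u : hom A B) (h : hpt A) :
  res u (mkXi h) = mkXi (hmap u h).
Proof. by apply: Xi_ext => D v p /=; rewrite -hmap_comp. Qed.

Lemma Xi_eq_chart (A : calg K) (xi eta : Xi K n A) (p : chart A) :
  xi_rel xi (hom_id A) p -> xi_rel eta (hom_id A) p -> xi = eta.
Proof.
move=> h1 h2; apply: Xi_ext => B u q.
have := xi_res u h1; have := xi_res u h2; rewrite hom_compu1 => h3 h4.
by rewrite (xi_glued q h3) (xi_glued q h4).
Qed.

Lemma xi_rel_res (A B : calg K) (xi : Xi K n A) (w : hom A B) q :
  xi_rel (res w xi) (hom_id B) q <-> xi_rel xi w q.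
Proof. by rewrite /= spec_res_id. Qed.

Lemma Xi_separated (A : calg K) (xi eta : Xi K n A) :
  locally (fun B (u : hom A B) => res u xi = res u eta) -> xi = eta.
Proof.
have H (x1 x2 : Xi K n A) B (u : hom A B) p :
    locally (fun B (u : hom A B) => res u x1 = res u x2) ->
    xi_rel x1 u p -> xi_rel x2 u p.
  move=> hl h; apply: xi_local; apply: locally_sub (locally_res u hl) => D v e.
  by apply/xi_rel_res; rewrite -e; apply/xi_rel_res; exact: xi_res.
move=> hl; apply: Xi_ext => B u p; split; apply: H => //.
by apply: locally_sub hl => D v ->.
Qed.

Lemma unim_l (A : comPzRingType) (x : A) : exists b1 b2, b1 * x + b2 * 1 = 1.
Proof. by exists 0, 1; rewrite mul0r mul1r add0r. Qed.

Lemma unim_r (A : comPzRingType) (x : A) : exists b1 b2, b1 * 1 + b2 * x = 1.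
Proof. by exists 1, 0; rewrite mul0r mul1r addr0. Qed.

Definition chart_hpt (A : comPzRingType) (p : chart A) : hpt A :=
  match p with
  | inl q => @HPt A q.1 1 q.2 (unim_l q.1)
  | inr q => @HPt A 1 q.1 q.2 (unim_r q.1)
  end.

Lemma hrel_chart_hpt (A : comPzRingType) (p : chart A) : hrel n (chart_hpt p) p.
Proof. by case: p => -[x t] /=; rewrite expr1n mulr1 mul1r. Qed.

Lemma mkXi_chart (A : calg K) (xi : Xi K n A) (p : chart A) :
  xi_rel xi (hom_id A) p -> xi = mkXi (chart_hpt p).
Proof.
move=> h; apply: (@Xi_eq_chart _ _ _ p) => //=.
have -> : hmap (hom_id A) (chart_hpt p) = chart_hpt p by exact: hpt_ext.
exact: hrel_chart_hpt.
Qed.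

Lemma Xi_locally_hpt (A : calg K) (xi : Xi K n A) :
  locally (fun B (u : hom A B) => exists h, res u xi = mkXi h).
Proof.
apply: locally_sub (xi_cover xi) => B u [p hp]; exists (chart_hpt p).
by apply: mkXi_chart; apply/xi_rel_res.
Qed.

Lemma mkXi_eqP (A : calg K) (h h' : hpt A) : mkXi h = mkXi h' <->
  exists c, [/\ invertible c, hx h' = c * hx h, hy h' = c * hy h & hz h = c ^+ n * hz h'].
Proof.
split=> [e|[c [ic ex ey ez]]]; last first.
  apply: Xi_ext => B u p /=; have iuc := invertible_map u ic.
  case: p => -[x t] /=; rewrite ex ey ez !rmorphM rmorphXn.
    rewrite exprMn (mulrA _ (u c ^+ n)) [u (hy h) ^+ n * _]mulrC.
    split=> -[e1 ->]; split=> //; first by rewrite e1; ring.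
    by apply: (invertible_can iuc); rewrite e1; ring.
  rewrite exprMn (mulrA _ (u c ^+ n)) [u (hx h) ^+ n * _]mulrC.
  split=> -[e1 ->]; split=> //; first by rewrite e1; ring.
  by apply: (invertible_can iuc); rewrite e1; ring.
have hl : locally (fun B (u : hom A B) => exists p, hrel n (hmap u h) p /\ hrel n (hmap u h') p).
  apply: locally_sub (hpt_locally h) => B u [p hp]; exists p; split=> //.
  by rewrite -[hrel _ _ _]/(xi_rel (mkXi h') u p) -e.
(* The charts give proportionality of (x, y) and (x', y'); a Bezout relation for the first pair then
   produces the scaling factor c. *)
have cross : hx h * hy h' = hy h * hx h'.
  apply: eq_locally; apply: locally_sub hl => B u [[[x t]|[x t]] [/= [e1 _] [e2 _]]].
    by rewrite !rmorphM e1 e2; ring.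
  by rewrite !rmorphM e1 e2; ring.
have [b1 [b2 eb]] := hpt_unim h; pose c := b1 * hx h' + b2 * hy h'.
have ex : hx h' = c * hx h.
  transitivity ((b1 * hx h + b2 * hy h) * hx h'); first by rewrite eb mul1r.
  by rewrite /c !mulrDl -[in RHS]mulrA [_ * hx h]mulrC -[b2 * hy h * _]mulrA -cross; ring.
have ey : hy h' = c * hy h.
  transitivity ((b1 * hx h + b2 * hy h) * hy h'); first by rewrite eb mul1r.
  by rewrite /c !mulrDl -[b1 * hx h * _]mulrA cross; ring.
exists c; split=> //.
  have [d1 [d2 ed]] := hpt_unim h'; exists (d1 * hx h + d2 * hy h).
  by rewrite -ed ex ey; ring.
apply: eq_locally; apply: locally_sub hl => B u [[[x t]|[x t]] [h1 h2]].
  have i1 := hrel_inl h1; have i2 := hrel_inl h2.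
  case: h1 h2 => [_ e1] [_ e2]; rewrite rmorphM rmorphXn.
  apply: (invertible_can (invertibleX n i1)); rewrite -e1 e2 /= ey rmorphM exprMn; ring.
have i1 := hrel_inr h1; have i2 := hrel_inr h2.
case: h1 h2 => [_ e1] [_ e2]; rewrite rmorphM rmorphXn.
apply: (invertible_can (invertibleX n i1)); rewrite -e1 e2 /= ex rmorphM exprMn; ring.
Qed.

(** The chart where the section x + k y of O(1) does not vanish. *)

Lemma hk_unim (A : calg K) (k : K) (a : A) :
  exists b1 b2, b1 * (1 - calg_str A k * a) + b2 * a = 1.
Proof. by exists 1, (calg_str A k); ring. Qed.

(** Homogeneous coordinates normalised by x + k y = 1, with y = a. *)
Definition hk (A : calg K) (k : K) (a b : A) : hpt A :=
  {| hx := 1 - calg_str A k * a; hy := a; hz := b; hpt_unim := hk_unim k a |}.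

Lemma hk_map (A B : calg K) (u : hom A B) k a b : hmap u (hk k a b) = hk k (u a) (u b).
Proof. by apply: hpt_ext => //=; rewrite rmorphB rmorph1 rmorphM homK. Qed.

Lemma mkXi_hkP (A : calg K) (h : hpt A) (k : K) (a b : A) :
  mkXi h = mkXi (hk k a b) <->
  (hx h + calg_str A k * hy h) * a = hy h /\
  [/\ invertible (hx h + calg_str A k * hy h) &
  b = (hx h + calg_str A k * hy h) ^+ n * hz h].
Proof.
set s := hx h + _; rewrite mkXi_eqP; split=> [[c /= [ic ex ey ez]]|[e1 [ic e2]]].
  have sc : c * s = 1 by rewrite /s mulrDr -ex mulrCA -ey subrK.
  split; first by rewrite ey mulrA [s * c]mulrC sc mul1r.
  split; first by exists c; rewrite mulrC.
  by rewrite ez mulrA -exprMn [s * c]mulrC sc expr1n mul1r.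
case: (ic) => c sc; exists c => /=.
have sc' : c * s = 1 by rewrite mulrC.
have ey : a = c * hy h by rewrite -e1 mulrA sc' mul1r.
split=> //; first by exists s.
  by rewrite -sc' ey /s; ring.
by rewrite e2 mulrA -exprMn sc' expr1n mul1r.
Qed.

Lemma mkXi_hk_inj (A : calg K) (k : K) (a b a' b' : A) :
  mkXi (hk k a b) = mkXi (hk k a' b') -> a = a' /\ b = b'.
Proof.
move=> /mkXi_hkP /=; have -> : 1 - calg_str A k * a + calg_str A k * a = 1 by ring.
by rewrite expr1n !mul1r => -[-> [_ ->]].
Qed.

Lemma mkXi_hk_ex (A : calg K) (h : hpt A) (k : K) :
  invertible (hx h + calg_str A k * hy h) -> exists a b, mkXi h = mkXi (hk k a b).
Proof.
move=> ic; case: (ic) => c sc; exists (c * hy h), ((hx h + calg_str A k * hy h) ^+ n * hz h).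
by apply/mkXi_hkP; rewrite mulrA sc mul1r.
Qed.
End MkXi.

(** * Gluing affine schemes over a Zariski cover of the base *)

Section LocLift.
Context (K : closedFieldType) (Q B D : calg K) (p : hom Q B) (f : Q)
  (h0 : forall x, p x = 0 -> exists N, f ^+ N * x = 0)
  (hs : forall b, exists N x, p x = p f ^+ N * b).

(** The hypotheses [h0] and [hs] make B a localization of Q at f up to powers of f, so fractions
    determine the values of the extension. *)
Lemma loc_like_lift (u : hom Q D) : invertible (u f) ->
  exists t : hom B D, hom_comp t p = u.
Proof.
move=> uf; pose rel b d := exists N x, p x = p f ^+ N * b /\ u f ^+ N * d = u x.
have rel_ex b : exists d, rel b d.
  have [N [x e]] := hs b; have [g hg] := invertibleX N uf.
  by exists (g * u x), N, x; split=> //; rewrite mulrA hg mul1r.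
have rel_uniq b d d' : rel b d -> rel b d' -> d = d'.
  move=> [N [x [e1 e2]]] [N' [x' [e1' e2']]].
  have [|M hM] := h0 (x := f ^+ N' * x - f ^+ N * x').
    by rewrite rmorphB !rmorphM !rmorphXn e1 e1' mulrCA subrr.
  apply: (invertible_can (invertibleX (M + (N + N')) uf)).
  have /(congr1 u) := hM; rewrite rmorph0 rmorphM rmorphB !rmorphM !rmorphXn -e2 -e2'.
  by move=> e; apply/subr0_eq; rewrite -[RHS]e !exprD; ring.
have [t ht] := choice rel_ex.
have tP b d : rel b d -> t b = d by apply: rel_uniq.
have tp x : t (p x) = u x by apply: tP; exists 0%N, x; rewrite !expr0 !mul1r.
unshelve eexists.
  apply: (@mk_hom K B D t).
  - move=> b b'; have [N [x [e1 e2]]] := ht b; have [N' [x' [e1' e2']]] := ht b'.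
    apply: tP; exists (N + N')%N, (f ^+ N' * x + f ^+ N * x').
    rewrite !rmorphD !rmorphM !rmorphXn e1 e1' -e2 -e2' !exprD.
    by split; ring.
  - move=> b b'; have [N [x [e1 e2]]] := ht b; have [N' [x' [e1' e2']]] := ht b'.
    apply: tP; exists (N + N')%N, (x * x').
    by rewrite !rmorphM e1 e1' -e2 -e2' !exprD; split; ring.
  - by move=> a; rewrite -(homK p) tp homK.
exact: hom_ext.
Qed.

Lemma loc_like_ext (t t' : hom B D) : invertible (p f) ->
  hom_comp t p = hom_comp t' p -> t = t'.
Proof.
move=> pf e; apply: hom_ext => b; have [N [x ex]] := hs b.
have E y : t (p y) = t' (p y) by rewrite -[LHS]/(hom_comp t p y) e.
apply: (invertible_can (invertible_map t (invertibleX N pf))).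
by rewrite -rmorphM -ex E ex rmorphM !rmorphXn E.
Qed.
End LocLift.

Section GlueAffine.
Context (K : closedFieldType) (G : functor K) (shG : is_sheaf G) (A : calg K)
  (st : mor G (Spec A)) (r : nat) (f : 'I_r -> A)
  (hf : unit_ideal (fun x => exists i, x = f i))
  (B : 'I_r -> calg K) (gam : forall i, G (B i))
  (gam_inv : forall i, invertible ((st _ (gam i)) (f i)))
  (gam_univ : forall i (D : calg K) (g : G D), invertible ((st _ g) (f i)) ->
     exists! t : hom (B i) D, res t (gam i) = g).

Local Notation F g i := ((st _ g) (f i)).
Local Notation O := (mor G (affine_line K)).

Lemma st_res (C D : calg K) (v : hom C D) (g : G C) (a : A) :
  (st _ (res v g)) a = v ((st _ g) a).
Proof. by rewrite mor_nat. Qed.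

Lemma glue_cover (D : calg K) (g : G D) :
  locally (fun C (v : hom D C) => exists i, invertible (F (res v g) i)).
Proof.
apply: (locally_cover (f := fun i => F g i)); first exact: unit_ideal_map.
by move=> i C v hv; exists i; rewrite st_res.
Qed.

(** G is represented over each D(f_j) by [B j] with universal point [gam j]. On piece j, a function
    vanishing over D(f_i) is killed by a power of f_i; finitely many pieces allow a uniform
    exponent. *)
Lemma fun_vanish (phi : O) (i : 'I_r) : phi _ (gam i) = 0 ->
  exists N, forall (D : calg K) (g : G D), F g i ^+ N * phi _ g = 0.
Proof.
move=> h0.
have [N hN] : exists N, forall j, F (gam j) i ^+ N * phi _ (gam j) = 0.
  apply: (@ex_max _ (fun j N => F (gam j) i ^+ N * phi _ (gam j) = 0)).
    by move=> j m n mn e; rewrite -(subnK mn) exprD -mulrA e mulr0.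
  move=> j; apply/loc_in0; set w := loc_in _.
  have hw : invertible (F (res w (gam j)) i) by rewrite st_res; exact: loc_inv.
  have [t [et _]] := gam_univ hw.
  by rewrite -[LHS]/(res w (phi _ (gam j))) -mor_nat -et mor_nat h0 /= rmorph0.
exists N => D g; apply: eq_locally; apply: locally_sub (glue_cover g) => C v [j hj].
have [t [et _]] := gam_univ hj.
rewrite rmorphM rmorphXn -st_res rmorph0 -[v (phi D g)]/(res v (phi D g)) -mor_nat -et.
by rewrite st_res -rmorphXn mor_nat -[res t _]/(t (phi _ (gam j))) -rmorphM hN rmorph0.
Qed.

Lemma fun_eq (phi psi : O) : (forall i, phi _ (gam i) = psi _ (gam i)) ->
  forall (D : calg K) (g : G D), phi _ g = psi _ g.
Proof.
move=> h D g; apply: eq_locally; apply: locally_sub (glue_cover g) => C v [j hj].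
have [t [et _]] := gam_univ hj.
rewrite -[v (phi _ _)]/(res v (phi _ _)) -[v (psi _ _)]/(res v (psi _ _)).
by rewrite -!mor_nat -et !mor_nat h.
Qed.

Definition gam_map i (D : calg K) (g : G D) (hg : invertible (F g i)) : hom (B i) D :=
  sval (cid (gam_univ hg)).

Lemma gam_mapE i (D : calg K) (g : G D) (hg : invertible (F g i)) :
  res (gam_map hg) (gam i) = g.
Proof. by rewrite /gam_map; case: cid => t []. Qed.

Lemma gam_map_uniq i (D : calg K) (g : G D) (hg : invertible (F g i)) (t : hom (B i) D) :
  res t (gam i) = g -> t = gam_map hg.
Proof. by move=> e; symmetry; exact: (proj2_sig (cid (gam_univ hg))).2. Qed.

Lemma gam_map_res i (C D : calg K) (w : hom C D) (g : G C) (hg : invertible (F g i))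
    (hg' : invertible (F (res w g) i)) (b : B i) :
  w (gam_map hg b) = gam_map hg' b.
Proof.
have <- : hom_comp w (gam_map hg) = gam_map hg' by apply: gam_map_uniq; rewrite res_comp gam_mapE.
by [].
Qed.

(** A function on piece i extends to the whole of G after multiplication by a power of f_i: N clears
    denominators on each piece, M makes the resulting functions agree on overlaps, and they glue. *)
Lemma fun_extend (i : 'I_r) (b : B i) :
  exists N (phi : O), phi _ (gam i) = F (gam i) i ^+ N * b.
Proof.
pose L j := loc (F (gam j) i).
have hL j : invertible (F (res (loc_in _ : hom _ (L j)) (gam j)) i).
  by rewrite st_res; exact: loc_inv.
have [N hN] : exists N, forall j, exists bj : B j,
    loc_in _ (F (gam j) i) ^+ N * gam_map (hL j) b = (loc_in _ bj : L j).
  apply: (@ex_max _ (fun j N => exists bj : B j,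
    loc_in _ (F (gam j) i) ^+ N * gam_map (hL j) b = (loc_in _ bj : L j))).
    move=> j m n mn [x e]; exists (F (gam j) i ^+ (n - m) * x).
    by rewrite -{1}(subnK mn) exprD -mulrA e rmorphM rmorphXn.
  by move=> j; exact: loc_surj.
pose bb j := sval (cid (hN j)).
have bbE j : loc_in _ (F (gam j) i) ^+ N * gam_map (hL j) b = (loc_in _ (bb j) : L j).
  by rewrite /bb; case: cid.
have star j (D : calg K) (g : G D) (hj : invertible (F g j)) (hi : invertible (F g i)) :
    gam_map hj (bb j) = F g i ^+ N * gam_map hi b.
  have hi' : invertible (gam_map hj (F (gam j) i)) by rewrite -st_res gam_mapE.
  have /(congr1 (loc_lift hi')) := bbE j.
  rewrite loc_liftE rmorphM rmorphXn loc_liftE -st_res gam_mapE => <-.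
  congr (_ * _); rewrite -[LHS]/(hom_comp (loc_lift hi') (gam_map (hL j)) b).
  congr (hom_fun _ b); apply: gam_map_uniq.
  by rewrite res_comp gam_mapE -res_comp loc_liftK gam_mapE.
have [M hM] : exists M, forall jl : 'I_r * 'I_r, forall (D : calg K) (g : G D)
    (hj : invertible (F g jl.1)) (hl : invertible (F g jl.2)),
    F g i ^+ M * gam_map hj (bb jl.1) = F g i ^+ M * gam_map hl (bb jl.2).
  have H (j l : 'I_r) : exists M, forall (D : calg K) (g : G D)
      (hj : invertible (F g j)) (hl : invertible (F g l)),
      F g i ^+ M * gam_map hj (bb j) = F g i ^+ M * gam_map hl (bb l).
    pose p := loc_in (F (gam j) l); pose g0 := res p (gam j).
    have hj0 : invertible (F g0 j) by rewrite st_res; exact/invertible_map/gam_inv.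
    have hl0 : invertible (F g0 l) by rewrite st_res; exact: loc_inv.
    have [M /eqP] : exists M, F g0 i ^+ M * (gam_map hj0 (bb j) - gam_map hl0 (bb l)) = 0.
      apply/loc_in0; set w := loc_in _.
      have hi : invertible (F (res w g0) i) by rewrite st_res; exact: loc_inv.
      have hj : invertible (F (res w g0) j) by rewrite st_res; exact/invertible_map.
      have hl : invertible (F (res w g0) l) by rewrite st_res; exact/invertible_map.
      rewrite rmorphB (gam_map_res hj0 hj) (gam_map_res hl0 hl).
      by rewrite !(star _ _ _ _ hi) subrr.
    rewrite mulrBr subr_eq0 => /eqP e; exists M => D g hj hl.
    have hl' : invertible (gam_map hj (F (gam j) l)) by rewrite -st_res gam_mapE.
    have eg : res (loc_lift hl') g0 = g by rewrite -res_comp loc_liftK gam_mapE.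
    have /(congr1 (loc_lift hl')) := e.
    rewrite !rmorphM !rmorphXn -!st_res eg.
    have hj' : invertible (F (res (loc_lift hl') g0) j) by rewrite eg.
    have hl2 : invertible (F (res (loc_lift hl') g0) l) by rewrite eg.
    rewrite (gam_map_res hj0 hj') (gam_map_res hl0 hl2).
    by move: hj' hl2; rewrite eg => hj' hl2; rewrite (Prop_irrelevance hj' hj) (Prop_irrelevance hl2 hl).
  have [M hM] : exists M : 'I_r -> 'I_r -> nat, forall j l (D : calg K) (g : G D)
      (hj : invertible (F g j)) (hl : invertible (F g l)),
      F g i ^+ M j l * gam_map hj (bb j) = F g i ^+ M j l * gam_map hl (bb l).
    exists (fun j => projT1 (choice (H j))) => j l.
    by case: choice => M /= hM; exact: hM.
  exists (\max_j \max_l M j l)%N => -[j l] /= D g hj hl.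
  have le : (M j l <= \max_j \max_l M j l)%N.
    by apply: leq_trans (leq_bigmax j); exact: leq_bigmax.
  by rewrite -(subnK le) exprD -!mulrA (hM j l).
pose S (D : calg K) (g : G D) C (v : hom D C) := exists j, invertible (F (res v g) j).
pose s (D : calg K) (g : G D) C (v : hom D C) (h : S D g C v) : C :=
  F (res v g) i ^+ M * gam_map (svalP (cid h)) (bb (sval (cid h))).
have sE (D : calg K) (g : G D) C (v : hom D C) (h : S D g C v) j (hj : invertible (F (res v g) j)) :
    s D g C v h = F (res v g) i ^+ M * gam_map hj (bb j).
  exact: (hM (_, _)).
have glue (D : calg K) (g : G D) : exists! x : D, forall C (v : hom D C) (h : S D g C v),
    v x = s D g C v h.
  apply: glue_elements; first by move=> C C' w v [j hj]; exists j; rewrite res_comp st_res; exact: invertible_map.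
    exact: glue_cover.
  move=> C C' w v [j hj] h'; have hj' : invertible (F (res (hom_comp w v) g) j).
    by rewrite res_comp st_res; exact: invertible_map.
  rewrite (sE _ _ _ _ _ _ hj) (sE _ _ _ _ _ _ hj') rmorphM rmorphXn.
  congr (_ ^+ M * _); first by rewrite res_comp st_res.
  have hj2 : invertible (F (res w (res v g)) j) by rewrite -res_comp.
  by rewrite (gam_map_res hj hj2); move: (hj') (hj2); rewrite res_comp => a1 a2; rewrite (Prop_irrelevance a1 a2).
pose ph (D : calg K) (g : G D) := sval (cid (glue D g)).
have phE (D : calg K) (g : G D) C (v : hom D C) j (hj : invertible (F (res v g) j)) :
    v (ph D g) = F (res v g) i ^+ M * gam_map hj (bb j).
  by rewrite /ph; case: cid => x [/= hx _]; rewrite (hx _ _ (ex_intro _ j hj)) (sE _ _ _ _ _ _ hj).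
have phnat (C D : calg K) (w : hom C D) (g : G C) : ph D (res w g) = w (ph C g).
  apply: eq_locally; apply: locally_sub (glue_cover (res w g)) => E v [j hj].
  have hj' : invertible (F (res (hom_comp v w) g) j) by rewrite res_comp.
  rewrite (phE _ _ _ _ _ hj) -[RHS]/(hom_comp v w (ph C g)) (phE _ _ _ _ _ hj').
  congr (_ ^+ M * _); first by rewrite res_comp.
  by move: (hj') (hj); rewrite res_comp => a1 a2; rewrite (Prop_irrelevance a1 a2).
exists (M + N)%N, (@Mor K G (affine_line K) ph phnat) => /=.
have hi : invertible (F (res (hom_id _) (gam i)) i) by rewrite res_id.
rewrite -[LHS]/(hom_id (B i) (ph _ _)) (phE _ _ _ _ _ hi) (star _ _ _ hi hi).
by rewrite -(@gam_map_uniq _ _ _ hi (hom_id (B i))) // res_id mulrA -exprD.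
Qed.

(** Global functions on G, recorded by their restrictions to the pieces; this keeps the ring in the
    universe of the [B i]. *)
Definition glue_pts := {b : forall i, B i | exists phi : O, forall i, phi _ (gam i) = b i}.

Lemma fun_opp (phi : O) : exists psi : O, forall D g, psi D g = - phi D g.
Proof.
unshelve eexists (@Mor K G (affine_line K) (fun D g => - phi D g) _) => //.
by move=> C D u g /=; rewrite mor_nat rmorphN.
Qed.

Lemma fun_add (phi phi' : O) : exists psi : O, forall D g, psi D g = phi D g + phi' D g.
Proof.
unshelve eexists (@Mor K G (affine_line K) (fun D g => phi D g + phi' D g) _) => //.
by move=> C D u g /=; rewrite !mor_nat rmorphD.
Qed.

Lemma fun_mul (phi phi' : O) : exists psi : O, forall D g, psi D g = phi D g * phi' D g.
Proof.
unshelve eexists (@Mor K G (affine_line K) (fun D g => phi D g * phi' D g) _) => //.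
by move=> C D u g /=; rewrite !mor_nat rmorphM.
Qed.

Lemma fun_base (a : A) : exists psi : O, forall D g, psi D g = (st D g) a.
Proof.
unshelve eexists (@Mor K G (affine_line K) (fun D g => (st D g) a) _) => //.
by move=> C D u g /=; rewrite st_res.
Qed.

Definition gp_const (a : A) : glue_pts.
Proof.
exists (fun i => (st _ (gam i)) a).
by have [psi h] := fun_base a; exists psi.
Defined.

Definition gp_opp (x : glue_pts) : glue_pts.
Proof.
exists (fun i => - sval x i); case: x => x [phi h] /=.
by have [psi h'] := fun_opp phi; exists psi => i; rewrite h' h.
Defined.

Definition gp_add (x y : glue_pts) : glue_pts.
Proof.
exists (fun i => sval x i + sval y i); case: x => x [phi h]; case: y => y [phi' h1] /=.
by have [psi h'] := fun_add phi phi'; exists psi => i; rewrite h' h h1.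
Defined.

Definition gp_mul (x y : glue_pts) : glue_pts.
Proof.
exists (fun i => sval x i * sval y i); case: x => x [phi h]; case: y => y [phi' h1] /=.
by have [psi h'] := fun_mul phi phi'; exists psi => i; rewrite h' h h1.
Defined.

Definition glue_pre : pre_ring.
Proof.
apply: (@family_ring glue_pts 'I_r B (fun i x => sval x i) (gp_const 0) (gp_const 1)
  gp_opp gp_add gp_mul) => // i /=; [exact: rmorph0|exact: rmorph1].
Defined.

Let Q := qring glue_pre.
Definition glue_pi (x : glue_pts) : Q := @qpi glue_pre x.

Lemma glue_piP x y : glue_pi x = glue_pi y <-> forall i, sval x i = sval y i.
Proof. exact: (@qpiP glue_pre). Qed.
Lemma glue_piD x y : glue_pi (gp_add x y) = glue_pi x + glue_pi y.
Proof. exact: (@qpiD glue_pre). Qed.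
Lemma glue_piM x y : glue_pi (gp_mul x y) = glue_pi x * glue_pi y.
Proof. exact: (@qpiM glue_pre). Qed.

Lemma glue_inB : zmod_morphism (fun a : A => glue_pi (gp_const a)).
Proof.
move=> x y; apply: (addIr (glue_pi (gp_const y))); rewrite subrK -glue_piD.
by apply/glue_piP => i /=; rewrite -rmorphD subrK.
Qed.

Lemma glue_inM : monoid_morphism (fun a : A => glue_pi (gp_const a)).
Proof.
split=> // x y; rewrite -glue_piM; apply/glue_piP => i /=; exact: rmorphM.
Qed.

Let ein := mk_rmorph glue_inB glue_inM.

Lemma glue_vanish (x : glue_pts) i : sval x i = 0 ->
  exists N, glue_pi (gp_const (f i)) ^+ N * glue_pi x = 0.
Proof.
case: x => x [phi h] /= xi0; have [|N hN] := @fun_vanish phi i; first by rewrite h.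
exists N; rewrite -[glue_pi (gp_const (f i))]/(ein (f i)) -rmorphXn.
rewrite -[ein _]/(glue_pi (gp_const (f i ^+ N))) -glue_piM.
rewrite -[0]/(glue_pi (gp_const 0)); apply/glue_piP => j /=.
by rewrite rmorph0 -h rmorphXn hN.
Qed.

Lemma glue_extend i (b : B i) : exists N (x : glue_pts), sval x i = F (gam i) i ^+ N * b.
Proof.
have [N [phi h]] := fun_extend b; exists N.
by exists (exist _ (fun i => phi _ (gam i)) (ex_intro _ phi (fun=> erefl))).
Qed.

Definition glue_str : {rmorphism K -> Q} := ein \o calg_str A.

(** Generators of A together with extensions of generators of each [B i] suffice: a power of f_i
    times any element lies in the subalgebra they generate, and these powers generate 1. *)
Lemma glue_fg : exists s : seq Q, forall P : Q -> Prop,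
  (forall a, P (glue_str a)) -> (forall x, x \in s -> P x) ->
  (forall x y, P x -> P y -> P (x + y)) ->
  (forall x y, P x -> P y -> P (x * y)) -> forall x, P x.
Proof.
have [sA hA] := calg_fg A.
pose s i := sval (cid (calg_fg (B i))).
have hs i := proj2_sig (cid (calg_fg (B i))); rewrite -/(s _) in hs.
pose g i (b : B i) : Q := glue_pi (sval (cid (svalP (cid (glue_extend b))))).
have gE i (b : B i) : exists N x, g i b = glue_pi x /\ sval x i = F (gam i) i ^+ N * b.
  rewrite /g; case: cid => N hN /=; case: cid => x hx /=; by exists N, x.
exists ([seq ein a | a <- sA] ++ flatten [seq [seq g i b | b <- s i] | i <- enum 'I_r]).
move=> P hK hP hD hM.
have PA a : P (ein a).
  apply: (hA (fun a => P (ein a))) => //.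
  - by move=> x hx; apply: hP; rewrite mem_cat; apply/orP; left; exact: (map_f ein).
  - by move=> x y px py; rewrite rmorphD; exact: hD.
  - by move=> x y px py; rewrite rmorphM; exact: hM.
have PB i (b : B i) : exists N x, P (glue_pi x) /\ sval x i = F (gam i) i ^+ N * b.
  apply: (hs i (fun b => exists N x, P (glue_pi x) /\ sval x i = F (gam i) i ^+ N * b)).
  - move=> a; exists 0%N, (gp_const (calg_str A a)); split; first exact: PA.
    by rewrite expr0 mul1r /= homK.
  - move=> b' hb; have [N [x [e ex]]] := gE i b'; exists N, x; rewrite -e; split=> //.
    apply: hP; rewrite mem_cat; apply/orP; right; apply/flattenP => /=.
    exists [seq g i b | b <- s i]; last exact: (map_f (g i)).
    by apply: (map_f (fun i => [seq g i b | b <- s i])); exact: mem_enum.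
  - move=> x y [N [p [Pp ep]]] [M [q [Pq eq]]].
    exists (N + M)%N, (gp_add (gp_mul (gp_const (f i ^+ M)) p) (gp_mul (gp_const (f i ^+ N)) q)).
    split; last by rewrite /= ep eq !rmorphXn exprD; ring.
    by rewrite glue_piD !glue_piM; apply: hD; apply: hM => //; exact: PA.
  - move=> x y [N [p [Pp ep]]] [M [q [Pq eq]]].
    exists (N + M)%N, (gp_mul p q); split; last by rewrite /= ep eq exprD; ring.
    by rewrite glue_piM; exact: hM.
apply: (@qring_ind glue_pre P) => x; rewrite -/(glue_pi x).
have [N hN] : exists N, forall i, P (ein (f i) ^+ N * glue_pi x).
  apply: (@ex_max _ (fun i N => P (ein (f i) ^+ N * glue_pi x))).
    by move=> i m n mn h; rewrite -(subnK mn) exprD -mulrA; apply: hM => //; rewrite -rmorphXn.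
  move=> i; have [N [p [Pp ep]]] := PB i (sval x i).
  pose d := gp_add p (gp_opp (gp_mul (gp_const (f i ^+ N)) x)).
  have [|M e] := @glue_vanish d i; first by rewrite /= ep rmorphXn subrr.
  exists (M + N)%N; suff -> : ein (f i) ^+ (M + N) * glue_pi x = ein (f i) ^+ M * glue_pi p.
    by apply: hM => //; rewrite -rmorphXn.
  move: e; rewrite glue_piD (_ : glue_pi (gp_opp _) = - (ein (f i ^+ N) * glue_pi x)).
    by rewrite mulrBr rmorphXn mulrA -exprD => /subr0_eq ->.
  by rewrite -[ein _ * _]glue_piM; exact: (@qpiN glue_pre).
have /idealP[c hc] := unit_ideal_pow N hf.
rewrite -[glue_pi x]mul1r -(rmorph1 ein) -hc rmorph_sum mulr_suml.
apply: (big_ind P) => //; first by rewrite -(rmorph0 ein).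
by move=> i _; rewrite rmorphM rmorphXn -mulrA; exact: hM.
Qed.

Definition glue_alg : calg K := @CAlg K Q glue_str glue_fg.

Definition glue_in : hom A glue_alg := @Hom K A glue_alg ein (fun=> erefl).

Definition glue_proj_fun i (x : glue_alg) : B i := sval (qrepr (P := glue_pre) x) i.

Lemma glue_proj_pi i x : glue_proj_fun i (glue_pi x) = sval x i.
Proof. exact: (@qrepr_pi glue_pre). Qed.

Lemma glue_ind (P : glue_alg -> Prop) : (forall x, P (glue_pi x)) -> forall x, P x.
Proof. exact: (@qring_ind glue_pre P). Qed.

Lemma glue_surj (y : glue_alg) : exists x, y = glue_pi x.
Proof. by elim/glue_ind: y => x; exists x. Qed.

Definition glue_proj i : hom glue_alg (B i).
Proof.
apply: (@mk_hom K glue_alg (B i) (@glue_proj_fun i)).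
- by apply: glue_ind => x; apply: glue_ind => y; rewrite -glue_piD !glue_proj_pi.
- by apply: glue_ind => x; apply: glue_ind => y; rewrite -glue_piM !glue_proj_pi.
- by move=> a; rewrite [LHS]glue_proj_pi /= homK.
Defined.

Lemma glue_projE i x : glue_proj i (glue_pi x) = sval x i.
Proof. exact: glue_proj_pi. Qed.

Lemma glue_proj_in i : hom_comp (glue_proj i) glue_in = st _ (gam i).
Proof. by apply: hom_ext => a; exact: glue_projE. Qed.

Lemma glue_proj_inE i a : glue_proj i (glue_in a) = (st _ (gam i)) a.
Proof. by rewrite -glue_proj_in. Qed.

Lemma glue_proj0 i (x : glue_alg) : glue_proj i x = 0 ->
  exists N, glue_in (f i) ^+ N * x = 0.
Proof. by elim/glue_ind: x => x; rewrite glue_projE; exact: glue_vanish. Qed.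

Lemma glue_proj_surj i (b : B i) : exists N x,
  glue_proj i x = F (gam i) i ^+ N * b.
Proof.
have [N [x e]] := glue_extend b; exists N, (glue_pi x).
by rewrite glue_projE.
Qed.

Lemma glue_ext (D : calg K) (u : hom glue_alg D) i : invertible (u (glue_in (f i))) ->
  exists t : hom (B i) D, hom_comp t (glue_proj i) = u.
Proof.
move=> hu; apply: loc_like_lift hu; first exact: glue_proj0.
move=> b; have [N [x e]] := glue_proj_surj b; exists N, x; rewrite e.
by rewrite glue_proj_inE.
Qed.

Lemma glue_ext_uniq (D : calg K) i (t t' : hom (B i) D) :
  hom_comp t (glue_proj i) = hom_comp t' (glue_proj i) -> t = t'.
Proof.
apply: (@loc_like_ext _ _ _ _ _ (glue_in (f i))).
  move=> b; have [N [x e]] := glue_proj_surj b; exists N, x; rewrite e.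
  by rewrite glue_proj_inE.
by rewrite glue_proj_inE.
Qed.

(** Global functions separate points over D(f_j), so two pieces give the same point of G once they
    give the same evaluation of global functions. *)
Lemma gam_overlap (D : calg K) i j (t : hom (B i) D) (t' : hom (B j) D) :
  hom_comp t (glue_proj i) = hom_comp t' (glue_proj j) -> res t (gam i) = res t' (gam j).
Proof.
move=> e; have hj : invertible (F (res t (gam i)) j).
  have E : t (glue_proj i (glue_in (f j))) = t' (glue_proj j (glue_in (f j))) :=
    congr1 (fun v : hom glue_alg D => v (glue_in (f j))) e.
  rewrite st_res -glue_proj_inE E glue_proj_inE.
  exact: (invertible_map t').
rewrite -(gam_mapE hj); congr (res _ _); apply: glue_ext_uniq; rewrite -e.
apply: hom_ext; apply: glue_ind => x.
rewrite -[LHS]/(gam_map hj (glue_proj j (glue_pi x))) -[RHS]/(t (glue_proj i (glue_pi x))).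
rewrite !glue_projE; case: x => x [phi hx] /=; rewrite -!hx.
rewrite -[LHS]/(res (gam_map hj) (phi _ (gam j))) -[RHS]/(res t (phi _ (gam i))).
by rewrite -!mor_nat gam_mapE.
Qed.

Lemma glue_gamma : exists g : G glue_alg, forall i, res (glue_proj i) g = gam i.
Proof.
pose S D (u : hom glue_alg D) := exists i, invertible (u (glue_in (f i))).
have ext D (u : hom glue_alg D) (h : S D u) :
    exists g : G D, exists i (t : hom (B i) D), hom_comp t (glue_proj i) = u /\ g = res t (gam i).
  by case: h => i /glue_ext[t e]; exists (res t (gam i)), i, t.
have [|||g [hg _]] := @shG glue_alg S (fun D u h => sval (cid (ext D u h))).
- by move=> D E v u [i h]; exists i; exact: (invertible_map v).
- apply: (locally_cover (f := fun i => glue_in (f i))); first exact: unit_ideal_map.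
  by move=> i D u hu; exists i.
- move=> D E v u hu hvu; case: cid => y [i [t [e ey]]]; case: cid => y' [j [t' [e' ey']]] /=.
  rewrite ey ey' -res_comp; apply: gam_overlap; by rewrite e -hom_compA e'.
exists g => i.
have hS : S _ (glue_proj i).
  by exists i; rewrite glue_proj_inE.
rewrite (hg _ _ hS); case: cid => y [j [t [e ey]]] /=.
rewrite ey -[RHS]res_id; apply: gam_overlap; by rewrite e spec_res_id.
Qed.

Lemma glue_gamma_st (g : G glue_alg) : (forall i, res (glue_proj i) g = gam i) ->
  st _ g = glue_in.
Proof.
move=> hg; apply: hom_ext => a; have [x e] := glue_surj (st _ g a).
rewrite e; apply/glue_piP => i /=.
by rewrite -(glue_projE i x) -e -st_res hg.
Qed.

(** The map t evaluates global functions at h. That it carries g to h is checked on the pieces. *)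
Lemma glue_univ (g : G glue_alg) : (forall i, res (glue_proj i) g = gam i) ->
  forall (D : calg K) (h : G D), exists! t : hom glue_alg D, res t g = h.
Proof.
move=> hg D h.
have funq (phi : O) x : (forall i, phi _ (gam i) = sval x i) -> phi _ g = glue_pi x.
  move=> hx; have [y e] := glue_surj (phi _ g); rewrite e.
  apply/glue_piP => i; rewrite -(glue_projE i y) -e -hx.
  by rewrite -[LHS]/(res (glue_proj i) (phi _ g)) -mor_nat hg.
have [T hT] : exists T : glue_pts -> D, forall x (phi : O),
    (forall i, phi _ (gam i) = sval x i) -> T x = phi _ h.
  exists (fun x : glue_pts => (sval (cid (proj2_sig x)) : O) D h) => x phi hx; case: cid => psi hpsi /=.
  by apply: fun_eq => i; rewrite hx hpsi.
have Tphi x : exists2 phi : O, (forall i, phi _ (gam i) = sval x i) & T x = phi _ h.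
  by case: x => x [phi hx]; exists phi => //; apply: hT.
pose t0 (x : glue_alg) := T (qrepr (P := glue_pre) x).
have t0E x : t0 (glue_pi x) = T x.
  have [phi hx ->] := Tphi x; apply: hT => i; rewrite hx; symmetry.
  exact: (@qrepr_pi glue_pre).
have [t ht] : exists t : hom glue_alg D, forall x, t (glue_pi x) = T x.
  unshelve eexists.
    apply: (@mk_hom K glue_alg D t0).
    - apply: glue_ind => x; apply: glue_ind => y; rewrite -glue_piD !t0E.
      have [phi hx ->] := Tphi x; have [psi hy ->] := Tphi y.
      have [chi hc] := fun_add phi psi; rewrite -hc; apply: hT => i.
      by rewrite hc hx hy.
    - apply: glue_ind => x; apply: glue_ind => y; rewrite -glue_piM !t0E.
      have [phi hx ->] := Tphi x; have [psi hy ->] := Tphi y.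
      have [chi hc] := fun_mul phi psi; rewrite -hc; apply: hT => i.
      by rewrite hc hx hy.
    - move=> a; rewrite -[calg_str glue_alg a]/(glue_pi (gp_const (calg_str A a))) t0E.
      have [psi hp] := fun_base (calg_str A a).
      by rewrite (hT _ psi) ?hp ?homK.
  by move=> x; rewrite /= t0E.
exists t; split.
  apply: sheaf_separated => //; apply: locally_sub (glue_cover h) => E v [i hi].
  rewrite -(gam_mapE hi) -res_comp.
  have e : hom_comp (gam_map hi) (glue_proj i) = hom_comp v t.
    apply: hom_ext; apply: glue_ind => x.
    rewrite -[LHS]/(gam_map hi (glue_proj i (glue_pi x))) -[RHS]/(v (t (glue_pi x))).
    rewrite ht glue_projE.
    have [phi hx ->] := Tphi x; rewrite -hx.
    rewrite -[LHS]/(res (gam_map hi) (phi _ (gam i))) -[RHS]/(res v (phi _ h)).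
    by rewrite -!mor_nat gam_mapE.
  by rewrite -e res_comp hg.
move=> t' et'; apply: hom_ext; apply: glue_ind => x.
rewrite ht; have [phi hx ->] := Tphi x.
rewrite -et' mor_nat (funq _ _ hx); done.
Qed.
End GlueAffine.

(** Affineness over the base is local on the base, with C the ring of global functions. The last
    clause says that [B i] is C localized at f_i, which is what finiteness and flatness will
    need. *)
Lemma glue_affine (K : closedFieldType) (G : functor K) (A : calg K)
    (st : mor G (Spec A)) (r : nat) (f : 'I_r -> A)
    (B : 'I_r -> calg K) (gam : forall i, G (B i)) :
  is_sheaf G -> unit_ideal (fun x => exists i, x = f i) ->
  (forall i, invertible ((st _ (gam i)) (f i))) ->
  (forall i (D : calg K) (g : G D), invertible ((st _ g) (f i)) ->
     exists! t : hom (B i) D, res t (gam i) = g) ->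
  exists (C : calg K) (g : G C),
   (forall D (h : G D), exists! t : hom C D, res t g = h) /\
   forall i (t : hom C (B i)), res t g = gam i ->
     (forall x, t x = 0 -> exists N, (st _ g) (f i) ^+ N * x = 0) /\
     (forall b, exists N x, t x = (st _ (gam i)) (f i) ^+ N * b).
Proof.
move=> shG hf inv univ; have [g hg] := glue_gamma shG hf inv univ.
exists _, g; have hu D h := glue_univ shG hg (D := D) h; split=> //.
move=> i t et; have -> : t = glue_proj hf inv univ i.
  by have [t' [_ u]] := hu _ (gam i); rewrite -(u _ et) (u _ (hg i)).
split=> [x h|b].
  by rewrite (glue_gamma_st hg); exact: glue_proj0 h.
have [N [x e]] := @glue_proj_surj _ _ _ _ _ _ hf _ _ inv univ i b.
by exists N, x.
Qed.

(** * Some Zariski sheaves *)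

Section Sheaves.
Context (K : closedFieldType).

Lemma Spec_sheaf (C : calg K) : is_sheaf (Spec C).
Proof.
move=> A S s Sres Sloc scomp.
have H (c : C) := @glue_elements K A S (fun B u hu => s B u hu c) Sres Sloc
  (fun B D v u hu hvu => congr1 (fun h : hom C D => h c) (scomp B D v u hu hvu)).
pose x c := sval (cid (H c)).
have xE c B (u : hom A B) (hu : S B u) : u (x c) = s B u hu c by exact: (proj2_sig (cid (H c))).1.
have sep (a b : A) : (forall B u (hu : S B u), u a = u b) -> a = b.
  by move=> e; apply: eq_locally; apply: locally_sub Sloc => B u hu; exact: e hu.
unshelve eexists (@mk_hom K C A x _ _ _).
- by move=> a b; apply: sep => B u hu; rewrite rmorphD !(xE _ _ _ hu) rmorphD.
- by move=> a b; apply: sep => B u hu; rewrite rmorphM !(xE _ _ _ hu) rmorphM.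
- by move=> a; apply: sep => B u hu; rewrite (xE _ _ _ hu) !homK.
split=> [B u hu|y hy]; first by apply: hom_ext => c /=; exact: xE.
apply: hom_ext => c /=; apply: sep => B u hu; rewrite (xE _ _ _ hu) -(hy _ _ hu) //.
Qed.

Lemma prod_sheaf (X Y : functor K) : is_sheaf X -> is_sheaf Y -> is_sheaf (prod_functor X Y).
Proof.
move=> hX hY A S s Sres Sloc scomp.
have [x [hx ux]] := hX A S (fun B u hu => (s B u hu).1) Sres Sloc
  (fun B D v u hu hvu => congr1 fst (scomp B D v u hu hvu)).
have [y [hy uy]] := hY A S (fun B u hu => (s B u hu).2) Sres Sloc
  (fun B D v u hu hvu => congr1 snd (scomp B D v u hu hvu)).
exists (x, y); split=> [B u hu|[x' y'] h].
  by rewrite /= hx hy -surjective_pairing.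
by congr pair; [apply: ux|apply: uy] => B u hu; rewrite -(h _ _ hu).
Qed.

Lemma sub_sheaf (X : functor K) (Z : sub X) : is_sheaf X -> is_local Z ->
  is_sheaf (sub_functor Z).
Proof.
move=> hX hZ A S s Sres Sloc scomp.
have [x [hx ux]] := hX A S (fun B u hu => sval (s B u hu)) Sres Sloc
  (fun B D v u hu hvu => congr1 sval (scomp B D v u hu hvu)).
have Zx : Z A x.
  by apply: hZ; apply: locally_sub Sloc => B u hu; rewrite (hx _ _ hu); exact: (svalP (s B u hu)).
exists (exist _ x Zx); split=> [B u hu|[x' hx'] h]; apply: exist_eq => /=; first exact: hx.
by apply: ux => B u hu; rewrite -(h _ _ hu).
Qed.

Lemma glued_map n (A B : comPzRingType) (u : {rmorphism A -> B}) (p q : chart A) :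
  glued n p q -> glued n (chart_map u p) (chart_map u q).
Proof.
case: p => -[x t]; case: q => -[x' t'] //=; try (by case=> -> ->).
  by case=> e1 e2; rewrite -rmorphM e1 rmorph1 e2 rmorphM rmorphXn.
by case=> e1 e2; rewrite -rmorphM e1 rmorph1 e2 rmorphM rmorphXn.
Qed.

Lemma glued_local n (A : calg K) (p q : chart A) :
  locally (fun B (u : hom A B) => glued n (chart_map u p) (chart_map u q)) -> glued n p q.
Proof.
case: p => -[x t]; case: q => -[x' t'] /= h; try split;
  try congr (_, _); apply: eq_locally; apply: locally_sub h => B u /=; case=> //.
- by move=> e _; rewrite rmorphM e rmorph1.
- by move=> _ ->; rewrite rmorphM rmorphXn.
- by move=> e _; rewrite rmorphM e rmorph1.
- by move=> _ ->; rewrite rmorphM rmorphXn.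
Qed.

Lemma chart_map_comp (A B D : calg K) (v : hom B D) (u : hom A B) p :
  chart_map (hom_comp v u) p = chart_map v (chart_map u p).
Proof. by case: p. Qed.

Lemma Xi_sheaf n : is_sheaf (Xi K n).
Proof.
move=> A S s Sres Sloc scomp.
have sE B (u u' : hom A B) (h : S B u) (h' : S B u') : u = u' -> s B u h = s B u' h'.
  by move=> e; subst u'; rewrite (Prop_irrelevance h h').
pose rel B (w : hom A B) (p : chart B) := locally (fun D (v : hom B D) =>
  exists h : S D (hom_comp v w), xi_rel (s D _ h) (hom_id D) (chart_map v p)).
have xicomp D E (v : hom D E) (u : hom A D) (h : S D u) (h' : S E (hom_comp v u)) p :
    xi_rel (s D u h) (hom_id D) p -> xi_rel (s E _ h') (hom_id E) (chart_map v p).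
  move=> /(xi_res v); rewrite hom_compu1 (scomp _ _ v u h h') => hp.
  by apply/xi_rel_res.
have rel_res B D (v : hom B D) (w : hom A B) p : rel B w p -> rel D (hom_comp v w) (chart_map v p).
  move=> h; apply: locally_sub (locally_res v h) => E v'.
  by rewrite hom_compA chart_map_comp => -[h' hp]; exists h'.
have rel_glued B (w : hom A B) p q : rel B w p -> (rel B w q <-> glued n p q).
  move=> hp; split=> hq.
    apply: glued_local; apply: locally_sub (locally_and hp hq) => D v [[h1 k1] [h2 k2]].
    by rewrite (Prop_irrelevance h2 h1) in k2; apply/(xi_glued _ k1).
  apply: locally_sub hp => D v [h1 k1]; exists h1; apply/(xi_glued _ k1).
  exact: glued_map.
have rel_local B (w : hom A B) p :
    locally (fun D (v : hom B D) => rel D (hom_comp v w) (chart_map v p)) -> rel B w p.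
  move=> h; apply: locally_trans; apply: locally_sub h => D v; apply: locally_sub => E v'.
  by rewrite hom_compA chart_map_comp.
have rel_S B (u : hom A B) (h : S B u) D (v : hom B D) p :
    rel D (hom_comp v u) p <-> xi_rel (s B u h) v p.
  split=> hp.
    apply: xi_local; apply: locally_sub hp => E w [h' hp'].
    apply/xi_rel_res; have h2 := Sres _ _ (hom_comp w v) _ h.
    by rewrite -(scomp _ _ _ _ h h2) (sE _ _ _ _ h') // hom_compA.
  apply: locallyT => E w; have h' := Sres _ _ (hom_comp w v) _ h.
  rewrite hom_compA; exists h'; rewrite (scomp _ _ _ _ h h').
  by apply/xi_rel_res; exact: xi_res.
have rel_cover : locally (fun B (u : hom A B) => exists p, rel B u p).
  apply: locally_trans; apply: locally_sub Sloc => B u hu.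
  by apply: locally_sub (xi_cover (s B u hu)) => D v [p hp]; exists p; apply/rel_S.
exists (@XiPt K n A rel rel_res rel_glued rel_local rel_cover).
have E B u (hu : S B u) : res u (@XiPt K n A rel rel_res rel_glued rel_local rel_cover : Xi K n A) = s B u hu.
  by apply: Xi_ext => D v p; exact: rel_S.
split=> // y hy; apply: Xi_separated; apply: locally_sub Sloc => B u hu.
by rewrite (E _ _ hu) -(hy _ _ hu).
Qed.

Lemma closed_local (X : functor K) (Z : sub X) : is_closed Z -> is_local Z.
Proof.
move=> hZ A x hl; have [I hI] := hZ A x; rewrite -[x]res_id; apply/hI => f If /=.
apply: eq_locally; apply: locally_sub hl => B u /hI h; rewrite rmorph0; exact: h.
Qed.
End Sheaves.

(** * Flatness and finiteness are local *)

Record pre_mod (A : comPzRingType) := PreMod {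
  pm_sort :> Type;
  pm_eq : pm_sort -> pm_sort -> Prop;
  pm_zero : pm_sort;
  pm_opp : pm_sort -> pm_sort;
  pm_add : pm_sort -> pm_sort -> pm_sort;
  pm_scale : A -> pm_sort -> pm_sort;
  pm_refl : forall x, pm_eq x x;
  pm_sym : forall x y, pm_eq x y -> pm_eq y x;
  pm_trans : forall y x z, pm_eq x y -> pm_eq y z -> pm_eq x z;
  pm_congN : forall x y, pm_eq x y -> pm_eq (pm_opp x) (pm_opp y);
  pm_congD : forall x x' y y', pm_eq x x' -> pm_eq y y' ->
    pm_eq (pm_add x y) (pm_add x' y');
  pm_congZ : forall a x y, pm_eq x y -> pm_eq (pm_scale a x) (pm_scale a y);
  pm_addA : forall x y z, pm_eq (pm_add x (pm_add y z)) (pm_add (pm_add x y) z);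
  pm_addC : forall x y, pm_eq (pm_add x y) (pm_add y x);
  pm_add0 : forall x, pm_eq (pm_add pm_zero x) x;
  pm_addN : forall x, pm_eq (pm_add (pm_opp x) x) pm_zero;
  pm_scaleA : forall a b x, pm_eq (pm_scale a (pm_scale b x)) (pm_scale (a * b) x);
  pm_scale1 : forall x, pm_eq (pm_scale 1 x) x;
  pm_scaleDr : forall a x y,
    pm_eq (pm_scale a (pm_add x y)) (pm_add (pm_scale a x) (pm_scale a y));
  pm_scaleDl : forall x a b,
    pm_eq (pm_scale (a + b) x) (pm_add (pm_scale a x) (pm_scale b x))
}.

Definition qmod (A : comPzRingType) (P : pre_mod A) := quo (@pm_eq A P).
HB.instance Definition _ (A : comPzRingType) (P : pre_mod A) := gen_eqMixin (qmod P).
HB.instance Definition _ (A : comPzRingType) (P : pre_mod A) := gen_choiceMixin (qmod P).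

Section Qmod.
Context (A : comPzRingType) (P : pre_mod A).

Definition mpi (x : P) : qmod P := quo_pi (@pm_eq A P) x.
Definition mrepr (q : qmod P) : P := quo_repr q.

Lemma mpiP x y : mpi x = mpi y <-> pm_eq x y.
Proof. apply: quo_eqP; [exact: pm_refl|exact: pm_sym|exact: pm_trans]. Qed.

Lemma qmod_ind (Q : qmod P -> Prop) : (forall x, Q (mpi x)) -> forall q, Q q.
Proof. exact: quo_ind. Qed.

Lemma mrepr_pi x : pm_eq (mrepr (mpi x)) x.
Proof. by apply/mpiP; exact: quo_reprK. Qed.

Definition mopp q := mpi (pm_opp (mrepr q)).
Definition madd q r := mpi (pm_add (mrepr q) (mrepr r)).
Definition mscale a q := mpi (pm_scale a (mrepr q)).

Lemma moppE x : mopp (mpi x) = mpi (pm_opp x).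
Proof. by apply/mpiP/pm_congN/mrepr_pi. Qed.
Lemma maddE x y : madd (mpi x) (mpi y) = mpi (pm_add x y).
Proof. by apply/mpiP/pm_congD; exact: mrepr_pi. Qed.
Lemma mscaleE a x : mscale a (mpi x) = mpi (pm_scale a x).
Proof. by apply/mpiP/pm_congZ/mrepr_pi. Qed.

Lemma maddA : associative madd.
Proof.
elim/qmod_ind=> x; elim/qmod_ind=> y; elim/qmod_ind=> z.
by rewrite !maddE; apply/mpiP/pm_addA.
Qed.
Lemma maddC : commutative madd.
Proof. by elim/qmod_ind=> x; elim/qmod_ind=> y; rewrite !maddE; apply/mpiP/pm_addC. Qed.
Lemma madd0 : left_id (mpi (pm_zero P)) madd.
Proof. by elim/qmod_ind=> x; rewrite !maddE; apply/mpiP/pm_add0. Qed.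
Lemma maddN : left_inverse (mpi (pm_zero P)) mopp madd.
Proof. by elim/qmod_ind=> x; rewrite moppE maddE; apply/mpiP/pm_addN. Qed.
Lemma mscaleA a b q : mscale a (mscale b q) = mscale (a * b) q.
Proof. by elim/qmod_ind: q => x; rewrite !mscaleE; apply/mpiP/pm_scaleA. Qed.
Lemma mscale1 : left_id 1 mscale.
Proof. by elim/qmod_ind=> x; rewrite !mscaleE; apply/mpiP/pm_scale1. Qed.
Lemma mscaleDr : right_distributive mscale madd.
Proof.
move=> a; elim/qmod_ind=> x; elim/qmod_ind=> y.
by rewrite !(mscaleE, maddE); apply/mpiP/pm_scaleDr.
Qed.
Lemma mscaleDl q : {morph mscale^~ q : a b / a + b >-> madd a b}.
Proof.
move=> a b; elim/qmod_ind: q => x.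
by rewrite !(mscaleE, maddE); apply/mpiP/pm_scaleDl.
Qed.
End Qmod.

HB.instance Definition _ (A : comPzRingType) (P : pre_mod A) :=
  GRing.isZmodule.Build (qmod P) (@maddA A P) (@maddC A P) (@madd0 A P) (@maddN A P).
HB.instance Definition _ (A : comPzRingType) (P : pre_mod A) :=
  GRing.Zmodule_isLmodule.Build A (qmod P)
    (@mscaleA A P) (@mscale1 A P) (@mscaleDr A P) (@mscaleDl A P).

Section QmodTheory.
Context (A : comPzRingType) (P : pre_mod A).
Implicit Types x y : P.
Lemma mpiD x y : mpi (pm_add x y) = mpi x + mpi y. Proof. by rewrite -maddE. Qed.
Lemma mpiZ a x : mpi (pm_scale a x) = a *: mpi x. Proof. by rewrite -mscaleE. Qed.
End QmodTheory.

Section LocalizedModule.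
Context (A : comPzRingType) (N : lmodType A) (f : A).

Definition locm_eq (x y : N * nat) : Prop :=
  exists M, f ^+ (M + y.2) *: x.1 = f ^+ (M + x.2) *: y.1.

Lemma scale_shift (x y : N) a b k : f ^+ a *: x = f ^+ b *: y ->
  f ^+ (k + a) *: x = f ^+ (k + b) *: y.
Proof. by move=> e; rewrite !exprD -!scalerA e. Qed.

Lemma scale_shift_eq (x y : N) a b a' b' k : f ^+ a *: x = f ^+ b *: y ->
  (a' = k + a)%N -> (b' = k + b)%N -> f ^+ a' *: x = f ^+ b' *: y.
Proof. by move=> e -> ->; exact: scale_shift. Qed.

Lemma scale_eq_exp (x : N) a b : a = b -> f ^+ a *: x = f ^+ b *: x.
Proof. by move=> ->. Qed.

Definition locm_pre : pre_mod A.
Proof.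
apply: (@PreMod A (N * nat) locm_eq (0, 0%N) (fun x => (- x.1, x.2))
    (fun x y => (f ^+ y.2 *: x.1 + f ^+ x.2 *: y.1, (x.2 + y.2)%N))
    (fun a x => (a *: x.1, x.2))).
- by move=> x; exists 0%N.
- by move=> x y [M e]; exists M.
- move=> [y n] [x m] [z p] [/= M e] [/= M' e']; exists (M + M' + n)%N => /=.
  rewrite (scale_shift_eq (a' := (M + M' + n + p)%N) (b' := (M + M' + m + p)%N) (k := (M' + p)%N) e); try by ring.
  by rewrite (scale_shift_eq (a' := (M + M' + m + p)%N) (b' := (M + M' + n + m)%N) (k := (M + m)%N) e'); try by ring.
- by move=> x y [M e]; exists M => /=; rewrite !scalerN e.
- move=> [x m] [x' m'] [y n] [y' n'] [/= M e] [/= M' e']; exists (M + M')%N => /=.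
  rewrite !scalerDr !scalerA -!exprD; congr (_ + _).
    apply: (scale_shift_eq (k := (M' + n + n')%N) e); by ring.
  apply: (scale_shift_eq (k := (M + m + m')%N) e'); by ring.
- move=> a [x m] [y n] [/= M e]; exists M => /=.
  by rewrite !scalerA ![_ * a]mulrC -!scalerA e.
- move=> [x m] [y n] [z p]; exists 0%N => /=; rewrite !scalerDr !scalerA -!exprD addrA.
  by do !congr (_ + _); apply: scale_eq_exp; ring.
- move=> [x m] [y n]; exists 0%N => /=; rewrite addrC !scalerDr !scalerA -!exprD.
  by do !congr (_ + _); apply: scale_eq_exp; ring.
- move=> [x m]; exists 0%N => /=; rewrite scaler0 add0r !scalerA -!exprD.
  by apply: scale_eq_exp; ring.
- move=> [x m]; exists 0%N => /=; by rewrite scalerN addNr !scaler0.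
- by move=> a b [x m]; exists 0%N => /=; rewrite !scalerA mulrA.
- by move=> [x m]; exists 0%N => /=; rewrite scale1r.
- move=> a [x m] [y n]; exists 0%N => /=; rewrite !scalerDr !scalerA.
  by congr (_ *: _ + _ *: _); ring.
- move=> [x m] a b; exists 0%N => /=; rewrite !scalerDr !scalerA -!scalerDl !exprD.
  by congr (_ *: _); ring.
Defined.

Definition locm := qmod locm_pre.
Definition locm_pi (x : N) n : locm := mpi (P := locm_pre) (x, n).

Lemma locm_piP x m y n : locm_pi x m = locm_pi y n <->
  exists M, f ^+ (M + n) *: x = f ^+ (M + m) *: y.
Proof. exact: (@mpiP A locm_pre). Qed.

Lemma locm_piD x y n : locm_pi (x + y) n = locm_pi x n + locm_pi y n.
Proof.
rewrite /locm_pi -mpiD; apply/locm_piP; exists 0%N => /=.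
rewrite !scalerDr !scalerA -!exprD; congr (_ + _); apply: scale_eq_exp; by ring.
Qed.

Lemma locm_piZ a x n : locm_pi (a *: x) n = a *: locm_pi x n.
Proof. by rewrite /locm_pi -mpiZ. Qed.

Lemma locm_pi0 n : locm_pi 0 n = 0.
Proof. by apply/locm_piP; exists 0%N; rewrite !scaler0. Qed.

Lemma locm_pi_sum (T : finType) (F : T -> N) n :
  locm_pi (\sum_t F t) n = \sum_t locm_pi (F t) n.
Proof.
apply: (big_morph (fun x => locm_pi x n)); last exact: locm_pi0.
by move=> x y; exact: locm_piD.
Qed.
End LocalizedModule.

Section LocallyFree.
Context (A B : comPzRingType) (e : {rmorphism A -> B}) (r : nat) (f : 'I_r -> A)
  (hf : unit_ideal (fun x => exists i, x = f i)) (m : nat) (y : 'I_r -> 'I_m -> B)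
  (gen : forall i b, exists N (a : 'I_m -> A), e (f i) ^+ N * b = \sum_j e (a j) * y i j).

(** A partition of unity turns generators over the D(f_i) into generators of B. *)
Lemma locally_free_finite : module_finite e.
Proof.
pose T : finType := ('I_r * 'I_m)%type.
suff H (b : B) : exists a : T -> A, b = \sum_t e (a t) * y t.1 t.2.
  exists #|T|, (fun k => y (enum_val k).1 (enum_val k).2) => b.
  have [a ->] := H b; exists (fun k => a (enum_val k)).
  exact: (@big_enum_val B 0 +%R T predT (fun t => e (a t) * y t.1 t.2)).
have [N hN] : exists N, forall i, exists a : 'I_m -> A,
    e (f i) ^+ N * b = \sum_j e (a j) * y i j.
  apply: (@ex_max _ (fun i N => exists a : 'I_m -> A,
    e (f i) ^+ N * b = \sum_j e (a j) * y i j)) => // i k l kl [a h].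
  exists (fun j => f i ^+ (l - k) * a j); rewrite -(subnK kl) exprD -mulrA h mulr_sumr.
  by apply: eq_bigr => j _; rewrite addnK rmorphM rmorphXn mulrA.
have [a ha] := choice hN.
have /idealP[c hc] := unit_ideal_pow N hf.
exists (fun t => c t.1 * a t.1 t.2).
rewrite -[LHS]mul1r -(rmorph1 e) -hc rmorph_sum mulr_suml.
rewrite -(pair_bigA _ (fun i j => e (c i * a i j) * y i j)) /=.
apply: eq_bigr => i _; rewrite rmorphM rmorphXn -mulrA ha mulr_sumr.
by apply: eq_bigr => j _; rewrite rmorphM mulrA.
Qed.

Context (indep : forall i (a : 'I_m -> A), \sum_j e (a j) * y i j = 0 ->
  exists N, forall j, f i ^+ N * a j = 0).

(** Over D(f_i) the [y i j] form a basis up to powers of f_i. Coordinates give bilinear maps into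
    the localization of N'; a tensor vanishing in N' therefore has coordinates killed by a power of
    f_i, already in N because j is injective. *)
Lemma locally_free_flat : flat e.
Proof.
move=> N N' j jinj k x b H P beta [bDl bDr bZl bZr].
set z := \sum_(i < k) _.
have beta_sum (T : finType) (F : T -> B) n : beta n (\sum_t F t) = \sum_t beta n (F t).
  apply: (big_morph (beta n)) => //.
  by apply: (addIr (beta n 0)); rewrite -bDr !add0r.
have beta_suml (T : finType) (F : T -> N) b' : beta (\sum_t F t) b' = \sum_t beta (F t) b'.
  apply: (big_morph (beta^~ b')) => //.
  by apply: (addIr (beta 0 b')); rewrite -bDl !add0r.
suff [M hM] : exists M, forall i, f i ^+ M *: z = 0.
  have /idealP[c hc] := unit_ideal_pow M hf.
  by rewrite -[z]scale1r -hc scaler_suml big1 // => i _; rewrite -scalerA hM scaler0.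
apply: (@ex_max _ (fun i M => f i ^+ M *: z = 0)) => [i p q pq h|i].
  by rewrite -(subnK pq) exprD -scalerA h scaler0.
pose coord (b : B) L (a : 'I_m -> A) := e (f i) ^+ L * b = \sum_j e (a j) * y i j.
have coord_shift b' L a M : coord b' L a -> coord b' (M + L)%N (fun j => f i ^+ M * a j).
  rewrite /coord exprD -mulrA => ->; rewrite mulr_sumr; apply: eq_bigr => l _.
  by rewrite rmorphM rmorphXn mulrA.
have coord_uniq b' L L' a a' : coord b' L a -> coord b' L' a' ->
    exists M, forall l, f i ^+ (M + L') * a l = f i ^+ (M + L) * a' l.
  move=> /(coord_shift _ _ _ L') h /(coord_shift _ _ _ L) h'.
  have [|M hM] := indep (i := i) (a := fun l => f i ^+ L' * a l - f i ^+ L * a' l).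
    under eq_bigr => l _ do rewrite rmorphB mulrBl.
    by rewrite sumrB -h -h' addnC subrr.
  by exists M => l; apply/subr0_eq; rewrite -[RHS](hM l) !exprD; ring.
have coord_ex b' : exists La, coord b' La.1 La.2.
  by have [L [a h]] := gen i b'; exists (L, a).
have [co hco] := choice coord_ex.
(* The l-th coordinate of b' times n, in the localized module. It is well defined because
   coordinates are unique up to powers of f_i. *)
pose gam l (n : N') (b' : B) : locm N' (f i) := locm_pi (f i) ((co b').2 l *: n) (co b').1.
have gamE l n b' L a : coord b' L a -> gam l n b' = locm_pi (f i) (a l *: n) L.
  move=> h; have [M hM] := coord_uniq _ _ _ _ _ (hco b') h.
  by apply/locm_piP; exists M; rewrite !scalerA hM.
have gam_bil l : is_bilinear e (gam l).
  split.
  - by move=> n n' b'; rewrite /gam scalerDr locm_piD.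
  - move=> n b1 b2; have h1 := coord_shift _ _ _ (co b2).1 (hco b1).
    have h2 := coord_shift _ _ _ (co b1).1 (hco b2); rewrite addnC in h2.
    have h3 : coord (b1 + b2) ((co b2).1 + (co b1).1)%N (fun j => f i ^+ (co b2).1 * (co b1).2 j + f i ^+ (co b1).1 * (co b2).2 j).
      rewrite /coord mulrDr h1 h2 -big_split; apply: eq_bigr => t _.
      by rewrite /= rmorphD mulrDl.
    by rewrite (gamE _ _ _ _ _ h1) (gamE _ _ _ _ _ h2) (gamE _ _ _ _ _ h3) scalerDl locm_piD.
  - by move=> a n b'; rewrite /gam -locm_piZ !scalerA [a * _]mulrC.
  - move=> a n b'; have h : coord (e a * b') (co b').1 (fun j => a * (co b').2 j).
      rewrite /coord mulrCA (hco b') mulr_sumr; apply: eq_bigr => t _.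
      by rewrite rmorphM mulrA.
    by rewrite (gamE _ _ _ _ _ h) -scalerA locm_piZ.
have [L hL] : exists L, forall s : 'I_k, exists a, coord (b s) L a.
  apply: (@ex_max _ (fun s L => exists a, coord (b s) L a)) => [s p q pq [a h]|s].
    by exists (fun j => f i ^+ (q - p) * a j); rewrite -{1}(subnK pq); exact: coord_shift.
  by exists (co (b s)).1, (co (b s)).2.
have [a ha] := choice hL.
have zero l : exists M, f i ^+ M *: \sum_s a s l *: x s = 0.
  have := H _ _ (gam_bil l).
  under eq_bigr => s _ do rewrite (gamE _ _ _ _ _ (ha s)).
  rewrite -locm_pi_sum.
  rewrite -(locm_pi0 _ _ L) => /locm_piP[M h]; exists (M + L)%N; apply: jinj.
  rewrite raddf0 linearZ /= raddf_sum /= -[RHS](scaler0 _ (f i ^+ (M + L))) -h.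
  by congr (_ *: _); apply: eq_bigr => s _; rewrite linearZ.
have [M hM] : exists M, forall l, f i ^+ M *: \sum_s a s l *: x s = 0.
  apply: (@ex_max _ (fun l M => f i ^+ M *: \sum_s a s l *: x s = 0)) => // l p q pq h.
  by rewrite -(subnK pq) exprD -scalerA h scaler0.
exists (M + L)%N; rewrite exprD -scalerA.
have -> : f i ^+ L *: z = \sum_l beta (\sum_s a s l *: x s) (y i l).
  transitivity (\sum_s \sum_l beta (a s l *: x s) (y i l)).
    rewrite /z scaler_sumr; apply: eq_bigr => s _.
    rewrite -bZr rmorphXn ha beta_sum; apply: eq_bigr => l _.
    by rewrite bZr bZl.
  by rewrite exchange_big; apply: eq_bigr => l _; rewrite beta_suml.
rewrite scaler_sumr big1 // => l _; rewrite -bZl hM.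
by rewrite -(scale0r 0) bZl scale0r.
Qed.
End LocallyFree.

(** * Closed subfunctors *)

Lemma pow_kill (A : comPzRingType) (x y : A) m n :
  (m <= n)%N -> x ^+ m * y = 0 -> x ^+ n * y = 0.
Proof. by move=> mn e; rewrite -(subnK mn) exprD -mulrA e mulr0. Qed.

Lemma hom_kill (K : closedFieldType) (A B : calg K) (u : hom A B) x y m :
  x ^+ m * y = 0 -> u x ^+ m * u y = 0.
Proof. by move=> /(congr1 u); rewrite rmorphM rmorphXn rmorph0. Qed.

Section Closed.
Context (K : closedFieldType) (X : functor K) (Z : sub X).

Definition closed_at (A : calg K) (x : X A) : Prop :=
  exists I : A -> Prop, forall (B : calg K) (u : hom A B),
    Z B (res u x) <-> (forall f, I f -> u f = 0).

(** Closedness is local on the test scheme. The ideal is taken to be all functions vanishing on Z;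
    the work is to show that a local equation over D(f_i), times a power of f_i, is one of them. *)
Lemma closed_crit : is_local Z ->
  (forall (A : calg K) (x : X A), locally (fun B (u : hom A B) => closed_at (res u x))) ->
  is_closed Z.
Proof.
move=> Zloc h A x; have [r [f [hf hc]]] := locallyP (h A x).
pose J i := sval (cid (hc i _ _ (loc_inv (f i)))).
have JP i (B : calg K) (u : hom (loc (f i)) B) :
   Z B (res u (res (loc_in (f i)) x)) <-> (forall g, J i g -> u g = 0).
  exact: (proj2_sig (cid (hc i _ _ (loc_inv (f i))))).
have JP' i (B : calg K) (v : hom A B) (hv : invertible (v (f i))) :
   Z B (res v x) <-> (forall g, J i g -> loc_lift hv g = 0).
  by rewrite -JP -res_comp loc_liftK.
exists (fun a => forall (B : calg K) (v : hom A B), Z B (res v x) -> v a = 0).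
move=> B v; split=> [hv a|hv]; first exact.
apply: Zloc; apply: (locally_cover (f := fun i => v (f i))); first exact: unit_ideal_map.
move=> i D w hw; rewrite -res_comp; have hwv : invertible (hom_comp w v (f i)) by [].
apply/(JP' _ _ _ hwv) => g Jg; have [N [a ea]] := loc_surj g.
(* On the part of Z over D(f_j), the numerator a of the equation g vanishes once f_i is inverted, so
   a power of f_i kills it. *)
have key j : exists M, quot_in (J j) (loc_in (f j) (f i)) ^+ M * quot_in (J j) (loc_in (f j) a) = 0.
  apply/loc_in0; pose p := loc_in (quot_in (J j) (loc_in (f j) (f i))).
  pose q := hom_comp p (hom_comp (quot_in (J j)) (loc_in (f j))).
  have hq : invertible (q (f i)) by exact: loc_inv.
  have Zq : Z _ (res q x).
    rewrite /q !res_comp; apply: mem_res; apply/JP => g'; exact: quot_gen.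
  have zg : loc_lift hq g = 0 := iffLR (JP' i _ q hq) Zq g Jg.
  have := congr1 (loc_lift hq) ea; rewrite rmorphM zg mulr0 loc_liftE => e.
  exact: (esym e).
have [M hM] : exists M, forall j,
    quot_in (J j) (loc_in (f j) (f i)) ^+ M * quot_in (J j) (loc_in (f j) a) = 0.
  apply: (ex_max _ key) => j m n mn; exact: pow_kill.
have va : v (f i ^+ M * a) = 0.
  apply: hv => C t Zt; apply: eq_locally.
  apply: (locally_cover (f := fun j => t (f j))); first exact: unit_ideal_map.
  move=> j E s hs; have hst : invertible (hom_comp s t (f j)) by [].
  have Zst : Z _ (res (hom_comp s t) x) by rewrite res_comp; exact: mem_res.
  have hJ := iffLR (JP' _ _ _ hst) Zst.
  have E1 y : quot_lift hJ (quot_in (J j) (loc_in (f j) y)) = s (t y).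
    exact: etrans (quot_liftE hJ _) (loc_liftE hst y).
  have e : s (t (f i)) ^+ M * s (t a) = 0.
    by rewrite -(E1 (f i)) -(E1 a); exact: hom_kill (hM j).
  by rewrite (rmorphM t) (rmorphM s) (rmorphXn t) (rmorphXn s) e !rmorph0.
apply: (invertible_can (invertibleX (M + N) hwv)).
have e : hom_comp w v (f i) ^+ N * loc_lift hwv g = hom_comp w v a.
  by rewrite -(loc_liftE hwv (f i)) -(loc_liftE hwv a) -ea (rmorphM (loc_lift hwv)) (rmorphXn (loc_lift hwv)).
rewrite mulr0 exprD -mulrA e; have := congr1 w va.
by rewrite rmorph0 (rmorphM v) (rmorphM w) (rmorphXn v) (rmorphXn w).
Qed.
End Closed.

(** Modulo s the determinant is that of the identity. The element t provides an inverse of s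
    wherever s M has a fixed vector normalised by a covector. *)
Lemma det_sub_scale (A : comPzRingType) m (s : A) (M : 'M[A]_m) :
  exists t, \det (1%:M - s *: M) = 1 - s * t.
Proof.
pose cong (x y : A) := exists z, x = y - s * z.
have congD x y x' y' : cong x y -> cong x' y' -> cong (x + x') (y + y').
  by move=> [z ->] [z' ->]; exists (z + z'); ring.
have congM x y x' y' : cong x y -> cong x' y' -> cong (x * x') (y * y').
  by move=> [z ->] [z' ->]; exists (y * z' + z * y' - s * z * z'); ring.
have cong_refl x : cong x x by exists 0; ring.
suff : cong (\det (1%:M - s *: M)) (\det (1%:M : 'M[A]_m)) by rewrite det1.
apply: (big_ind2 cong); [exact: cong_refl|by move=> *; exact: congD|move=> p _].
apply: (@congM _ _ _ _ _) => //.
apply: (big_ind2 cong); [exact: cong_refl|by move=> *; exact: congM|move=> i _].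
by rewrite !mxE; eexists.
Qed.

(** * The subscheme of a cocyclic triple *)

Section TripleScheme.
Context (K : closedFieldType) (n m : nat).

Definition Zt (A : calg K) (k : K) (T : triple m A) :
  sub (prod_functor (Spec A) (Xi K n)).
Proof.
refine (@Sub K (prod_functor (Spec A) (Xi K n)) (fun B x =>
  exists a b w, x.2 = mkXi n (hk k a b) /\ eig (tmap x.1 T) a b w) _).
move=> B D u [v y] [a [b [w [/= -> hw]]]]; exists (u a), (u b), (map_mx u w).
by split; [rewrite -hk_map -mkXi_res|have := eig_map u hw; rewrite tmap_comp].
Defined.

Lemma Zt_base (A A' : calg K) (k : K) (T : triple m A) (u : hom A A')
    (B : calg K) (v : hom A' B) (y : Xi K n B) :
  Zt k T B (hom_comp v u, y) <-> Zt k (tmap u T) B (v, y).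
Proof. by rewrite /= tmap_comp. Qed.

Lemma Zt_pullback (A : calg K) (k : K) (T : triple m A) (hT : cocyclic T) :
  pullback_is_Spec (Zt k T) (hom_id A) (alg_in hT).
Proof.
exists (mkXi n (hk k (algX hT) (algY hT))).
  exists (algX hT), (algY hT), (\col_j alg_basis hT j); split=> //=.
  exact: alg_eig.
move=> D v y; rewrite hom_compu1 => -[a [b [w [e hw]]]].
have {e} ey : y = mkXi n (hk k a b) := e.
exists (alg_lift hT hw); split.
  by rewrite alg_liftK mkXi_res hk_map alg_liftX alg_liftY ey.
move=> t [e1]; rewrite mkXi_res hk_map ey => /mkXi_hk_inj[e2 e3].
apply: alg_hom_ext; rewrite ?alg_liftK ?alg_liftX ?alg_liftY //.
Qed.

(** The chart is only open in [Xi]; the family is closed because it is finite over the base. At its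
    points s TT fixes w, by the Bezout relation for (x, y), so det (1 - s TT) = 1 - s sg kills w,
    and l w = 1 shows that sg inverts s. Then a, b and w are forced to come from elements of A, and
    the conditions become equations. *)
Lemma Zt_closed_at (A : calg K) (k : K) (T : triple m A) (h : hpt A) : cocyclic T ->
  closed_at (Zt k T) (hom_id A, mkXi n h).
Proof.
move=> hT; pose s := hx h + calg_str A k * hy h.
have [b1 [b2 eb]] := hpt_unim h.
pose TT := b1%:M + (b2 - calg_str A k * b1) *: tD T.
have [sg det_sg] := det_sub_scale s TT.
have [f hf] := choice hT.2.
pose a := sg * hy h; pose b := s ^+ n * hz h.
pose w := \col_j beval a b (f j) : 'cV[A]_m.
exists (fun x => [\/ x = 1 - s * sg, exists i j, x = (tl T *m w - 1%:M) i j,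
  exists i j, x = (tD T *m w - a *: w) i j | exists i j, x = (tE T *m w - b *: w) i j]).
move=> B u; rewrite -[res u _]/((hom_comp u (hom_id A), res u (mkXi n h)) :
  prod_functor (Spec A) (Xi K n) B) hom_compu1 mkXi_res.
have us : hx (hmap u h) + calg_str B k * hy (hmap u h) = u s.
  by rewrite /s rmorphD rmorphM homK.
split=> [[a' [b' [w' [/mkXi_hkP [] ]]]]|hu].
  rewrite us /= => ea' [_ eb'] hw'.
  have sw : u s *: (map_mx u TT *m w') = w'.
    case: hw' => /= _ eD _.
    rewrite /TT map_mxD map_scalar_mx map_mxZ mulmxDl mul_scalar_mx -scalemxAl eD.
    rewrite scalerDr !scalerA -scalerDl -[RHS]scale1r -(rmorph1 u) -eb; congr (_ *: _).
    transitivity (u s * u b1 + u (b2 - calg_str A k * b1) * (u s * a')); first by ring.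
    by rewrite ea' -!rmorphM -rmorphD; congr (u _); rewrite /s; ring.
  have sgE : u s * u sg = 1.
    have : \det (1%:M - u s *: map_mx u TT) *: w' = 0.
      rewrite -mul_scalar_mx -mul_adj_mx -mulmxA mulmxBl mul1mx -scalemxAl sw subrr.
      by rewrite mulmx0.
    rewrite -map_mxZ -(map_mx1 u) -map_mxB det_map_mx det_sg.
    move=> /(congr1 (mulmx (tl (tmap u T)))); rewrite mulmx0 -scalemxAr.
    case: hw' => -> _ _ /matrixP/(_ 0 0); rewrite !mxE mulr1 => /eqP.
    by rewrite rmorphB rmorph1 subr_eq0 rmorphM => /eqP.
  have ea : a' = u a by rewrite /a rmorphM -[LHS]mul1r -sgE mulrAC -ea'; ring.
  have eb2 : b' = u b by rewrite /b rmorphM rmorphXn.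
  move: hw'; rewrite ea eb2 => {}hw'.
  have ew : w' = map_mx u w.
    apply/colP => j; rewrite !mxE -beval_map.
    have := eig_ltmx (bmap u (f j)) hw'; rewrite tmx_tmap -map_mxM hf map_delta_mx -rowE.
    by move=> /matrixP/(_ 0 0); rewrite !mxE eqxx mulr1n.
  subst w'; case: hw' => /= e1 e2 e3.
  have z1 : map_mx u (tl T *m w - 1%:M) = 0.
    by rewrite map_mxB map_mxM map_scalar_mx rmorph1 e1 subrr.
  have z2 : map_mx u (tD T *m w - a *: w) = 0 by rewrite map_mxB map_mxM map_mxZ e2 subrr.
  have z3 : map_mx u (tE T *m w - b *: w) = 0 by rewrite map_mxB map_mxM map_mxZ e3 subrr.
  move=> x [->|[i [j ->]]|[i [j ->]]|[i [j ->]]].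
  - by rewrite rmorphB rmorph1 rmorphM sgE subrr.
  - by have /matrixP/(_ i j) := z1; rewrite !mxE.
  - by have /matrixP/(_ i j) := z2; rewrite !mxE.
  - by have /matrixP/(_ i j) := z3; rewrite !mxE.
have sgE : u s * u sg = 1.
  have /eqP := hu _ (Or41 _ _ _ (erefl (1 - s * sg))).
  by rewrite rmorphB rmorph1 rmorphM subr_eq0 => /eqP.
exists (u a), (u b), (map_mx u w); split.
  apply/mkXi_hkP; rewrite us /= /a /b !rmorphM rmorphXn mulrA sgE mul1r; split=> //.
  by split=> //; exists (u sg).
split=> /=; apply/eqP; rewrite -subr_eq0.
- rewrite -map_mxM -(rmorph1 u) -map_scalar_mx -map_mxB; apply/eqP/matrixP => i j.
  by rewrite [LHS]mxE [RHS]mxE; apply: hu; apply: Or42; exists i, j.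
- rewrite -map_mxM -map_mxZ -map_mxB; apply/eqP/matrixP => i j.
  by rewrite [LHS]mxE [RHS]mxE; apply: hu; apply: Or43; exists i, j.
- rewrite -map_mxM -map_mxZ -map_mxB; apply/eqP/matrixP => i j.
  by rewrite [LHS]mxE [RHS]mxE; apply: hu; apply: Or44; exists i, j.
Qed.
End TripleScheme.

Lemma alg_free (K : closedFieldType) (m : nat) (A : calg K) (T : triple m A)
  (hT : cocyclic T) : free_of_rank m (alg_in hT).
Proof.
exists (alg_basis hT) => x; elim/alg_ind: x => t.
exists [ffun j => (tl T *m tmx T t) 0 j]; split.
  by rewrite {1}alg_basisE; apply: eq_bigr => j _; rewrite ffunE.
move=> a ea; apply/ffunP => j; rewrite ffunE; apply/subr0_eq; move: j.
apply: (alg_lin_free (hT := hT)).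
under eq_bigr => j _ do rewrite rmorphB mulrBl.
by rewrite sumrB -ea -alg_basisE subrr.
Qed.

Section LocallyTriple.
Context (R : realType) (n m : nat).
Local Notation K := R[i].

Definition is_triple (A : calg K) (Z : sub (prod_functor (Spec A) (Xi K n)))
    (B : calg K) (u : hom A B) : Prop :=
  exists k (T : triple m B), cocyclic T /\
    forall D (v : hom B D) y, Z D (hom_comp v u, y) <-> Zt n k T D (v, y).

Context (A : calg K) (Z : sub (prod_functor (Spec A) (Xi K n))) (Zloc : is_local Z)
  (hZ : locally (is_triple Z)).

Lemma loc_triple_closed : is_closed Z.
Proof.
apply: closed_crit => // A' [u0 xi].
apply: locally_sub (locally_and (locally_res u0 hZ) (Xi_locally_hpt xi)) => B w.
move=> [[k [T [hT hZT]]] [h eh]].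
have [I hI] := @Zt_closed_at K n m B k T h hT; exists I => C v.
have {}hI : Zt n k T C (hom_comp v (hom_id B), res v (mkXi n h)) <->
  (forall f, I f -> v f = 0) := hI C v.
rewrite hom_compu1 -eh in hI; rewrite -hI; exact: hZT.
Qed.

Let G := sub_functor Z.

Definition over_base : mor G (Spec A) :=
  @Mor K G (Spec A) (fun D g => (sval g).1) (fun _ _ _ _ => erefl).

(** Over a cover of the base the family is given by free algebras [alg]; [glue_affine] glues them.
    Powers of f_i clear the denominators of their bases, which yields the local data for finiteness
    and flatness. *)
Lemma loc_triple_affine : exists (B : calg K) (e : hom A B),
  [/\ pullback_is_Spec Z (hom_id A) e, module_finite e & flat e].
Proof.
have [r [f [hf hT]]] := locallyP hZ.
have H i : exists (B : calg K) (x : G B) (e : hom (loc (f i)) B) (bs : 'I_m -> B),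
    [/\ over_base B x = hom_comp e (loc_in (f i)),
     forall (D : calg K) (g : G D), invertible (over_base D g (f i)) ->
       exists! t : hom B D, res t x = g,
     forall b, exists a, b = \sum_j e (a j) * bs j &
     forall a, \sum_j e (a j) * bs j = 0 -> forall j, a j = 0].
  have [k [T [hc hZT]]] := hT i _ _ (loc_inv (f i)).
  have [x hx ux] := @Zt_pullback K n m _ k T hc.
  have Zx : Z (alg hc) (hom_comp (alg_in hc) (loc_in (f i)), x).
    by apply/hZT; rewrite -[alg_in hc]hom_compu1.
  exists (alg hc), (exist _ (_, _) Zx), (alg_in hc), (alg_basis hc); split=> //.
  - move=> D [[v y] hg] hv.
    have hv' : invertible (v (f i)) := hv.
    have [|t [[t1 t2] ut]] := ux D (loc_lift hv') y.
      by rewrite hom_compu1; apply/hZT; rewrite loc_liftK.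
    exists t; split.
      apply: exist_eq; rewrite -[LHS]/((hom_comp t (hom_comp (alg_in hc) (loc_in (f i))), res t x)).
      by rewrite hom_compA t1 loc_liftK t2.
    move=> t' /(congr1 sval); rewrite -[LHS]/((hom_comp t' (hom_comp (alg_in hc) (loc_in (f i))), res t' x)).
    move=> [e1 e2]; apply: ut; split=> //.
    by apply: loc_hom_ext; rewrite loc_liftK -hom_compA.
  - by elim/alg_ind=> t; exists (fun j => (tl T *m tmx T t) 0 j); exact: alg_basisE.
  - exact: alg_lin_free.
pose B i := sval (cid (H i)).
pose x i : G (B i) := sval (cid (proj2_sig (cid (H i)))).
have H' i : exists (e : hom (loc (f i)) (B i)) (bs : 'I_m -> B i),
    [/\ over_base _ (x i) = hom_comp e (loc_in (f i)),
     forall (D : calg K) (g : G D), invertible (over_base D g (f i)) ->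
       exists! t : hom (B i) D, res t (x i) = g,
     forall b, exists a, b = \sum_j e (a j) * bs j &
     forall a, \sum_j e (a j) * bs j = 0 -> forall j, a j = 0].
  exact: (proj2_sig (cid (proj2_sig (cid (H i))))).
have shG : is_sheaf G.
  apply: sub_sheaf => //; apply: prod_sheaf; [exact: Spec_sheaf|exact: Xi_sheaf].
have xf i (a : A) (e : hom (loc (f i)) (B i)) :
    over_base _ (x i) = hom_comp e (loc_in (f i)) -> over_base _ (x i) a = e (loc_in (f i) a).
  by move=> ->.
have xinv i : invertible (over_base _ (x i) (f i)).
  have [e [bs [e1 _ _ _]]] := H' i; rewrite (xf _ _ _ e1); apply: (invertible_map e).
  exact: loc_inv.
have [|C [g [ug gl]]] := @glue_affine K G A over_base r f B x shG hf xinv.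
  by move=> i; have [e [bs [_ h _ _]]] := H' i.
pose ep : hom A C := over_base C g.
have pull : pullback_is_Spec Z (hom_id A) ep.
  exists (sval g).2.
    by rewrite hom_compu1; case: g {ug gl} @ep => -[v y] hg.
  move=> D v y; rewrite hom_compu1 => hvy.
  have [t [et ut]] := ug D (exist _ (v, y) hvy).
  exists t; split.
    by have := congr1 sval et => /(congr1 (fun z => (z.1, z.2))) [<- <-].
  move=> t' [e1 e2]; apply: ut; apply: exist_eq.
  by rewrite -[LHS]/((hom_comp t' ep, res t' (sval g).2)) e1 e2.
exists C, ep.
have loc_i i : exists (t : hom C (B i)) (e : hom (loc (f i)) (B i)) (bs : 'I_m -> B i),
   [/\ forall a, t (ep a) = e (loc_in (f i) a),
     forall c, t c = 0 -> exists N, ep (f i) ^+ N * c = 0,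
     forall b, exists N c, t c = e (loc_in (f i) (f i)) ^+ N * b,
     forall b, exists a, b = \sum_j e (a j) * bs j &
     forall a, \sum_j e (a j) * bs j = 0 -> forall j, a j = 0].
  have [t [et _]] := ug _ (x i); have [e [bs [e1 e2 e3 e4]]] := H' i.
  have [g1 g2] := gl i t et; exists t, e, bs; split=> //.
    by move=> a; rewrite -(xf _ _ _ e1) -et.
  by move=> b; have [N [c hc]] := g2 b; exists N, c; rewrite hc (xf _ _ _ e1).
have gens i : exists (y : 'I_m -> C),
   (forall c, exists N (a : 'I_m -> A), ep (f i) ^+ N * c = \sum_j ep (a j) * y j) /\
   (forall a : 'I_m -> A, \sum_j ep (a j) * y j = 0 -> exists N, forall j, f i ^+ N * a j = 0).
  have [t [e [bs [te t0 ts gen free]]]] := loc_i i.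
  have [N hN] : exists N, forall j, exists c, t c = e (loc_in (f i) (f i)) ^+ N * bs j.
    apply: (@ex_max _ (fun j N => exists c, t c = e (loc_in (f i) (f i)) ^+ N * bs j)).
      move=> j p q pq [c h]; exists (ep (f i) ^+ (q - p) * c).
      by rewrite rmorphM rmorphXn te h mulrA -exprD subnK.
    by move=> j; exact: ts.
  have [y hy] := choice hN; exists y; split=> [c|a ha].
    have [a ea] := gen (t c).
    have [M hM] : exists M, forall j, exists a', loc_in (f i) (f i) ^+ M * a j = loc_in (f i) a'.
      apply: (@ex_max _ (fun j M => exists a', loc_in (f i) (f i) ^+ M * a j = loc_in (f i) a')).
        move=> j p q pq [c' h]; exists (f i ^+ (q - p) * c').
        by rewrite rmorphM rmorphXn -h mulrA -exprD subnK.
      by move=> j; exact: loc_surj.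
    have [a' ha'] := choice hM.
    have [|L hL] := t0 (ep (f i) ^+ (N + M) * c - \sum_j ep (a' j) * y j).
      rewrite rmorphB rmorphM rmorphXn te ea rmorph_sum mulr_sumr -sumrB big1 // => j _.
      by rewrite rmorphM te hy -ha' rmorphM rmorphXn exprD; ring.
    exists (L + (N + M))%N, (fun j => f i ^+ L * a' j).
    move: hL; rewrite mulrBr mulrA -exprD => /subr0_eq ->; rewrite mulr_sumr.
    by apply: eq_bigr => j _; rewrite rmorphM rmorphXn mulrA.
  have h : \sum_j e (loc_in (f i) (f i ^+ N * a j)) * bs j = 0.
    have e0 : t (\sum_j ep (a j) * y j) = 0 by rewrite ha rmorph0.
    rewrite -[RHS]e0 rmorph_sum; apply: eq_bigr => j _.
    by rewrite !rmorphM te hy !rmorphXn; ring.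
  have {}h j : exists L, f i ^+ L * a j = 0.
    have /loc_in0[L hL] := free _ h j; exists (L + N)%N.
    by rewrite exprD -mulrA.
  by apply: (@ex_max _ (fun j L => f i ^+ L * a j = 0)) h => j p q; exact: pow_kill.
have [y hy] := choice gens; split=> //.
  by apply: (locally_free_finite hf) => i; exact: (hy i).1.
by apply: (locally_free_flat hf) => i; [exact: (hy i).1|exact: (hy i).2].
Qed.
End LocallyTriple.

Section LocallyTriple2.
Context (R : realType) (n m : nat).
Local Notation K := R[i].
Context (A : calg K) (Z : sub (prod_functor (Spec A) (Xi K n))) (Zloc : is_local Z)
  (hZ : locally (@is_triple R n m A Z)).

Lemma pullback_base (A' : calg K) (u : hom A A') (B : calg K) (e : hom A' B) :
  pullback_is_Spec (preim (basechange (Xi K n) u) Z) (hom_id A') e ->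
  pullback_is_Spec Z u e.
Proof.
case=> x hx hu; exists x; first by rewrite -[e]hom_compu1.
move=> D v y hv; apply: hu; by rewrite /= hom_compu1.
Qed.

Lemma loc_triple_finite_flat : finite_flat_of_degree m Z.
Proof.
split=> [A' u|u].
  have loc' : is_local (preim (basechange (Xi K n) u) Z).
    move=> B x hl; apply: Zloc; apply: locally_sub hl => C v.
    by rewrite /= hom_compA.
  have [|B [e [h1 h2 h3]]] := loc_triple_affine (m := m) loc'.
    apply: locally_sub (locally_res u hZ) => B v [k [T [hT hZT]]].
    by exists k, T; split=> // D w y; rewrite -hZT /= hom_compA.
  by exists B, e; split=> //; exact: pullback_base.
have [k [T [hT hZT]]] := nbhd_pt (nbhd_locally u hZ).
exists (alg hT), (alg_in hT); split; last exact: alg_free.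
have [x hx ux] := @Zt_pullback K n m _ k T hT.
exists x; first by apply/hZT; rewrite -[alg_in hT]hom_compu1.
by move=> D v y /hZT h; apply: ux; rewrite hom_compu1.
Qed.
End LocallyTriple2.

Lemma ex_choice (T U : Type) (P : T -> U -> Prop) :
  (forall x, exists y, P x y) -> exists f, forall x, P x (f x).
Proof. by move=> /choice[f hf]; exists f. Qed.

(** * Finite algebras near a closed point *)

Section FiniteAlgebra.
Context (R : realType).
Local Notation K := R[i].
Context (A B : calg K) (e : hom A B) (p : hom A (base K)).

(** Generators of the ideal of B that cuts out the fibre at p. *)
Definition pgen (b : B) : Prop := exists2 a : A, p a = 0 & b = e a.

Lemma pgen_str a : ideal pgen (e a - calg_str B (p a)).
Proof.
apply: ideal_gen; exists (a - calg_str A (p a)); last by rewrite rmorphB homK.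
by rewrite rmorphB homK /= subrr.
Qed.

Lemma pgen_comb k (y : 'I_k -> B) :
  (forall b, exists a : 'I_k -> A, b = \sum_i e (a i) * y i) ->
  forall b, ideal pgen b ->
  exists a : 'I_k -> A, (forall i, p (a i) = 0) /\ b = \sum_i e (a i) * y i.
Proof.
move=> gen; apply: (ideal_min (P := fun b => exists a : 'I_k -> A,
  (forall i, p (a i) = 0) /\ b = \sum_i e (a i) * y i)).
- exists (fun=> 0); split=> [i|]; first exact: rmorph0.
  by rewrite big1 // => i _; rewrite rmorph0 mul0r.
- move=> _ _ [a [pa ->]] [a' [pa' ->]]; exists (fun i => a i + a' i); split.
    by move=> i; rewrite rmorphD pa pa' addr0.
  by rewrite -big_split; apply: eq_bigr => i _; rewrite rmorphD mulrDl.
- move=> c _ [a [pa ->]]; have [cc hcc] := choice (fun i => gen (c * y i)).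
  exists (fun j => \sum_i a i * cc i j); split=> [j|].
    by rewrite rmorph_sum big1 // => i _; rewrite rmorphM pa mul0r.
  rewrite mulr_sumr; under [RHS]eq_bigr => j _ do rewrite rmorph_sum mulr_suml.
  rewrite exchange_big; apply: eq_bigr => i _.
  by rewrite mulrCA hcc mulr_sumr; apply: eq_bigr => j _; rewrite rmorphM mulrA.
- move=> _ [a pa ->]; have [c hc] := gen 1; exists (fun i => a * c i); split.
    by move=> i; rewrite rmorphM pa mul0r.
  by rewrite -[LHS]mulr1 hc mulr_sumr; apply: eq_bigr => i _; rewrite rmorphM mulrA.
Qed.

Lemma det_one_sub_pt k (P : 'M[A]_k) : (forall i j, p (P i j) = 0) ->
  p (\det (1%:M - P)) = 1.
Proof.
move=> hP; rewrite -det_map_mx (_ : map_mx p _ = 1%:M) ?det1 //.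
by apply/matrixP => i j; rewrite !mxE rmorphB hP subr0 rmorphMn rmorph1.
Qed.

(** Determinant trick: the generators y satisfy (1 - P) y in J with P vanishing at p, and g = det (1
    - P) has value 1 at p. *)
Lemma nakayama (J : B -> Prop) : module_finite e ->
  J 0 -> (forall b b', J b -> J b' -> J (b + b')) -> (forall a b, J b -> J (e a * b)) ->
  (forall b, exists2 j, J j & ideal pgen (b - j)) ->
  exists2 g, p g = 1 & forall b, J (e g * b).
Proof.
move=> [k [y gen]] J0 JD JM Jp.
have [j hj] : exists j : 'I_k -> B, forall i, J (j i) /\ ideal pgen (y i - j i).
  apply: (ex_choice (P := fun i z => J z /\ ideal pgen (y i - z))) => i.
  by have [z h1 h2] := Jp (y i); exists z.
have [P hP] := choice (fun i => pgen_comb gen (hj i).2).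
pose M := 1%:M - \matrix_(i, l) P i l.
have My i : \sum_l e (M i l) * y l = j i.
  under eq_bigr => l _ do rewrite !mxE rmorphB mulrBl rmorphMn rmorph1.
  rewrite sumrB -(hP i).2 (bigD1 i) //= eqxx mul1r big1 ?addr0 ?subKr //.
  by move=> l li; rewrite eq_sym (negPf li) mul0r.
exists (\det M).
  by apply: det_one_sub_pt => i l; rewrite mxE; exact: (hP i).1.
have Jy l : J (e (\det M) * y l).
  have -> : e (\det M) * y l = \sum_i e (\adj M l i) * j i.
    under eq_bigr => i _ do rewrite -My mulr_sumr.
    rewrite exchange_big /=.
    have H t : \sum_i e (\adj M l i) * (e (M i t) * y t) = e ((\det M)%:M l t) * y t.
      rewrite -mul_adj_mx mxE rmorph_sum mulr_suml; apply: eq_bigr => i _.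
      by rewrite rmorphM mulrA.
    under eq_bigr => t _ do rewrite H.
    rewrite (bigD1 l) //= mxE eqxx big1 ?addr0 // => t tl.
    by rewrite mxE eq_sym (negPf tl) rmorph0 mul0r.
  by apply: (big_ind J) => // i _; apply: JM; exact: (hj i).1.
move=> b; have [a ->] := gen b; rewrite mulr_sumr.
by apply: (big_ind J) => // i _; rewrite mulrCA; exact: JM.
Qed.

Definition fibre_basis m (beta : 'I_m -> B) : Prop :=
  (forall b, exists al : 'I_m -> K,
     ideal pgen (b - \sum_j calg_str B (al j) * beta j)) /\
  (forall al : 'I_m -> K, ideal pgen (\sum_j calg_str B (al j) * beta j) ->
     forall j, al j = 0).

Lemma pgen_kill (D : calg K) (t : hom B D) (v : hom (base K) D) :
  hom_comp t e = hom_comp v p -> forall b, ideal pgen b -> t b = 0.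
Proof.
move=> te; apply: hom_ideal => _ [a pa ->].
have : t (e a) = v (p a) by rewrite -[LHS]/(hom_comp t e a) te.
by rewrite pa rmorph0.
Qed.

(** The fibre has dimension m, so m spanning vectors are independent: the two transition matrices
    are inverse to each other. *)
Lemma fibre_spanning m (beta beta' : 'I_m -> B) :
  fibre_basis beta' ->
  (forall b, exists al : 'I_m -> K,
     ideal pgen (b - \sum_j calg_str B (al j) * beta j)) -> fibre_basis beta.
Proof.
move=> [sp' ind'] sp; split=> // al hal.
have [M hM] := choice (fun i => sp (beta' i)).
have [M' hM'] := choice (fun i => sp' (beta i)).
pose P := \matrix_(i, j) M i j; pose P' := \matrix_(i, j) M' i j.
have subst (c : 'I_m -> K) (N : 'I_m -> 'I_m -> K) (x y : 'I_m -> B) :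
    (forall i, ideal pgen (x i - \sum_j calg_str B (N i j) * y j)) ->
    ideal pgen (\sum_i calg_str B (c i) * x i -
      \sum_j calg_str B (\sum_i c i * N i j) * y j).
  move=> h; have -> : \sum_j calg_str B (\sum_i c i * N i j) * y j =
      \sum_i calg_str B (c i) * \sum_j calg_str B (N i j) * y j.
    under eq_bigr => j _ do rewrite rmorph_sum mulr_suml.
    rewrite exchange_big; apply: eq_bigr => i _; rewrite mulr_sumr.
    by apply: eq_bigr => j _; rewrite rmorphM mulrA.
  rewrite -sumrB; apply: ideal_sum => i _; rewrite -mulrBr; exact: idealM.
have PP : P *m P' = 1%:M.
  apply/matrixP => i j; apply/subr0_eq.
  apply: (ind' (fun j => (P *m P') i j - (1%:M : 'M[K]_m) i j)).
  under eq_bigr => l _ do rewrite rmorphB mulrBl.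
  rewrite sumrB (_ : \sum_l calg_str B ((1%:M : 'M[K]_m) i l) * beta' l = beta' i).
    have h1 := subst (M i) M' beta beta' hM'.
    have h2 := idealN (idealD (hM i) h1); rewrite addrA subrK opprB in h2.
    move: h2; congr (ideal pgen (_ - _)); apply: eq_bigr => l _; congr (calg_str B _ * _).
    by rewrite mxE; apply: eq_bigr => t _; rewrite !mxE.
  rewrite (bigD1 i) //= mxE eqxx rmorph1 mul1r big1 ?addr0 // => l li.
  by rewrite mxE eq_sym (negPf li) rmorph0 mul0r.
have P'P := mulmx1C PP.
have alP : (\row_j al j) *m P' = 0.
  apply/rowP => j; rewrite [RHS]mxE.
  apply: (ind' (fun j => ((\row_j al j) *m P') 0 j)).
  have := idealB hal (subst al M' beta beta' hM'); rewrite subKr.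
  congr (ideal pgen _); apply: eq_bigr => l _; congr (calg_str B _ * _).
  by rewrite mxE; apply: eq_bigr => t _; rewrite !mxE.
move=> j; have : (\row_j al j) *m P' *m P = 0 by rewrite alP mul0mx.
by rewrite -mulmxA P'P mulmx1 => /rowP/(_ j); rewrite !mxE.
Qed.

Lemma nakayama_basis m (beta : 'I_m -> B) : module_finite e -> fibre_basis beta ->
  exists2 g, p g = 1 & forall b, exists a : 'I_m -> A, e g * b = \sum_j e (a j) * beta j.
Proof.
move=> fin [sp _].
have [|||b|g pg hg] := @nakayama (fun b => exists a : 'I_m -> A, b = \sum_j e (a j) * beta j) fin.
- by exists (fun=> 0); rewrite big1 // => j _; rewrite rmorph0 mul0r.
- move=> _ _ [a ->] [a' ->]; exists (fun j => a j + a' j); rewrite -big_split.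
  by apply: eq_bigr => j _; rewrite rmorphD mulrDl.
- move=> c _ [a ->]; exists (fun j => c * a j); rewrite mulr_sumr.
  by apply: eq_bigr => j _; rewrite rmorphM mulrA.
- have [al hal] := sp b; exists (\sum_j calg_str B (al j) * beta j) => //.
  by exists (fun j => calg_str A (al j)); apply: eq_bigr => j _; rewrite homK.
by exists g.
Qed.
End FiniteAlgebra.

(** * Quotient modules and the local criterion *)

Section SubmoduleQuotient.
Context (A : comPzRingType) (V : lmodType A) (S : V -> Prop)
  (S0 : S 0) (SD : forall x y, S x -> S y -> S (x + y)) (SZ : forall a x, S x -> S (a *: x)).

Lemma submodN x : S x -> S (- x).
Proof. by rewrite -scaleN1r; exact: SZ. Qed.

Lemma submod_eq x y : x = y -> S (x - y).
Proof. by move=> ->; rewrite subrr. Qed.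

Definition subquot_pre : pre_mod A.
Proof.
apply: (@PreMod A V (fun x y => S (x - y)) 0 -%R +%R *:%R).
- by move=> x; exact: submod_eq.
- by move=> x y h; rewrite -opprB; exact: submodN.
- by move=> y x z h h'; rewrite -(subrK y x) -addrA; exact: SD.
- by move=> x y h; rewrite -opprD; exact: submodN.
- by move=> x x' y y' h h'; rewrite opprD addrACA; exact: SD.
- by move=> a x y h; rewrite -scalerBr; exact: SZ.
- by move=> x y z; apply: submod_eq; rewrite addrA.
- by move=> x y; apply: submod_eq; rewrite addrC.
- by move=> x; apply: submod_eq; rewrite add0r.
- by move=> x; apply: submod_eq; rewrite addNr.
- by move=> a b x; apply: submod_eq; rewrite scalerA.
- by move=> x; apply: submod_eq; rewrite scale1r.
- by move=> a x y; apply: submod_eq; rewrite scalerDr.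
- by move=> x a b; apply: submod_eq; rewrite scalerDl.
Defined.

Definition subquot := qmod subquot_pre.
Definition sq_pi (x : V) : subquot := mpi (P := subquot_pre) x.

Lemma sq_piP x y : sq_pi x = sq_pi y <-> S (x - y).
Proof. exact: (@mpiP A subquot_pre). Qed.
Lemma sq_piD x y : sq_pi (x + y) = sq_pi x + sq_pi y.
Proof. exact: (@mpiD A subquot_pre). Qed.
Lemma sq_piZ a x : sq_pi (a *: x) = a *: sq_pi x.
Proof. exact: (@mpiZ A subquot_pre). Qed.
Lemma sq_ind (P : subquot -> Prop) : (forall x, P (sq_pi x)) -> forall y, P y.
Proof. exact: (@qmod_ind A subquot_pre P). Qed.

Lemma sq_pi0P x : sq_pi x = 0 <-> S x.
Proof.
rewrite -[0]/(sq_pi 0); split=> [/sq_piP|h]; first by rewrite subr0.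
by apply/sq_piP; rewrite subr0.
Qed.

Lemma sq_lift (W : Type) (h : V -> W) : (forall x y, S (x - y) -> h x = h y) ->
  exists h' : subquot -> W, forall x, h' (sq_pi x) = h x.
Proof.
move=> hS; exists (fun y => h (mrepr (P := subquot_pre) y)) => x.
by apply: hS; exact: (@mrepr_pi A subquot_pre).
Qed.
End SubmoduleQuotient.

Definition pack_linear (A : comPzRingType) (V W : lmodType A) (h : V -> W)
  (lin : linear h) : {linear V -> W} :=
  HB.pack h (GRing.isLinear.Build A V W *:%R h lin).

Lemma mk_linear (A : comPzRingType) (V W : lmodType A) (h : V -> W) :
  (forall x y, h (x + y) = h x + h y) -> (forall a x, h (a *: x) = a *: h x) ->
  exists h' : {linear V -> W}, h' =1 h.
Proof.
move=> hD hZ.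
have lin : linear h by move=> a x y; rewrite hD hZ.
by exists (pack_linear lin).
Qed.

Section FlatFibre.
Context (R : realType).
Local Notation K := R[i].
Context (A B : calg K) (e : hom A B) (p : hom A (base K)) (m : nat) (beta : 'I_m -> B)
  (hb : fibre_basis e p beta) (hflat : flat e).

(* If the beta_j form a basis of the fibre at p, a relation between them      *)
(* generates an ideal I with I = p I by flatness, so it vanishes near p.      *)
Lemma flat_relation (a : 'I_m -> A) : \sum_j e (a j) * beta j = 0 ->
  exists2 s, p s = 1 & forall j, s * a j = 0.
Proof.
move=> ha; pose V : lmodType A := 'rV[A]_m.
pose ev (x : V) : A := \sum_j x 0 j * a j.
have evD x y : ev (x + y) = ev x + ev y.
  by rewrite /ev -big_split; apply: eq_bigr => j _; rewrite mxE mulrDl.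
have evZ c x : ev (c *: x) = c * ev x.
  by rewrite /ev mulr_sumr; apply: eq_bigr => j _; rewrite mxE mulrA.
pose S1 (x : V) := ev x = 0.
pose S2 (x : V) := exists y : V, (forall j, p (y 0 j) = 0) /\ ev (x - y) = 0.
have S10 : S1 0 by rewrite /S1 -(scale0r 0) evZ mul0r.
have S1D x y : S1 x -> S1 y -> S1 (x + y) by rewrite /S1 evD => -> ->; rewrite addr0.
have S1Z c x : S1 x -> S1 (c *: x) by rewrite /S1 evZ => ->; rewrite mulr0.
have S20 : S2 0 by exists 0; split=> [j|]; rewrite ?mxE ?rmorph0 ?subr0.
have S2D x y : S2 x -> S2 y -> S2 (x + y).
  move=> [x' [px ex]] [y' [py ey]]; exists (x' + y'); split=> [j|].
    by rewrite mxE rmorphD px py addr0.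
  by rewrite opprD addrACA evD ex ey addr0.
have S2Z c x : S2 x -> S2 (c *: x).
  move=> [x' [px ex]]; exists (c *: x'); split=> [j|].
    by rewrite mxE rmorphM px mulr0.
  by rewrite -scalerBr evZ ex mulr0.
have S12 x : S1 x -> S2 x.
  by move=> h; exists 0; split=> [j|]; rewrite ?mxE ?rmorph0 ?subr0.
(* N is A^m modulo the kernel of [ev], that is the ideal I generated by the [a j], and [ev] embeds
   it in A; P is I / p I. *)
pose N := subquot S10 S1D S1Z; pose P := subquot S20 S2D S2Z.
have evB x y : S1 (x - y) -> ev x = ev y.
  move=> h; apply/subr0_eq; rewrite -[RHS]h evD; congr (_ + _).
  by rewrite -scaleN1r evZ mulN1r.
have [j0 hj0] := sq_lift S10 S1D S1Z evB.
have [||j hj] := @mk_linear A N (A^o) j0.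
- by elim/sq_ind=> x; elim/sq_ind=> y; rewrite -sq_piD !hj0 evD.
- by move=> c; elim/sq_ind=> x; rewrite -sq_piZ !hj0 evZ.
have jinj : injective j.
  elim/sq_ind=> x; elim/sq_ind=> y; rewrite !hj !hj0 => exy; apply/sq_piP.
  by rewrite /S1 evD exy -scaleN1r evZ mulN1r subrr.
have [q0 hq0] : exists q : N -> P, forall x, q (sq_pi S10 S1D S1Z x) = sq_pi S20 S2D S2Z x.
  by apply: sq_lift => x y h; apply/sq_piP/S12.
have qD x y : q0 (x + y) = q0 x + q0 y.
  by elim/sq_ind: x => x; elim/sq_ind: y => y; rewrite -!sq_piD !hq0 sq_piD.
have qZ c x : q0 (c *: x) = c *: q0 x.
  by elim/sq_ind: x => x; rewrite -sq_piZ !hq0 sq_piZ.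
have pP c (y : P) : p c = 0 -> c *: y = 0.
  elim/sq_ind: y => y pc; rewrite -sq_piZ; apply/sq_pi0P.
  exists (c *: y); split=> [l|]; first by rewrite mxE rmorphM pc mul0r.
  by rewrite subrr.
case: hb => sp ind; have [co hco] := choice sp.
have co_uniq b (al : 'I_m -> K) : ideal (pgen e p) (b - \sum_j calg_str B (al j) * beta j) ->
    forall j, co b j = al j.
  move=> h l; apply/subr0_eq; apply: (ind (fun l => co b l - al l)).
  under eq_bigr => t _ do rewrite rmorphB mulrBl.
  rewrite sumrB; have := idealB h (hco b); congr (ideal _ _); ring.
pose x0 (i : 'I_m) : N := sq_pi S10 S1D S1Z (delta_mx 0 i).
have tz : tensor_zero e (fun i => j (x0 i)) beta.
  move=> Q be [bDl bDr bZl bZr].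
  have ej i : j (x0 i) = a i *: (1 : A^o).
    rewrite hj hj0 /ev (bigD1 i) //= mxE !eqxx mul1r big1 ?addr0.
      by rewrite -[RHS]/(a i * 1) mulr1.
    by move=> t ti; rewrite mxE eqxx (negPf ti) mul0r.
  have be0 x : be x 0 = 0 by apply: (addIr (be x 0)); rewrite -bDr !add0r.
  transitivity (be 1 (\sum_i e (a i) * beta i)); last by rewrite ha be0.
  rewrite (big_morph (be 1) (bDr 1) (be0 1)); apply: eq_bigr => i _.
  by rewrite ej bZl bZr.
(* The k-th coordinate in the fibre gives a bilinear map from N and B to I / p I. Flatness applied
   to the relation [tz] shows that the class of [a k] vanishes. *)
have key k : sq_pi S20 S2D S2Z (delta_mx 0 k) = 0.
  pose ga (x : N) (b : B) : P := calg_str A (co b k) *: q0 x.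
  have bil : is_bilinear e ga.
    split.
    - by move=> x y b; rewrite /ga qD scalerDr.
    - move=> x b b'; rewrite /ga -scalerDl -rmorphD; congr (calg_str A _ *: _).
      apply: (co_uniq _ (fun l => co b l + co b' l)).
      under eq_bigr => t _ do rewrite rmorphD mulrDl.
      rewrite big_split opprD addrACA; exact: idealD.
    - by move=> c x b; rewrite /ga qZ !scalerA mulrC.
    - move=> c x b; rewrite /ga; have -> : co (e c * b) k = p c * co b k.
        apply: (co_uniq _ (fun l => p c * co b l)).
        under eq_bigr => t _ do rewrite rmorphM -mulrA.
        rewrite -mulr_sumr -{1}(subrK (calg_str B (p c)) (e c)) mulrDl -addrA -mulrBr.
        by apply: idealD; [apply: idealMr; exact: pgen_str|exact: idealM].
      rewrite rmorphM -scalerA; apply/esym/subr0_eq; rewrite -scalerBl.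
      by apply: pP; rewrite rmorphB homK /= subrr.
  have := hflat jinj tz bil; rewrite (bigD1 k) //= big1 ?addr0.
    rewrite /ga hq0 (co_uniq _ (fun l => (l == k)%:R)) ?eqxx ?rmorph1 ?scale1r //.
    rewrite (bigD1 k) //= eqxx rmorph1 mul1r big1 ?addr0 ?subrr; first exact: ideal0.
    by move=> t /negPf ->; rewrite rmorph0 mul0r.
  move=> i ik; rewrite /ga (co_uniq _ (fun l => (l == i)%:R)) 1?eq_sym ?(negPf ik) ?rmorph0 ?scale0r //.
  rewrite (bigD1 i) //= eqxx rmorph1 mul1r big1 ?addr0 ?subrr; first exact: ideal0.
  by move=> t /negPf ->; rewrite rmorph0 mul0r.
have [y hy] := choice (fun k => iffLR (sq_pi0P S20 S2D S2Z _) (key k)).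
(* Now a = Y a with the matrix Y vanishing at p, so det (1 - Y) annihilates every [a l]. *)
pose M := 1%:M - \matrix_(k, l) y k 0 l.
have Ma : M *m (\col_l a l) = 0.
  apply/colP => k; rewrite !mxE -[RHS](hy k).2 /ev; apply: eq_bigr => l _.
  by rewrite !mxE eqxx eq_sym.
exists (\det M).
  by apply: det_one_sub_pt => k l; rewrite mxE; exact: (hy k).1.
move=> l; have : \adj M *m M *m (\col_l a l) = 0 by rewrite -mulmxA Ma mulmx0.
by rewrite mul_adj_mx mul_scalar_mx => /colP/(_ l); rewrite !mxE.
Qed.
End FlatFibre.

(** * Closed finite flat families are locally given by triples *)

Definition represents (K : closedFieldType) (X : functor K) (A B : calg K)
    (Z : sub (prod_functor (Spec A) X)) (e : hom A B) (x : X B) : Prop :=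
  Z B (e, x) /\ forall (D : calg K) (v : hom A D) (y : X D), Z D (v, y) ->
    exists! t : hom B D, hom_comp t e = v /\ res t x = y.

Lemma pullback_represents (K : closedFieldType) (X : functor K) (A B : calg K)
    (Z : sub (prod_functor (Spec A) X)) (e : hom A B) :
  pullback_is_Spec Z (hom_id A) e -> exists x, represents Z e x.
Proof.
case=> x hx hu; exists x; split; first by rewrite -[e]hom_compu1.
by move=> D v y hv; apply: hu; rewrite hom_compu1.
Qed.

Section TermSubalgebra.
Context (K : closedFieldType) (A B : calg K) (e : hom A B) (a b : B).

Definition tval (t : bterm A) : B := beval a b (bmap e t).

Definition sub_pre : pre_ring.
Proof.
apply: (@family_ring (bterm A) unit (fun _ => B) (fun _ t => tval t)
  (BC 0) (BC 1) (BM (BC (-1))) (@BD A) (@BM A)) => // _; rewrite /tval /=.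
- exact: rmorph0.
- exact: rmorph1.
- by move=> t; rewrite rmorphN rmorph1 mulN1r.
Defined.

Let Q := qring sub_pre.
Definition sub_pi (t : bterm A) : Q := @qpi sub_pre t.

Lemma sub_piP s t : sub_pi s = sub_pi t <-> tval s = tval t.
Proof.
split=> [/(@qpiP sub_pre) h|h]; first exact: (h tt).
by apply/(@qpiP sub_pre) => -[].
Qed.
Lemma sub_piD s t : sub_pi (BD s t) = sub_pi s + sub_pi t.
Proof. exact: (@qpiD sub_pre). Qed.
Lemma sub_piM s t : sub_pi (BM s t) = sub_pi s * sub_pi t.
Proof. exact: (@qpiM sub_pre). Qed.

Lemma sub_inB : zmod_morphism (fun c : A => sub_pi (BC c)).
Proof.
move=> x y; apply: (addIr (sub_pi (BC y))); rewrite subrK -sub_piD.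
by apply/sub_piP; rewrite /tval /= -rmorphD subrK.
Qed.

Lemma sub_inM : monoid_morphism (fun c : A => sub_pi (BC c)).
Proof.
split=> // x y; rewrite -sub_piM; apply/sub_piP.
by rewrite /tval /= rmorphM.
Qed.

Definition sub_str : {rmorphism K -> Q} := mk_rmorph sub_inB sub_inM \o calg_str A.

Lemma sub_fg : exists s : seq Q, forall P : Q -> Prop,
  (forall a, P (sub_str a)) -> (forall x, x \in s -> P x) ->
  (forall x y, P x -> P y -> P (x + y)) ->
  (forall x y, P x -> P y -> P (x * y)) -> forall x, P x.
Proof.
have [s hs] := calg_fg A.
exists [:: sub_pi BX, sub_pi BY & [seq sub_pi (BC x) | x <- s]] => P hK hP hD hM.
suff h (t : bterm A) : P (sub_pi t) by apply: (@qring_ind sub_pre P) => t; exact: h.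
elim: t => [c| | |t1 h1 t2 h2|t1 h1 t2 h2].
- apply: (hs (fun x => P (sub_pi (BC x)))) => //.
  + move=> y hy; apply: hP; rewrite !inE; apply/orP; right; apply/orP; right.
    exact: (map_f (fun x => sub_pi (BC x))).
  + by move=> y z hy hz; have := hD _ _ hy hz; rewrite -(raddfD (mk_rmorph sub_inB sub_inM)).
  + by move=> y z hy hz; have := hM _ _ hy hz; rewrite -(rmorphM (mk_rmorph sub_inB sub_inM)).
- by apply: hP; rewrite inE eqxx.
- by apply: hP; rewrite !inE eqxx orbT.
- by rewrite sub_piD; exact: hD.
- by rewrite sub_piM; exact: hM.
Qed.

Definition subalg : calg K := @CAlg K Q sub_str sub_fg.
Definition sub_in : hom A subalg := @Hom K A subalg (mk_rmorph sub_inB sub_inM) (fun=> erefl).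

Lemma sub_ind (P : subalg -> Prop) : (forall t, P (sub_pi t)) -> forall x, P x.
Proof. exact: (@qring_ind sub_pre P). Qed.

Definition sub_val_fun (x : subalg) : B := tval (qrepr (P := sub_pre) x).

Lemma sub_val_pi t : sub_val_fun (sub_pi t) = tval t.
Proof. exact: (@qrepr_pi sub_pre t tt). Qed.

Definition sub_val : hom subalg B.
Proof.
apply: (@mk_hom K subalg B sub_val_fun).
- by apply: sub_ind => s; apply: sub_ind => t; rewrite -sub_piD !sub_val_pi.
- by apply: sub_ind => s; apply: sub_ind => t; rewrite -sub_piM !sub_val_pi.
- by move=> c; rewrite [LHS]sub_val_pi /tval /= homK.
Defined.

Lemma sub_valE t : sub_val (sub_pi t) = tval t. Proof. exact: sub_val_pi. Qed.

Lemma sub_val_in : hom_comp sub_val sub_in = e.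
Proof. by apply: hom_ext => c; exact: sub_val_pi. Qed.

Lemma sub_val_inj : injective sub_val.
Proof.
by apply: sub_ind => s; apply: sub_ind => t; rewrite !sub_valE => /sub_piP.
Qed.

Lemma sub_val_term x : exists t, sub_val x = tval t.
Proof. by elim/sub_ind: x => t; exists t; exact: sub_valE. Qed.
End TermSubalgebra.

(** * Free families inside one chart *)

Section Frame.
Context (K : closedFieldType) (n m : nat) (A B : calg K)
  (Z : sub (prod_functor (Spec A) (Xi K n))) (Zc : is_closed Z)
  (e : hom A B) (k : K) (a b : B) (hrep : represents Z e (mkXi n (hk k a b)))
  (beta : 'I_m -> B)
  (gen : forall c, exists al : 'I_m -> A, c = \sum_j e (al j) * beta j)
  (free : forall al : 'I_m -> A, \sum_j e (al j) * beta j = 0 -> forall j, al j = 0).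

(** The tautological point has coordinates in the A-subalgebra generated by a and b, and lies in Z
    already there because Z is closed and the subalgebra embeds in B. Universality then gives a map
    from B to the subalgebra whose composite with the inclusion is the identity of B. *)
Lemma frame_terms (c : B) : exists t, c = beval a b (bmap e t).
Proof.
have [Zx uni] := hrep.
pose S := subalg e a b; pose x0 : Xi K n S := mkXi n (@hk K S k (sub_pi e a b BX) (sub_pi e a b BY)).
have [I hI] := Zc ((sub_in e a b, x0) : prod_functor (Spec A) (Xi K n) S).
have ex : res (sub_val e a b) x0 = mkXi n (hk k a b).
  by rewrite mkXi_res hk_map !sub_valE.
have Zval : Z B (hom_comp (sub_val e a b) (sub_in e a b), res (sub_val e a b) x0).
  by rewrite ex sub_val_in.
have Zx0 : Z S (sub_in e a b, x0).
  have := hI S (hom_id S); rewrite res_id => ->; move=> f If.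
  apply: (@sub_val_inj _ _ _ e a b); rewrite [LHS]/= rmorph0.
  exact: (iffLR (hI B (sub_val e a b)) Zval).
have [t [[t1 t2] _]] := uni S _ _ Zx0.
have [t' [[_ _] tu]] := uni B _ _ Zx.
have et : hom_comp (sub_val e a b) t = hom_id B.
  rewrite -(tu (hom_comp (sub_val e a b) t)); last first.
    by rewrite -hom_compA t1 sub_val_in res_comp t2 ex.
  by apply: tu; rewrite res_id; split=> //; exact: spec_res_id.
have [s hs] := sub_val_term (t c); exists s; rewrite -[RHS]/(tval e a b s) -hs.
by rewrite -[RHS]/(hom_comp (sub_val e a b) t c) et.
Qed.

Lemma frame_inj (al al' : 'I_m -> A) :
  \sum_j e (al j) * beta j = \sum_j e (al' j) * beta j -> al =1 al'.
Proof.
move=> h j; apply/subr0_eq; apply: (free (al := fun j => al j - al' j)).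
under eq_bigr => l _ do rewrite rmorphB mulrBl.
by rewrite sumrB h subrr.
Qed.

(** D and E are the matrices of multiplication by a and b in the basis, l the coordinates of 1;
    cocyclicity holds because a and b generate B. *)
Lemma frame_triple : exists T : triple m A, cocyclic T /\
  forall D (v : hom A D) y, Z D (v, y) <-> Zt n k T D (v, y).
Proof.
have [Zx uni] := hrep.
have [MD hD] := ex_choice (fun i => gen (a * beta i)).
have [ME hE] := ex_choice (fun i => gen (b * beta i)).
have [ml hl] := gen 1.
pose T : triple m A := {| tD := \matrix_(i, j) MD i j; tE := \matrix_(i, j) ME i j;
  tl := \row_j ml j |}.
pose w := \col_j beta j.
have hw : eig (tmap e T) a b w.
  split; apply/matrixP => i j; rewrite !ord1 !mxE.
  - by rewrite eqxx hl; apply: eq_bigr => l _; rewrite !mxE.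
  - by rewrite hD; apply: eq_bigr => l _; rewrite !mxE.
  - by rewrite hE; apply: eq_bigr => l _; rewrite !mxE.
have coordE (r r' : 'rV[A]_m) : map_mx e r *m w = map_mx e r' *m w -> r = r'.
  move=> /matrixP/(_ 0 0); rewrite !mxE => h; apply/rowP.
  apply: (frame_inj (al := r 0) (al' := r' 0)).
  by move: h; under eq_bigr => l _ do rewrite !mxE; under [RHS]eq_bigr => l _ do rewrite !mxE.
have lt t : map_mx e (tl T *m tmx T t) *m w = (beval a b (bmap e t))%:M.
  by rewrite map_mxM -tmx_tmap; exact: (eig_ltmx (bmap e t) hw).
have hT : cocyclic T.
  split.
    apply/row_matrixP => i; apply: coordE; rewrite !map_row -!row_mul !map_mxM.
    congr (row i _); rewrite -!mulmxA; case: hw => _ h1 h2.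
    by rewrite h1 h2 -!scalemxAr h1 h2 !scalerA mulrC.
  move=> j; have [t ht] := frame_terms (beta j); exists t; apply: coordE.
  by rewrite lt -ht map_delta_mx -rowE; apply/matrixP => i l; rewrite !ord1 !mxE eqxx.
exists T; split=> // D v y; split=> [/uni[t [[<- <-] _]]|].
  exists (t a), (t b), (map_mx t w); split; first by rewrite -hk_map -mkXi_res.
  by have := eig_map t hw; rewrite tmap_comp.
move=> [a' [b' [w' [ey hw']]]].
have [s hs] : exists s : B -> bterm A, forall c, c = beval a b (bmap e (s c)).
  exact: ex_choice frame_terms.
have wd t t' : beval a b (bmap e t) = beval a b (bmap e t') ->
    beval a' b' (bmap v t) = beval a' b' (bmap v t').
  move=> h; apply: (alg_lift_wd hw'); apply: (cocyclic_inj hT); try by move=> ?; exact: tmxC.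
  by apply: coordE; rewrite !lt h.
have [t ht] : exists t : hom B D, forall r, t (beval a b (bmap e r)) = beval a' b' (bmap v r).
  unshelve eexists.
    apply: (@mk_hom K B D (fun c => beval a' b' (bmap v (s c)))).
    - move=> x z; rewrite -[RHS]/(beval a' b' (bmap v (BD (s x) (s z)))); apply: wd.
      by rewrite -hs /= -!hs.
    - move=> x z; rewrite -[RHS]/(beval a' b' (bmap v (BM (s x) (s z)))); apply: wd.
      by rewrite -hs /= -!hs.
    - move=> c; rewrite -(homK v) -[RHS]/(beval a' b' (bmap v (BC (calg_str A c)))).
      by apply: wd; rewrite -hs /= homK.
  by move=> r /=; apply: wd; rewrite -hs.
have te : hom_comp t e = v by apply: hom_ext => c; exact: (ht (BC c)).
have ty : res t (mkXi n (hk k a b)) = y.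
  rewrite mkXi_res hk_map; have -> : t a = a' := ht BX; have -> : t b = b' := ht BY.
  exact: (esym ey).
rewrite -te -ty; exact: (mem_res t Zx).
Qed.
End Frame.

(** * Families whose points lie in the chart of a constant k *)

Section InChart.
Context (R : realType) (n : nat).
Local Notation K := R[i].

Definition in_chart (k : K) (A : calg K) (y : Xi K n A) : Prop :=
  exists a b, y = mkXi n (hk k a b).

Lemma in_chart_res k (A B : calg K) (u : hom A B) (y : Xi K n A) :
  in_chart k y -> in_chart k (res u y).
Proof. by move=> [a [b ->]]; exists (u a), (u b); rewrite mkXi_res hk_map. Qed.

(** The two chart coordinates are unique, so they glue. *)
Lemma in_chart_local k (A : calg K) (y : Xi K n A) :
  locally (fun B (u : hom A B) => in_chart k (res u y)) -> in_chart k y.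
Proof.
set S := fun B (u : hom A B) => _; move=> Sl.
have Sres B D (v : hom B D) (u : hom A B) : S B u -> S D (hom_comp v u).
  by rewrite /S res_comp; exact: in_chart_res.
have coord B (u : hom A B) : S B u -> exists ab : B * B, res u y = mkXi n (hk k ab.1 ab.2).
  by move=> [a [b e]]; exists (a, b).
pose c B (u : hom A B) (h : S B u) := sval (cid (coord B u h)).
have cE B (u : hom A B) (h : S B u) : res u y = mkXi n (hk k (c B u h).1 (c B u h).2).
  exact: (proj2_sig (cid (coord B u h))).
have ccomp B D (v : hom B D) (u : hom A B) (h : S B u) (h' : S D (hom_comp v u)) :
    (c D _ h').1 = v (c B u h).1 /\ (c D _ h').2 = v (c B u h).2.
  by apply: (@mkXi_hk_inj _ n _ k); rewrite -cE res_comp (cE _ _ h) mkXi_res hk_map.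
have [a [ha _]] := glue_elements Sres Sl (s := fun B u h => (c B u h).1)
  (fun B D v u h h' => (ccomp B D v u h h').1).
have [b [hb _]] := glue_elements Sres Sl (s := fun B u h => (c B u h).2)
  (fun B D v u h h' => (ccomp B D v u h h').2).
exists a, b; apply: Xi_separated; apply: locally_sub Sl => B u h.
by rewrite mkXi_res hk_map (ha _ _ h) (hb _ _ h) -cE.
Qed.

Lemma in_chart_nbhd k (A : calg K) (y : Xi K n A) (q : hom A (base K)) :
  in_chart k (res q y) -> nbhd q (fun B u => in_chart k (res u y)).
Proof.
move=> hq; apply: nbhd_trans; apply: nbhd_sub (nbhd_locally q (Xi_locally_hpt y)).
move=> B u [h eh] q' eq.
have : in_chart k (res q' (mkXi n h)) by rewrite -eh -res_comp eq.
move=> [a [b]]; rewrite mkXi_res => /mkXi_hkP[_ [inv _]].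
have inv' : q' (hx h + calg_str B k * hy h) != 0.
  apply: invertible_neq0; move: inv; congr invertible.
  by rewrite rmorphD rmorphM homK.
apply: nbhd_sub (nbhd_neq0 inv') => D v hv; rewrite res_comp eh mkXi_res.
have [|a' [b' e']] := @mkXi_hk_ex _ n _ (hmap v h) k; last by exists a', b'.
by move: hv; congr invertible; rewrite rmorphD rmorphM homK.
Qed.

(** B is finite over A, so the points outside the chart have closed image. In terms of ideals:
    functions whose nonvanishing forces the chart generate 1 together with p B, and Nakayama's lemma
    replaces this by some g with value 1 at p. *)
Lemma in_chart_finite (A B : calg K) (e : hom A B) (p : hom A (base K)) (k : K)
    (y : Xi K n B) : module_finite e ->
  (forall t : hom B (base K), hom_comp t e = p -> in_chart k (res t y)) ->
  exists2 g, p g = 1 & forall D (u : hom B D), invertible (u (e g)) -> in_chart k (res u y).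
Proof.
move=> fin hp.
pose J (c : B) := forall D (u : hom B D), invertible (u c) -> in_chart k (res u y).
have U : ideal (fun c => J c \/ pgen e p c) 1.
  apply: unit_ideal_pt => t; case: (pselect (hom_comp t e = p)) => te.
    have [c tc hc] := in_chart_nbhd (hp t te); exists c => //; by left.
  have [a ha] : exists a, t (e a) != p a.
    apply: contrapT => /forallNP h; apply: te; apply: hom_ext => a.
    by apply/eqP; move/negP: (h a); rewrite negbK.
  exists (e (a - calg_str A (p a))).
    by right; exists (a - calg_str A (p a)) => //; rewrite rmorphB homK /= subrr.
  by rewrite rmorphB homK rmorphB homK /= subr_eq0.
have U' : exists2 j, ideal J j & ideal (pgen e p) (1 - j).
  move: U; apply: (ideal_min (P := fun x => exists2 j, ideal J j & ideal (pgen e p) (x - j))).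
  - by exists 0; rewrite ?subr0; exact: ideal0.
  - move=> x z [j hj hx] [j' hj' hz]; exists (j + j'); first exact: idealD.
    by rewrite opprD addrACA; exact: idealD.
  - move=> c x [j hj hx]; exists (c * j); first exact: idealM.
    by rewrite -mulrBr; exact: idealM.
  - move=> x [hx|hx]; first by exists x; rewrite ?subrr; [exact: ideal_gen|exact: ideal0].
    by exists 0; rewrite ?subr0; [exact: ideal0|exact: ideal_gen].
have [j hj h1] := U'.
have [|||b|g pg hg] := nakayama (e := e) (p := p) (J := ideal J) fin.
- exact: ideal0.
- exact: idealD.
- by move=> c b; exact: idealM.
- exists (b * j); first exact: idealM.
  by rewrite -{1}[b]mulr1 -mulrBr; exact: idealM.
exists g => // D u hu; apply: in_chart_local.
have := hg 1; rewrite mulr1 => hJ.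
have {}hJ : ideal (fun d => exists2 c, J c & d = u c) (u (e g)).
  by apply: ideal_map hJ => c hc; apply: ideal_gen; exists c.
have : ideal (fun d => exists2 c, J c & d = u c) 1.
  by have [z hz] := hu; rewrite -hz mulrC; exact: idealM.
apply: ideal_sub => _ [c hc ->]; apply: ideal_gen => E v hv.
by rewrite -res_comp; exact: hc.
Qed.
End InChart.

Section TripleNear.
Context (R : realType) (n m : nat).
Local Notation K := R[i].
Context (A : calg K) (Z : sub (prod_functor (Spec A) (Xi K n))).

Definition triple_at (k : K) (B : calg K) (u : hom A B) : Prop :=
  exists T : triple m B, cocyclic T /\
    forall D (v : hom B D) y, Z D (hom_comp v u, y) <-> Zt n k T D (v, y).

Lemma triple_at_comp k (B C : calg K) (u : hom A B) (w : hom B C) :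
  triple_at k u -> triple_at k (hom_comp w u).
Proof.
move=> [T [hT hZ]]; exists (tmap w T); split; first exact: cocyclic_map.
by move=> D v y; rewrite hom_compA hZ Zt_base.
Qed.

Context (B : calg K) (e : hom A B) (x : Xi K n B) (hrep : represents Z e x).

(** B modulo p B has the universal property of the fibre, so the basis supplied by the degree
    condition lifts to B. *)
Lemma fibre_basis_exists (p : hom A (base K)) (Bp : calg K) (ep : hom (base K) Bp) :
  pullback_is_Spec Z p ep -> free_of_rank m ep ->
  exists beta : 'I_m -> B, fibre_basis e p beta.
Proof.
move=> [xp Zp up] [b hb]; have [Zx uni] := hrep.
pose Q := quot (pgen e p); pose q : hom B Q := quot_in (pgen e p).
have K0 : forall c d : K, calg_str Q (c + d) = calg_str Q c + calg_str Q d by exact: rmorphD.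
pose e0 : hom (base K) Q := @mk_hom K (base K) Q (calg_str Q) K0
  (rmorphM _) (fun=> erefl).
have qe : hom_comp q e = hom_comp e0 p.
  apply: hom_ext => a.
  have h : q (e a - calg_str B (p a)) = 0 := iffRL (quot_in0 _ _) (pgen_str e p a).
  rewrite rmorphB homK in h; exact: (subr0_eq h).
have ZQ : Z Q (hom_comp e0 p, res q x) by rewrite -qe; exact: (mem_res q Zx).
have [t1 [[t1e t1x] _]] := up Q e0 (res q x) ZQ.
have [t2 [[t2e t2x] _]] := uni Bp (hom_comp ep p) xp Zp.
have t12 : hom_comp t1 t2 = q.
  have [t [_ ut]] := uni Q _ _ ZQ.
  rewrite -(ut q) ?qe //; symmetry; apply: ut.
  by rewrite -hom_compA t2e hom_compA t1e res_comp t2x t1x.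
have kill : forall y, pgen e p y -> t2 y = 0.
  by move=> y hy; apply: (pgen_kill t2e); exact: ideal_gen.
pose t2' : hom Q Bp := quot_lift kill.
have t2q : hom_comp t2' q = t2 by exact: quot_liftK.
have t21 : hom_comp t2' t1 = hom_id Bp.
  have Zp' : Z Bp (hom_comp ep p, xp) by [].
  have [t [_ ut]] := up Bp ep xp Zp'.
  rewrite -(ut (hom_id Bp)); last by rewrite spec_res_id res_id.
  symmetry; apply: ut; split; last by rewrite res_comp t1x -res_comp t2q.
  rewrite -hom_compA t1e; apply: hom_ext => a.
  by rewrite -[LHS]/(t2' (calg_str Q a)) homK -(homK ep).
have [beta hbeta] := ex_choice (fun j => quot_surj (t1 (b j))).
have qb j : q (beta j) = t1 (b j) by exact: hbeta.
have epK (c : K) : ep c = calg_str Bp c by rewrite -(homK ep).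
have qsum (al : 'I_m -> K) : q (\sum_j calg_str B (al j) * beta j) = t1 (\sum_j ep (al j) * b j).
  rewrite !rmorph_sum; apply: eq_bigr => j _.
  by rewrite !rmorphM qb homK epK homK.
exists beta; split=> [c|al hal].
  have [al [hal _]] := hb (t2 c); exists al; apply/quot_in0.
  rewrite -[quot_in _ _]/(q (c - \sum_j calg_str B (al j) * beta j)) rmorphB qsum -hal.
  by rewrite -[t1 (t2 c)]/(hom_comp t1 t2 c) t12 subrr.
have h0 : \sum_j ep (al j) * b j = 0.
  rewrite -[LHS]/(hom_id Bp _) -t21 -[LHS]/(t2' (t1 _)) -qsum.
  by rewrite (iffRL (quot_in0 _ _) hal) rmorph0.
have [c [_ uc]] := hb 0.
have e1 : c = [ffun j => al j].
  by apply: uc; rewrite -[LHS]h0; apply: eq_bigr => j _; rewrite ffunE.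
have e2 : c = [ffun j => 0].
  by apply: uc; rewrite big1 // => j _; rewrite ffunE rmorph0 mul0r.
by move=> j; move/ffunP/(_ j): e2; rewrite e1 !ffunE.
Qed.

(** A product of functions vanishes at all the given points but one. *)
Lemma dedekind N (t : 'I_N -> hom B (base K)) (c : 'I_N -> K) :
  injective t -> (forall b, \sum_i c i * t i b = 0) -> forall i, c i = 0.
Proof.
move=> tinj h i.
have sep j : exists b, j != i -> t j b = 0 /\ t i b != 0.
  case: (eqVneq j i) => [_|ji]; first by exists 0.
  have [b hb] : exists b, t i b != t j b.
    apply: contrapT => /forallNP hn; move/eqP: ji; apply; apply: tinj; apply: hom_ext => b.
    by apply/eqP; rewrite eq_sym; move/negP: (hn b); rewrite negbK.
  exists (b - calg_str B (t j b)) => _; rewrite !rmorphB !homK /= subrr.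
  by rewrite subr_eq0.
have [u hu] := ex_choice sep.
pose b := \prod_(j | j != i) u j.
have tj j : j != i -> t j b = 0.
  by move=> ji; rewrite /b rmorph_prod (bigD1 j) //= (hu j ji).1 mul0r.
have ti : (t i b : K) != 0.
  rewrite /b rmorph_prod; apply: (big_ind (fun z : base K => (z : K) != 0)).
  - exact: oner_neq0.
  - by move=> y z hy hz; apply: mulf_neq0.
  - by move=> j ji; exact: (hu j ji).2.
have := h b; rewrite (bigD1 i) //= [X in _ + X]big1 ?addr0.
  by move=> /eqP; rewrite mulf_eq0 (negPf ti) orbF => /eqP.
by move=> j ji; rewrite tj // mulr0.
Qed.

(** A point is missed by at most one of the charts k = 0, ..., m. If each missed a point of the
    fibre, there would be m + 1 distinct points, linearly independent as characters on an
    m-dimensional fibre. *)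
Lemma chart_choice (p : hom A (base K)) (beta : 'I_m -> B) : fibre_basis e p beta ->
  exists k : 'I_m.+1, forall y, Z (base K) (p, y) -> in_chart ((k : nat)%:R) y.
Proof.
move=> [sp _]; have [Zx uni] := hrep; apply: contrapT => /forallNP hn.
have bad (k : 'I_m.+1) : exists t : hom B (base K), hom_comp t e = p /\
    exists h : hpt K, res t x = mkXi n (h : hpt (base K)) /\ hx h + (k : nat)%:R * hy h = 0.
  apply: contrapT => hk; apply: (hn k) => y hy.
  have [t [[te tx] _]] := uni _ _ _ hy.
  have [h eh] := nbhd_pt (nbhd_locally (hom_id _) (Xi_locally_hpt y)).
  rewrite res_id in eh; apply: contrapT => hc; apply: hk.
  exists t; split=> //; exists h; split; first by rewrite tx.
  apply: contrapT => /eqP h0; apply: hc; rewrite eh.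
  by apply: mkXi_hk_ex; apply: base_invertible; exact: h0.
have [t ht] := ex_choice bad.
have tinj : injective t.
  move=> k k' ekk; have [_ [h [e1 e2]]] := ht k; have [_ [h' [e1' e2']]] := ht k'.
  have : mkXi n (h : hpt (base K)) = mkXi n (h' : hpt (base K)) by rewrite -e1 -e1' ekk.
  move=> /mkXi_eqP[c [_ ex ey _]].
  have [//|kk'] := eqVneq k k'; exfalso.
  have e3 : ((k : nat)%:R - (k' : nat)%:R) * hy h' = 0 :> K.
    transitivity (c * (hx h + (k : nat)%:R * hy h) - (hx h' + (k' : nat)%:R * hy h')).
      by rewrite ex ey; ring.
    by rewrite e2 e2' mulr0 subr0.
  have hy0 : hy h' = 0.
    move/eqP: e3; rewrite mulf_eq0 => /orP[|/eqP //].
    by rewrite subr_eq0 eqr_nat => /eqP/val_inj e3; rewrite e3 eqxx in kk'.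
  have hx0 : hx h' = 0 by move: e2'; rewrite hy0 mulr0 addr0.
  have [b1 [b2 ]] := hpt_unim h'; rewrite hx0 hy0 !mulr0 addr0 => /eqP.
  by rewrite eq_sym oner_eq0.
have [v v0 hv] := left_kernel_nonzero (\matrix_(i, j) t i (beta j)) (ltnSn m).
move/eqP: v0; apply; apply/rowP => i; rewrite [RHS]mxE.
apply: (@dedekind _ t (v 0) tinj) => b.
have [al hal] := sp b.
have tb l : t l b = \sum_j al j * t l (beta j).
  have := pgen_kill (t := t l) (v := hom_id _) (etrans (ht l).1 (esym (spec_res_id p))) hal.
  rewrite rmorphB => /subr0_eq ->; rewrite rmorph_sum; apply: eq_bigr => j _.
  by rewrite rmorphM homK.
transitivity (\sum_j al j * (\sum_l v 0 l * t l (beta j))).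
  under eq_bigr => l _ do rewrite tb mulr_sumr.
  rewrite exchange_big; apply: eq_bigr => j _; rewrite mulr_sumr; apply: eq_bigr => l _.
  exact: mulrCA.
apply: big1 => j _; move/rowP/(_ j): hv; rewrite !mxE => h.
by rewrite (_ : \sum_l _ = 0) ?mulr0 // -[RHS]h; apply: eq_bigr => l _; rewrite mxE.
Qed.
End TripleNear.

Section Spread.
Context (A B A' B' : comPzRingType) (i : {rmorphism A -> A'}) (i' : {rmorphism B -> B'})
  (e : {rmorphism A -> B}) (e' : {rmorphism A' -> B'}) (sq : forall a, e' (i a) = i' (e a))
  (g g1 : A) (m : nat) (beta : 'I_m -> B).

Lemma spread_gen :
  (forall b, exists a : 'I_m -> A, e g1 * b = \sum_j e (a j) * beta j) ->
  invertible (i g1) -> invertible (i g) ->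
  (forall c, exists N c0, i' (e g) ^+ N * c = i' c0) ->
  forall c, exists al : 'I_m -> A', c = \sum_j e' (al j) * i' (beta j).
Proof.
move=> hg1 ig1 ig hs c; have [N [c0 hc0]] := hs c; have [al hal] := hg1 c0.
have [z hz] : invertible (i (g ^+ N * g1)).
  by rewrite rmorphM; apply/invertibleM; split=> //; rewrite rmorphXn; exact: invertibleX.
exists (fun j => z * i (al j)).
have h1 : i' (e (g ^+ N * g1)) * e' z = 1 by rewrite -sq -rmorphM hz rmorph1.
have -> : c = e' z * i' (e g1 * c0).
  by rewrite -[LHS]mul1r -h1 !rmorphM !rmorphXn -hc0; ring.
rewrite hal rmorph_sum mulr_sumr; apply: eq_bigr => j _.
by rewrite !rmorphM sq mulrA.
Qed.

Lemma spread_free :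
  (forall a : 'I_m -> A, \sum_j e (a j) * beta j = 0 -> exists N, forall j, g1 ^+ N * a j = 0) ->
  invertible (i g1) -> invertible (i g) ->
  (forall c, exists N c0, i g ^+ N * c = i c0) ->
  (forall c, i' c = 0 -> exists N, e g ^+ N * c = 0) ->
  forall al : 'I_m -> A', \sum_j e' (al j) * i' (beta j) = 0 -> forall j, al j = 0.
Proof.
move=> indep ig1 ig hs h0 al hal.
have [N hN] : exists N, forall j, exists a', i g ^+ N * al j = i a'.
  apply: (@ex_max _ (fun j N => exists a', i g ^+ N * al j = i a')).
    move=> j q r qr [c h]; exists (g ^+ (r - q) * c).
    by rewrite rmorphM rmorphXn -h mulrA -exprD subnK.
  by move=> j; exact: hs.
have [a' ha'] := ex_choice hN.
have [|M hM] := h0 (\sum_j e (a' j) * beta j).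
  transitivity (e' (i g ^+ N) * \sum_j e' (al j) * i' (beta j)); last by rewrite hal mulr0.
  rewrite rmorph_sum mulr_sumr.
  by apply: eq_bigr => j _; rewrite rmorphM -sq -ha' rmorphM mulrA.
have [|L hL] := indep (fun j => g ^+ M * a' j).
  rewrite -[RHS]hM mulr_sumr; apply: eq_bigr => j _.
  by rewrite rmorphM rmorphXn mulrA.
move=> j; apply: (invertible_can (invertibleX N ig)); rewrite mulr0 ha'.
apply: (invertible_can (x := i (g1 ^+ L * g ^+ M))).
  by rewrite rmorphM !rmorphXn; apply/invertibleM; split; exact: invertibleX.
by rewrite mulr0 -rmorphM -mulrA hL rmorph0.
Qed.
End Spread.

Section TripleNear2.
Context (R : realType) (n m : nat).
Local Notation K := R[i].
Context (A : calg K) (Z : sub (prod_functor (Spec A) (Xi K n))).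

Definition loc_map (B : calg K) (e : hom A B) (g : A) : hom (loc g) (loc (e g)) :=
  loc_lift (u := hom_comp (loc_in (e g)) e) (loc_inv (e g)).

Lemma loc_mapE (B : calg K) (e : hom A B) (g : A) a :
  loc_map e g (loc_in g a) = loc_in (e g) (e a).
Proof. exact: loc_liftE. Qed.

Lemma loc_mapK (B : calg K) (e : hom A B) (g : A) :
  hom_comp (loc_map e g) (loc_in g) = hom_comp (loc_in (e g)) e.
Proof. exact: loc_liftK. Qed.

Lemma loc_represents (B : calg K) (e : hom A B) (x : Xi K n B) (g : A) :
  represents Z e x ->
  represents (preim (basechange (Xi K n) (loc_in g)) Z) (loc_map e g) (res (loc_in (e g)) x).
Proof.
move=> [Zx uni]; split.
  have : Z _ (hom_comp (loc_in (e g)) e, res (loc_in (e g)) x) := mem_res _ Zx.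
  by rewrite -loc_mapK.
move=> D v y hv; have [t [[te tx] ut]] := uni D (hom_comp v (loc_in g)) y hv.
have ig : invertible (t (e g)).
  rewrite -[t (e g)]/(hom_comp t e g) te; apply: (invertible_map v); exact: loc_inv.
exists (loc_lift ig); split.
  split; last by rewrite -res_comp loc_liftK.
  by apply: loc_hom_ext; rewrite -hom_compA loc_mapK hom_compA loc_liftK.
move=> t' [e1 e2]; apply: loc_hom_ext; rewrite loc_liftK; apply: ut.
by rewrite -hom_compA -loc_mapK hom_compA e1 res_comp e2.
Qed.

(** A basis of the fibre at p generates B near p by Nakayama's lemma and is independent there by
    flatness; the tautological point lies in the chart near p. [frame_triple] then applies over a
    localization. *)
Lemma triple_near (k : K) (p : hom A (base K)) :
  is_closed Z -> finite_flat_of_degree m Z ->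
  (forall y, Z (base K) (p, y) -> in_chart k y) -> nbhd p (triple_at m Z k).
Proof.
move=> Zc [ff deg] hk.
have [B [e [/pullback_represents[x hrep] fin fl]]] := ff A (hom_id A).
have basis (q : hom A (base K)) : exists beta : 'I_m -> B, fibre_basis e q beta.
  have [Bq [eq [pq fq]]] := deg q; exact: (fibre_basis_exists hrep pq fq).
have [beta hb] := basis p.
have [g1 pg1 hg1] := nakayama_basis fin hb.
have [g2 pg2 hg2] : exists2 g, p g = 1 &
    forall D (u : hom B D), invertible (u (e g)) -> in_chart k (res u x).
  apply: (in_chart_finite fin) => t te; apply: hk; rewrite -te.
  exact: (mem_res t hrep.1).
(* At every closed point q where g1 is nonzero the same family spans, hence is a basis of the fibre,
   and [flat_relation] gives an annihilator of the [a j] with value 1 at q. By the Nullstellensatz a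
   power of g1 annihilates them. *)
have indep (a : 'I_m -> A) : \sum_j e (a j) * beta j = 0 -> exists N, forall j, g1 ^+ N * a j = 0.
  move=> ha; pose I s := forall j, s * a j = 0.
  have idI s : ideal I s -> I s.
    apply: (ideal_min (P := I)) => //.
    - by move=> j; rewrite mul0r.
    - by move=> s1 s2 h1 h2 j; rewrite mulrDl h1 h2 addr0.
    - by move=> c s1 h1 j; rewrite -mulrA h1 mulr0.
  have [|N hN] := @ideal_power_pt R A I g1; last by exists N; exact: idI hN.
  move=> q qg1; have [beta' hb'] := basis q.
  have hbq : fibre_basis e q beta.
    apply: (fibre_spanning hb') => b; have [al hal] := hg1 b.
    exists (fun j => (q g1)^-1 * q (al j)).
    have -> : b - \sum_j calg_str B ((q g1)^-1 * q (al j)) * beta j =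
       calg_str B (q g1)^-1 * (\sum_j (e (al j) - calg_str B (q (al j))) * beta j) -
       calg_str B (q g1)^-1 * (e g1 - calg_str B (q g1)) * b.
      under [X in _ = _ * X - _]eq_bigr => j _ do rewrite mulrBl.
      rewrite sumrB -hal.
      have c1 : calg_str B (q g1)^-1 * calg_str B (q g1) = 1 by rewrite -rmorphM mulVf ?rmorph1.
      have -> : \sum_j calg_str B ((q g1)^-1 * q (al j)) * beta j =
          calg_str B (q g1)^-1 * \sum_j calg_str B (q (al j)) * beta j.
        by rewrite mulr_sumr; apply: eq_bigr => j _; rewrite rmorphM mulrA.
      transitivity (calg_str B (q g1)^-1 * calg_str B (q g1) * b -
         calg_str B (q g1)^-1 * \sum_j calg_str B (q (al j)) * beta j); last by ring.
      by rewrite c1 mul1r.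
    apply: idealB; first by apply/idealM/ideal_sum => j _; apply: idealMr; exact: pgen_str.
    by apply: idealMr; apply: idealM; exact: pgen_str.
  have [s qs hs] := flat_relation hbq fl ha; exists s; last by rewrite qs oner_neq0.
  exact: ideal_gen.
pose g := g1 * g2; exists g; first by rewrite rmorphM pg1 pg2 mulr1 oner_neq0.
move=> C u hu; rewrite -(loc_liftK hu); apply: triple_at_comp.
have [ig1 ig2] : invertible (loc_in g g1) /\ invertible (loc_in g g2).
  by apply/invertibleM; rewrite -rmorphM; exact: loc_inv.
have [a [b eab]] : in_chart k (res (loc_in (e g)) x).
  apply: hg2; rewrite -loc_mapE; exact: (invertible_map (loc_map e g)).
have := loc_represents g hrep; rewrite eab => hrep'.
have Zc' := closed_preim (basechange (Xi K n) (loc_in g)) Zc.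
have [||T [hT hZT]] := @frame_triple _ n m _ _ _ Zc' _ k a b hrep' (fun j => loc_in (e g) (beta j)).
- exact: (@spread_gen A B (loc g) (loc (e g)) (loc_in g) (loc_in (e g)) e (loc_map e g)
    (loc_mapE e g) g g1 m beta hg1 ig1 (loc_inv g) (@loc_surj _ B (e g))).
- exact: (@spread_free A B (loc g) (loc (e g)) (loc_in g) (loc_in (e g)) e (loc_map e g)
    (loc_mapE e g) g g1 m beta indep ig1 (loc_inv g) (@loc_surj _ A g)
    (fun c => iffLR (@loc_in0 _ B (e g) c))).
by exists T; split=> // D v y; rewrite -hZT.
Qed.

Lemma chart_near (p : hom A (base K)) : finite_flat_of_degree m Z ->
  exists k : 'I_m.+1, forall y, Z (base K) (p, y) -> in_chart ((k : nat)%:R) y.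
Proof.
move=> [ff deg].
have [B [e [/pullback_represents[x hrep] fin fl]]] := ff A (hom_id A).
have [Bp [ep [hp fp]]] := deg p.
have [beta hb] := fibre_basis_exists hrep hp fp.
exact: (chart_choice hrep hb).
Qed.
End TripleNear2.

(** * Representations attached to commuting data *)

(** The eigenvector is determined by a and b, so only the point of the chart has to be glued. *)
Lemma Zt_local (K : closedFieldType) (n m : nat) (A : calg K) (k : K) (T : triple m A) :
  cocyclic T -> (forall (B : calg K) (y : Xi K n B),
    locally (fun D (v : hom B D) => exists a b, res v y = mkXi n (hk k a b)) ->
    exists a b, y = mkXi n (hk k a b)) -> is_local (Zt n k T).
Proof.
move=> hT hloc B [u y] hl.
have [a [b ey]] : exists a b, y = mkXi n (hk k a b).
  apply: hloc; apply: locally_sub hl => D v [a [b [w [e _]]]]; exists a, b; exact: e.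
have [f hf] := ex_choice hT.2.
pose w : 'cV[B]_m := \col_j beval a b (bmap u (f j)).
exists a, b, w; split=> //=.
have key (D : calg K) (v : hom B D) : Zt n k T D (res v ((u, y) : prod_functor (Spec A) (Xi K n) B)) ->
    eig (tmap v (tmap u T)) (v a) (v b) (map_mx v w).
  move=> [a' [b' [w' [e hw]]]].
  have {}e : res v y = mkXi n (hk k a' b') := e.
  have {}hw : eig (tmap v (tmap u T)) a' b' w' by rewrite tmap_comp; exact: hw.
  have [ea eb] : a' = v a /\ b' = v b.
    by apply: (@mkXi_hk_inj _ n _ k); rewrite -e ey mkXi_res hk_map.
  subst a' b'; suff -> : map_mx v w = w' by [].
  apply/colP => j; rewrite !mxE -beval_map.
  have := eig_ltmx (bmap v (bmap u (f j))) hw.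
  rewrite !tmx_tmap -!map_mxM hf !map_delta_mx -rowE.
  by move=> /matrixP/(_ 0 0); rewrite !mxE eqxx mulr1n.
split; apply/matrixP => i j; apply: eq_locally; apply: locally_sub hl => D v /key[h1 h2 h3].
- have := congr1 (fun M : 'M_1 => M i j) h1; rewrite -[tl (tmap v _)]/(map_mx v (tl (tmap u T))).
  by rewrite -map_mxM -(rmorph1 v) -map_scalar_mx !(mxE (map_mx_key)).
- have := congr1 (fun M : 'cV_m => M i j) h2; rewrite -[tD (tmap v _)]/(map_mx v (tD (tmap u T))).
  by rewrite -map_mxM -map_mxZ !(mxE (map_mx_key)).
- have := congr1 (fun M : 'cV_m => M i j) h3; rewrite -[tE (tmap v _)]/(map_mx v (tE (tmap u T))).
  by rewrite -map_mxM -map_mxZ !(mxE (map_mx_key)).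
Qed.

Record adhm (c d : nat) (A : Type) := Adhm {
  aT : triple c A; aF : 'M[A]_(d, c); aD : 'M[A]_d; aE : 'M[A]_d }.

Definition amap c d (A B : Type) (u : A -> B) (x : adhm c d A) : adhm c d B :=
  {| aT := tmap u (aT x); aF := map_mx u (aF x); aD := map_mx u (aD x);
     aE := map_mx u (aE x) |}.

(* N is a basis of the kernel of F; P and R split the resulting sequence. *)
Definition split_by c d c' (A : pzRingType) (F : 'M[A]_(d, c)) (R : 'M[A]_(c, d))
    (N : 'M[A]_(c, c')) (P : 'M[A]_(c', c)) : Prop :=
  [/\ F *m R = 1%:M, F *m N = 0, P *m N = 1%:M & R *m F + N *m P = 1%:M].

Definition good c d c' (A : comPzRingType) (x : adhm c d A) : Prop :=
  [/\ cocyclic (aT x), aF x *m tD (aT x) = aD x *m aF x,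
      aF x *m tE (aT x) = aE x *m aF x &
      exists R N P, @split_by c d c' A (aF x) R N P].

(** Enough for the relations and the stability of [Phi], and exactly what a slice provides. *)
Definition pregood c d (A : comPzRingType) (x : adhm c d A) : Prop :=
  [/\ cocyclic (aT x), aF x *m tD (aT x) = aD x *m aF x,
      aF x *m tE (aT x) = aE x *m aF x & exists R, aF x *m R = 1%:M].

Lemma good_pregood c d c' (A : comPzRingType) (x : adhm c d A) : good c' x -> pregood x.
Proof. by case=> h1 h2 h3 [R [N [P [h4 _ _ _]]]]; split=> //; exists R. Qed.

Lemma pregood_map c d (A B : comPzRingType) (u : {rmorphism A -> B}) (x : adhm c d A) :
  pregood x -> pregood (amap u x).
Proof.
case=> h1 h2 h3 [S h4]; split => /=; first exact: cocyclic_map.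
- by rewrite -!map_mxM h2.
- by rewrite -!map_mxM h3.
- by exists (map_mx u S); rewrite -map_mxM h4 map_mx1.
Qed.

Lemma split_by_map c d c' (A B : pzRingType) (u : {rmorphism A -> B})
    (F : 'M[A]_(d, c)) R N P :
  @split_by c d c' A F R N P ->
  split_by (map_mx u F) (map_mx u R) (map_mx u N) (map_mx u P).
Proof.
case=> h1 h2 h3 h4; split; rewrite -!map_mxM ?h1 ?h2 ?h3 ?map_mx0 ?map_mx1 //.
by rewrite -map_mxD h4 map_mx1.
Qed.

Section KernelTriple.
Context (c d c' : nat) (A : comPzRingType) (x : adhm c d A) (S : 'M[A]_(c, d))
  (N : 'M[A]_(c, c')) (P : 'M[A]_(c', c)) (hs : split_by (aF x) S N P)
  (hT : cocyclic (aT x)) (hD : aF x *m tD (aT x) = aD x *m aF x)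
  (hE : aF x *m tE (aT x) = aE x *m aF x).

(** The restriction of (D, E, l) to the kernel of F in the basis N; it describes the smaller
    subscheme. *)
Definition ker_triple : triple c' A :=
  {| tD := P *m tD (aT x) *m N; tE := P *m tE (aT x) *m N; tl := tl (aT x) *m N |}.

Lemma kerN (X : 'M[A]_c) (X' : 'M[A]_d) : aF x *m X = X' *m aF x ->
  X *m N = N *m (P *m X *m N).
Proof.
case: hs => h1 h2 h3 h4 e.
rewrite !mulmxA -{1}[X]mul1mx -h4 mulmxDl mulmxDl -!mulmxA [in X in X + _](mulmxA _ X N) e.
by rewrite -!mulmxA h2 !mulmx0 add0r.
Qed.

Lemma ker_tmx t : tmx (aT x) t *m N = N *m tmx ker_triple t.
Proof.
elim: t => [a| | |s hs' t ht|s hs' t ht]; rewrite /tmx /=.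
- by rewrite mul_scalar_mx mul_mx_scalar.
- exact: kerN hD.
- exact: kerN hE.
- by rewrite mulmxDl mulmxDr -!/(tmx _ _) hs' ht.
- by rewrite -mulmxA -!/(tmx _ _) ht mulmxA hs' -mulmxA.
Qed.

Lemma ker_cocyclic : cocyclic ker_triple.
Proof.
case: (hs) => h1 h2 h3 h4; have Ninj (r : nat) (X Y : 'M[A]_(c', r)) : N *m X = N *m Y -> X = Y.
  by move=> /(congr1 (mulmx P)); rewrite !mulmxA h3 !mul1mx.
split.
  apply: Ninj; rewrite -[tD ker_triple *m _]/(tmx ker_triple (BM BX BY)) -ker_tmx.
  rewrite -[tE ker_triple *m _]/(tmx ker_triple (BM BY BX)) -ker_tmx; congr (_ *m N).
  by case: hT.
move=> j; have [t ht] := cocyclic_row hT (delta_mx 0 j *m P); exists t.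
by rewrite /= -mulmxA -ker_tmx mulmxA ht -mulmxA h3 mulmx1.
Qed.

Lemma ker_eig a b w : eig ker_triple a b w <-> eig (aT x) a b (N *m w).
Proof.
case: (hs) => h1 h2 h3 h4; have Ninj (r : nat) (X Y : 'M[A]_(c', r)) : N *m X = N *m Y -> X = Y.
  by move=> /(congr1 (mulmx P)); rewrite !mulmxA h3 !mul1mx.
have kD := kerN hD; have kE := kerN hE.
split=> -[/= e1 e2 e3]; split.
- by rewrite mulmxA.
- by rewrite mulmxA kD -mulmxA e2 scalemxAr.
- by rewrite mulmxA kE -mulmxA e3 scalemxAr.
- by rewrite -mulmxA.
- by apply: Ninj; rewrite mulmxA -kD -mulmxA e2 scalemxAr.
- by apply: Ninj; rewrite mulmxA -kE -mulmxA e3 scalemxAr.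
Qed.
End KernelTriple.

Section Phi.
Context (n c d : nat).

(** In the normal form A1 = 1 - k D and A2 = D stand for x and y, and E for the fibre coordinate z,
    so C_q is multiplication by z x^q y^(n-1-q). *)
Definition mxC (A : pzRingType) m (k : A) (D E : 'M[A]_m) (i : 'I_n) : 'M[A]_m :=
  (1%:M - k *: D) ^+ i *m D ^+ (n.-1 - i) *m E.

Definition Phi (A : comPzRingType) (k : A) (x : adhm c d A) : frep n c d A :=
  {| fA1 := 1%:M - k *: tD (aT x); fA2 := tD (aT x); fC := mxC k (tD (aT x)) (tE (aT x));
     fA1' := 1%:M - k *: aD x; fA2' := aD x; fC' := mxC k (aD x) (aE x);
     fl := tl (aT x); fh := fun=> 0; fF1 := aF x; fF2 := aF x |}.

Lemma map_mxX (A B : pzRingType) (u : {rmorphism A -> B}) m (X : 'M[A]_m) i :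
  map_mx u (X ^+ i) = (map_mx u X) ^+ i.
Proof.
elim: i => [|i IH]; first by rewrite !expr0 -[1]/(1%:M) map_mx1.
by rewrite !exprS -[X * _]/(X *m _) map_mxM IH.
Qed.

Lemma map_mxC (A B : pzRingType) (u : {rmorphism A -> B}) m k (D E : 'M[A]_m) i :
  map_mx u (mxC k D E i) = mxC (u k) (map_mx u D) (map_mx u E) i.
Proof. by rewrite /mxC !map_mxM !map_mxX map_mxB map_mx1 map_mxZ. Qed.

Lemma frep_ext (A : Type) (x y : frep n c d A) :
  fA1 x = fA1 y -> fA2 x = fA2 y -> fC x =1 fC y -> fA1' x = fA1' y ->
  fA2' x = fA2' y -> fC' x =1 fC' y -> fl x = fl y -> fh x =1 fh y ->
  fF1 x = fF1 y -> fF2 x = fF2 y -> x = y.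
Proof.
case: x; case: y => /= ? ? ? ? ? ? ? ? ? ? ? ? ? ? ? ? ? ? ? ? -> -> /funext -> -> -> /funext ->.
by move=> -> /funext -> -> ->.
Qed.

Lemma Phi_map (A B : comPzRingType) (u : {rmorphism A -> B}) k (x : adhm c d A) :
  frep_map u (Phi k x) = Phi (u k) (amap u x).
Proof.
apply: frep_ext => //= [|i||i|i]; rewrite ?map_mxC ?map_mx0 //.
- by rewrite map_mxB map_mx1 map_mxZ.
- by rewrite map_mxB map_mx1 map_mxZ.
Qed.

Lemma intertwineX (A : pzRingType) m m' (F : 'M[A]_(m', m)) (X : 'M[A]_m) (X' : 'M[A]_m') i :
  F *m X = X' *m F -> F *m X ^+ i = X' ^+ i *m F.
Proof.
move=> e; elim: i => [|i IH]; first by rewrite !expr0 mulmx1 mul1mx.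
by rewrite !exprS -[X * _]/(X *m _) -[X' * _]/(X' *m _) mulmxA e -mulmxA IH mulmxA.
Qed.

Lemma intertwine_one_sub (A : comPzRingType) m m' (F : 'M[A]_(m', m)) (X : 'M[A]_m) (X' : 'M[A]_m') (k : A) :
  F *m X = X' *m F -> F *m (1%:M - k *: X) = (1%:M - k *: X') *m F.
Proof. by move=> e; rewrite mulmxBr mulmxBl mulmx1 mul1mx -scalemxAr -scalemxAl e. Qed.

Lemma intertwine_mxC (A : comPzRingType) m m' (F : 'M[A]_(m', m)) (D E : 'M[A]_m)
    (D' E' : 'M[A]_m') (k : A) i :
  F *m D = D' *m F -> F *m E = E' *m F -> F *m mxC k D E i = mxC k D' E' i *m F.
Proof.
move=> hD hE; rewrite /mxC !mulmxA (intertwineX _ (intertwine_one_sub k hD)).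
by rewrite -!mulmxA -hE (mulmxA F) (intertwineX _ hD) !mulmxA.
Qed.

Section MxCRelations.
Context (A : comPzRingType) (m : nat) (k : A) (D E : 'M[A]_m) (hDE : D *m E = E *m D).
Let P := 1%:M - k *: D.

Lemma commPD : P *m D = D *m P. Proof. exact/esym/intertwine_one_sub. Qed.
Lemma commPE : P *m E = E *m P. Proof. exact/esym/intertwine_one_sub/esym. Qed.

Lemma comm_mxC_D i : D *m mxC k D E i = mxC k D E i *m D.
Proof. exact: intertwine_mxC. Qed.

Lemma comm_mxC_P i : P *m mxC k D E i = mxC k D E i *m P.
Proof. by apply: intertwine_mxC; [exact: commPD|exact: commPE]. Qed.

Lemma mxC_rel (i j : 'I_n) : j = i.+1 :> nat -> P *m mxC k D E i = D *m mxC k D E j.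
Proof.
move=> ej; rewrite /mxC -/P ej !mulmxA.
rewrite (intertwineX i.+1 (esym commPD)) -[P *m _]/(P * _) -exprS.
have -> : (n.-1 - i = (n.-1 - i.+1).+1)%N.
  by rewrite subnSK // ltn_predRL -ej.
by rewrite [D ^+ _.+1]exprS -[D * _]/(D *m _) !mulmxA.
Qed.

Lemma mxC_rel1 i : P *m mxC k D E i *m D = D *m mxC k D E i *m P.
Proof. by rewrite comm_mxC_P comm_mxC_D -!mulmxA commPD. Qed.
End MxCRelations.

(** D' and E' commute because F has a right inverse and intertwines them with D and E. The rest are
    identities between commuting matrices, with h = 0. *)
Lemma Phi_relations (A : comPzRingType) (k : A) (x : adhm c d A) :
  pregood x -> relations (Phi k x).
Proof.
case=> -[hDE hc] hD hE [S h1].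
have hDE' : aD x *m aE x = aE x *m aD x.
  rewrite -[LHS]mulmx1 -[RHS]mulmx1 -h1 !mulmxA; congr (_ *m S).
  by rewrite -!mulmxA -hD -hE !mulmxA -hD -hE -!mulmxA hDE.
rewrite /relations; case: eqP => n1.
  split=> [t|] /=; last by split=> //; exact: intertwine_one_sub.
  by split; [exact: mxC_rel1|exact: mxC_rel1|exact: intertwine_mxC].
split=> /= [q i j hi hj|q||t]; last exact: intertwine_mxC.
- have ij : j = i.+1 :> nat by rewrite hj hi.
  rewrite mul0mx addr0 -!comm_mxC_P // -!comm_mxC_D //.
  by split; apply: mxC_rel.
- exact: mulmx0.
- by split=> //; exact: intertwine_one_sub.
Qed.
End Phi.

(** * The subschemes attached to a representation *)

Section RepScheme.
Context (K : closedFieldType) (n c d : nat).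

(* b = true adds the condition defining the smaller subscheme. *)
Definition eigrep (b : bool) (A : comPzRingType) (x : frep n c d A) (h : hpt A)
    (w1 w2 : 'cV[A]_c) : Prop :=
  [/\ fl x *m w1 = 1%:M, fA1 x *m w1 = hx h *: w2, fA2 x *m w1 = hy h *: w2,
      forall i, fC x i *m w2 = (hz h * hx h ^+ i * hy h ^+ (n.-1 - i)) *: w1 &
      b -> fF1 x *m w1 = 0].

Lemma frep_map_comp (A B D : calg K) (v : hom B D) (u : hom A B) (x : frep n c d A) :
  frep_map (hom_comp v u) x = frep_map v (frep_map u x).
Proof. by apply: frep_ext => [||i|||i||i||]; apply/matrixP => ? ?; rewrite !mxE. Qed.

(** Stated locally because a point of [Xi] has homogeneous coordinates only locally. *)
Definition Zr (b : bool) (A : calg K) (x : frep n c d A) :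
  sub (prod_functor (Spec A) (Xi K n)).
Proof.
refine (@Sub K (prod_functor (Spec A) (Xi K n)) (fun B y =>
  locally (fun D (v : hom B D) => exists h w1 w2, res v y.2 = mkXi n h /\
    eigrep b (frep_map (hom_comp v y.1) x) h w1 w2)) _).
move=> B D w [u y] h; apply: locally_sub (locally_res w h) => E v [hh [w1 [w2 [e he]]]].
exists hh, w1, w2; rewrite hom_compA; split=> //.
by rewrite -e -[res v _]/(res v (res w y)) res_comp.
Defined.

Lemma Zr_local b (A : calg K) (x : frep n c d A) : is_local (Zr b x).
Proof.
move=> B [u y] h; apply: locally_trans; apply: locally_sub h => D v.
apply: locally_sub => E w [hh [w1 [w2 [e he]]]].
exists hh, w1, w2; rewrite -hom_compA; split=> //.
by rewrite -e -[res w _]/(res w (res v y)) res_comp.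
Qed.

Lemma Zr_base b (A A' : calg K) (u : hom A A') (x : frep n c d A) (B : calg K)
    (v : hom A' B) (y : Xi K n B) :
  Zr b x B (hom_comp v u, y) <-> Zr b (frep_map u x) B (v, y).
Proof.
have e0 D (w : hom B D) : frep_map (hom_comp w (hom_comp v u)) x =
    frep_map (hom_comp w v) (frep_map u x) by rewrite hom_compA frep_map_comp.
by split; apply: locally_sub => D w [hh [w1 [w2 [e he]]]]; exists hh, w1, w2; split=> //;
  move: he => /=; rewrite e0.
Qed.

Lemma Zr_sub (A : calg K) (x : frep n c d A) B y : Zr true x B y -> Zr false x B y.
Proof.
apply: locally_sub => D w [hh [w1 [w2 [e he]]]]; exists hh, w1, w2; split=> //.
by case: he => h1 h2 h3 h4 _; split.
Qed.

Lemma eigrep_orbit b (A : comPzRingType) (x y : frep n c d A) h w1 w2 : same_orbit x y ->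
  eigrep b x h w1 w2 -> exists w1' w2', eigrep b y h w1' w2'.
Proof.
move=> [g1 [g2 [g3 [g4 [_ [[e1 e2 e3] [_ [e4 e5 e6 e7]]]]]]]] [h1 h2 h3 h4 h5].
exists (g1 *m w1), (g2 *m w2); split.
- by rewrite mulmxA e4.
- by rewrite mulmxA e1 -mulmxA h2 scalemxAr.
- by rewrite mulmxA e2 -mulmxA h3 scalemxAr.
- by move=> i; rewrite mulmxA e3 -mulmxA h4 scalemxAr.
- by move=> hb; rewrite mulmxA e6 -mulmxA h5 ?mulmx0.
Qed.

Lemma is_GL_map (A B : pzRingType) (u : {rmorphism A -> B}) k (g : 'M[A]_k) :
  is_GL g -> is_GL (map_mx u g).
Proof. by case=> g' [e1 e2]; exists (map_mx u g'); rewrite -!map_mxM e1 e2 map_mx1. Qed.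

Lemma same_orbit_map (A B : pzRingType) (u : {rmorphism A -> B}) (x y : frep n c d A) :
  same_orbit x y -> same_orbit (frep_map u x) (frep_map u y).
Proof.
move=> [g1 [g2 [g3 [g4 [[i1 i2 i3 i4] [[e1 e2 e3] [[e1' e2' e3'] [e4 e5 e6 e7]]]]]]]].
exists (map_mx u g1), (map_mx u g2), (map_mx u g3), (map_mx u g4).
split; first by split; exact: is_GL_map.
by do !split => /=; move=> *; rewrite -!map_mxM ?e1 ?e2 ?e3 ?e1' ?e2' ?e3' ?e4 ?e5 ?e6 ?e7.
Qed.

Lemma is_GL_sym (A : pzRingType) k (g : 'M[A]_k) : is_GL g -> exists2 g', is_GL g' &
  g *m g' = 1%:M /\ g' *m g = 1%:M.
Proof. by case=> g' [e1 e2]; exists g' => //; exists g. Qed.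

Lemma same_orbit_sym (A : pzRingType) (x y : frep n c d A) :
  same_orbit x y -> same_orbit y x.
Proof.
move=> [g1 [g2 [g3 [g4 [[i1 i2 i3 i4] [[e1 e2 e3] [[e1' e2' e3'] [e4 e5 e6 e7]]]]]]]].
have [j1 I1 [r1 l1]] := is_GL_sym i1; have [j2 I2 [r2 l2]] := is_GL_sym i2.
have [j3 I3 [r3 l3]] := is_GL_sym i3; have [j4 I4 [r4 l4]] := is_GL_sym i4.
have conj (p q : nat) (X Y : 'M[A]_(p, q)) (g g' : 'M[A]_p) (k k' : 'M[A]_q) :
    g' *m g = 1%:M -> k *m k' = 1%:M -> Y *m k = g *m X -> X *m k' = g' *m Y.
  move=> h1 h2 e; rewrite -[X]mul1mx -h1 -!mulmxA (mulmxA g) -e.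
  by rewrite -!mulmxA h2 mulmx1.
exists j1, j2, j3, j4; split=> //; split; last split; last split.
- by split=> [||t]; [exact: conj e1|exact: conj e2|exact: conj (e3 t)].
- by split=> [||t]; [exact: conj e1'|exact: conj e2'|exact: conj (e3' t)].
- by rewrite -e4 -mulmxA r1 mulmx1.
- by move=> q; rewrite e5 mulmxA l1 mul1mx.
- exact: conj e6.
- exact: conj e7.
Qed.

Lemma same_orbit_trans (A : pzRingType) (x y z : frep n c d A) :
  same_orbit x y -> same_orbit y z -> same_orbit x z.
Proof.
move=> [g1 [g2 [g3 [g4 [[i1 i2 i3 i4] [[e1 e2 e3] [[e1' e2' e3'] [e4 e5 e6 e7]]]]]]]].
move=> [k1 [k2 [k3 [k4 [[j1 j2 j3 j4] [[f1 f2 f3] [[f1' f2' f3'] [f4 f5 f6 f7]]]]]]]].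
have glM k (g h : 'M[A]_k) : is_GL g -> is_GL h -> is_GL (g *m h).
  move=> [g' [a1 a2]] [h' [b1 b2]]; exists (h' *m g'); split.
    by rewrite -mulmxA (mulmxA h) b1 mul1mx.
  by rewrite -mulmxA (mulmxA g') a2 mul1mx.
exists (k1 *m g1), (k2 *m g2), (k3 *m g3), (k4 *m g4); split; first by split; exact: glM.
have tr (p q : nat) (X Y W : 'M[A]_(p, q)) g k g' k' : Y *m g = k *m X -> W *m g' = k' *m Y ->
    W *m (g' *m g) = (k' *m k) *m X.
  by move=> a b; rewrite mulmxA b -mulmxA a mulmxA.
split; last split; last split.
- by split=> [||t]; [exact: tr e1 f1|exact: tr e2 f2|exact: tr (e3 t) (f3 t)].
- by split=> [||t]; [exact: tr e1' f1'|exact: tr e2' f2'|exact: tr (e3' t) (f3' t)].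
- by rewrite mulmxA f4 e4.
- by move=> q; rewrite f5 e5 mulmxA.
- exact: tr e6 f6.
- exact: tr e7 f7.
Qed.

Lemma Zr_orbit b (A : calg K) (x y : frep n c d A) : same_orbit x y ->
  forall B z, Zr b x B z <-> Zr b y B z.
Proof.
have H (x' y' : frep n c d A) B z : same_orbit x' y' -> Zr b x' B z -> Zr b y' B z.
  move=> o; apply: locally_sub => D w [hh [w1 [w2 [e he]]]].
  have [w1' [w2' he']] := eigrep_orbit (same_orbit_map (hom_comp w z.1) o) he.
  by exists hh, w1', w2'.
by move=> o B z; split; apply: H => //; exact: same_orbit_sym.
Qed.
End RepScheme.

Section ZrPhi.
Context (K : closedFieldType) (n c d : nat) (n_gt0 : (0 < n)%N).

Lemma exprZ_mx (A : comPzRingType) m (k : A) (D : 'M[A]_m) j :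
  (k *: D) ^+ j = k ^+ j *: D ^+ j.
Proof.
elim: j => [|j IH]; first by rewrite !expr0 scale1r.
rewrite !exprS IH -[LHS]/(_ *m _) -[D * _]/(D *m _).
by rewrite -scalemxAl -scalemxAr scalerA.
Qed.

(* The binomial expansion of (kD + (1 - kD))^(n-1) = 1. *)
Lemma sum_mxC (A : comPzRingType) m (k : A) (D E : 'M[A]_m) :
  \sum_(i < n) (k ^+ (n.-1 - i) *+ 'C(n.-1, i)) *: mxC k D E i = E.
Proof.
have cPD : GRing.comm (k *: D) (1%:M - k *: D).
  rewrite /GRing.comm -[LHS]/(_ *m _) -[RHS]/(_ *m _).
  by rewrite -scalemxAl -scalemxAr commPD.
have e1 : (k *: D + (1%:M - k *: D)) ^+ n.-1 = 1%:M.
  by rewrite addrC subrK expr1n.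
rewrite -[RHS]mul1mx -e1 exprDn_comm // mulmx_suml prednK //.
apply: eq_bigr => i _; rewrite /mxC -scalerMnl.
rewrite -[RHS]/(mulmxr E _) raddfMn; congr (_ *+ _).
rewrite /mulmxr -[X in _ = X *m _]/(_ *m _) exprZ_mx -scalemxAl.
have -> : (1%:M - k *: D) ^+ i *m D ^+ (n.-1 - i) = D ^+ (n.-1 - i) *m (1%:M - k *: D) ^+ i.
  by apply: intertwineX; apply/esym/intertwineX/esym/commPD.
by rewrite -scalemxAl.
Qed.

Lemma mulX_eig (A : comPzRingType) m (D : 'M[A]_m) (a : A) (w : 'cV[A]_m) j :
  D *m w = a *: w -> D ^+ j *m w = a ^+ j *: w.
Proof.
move=> e; elim: j => [|j IH]; first by rewrite !expr0 mul1mx scale1r.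
by rewrite exprS -[_ * _]/(_ *m _) -mulmxA IH -scalemxAr e scalerA exprSr.
Qed.

(** A1 + k A2 = 1 forces w1 = s w2 with s = x + k y, and l w1 = 1 makes s invertible: the point lies
    in the chart. E is recovered from the C_q by [sum_mxC]. *)
Lemma eigrep_Phi b (A : calg K) (k : K) (x : adhm c d A) (h : hpt A) w1 w2 :
  eigrep b (Phi n (calg_str A k) x) h w1 w2 ->
  exists al be, [/\ mkXi n h = mkXi n (hk k al be), eig (aT x) al be w1 & b -> aF x *m w1 = 0].
Proof.
set s := hx h + calg_str A k * hy h; move=> [/= hl h1 h2 h3 h4].
have ew : w1 = s *: w2.
  rewrite -[w1]mul1mx -(subrK (calg_str A k *: tD (aT x)) 1%:M) mulmxDl h1.
  by rewrite -scalemxAl h2 scalerA -scalerDl.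
have si : invertible s.
  exists ((tl (aT x) *m w2) 0 0); move: hl; rewrite ew -scalemxAr => /matrixP/(_ 0 0).
  by rewrite !mxE eqxx mulr1n.
have [t ht] := si.
have ew2 : w2 = t *: w1 by rewrite ew scalerA mulrC ht scale1r.
exists (t * hy h), (s ^+ n * hz h); split=> //.
  by apply/mkXi_hkP; split; [rewrite mulrA ht mul1r|].
split=> //; first by rewrite h2 ew2 scalerA mulrC.
rewrite -[tE _](sum_mxC (calg_str A k) (tD (aT x))) mulmx_suml ew.
transitivity (\sum_(i < n) (hz h * s * (calg_str A k ^+ (n.-1 - i) *+ 'C(n.-1, i)
    * (hx h ^+ i * hy h ^+ (n.-1 - i)))) *: w1).
  apply: eq_bigr => i _; rewrite -scalemxAl -scalemxAr h3 !scalerA; congr (_ *: _).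
  by rewrite -!mulrA; ring.
rewrite -scaler_suml ew scalerA scalerA; congr (_ *: _).
have -> : \sum_(i < n) (hz h * s * (calg_str A k ^+ (n.-1 - i) *+ 'C(n.-1, i)
    * (hx h ^+ i * hy h ^+ (n.-1 - i)))) = hz h * s * s ^+ n.-1.
  rewrite -mulr_sumr; congr (_ * _); rewrite /s addrC exprDn prednK //; apply: eq_bigr => i _.
  by rewrite exprMn mulrnAl; congr (_ *+ _); ring.
by rewrite -[in RHS](prednK n_gt0) exprS; ring.
Qed.

Lemma Phi_eigrep (b : bool) (A : calg K) (k : K) (x : adhm c d A) al be w :
  eig (aT x) al be w -> (b -> aF x *m w = 0) ->
  eigrep b (Phi n (calg_str A k) x) (hk k al be) w w.
Proof.
case=> h1 h2 h3 h4; have hP : (1%:M - calg_str A k *: tD (aT x)) *m w = (1 - calg_str A k * al) *: w.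
  by rewrite mulmxBl mul1mx -scalemxAl h2 scalerA scalerBl scale1r.
split=> //= i; rewrite /mxC -!mulmxA h3 -!scalemxAr (mulX_eig _ h2) -scalemxAr (mulX_eig _ hP).
by rewrite !scalerA mulrAC.
Qed.

End ZrPhi.

Section ZrPhiSub.
Context (R : realType) (n c d c' : nat) (n_gt0 : (0 < n)%N).
Local Notation K := R[i].
Context (A : calg K) (k : K) (x : adhm c d A) (hx : good c' x).

Lemma Zr_PhiP b B (u : hom A B) (y : Xi K n B) :
  Zr b (Phi n (calg_str A k) x) B (u, y) <->
  locally (fun D (v : hom B D) => exists al be w,
    [/\ res v y = mkXi n (hk k al be), eig (tmap (hom_comp v u) (aT x)) al be w &
        b -> map_mx (hom_comp v u) (aF x) *m w = 0]).
Proof.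
have e0 D (v : hom B D) : frep_map (hom_comp v u) (Phi n (calg_str A k) x) =
    Phi n (calg_str D k) (amap (hom_comp v u) x) by rewrite Phi_map homK.
split; apply: locally_sub => D v.
  move=> [h [w1 [w2 [e]]]]; rewrite -[(u, y).1]/u e0 => /(eigrep_Phi n_gt0)[al [be [e1 e2 e3]]].
  by exists al, be, w1; rewrite -e1.
move=> [al [be [w [e e2 e3]]]]; exists (hk k al be), w, w; split=> //.
rewrite -[(u, y).1]/u e0; exact: Phi_eigrep.
Qed.

Lemma Zr_Phi_false B z : Zr false (Phi n (calg_str A k) x) B z <-> Zt n k (aT x) B z.
Proof.
case: z => u y; rewrite Zr_PhiP; split.
  move=> h; apply: Zt_local; first by case: hx.
    by move=> C z hz; apply: in_chart_local hz.
  by apply: locally_sub h => D v [al [be [w [e1 e2 _]]]]; exists al, be, w.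
by move=> hz; apply: locallyT => D v; have [al [be [w [e1 e2]]]] := mem_res v hz; exists al, be, w.
Qed.

(** By the splitting, a vector w killed by F equals N (P w), so eigenvectors in the kernel of F are
    those of the restricted triple. *)
Lemma Zr_Phi_true Rm N P : @split_by c d c' A (aF x) Rm N P ->
  forall B z, Zr true (Phi n (calg_str A k) x) B z <-> Zt n k (ker_triple x N P) B z.
Proof.
move=> hs B [u y]; rewrite Zr_PhiP; case: (hx) => hT hD hE _.
have hs' D (v : hom A D) := split_by_map v hs.
have hD' D (v : hom A D) : map_mx v (aF x) *m tD (tmap v (aT x)) = map_mx v (aD x) *m map_mx v (aF x).
  by rewrite -!map_mxM hD.
have hE' D (v : hom A D) : map_mx v (aF x) *m tE (tmap v (aT x)) = map_mx v (aE x) *m map_mx v (aF x).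
  by rewrite -!map_mxM hE.
have ek D (v : hom A D) : tmap v (ker_triple x N P) = ker_triple (amap v x) (map_mx v N) (map_mx v P).
  by rewrite /tmap /ker_triple /= !map_mxM.
have ke D (v : hom A D) a b w := @ker_eig _ _ _ _ (amap v x) _ _ _ (hs' D v) (hD' D v) (hE' D v) a b w.
split.
  move=> h; apply: Zt_local; first exact: (ker_cocyclic hs hT hD hE).
    by move=> C z hz; apply: in_chart_local hz.
  apply: locally_sub h => D v [al [be [w [e1 e2 e3]]]].
  exists al, be, (map_mx (hom_comp v u) P *m w); split=> //.
  change (eig (tmap (hom_comp v u) (ker_triple x N P)) al be (map_mx (hom_comp v u) P *m w)).
  rewrite ek; apply/ke.
  suff <- : w = map_mx (hom_comp v u) N *m (map_mx (hom_comp v u) P *m w) by [].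
  have [_ _ _ e4] := hs' _ (hom_comp v u).
  by rewrite -[LHS]mul1mx -e4 mulmxDl -mulmxA e3 // mulmx0 add0r mulmxA.
move=> hz; apply: locallyT => D v; have [al [be [w [e1 e2]]]] := mem_res v hz.
have {}e1 : res v y = mkXi n (hk k al be) := e1.
have {e2} : eig (tmap (hom_comp v u) (ker_triple x N P)) al be w := e2.
rewrite ek => /ke e2.
exists al, be, (map_mx (hom_comp v u) N *m w); split=> //.
by move=> _; have [_ e4 _ _] := hs' _ (hom_comp v u); rewrite mulmxA e4 mul0mx.
Qed.
End ZrPhiSub.

(** * Consequences of semistability *)

Section Semistable.
Context (R : realType) (K : fieldType) (th1 th2 th3 th4 : R) (n c d : nat)
  (c_gt0 : (0 < c)%N) (h1 : 0 < th1) (h2 : - th1 < th2)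
  (h2' : th2 < - ((c%:R - 1) / c%:R) * th1)
  (h3 : th3 < 0) (h4 : th4 < 0)
  (h5 : 0 < th1 + th2 + (th3 + th4) * d%:R).
Context (x : frep n c d K).

Lemma c_gt0R : 0 < c%:R :> R. Proof. by rewrite ltr0n. Qed.

Lemma th2_lt0 : th2 < 0.
Proof.
apply: lt_le_trans h2' _; rewrite mulNr oppr_le0.
by rewrite mulr_ge0 ?(ltW h1) // divr_ge0 ?ler0n // subr_ge0 ler1n.
Qed.

(** The upper bound on [th2] with its denominator cleared. *)
Lemma th12_c : (th1 + th2) * c%:R < th1.
Proof.
have c0 : c%:R != 0 :> R by rewrite gt_eqF ?c_gt0R.
have -> : th1 = (th1 + - ((c%:R - 1) / c%:R) * th1) * c%:R by field.
by rewrite ltr_pM2r ?c_gt0R // -subr_gt0; move: h2'; rewrite -subr_gt0; congr (_ < _); field.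
Qed.

Lemma th12_gt0 : 0 < th1 + th2. Proof. by rewrite -ltrBlDl sub0r. Qed.

Lemma dim_fullcV m : \dim (fullv : {vspace 'cV[K]_m}) = m.
Proof. by rewrite dimvf /dim /= muln1. Qed.

Lemma dim_cV m (S : {vspace 'cV[K]_m}) : (\dim S <= m)%N.
Proof. by have := dimvS (subvf S); rewrite dim_fullcV. Qed.

Lemma slope_ker (s1 s2 : nat) : (s2 <= s1)%N -> (0 < s1)%N ->
  0 < th1 * s1%:R + th2 * s2%:R + th3 * d%:R + th4 * d%:R.
Proof.
move=> s21 s0; have e0 : th2 * s1%:R <= th2 * s2%:R by rewrite ler_nM2l ?th2_lt0 // ler_nat.
have e1 : (th1 + th2) <= (th1 + th2) * s1%:R by rewrite ler_peMr ?(ltW th12_gt0) // ler1n.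
rewrite -addrA -mulrDl; apply: lt_le_trans h5 _; rewrite lerD2r.
by apply: le_trans e1 _; rewrite mulrDl lerD2l.
Qed.

Lemma slope_im (s1 s2 : nat) : (s2 < s1)%N -> 
  (th1 + th2) * c%:R < th1 * s1%:R + th2 * s2%:R.
Proof.
move=> s21; have e0 : th2 * (s1%:R - 1) <= th2 * s2%:R.
  by rewrite ler_nM2l ?th2_lt0 // lerBrDr natr1 ler_nat.
apply: lt_le_trans (_ : th1 * s1%:R + th2 * (s1%:R - 1) <= _); last by rewrite lerD2l.
rewrite mulrBr mulr1 addrA -mulrDl.
have e1 : (th1 + th2) <= (th1 + th2) * s1%:R.
  by rewrite ler_peMr ?(ltW th12_gt0) // ler1n (leq_ltn_trans _ s21).
apply: lt_le_trans (_ : th1 + th2 - th2 <= _); last by rewrite lerB.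
by rewrite addrK th12_c.
Qed.

Section Semi.
Context (ss : semistable th1 th2 th3 th4 x).

(** Tested on (S1, S2, V3, V4): by [h5] its slope is positive once S1 is nonzero and dim S2 <= dim
    S1. *)
Lemma semistable_ker (S1 S2 : {vspace 'cV[K]_c}) :
  (forall v, v \in S1 -> fA1 x *m v \in S2 /\ fA2 x *m v \in S2) ->
  (forall (t : 'I_n) v, v \in S2 -> fC x t *m v \in S1) ->
  (forall v, v \in S1 -> fl x *m v = 0) -> (\dim S2 <= \dim S1)%N -> S1 = 0%VS.
Proof.
move=> a b e s21; apply/eqP; rewrite -dimv_eq0; apply/negPn/negP; rewrite -lt0n => s0.
have pr : preserved x S1 S2 fullv fullv.
  by split=> [v /a//|t v /b//|v _|t v _|]; [split| |split=> v _]; rewrite ?memvf.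
have [/(_ e) + _] := ss pr.
by rewrite /slope !dim_fullcV leNgt slope_ker.
Qed.

(** Tested on (S1, S2, V3, V4) again, now with the second condition: if dim S2 < dim S1, the slope
    exceeds that of the whole representation. *)
Lemma semistable_im (S1 S2 : {vspace 'cV[K]_c}) :
  (forall v, v \in S1 -> fA1 x *m v \in S2 /\ fA2 x *m v \in S2) ->
  (forall (t : 'I_n) v, v \in S2 -> fC x t *m v \in S1) ->
  (forall q, fh x q \in S1) -> (\dim S1 <= \dim S2)%N.
Proof.
move=> a b e; rewrite leqNgt; apply/negP => s21.
have pr : preserved x S1 S2 fullv fullv.
  by split=> [v /a//|t v /b//|v _|t v _|]; [split| |split=> v _]; rewrite ?memvf.
have [_ /(_ e)] := ss pr.
rewrite /slope !dim_fullcV -!addrA !(addrA (th1 * _)) lerD2r -mulrDl leNgt.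
by rewrite slope_im.
Qed.

(** Tested on (V1, V2, im F1, im F2): since [th3] and [th4] are negative, a proper image would raise
    the slope. *)
Lemma semistable_surj : fF2 x *m fA1 x = fA1' x *m fF1 x -> fF2 x *m fA2 x = fA2' x *m fF1 x ->
  (forall t, fF1 x *m fC x t = fC' x t *m fF2 x) ->
  (exists G, fF1 x *m G = 1%:M) /\ (exists G, fF2 x *m G = 1%:M).
Proof.
move=> e1 e2 e3.
pose S1' := limg (linfun (mulmx (fF1 x) : 'cV_c -> 'cV_d)).
pose S2' := limg (linfun (mulmx (fF2 x) : 'cV_c -> 'cV_d)).
have pr : preserved x fullv fullv S1' S2'.
  split=> [v _|t v _|v|t v|]; rewrite ?memvf //.
  - move=> /memv_imgP[u _ ->]; rewrite lfunE /= !mulmxA -e1 -e2 -!mulmxA.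
    by split; apply/memv_imgP; eexists; rewrite ?memvf // lfunE.
  - move=> /memv_imgP[u _ ->]; rewrite lfunE /= mulmxA -e3 -mulmxA.
    by apply/memv_imgP; eexists; rewrite ?memvf // lfunE.
  - by split=> v _; apply/memv_imgP; exists v; rewrite ?memvf // lfunE.
have [_ /(_ (fun q => memvf _))] := ss pr; rewrite /slope !dim_fullcV -!addrA !lerD2l => hle.
have dS1 : th3 * d%:R <= th3 * (\dim S1')%:R by rewrite ler_nM2l // ler_nat dim_cV.
have dS2 : th4 * d%:R <= th4 * (\dim S2')%:R by rewrite ler_nM2l // ler_nat dim_cV.
have full (th : R) (S : {vspace 'cV[K]_d}) : th < 0 ->
    th * (\dim S)%:R <= th * d%:R -> S = fullv.
  by move=> th0; rewrite ler_nM2l // ler_nat => le; apply/eqP; rewrite eqEdim subvf dim_fullcV.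
have surj (F : 'M[K]_(d, c)) : limg (linfun (mulmx F : 'cV_c -> 'cV_d)) = fullv -> exists G, F *m G = 1%:M.
  move=> hF; have /ex_choice[g hg] (j : 'I_d) : exists w : 'cV_c, F *m w = delta_mx j 0.
    by have /memv_imgP[w _] : delta_mx j 0 \in limg (linfun (mulmx F : 'cV_c -> 'cV_d));
      rewrite ?hF ?memvf // lfunE => e; exists w.
  exists (\matrix_(i, j) g j i 0); apply/matrixP => i j.
  have /matrixP/(_ i 0) := hg j; rewrite !mxE eqxx andbT => <-.
  by apply: eq_bigr => k _; rewrite !mxE.
split; apply: surj; [apply: (full th3)|apply: (full th4)] => //.
  by rewrite -(lerD2r (th4 * d%:R)); apply: le_trans hle; rewrite lerD2l.
by rewrite -(lerD2l (th3 * d%:R)); apply: le_trans hle; rewrite lerD2r.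
Qed.
End Semi.

(** With [slope_imE], the estimate behind the stability of normal forms, where S1 lies in S2. The
    extreme case here is dim S1 = c - 1, dim S2 = c. *)
Lemma slope_kerE s1 s2 s3 s4 : (s1 < s2)%N -> (s2 <= c)%N ->
  th1 * s1%:R + th2 * s2%:R + th3 * s3%:R + th4 * s4%:R < 0.
Proof.
move=> s12 s2c; have e0 : th2 * s2%:R <= th2 * (s1%:R + 1).
  by rewrite ler_nM2l ?th2_lt0 // natr1 ler_nat.
have e3 : th3 * s3%:R <= 0 by rewrite mulr_le0_ge0 ?(ltW h3) ?ler0n.
have e4 : th4 * s4%:R <= 0 by rewrite mulr_le0_ge0 ?(ltW h4) ?ler0n.
apply: le_lt_trans (_ : th1 * s1%:R + th2 * (s1%:R + 1) + 0 + 0 < 0).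
  by do !apply: lerD => //.
rewrite !addr0 mulrDr mulr1 addrA -mulrDl.
have e1 : (th1 + th2) * s1%:R <= (th1 + th2) * (c%:R - 1).
  by rewrite ler_pM2l ?th12_gt0 // lerBrDr natr1 ler_nat (leq_trans s12).
apply: le_lt_trans (_ : (th1 + th2) * (c%:R - 1) + th2 < 0); first by rewrite lerD2r.
have -> : (th1 + th2) * (c%:R - 1) + th2 = (th1 + th2) * c%:R - th1 by ring.
by rewrite subr_lt0 th12_c.
Qed.

Lemma slope_imE s1 s2 s3 s4 : (s1 <= s2)%N -> (s1 < c)%N -> (s3 <= d)%N -> (s4 <= d)%N ->
  th1 * s1%:R + th2 * s2%:R + th3 * s3%:R + th4 * s4%:R <
  th1 * c%:R + th2 * c%:R + th3 * d%:R + th4 * d%:R.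
Proof.
move=> s12 s1c s3d s4d; have e0 : th2 * s2%:R <= th2 * s1%:R.
  by rewrite ler_nM2l ?th2_lt0 // ler_nat.
have e3 : th3 * s3%:R <= 0 by rewrite mulr_le0_ge0 ?(ltW h3) ?ler0n.
have e4 : th4 * s4%:R <= 0 by rewrite mulr_le0_ge0 ?(ltW h4) ?ler0n.
apply: le_lt_trans (_ : th1 * s1%:R + th2 * s1%:R + 0 + 0 < _).
  by do !apply: lerD => //.
rewrite !addr0 -!mulrDl -addrA -mulrDl.
apply: le_lt_trans (_ : (th1 + th2) * (c%:R - 1) < _).
  by rewrite ler_pM2l ?th12_gt0 // lerBrDr natr1 ler_nat.
rewrite -subr_gt0; have -> : (th1 + th2) * c%:R + (th3 + th4) * d%:R - (th1 + th2) * (c%:R - 1) =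
  th1 + th2 + (th3 + th4) * d%:R by ring.
by [].
Qed.
End Semistable.

(** * The pencil of a semistable representation *)

Section MinimalKernel.
Context (K : fieldType) (m : nat).
Local Notation "M ^P" := (map_mx polyC M) (at level 2, format "M ^P").
Implicit Types (v w : 'cV[{poly K}]_m) (B : 'M[K]_m).

(** One more than the degree of a nonzero polynomial vector, and 0 for the zero vector. *)
Definition psz v := (\max_i size (v i 0%R))%N.

Lemma psz_ge v i : (size (v i 0%R) <= psz v)%N.
Proof. exact: (@leq_bigmax _ (fun i => size (v i 0%R))). Qed.

Lemma psz_mul B v : (psz (B^P *m v) <= psz v)%N.
Proof.
apply/bigmax_leqP => i _; rewrite mxE; apply: (big_ind (fun p : {poly K} => size p <= psz v)%N).
- by rewrite size_poly0.
- by move=> p q hp hq; apply: leq_trans (size_polyD p q) _; rewrite geq_max hp.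
- move=> j _; rewrite mxE; apply: leq_trans (psz_ge v j).
  by rewrite mul_polyC size_scale_leq.
Qed.

Lemma psz_mulX v w : w != 0 -> w = - ('X *: v) -> (psz v < psz w)%N.
Proof.
move=> w0 e; have w_gt0 : (0 < psz w)%N.
  rewrite lt0n; apply: contraNneq w0 => z; apply/eqP/colP => i; rewrite mxE.
  by apply/eqP; rewrite -size_poly_eq0 -leqn0; have := psz_ge w i; rewrite z.
rewrite -(prednK w_gt0) ltnS; apply/bigmax_leqP => i _.
have [->|vi] := eqVneq (v i 0) 0; first by rewrite size_poly0.
rewrite -ltnS (prednK w_gt0); apply: leq_trans (psz_ge w i).
by rewrite e !mxE size_polyN mulrC size_mulX.
Qed.

(* For a kernel vector of minimal degree of a singular pencil, an operator
   through which the pencil can be commuted annihilates A2 v: it would produce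
   a kernel vector of smaller degree. *)
Lemma minimal_kernel (A1 A2 : 'M[K]_m) : \det (A1^P + 'X *: A2^P) = 0 ->
  exists v, [/\ v != 0, A1^P *m v = - ('X *: (A2^P *m v)) &
    forall B, A1^P *m (B^P *m (A2^P *m v)) = A2^P *m (B^P *m (A1^P *m v)) ->
      B^P *m (A2^P *m v) = 0].
Proof.
move=> det0; pose ker v := (A1^P + 'X *: A2^P) *m v = 0.
pose P k := `[< exists v, [/\ v != 0, ker v & psz v = k] >].
have exP : exists k, P k.
  have /det0P[r r0 hr] : \det (A1^P + 'X *: A2^P)^T == 0 by rewrite det_tr det0.
  exists (psz r^T); apply/asboolP; exists r^T; split=> //.
    by apply: contra r0 => /eqP/(congr1 trmx); rewrite trmxK trmx0 => ->.
  by apply: trmx_inj; rewrite trmx_mul trmxK hr trmx0.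
case: (ex_minnP exP) => k /asboolP[v [v0 kv <-]] kmin.
have kerE w : ker w <-> A1^P *m w = - ('X *: (A2^P *m w)).
  rewrite /ker mulmxDl -scalemxAl; split=> [/eqP|->]; last by rewrite addNr.
  by rewrite addr_eq0 => /eqP.
exists v; split=> //; first exact/kerE.
move=> B hB; apply: contrapT => /eqP w0.
have := kmin (psz (B^P *m (A2^P *m v))); rewrite leqNgt => /(_ _)/negP; apply.
  apply/asboolP; eexists; split; [exact: w0| |by []]; apply/kerE.
  by rewrite hB; move/kerE: kv => ->; rewrite !mulmxN -!scalemxAr.
apply: leq_ltn_trans (psz_mul _ _) _.
have [A1v|A1v] := eqVneq (A1^P *m v) 0.
  case/eqP: w0; suff -> : A2^P *m v = 0 by rewrite mulmx0.
  move/kerE: kv => /eqP; rewrite A1v eq_sym oppr_eq0 scalemx_eq0 polyX_eq0 /=.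
  by move/eqP.
apply: leq_trans (psz_mul A1 v); apply: psz_mulX => //; exact/kerE.
Qed.
End MinimalKernel.

Section Pencil.
Context (K : fieldType) (n c d : nat) (x : frep n c d K) (rx : relations x).
Local Notation "M ^P" := (map_mx polyC M) (at level 2, format "M ^P").

(** The relations linking C_q and C_(q+1) move A1 and A2 across C_q up to a term e l. The last index
    has no successor, so there the relations with C_(q-1) are used. *)
Lemma relation_commute q : fA1 x *m fC x q *m fA2 x = fA2 x *m fC x q *m fA1 x \/
  exists j e, (e = fA2 x *m fh x j \/ e = fA1 x *m fh x j) /\
   fA1 x *m fC x q *m fA2 x = fA2 x *m fC x q *m fA1 x + e *m fl x.
Proof.
move: rx; rewrite /relations; case: eqP => [_ [h _]|n1 [h _ _ _]].
  by left; have [] := h q.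
right; case: (ltnP q n.-1) => hq.
  have qn : (q.+1 < n)%N by rewrite -ltn_predRL.
  have [e1 e2 _ _] := h (Ordinal hq) q (Ordinal qn) erefl erefl.
  exists (Ordinal hq), (fA2 x *m fh x (Ordinal hq)); split; first by left.
  by rewrite e1 -!mulmxA -e2 mulmxDr.
have q0 : (0 < q)%N by move: (ltn_ord q) n1 hq; case: (nat_of_ord q) => //; case: (n) => [|[|]].
have hj : (q.-1 < n.-1)%N.
  by rewrite ltn_predRL prednK.
have hi : (q.-1 < n)%N by rewrite (leq_ltn_trans (leq_pred _)).
have [e1 e2 _ _] := h (Ordinal hj) (Ordinal hi) q erefl (esym (prednK q0)).
exists (Ordinal hj), (fA1 x *m fh x (Ordinal hj)); split; first by right.
by rewrite -[LHS]mulmxA -e2 mulmxDr !mulmxA e1.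
Qed.

Lemma relation_h (n2 : (1 < n)%N) j : exists q q',
  fA1 x *m fC x q = fA2 x *m fC x q' /\
  fC x q *m fA1 x + fh x j *m fl x = fC x q' *m fA2 x.
Proof.
move: rx; rewrite /relations; case: eqP => [n1|_ [h _ _ _]]; first by rewrite n1 in n2.
have hi : (j < n)%N by rewrite (leq_trans (ltn_ord j)) ?leq_pred.
have hj : (j.+1 < n)%N by rewrite -ltn_predRL.
by have [e1 e2 _ _] := h j (Ordinal hi) (Ordinal hj) erefl erefl; exists (Ordinal hi), (Ordinal hj).
Qed.

Definition coefv k (v : 'cV[{poly K}]_k) i : 'cV[K]_k := \col_j (v j 0)`_i.

Lemma coefv_mul k l (B : 'M[K]_(k, l)) v i : coefv (B^P *m v) i = B *m coefv v i.
Proof.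
apply/colP => j; rewrite !mxE coef_sum; apply: eq_bigr => a _.
by rewrite !mxE coefCM.
Qed.

Lemma coefvX k (v w : 'cV[{poly K}]_k) i : v = - ('X *: w) ->
  coefv v i = if i == 0%N then 0 else - coefv w i.-1.
Proof. by move=> ->; apply/colP => j; rewrite !mxE coefN coefXM; case: i => [|i]; rewrite !mxE ?oppr0. Qed.

Lemma coefv_eq0 k (v : 'cV[{poly K}]_k) : (forall i, coefv v i = 0) -> v = 0.
Proof. by move=> e; apply/colP => j; apply/polyP => i; have /colP/(_ j) := e i; rewrite !mxE coef0. Qed.

Lemma coefv_big k (v : 'cV[{poly K}]_k) i : (psz v <= i)%N -> coefv v i = 0.
Proof.
by move=> h; apply/colP => j; rewrite !mxE nth_default // (leq_trans (psz_ge v j)).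
Qed.

Lemma span_mul k l (B : 'M[K]_(k, l)) (X : seq 'cV[K]_l) (U : {vspace 'cV[K]_k}) :
  (forall v, v \in X -> B *m v \in U) -> forall v, v \in <<X>>%VS -> B *m v \in U.
Proof.
move=> h v hv; have -> : B *m v = linfun (mulmx B : 'cV_l -> 'cV_k) v by rewrite lfunE.
have : linfun (mulmx B : 'cV_l -> 'cV_k) v \in (linfun (mulmx B) @: <<X>>)%VS by exact: memv_img.
rewrite limg_span; apply/subvP/span_subvP => w /mapP[u hu ->].
by rewrite lfunE /=; exact: h.
Qed.

Context (Hker : forall S1 S2 : {vspace 'cV[K]_c},
  (forall v, v \in S1 -> fA1 x *m v \in S2 /\ fA2 x *m v \in S2) ->
  (forall (t : 'I_n) v, v \in S2 -> fC x t *m v \in S1) ->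
  (forall v, v \in S1 -> fl x *m v = 0) -> (\dim S2 <= \dim S1)%N -> S1 = 0%VS)
 (Him : forall S1 S2 : {vspace 'cV[K]_c},
  (forall v, v \in S1 -> fA1 x *m v \in S2 /\ fA2 x *m v \in S2) ->
  (forall (t : 'I_n) v, v \in S2 -> fC x t *m v \in S1) ->
  (forall q, fh x q \in S1) -> (\dim S1 <= \dim S2)%N).

(** If l v = 0, let S1 be spanned by the coefficients of v and S2 = A2 S1. The kernel equation puts
    A1 S1 in S2, the C_q kill S2 and l kills S1, so [Hker] gives v = 0. *)
Lemma pencil_kernel (v : 'cV[{poly K}]_c) : v != 0 -> (fA1 x)^P *m v = - ('X *: ((fA2 x)^P *m v)) ->
  (forall q, (fC x q)^P *m ((fA2 x)^P *m v) = 0) -> (fl x)^P *m v <> 0.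
Proof.
move=> v0 kv cv lv; case/eqP: v0; apply: coefv_eq0 => i.
pose X := [seq coefv v i | i <- iota 0 (psz v)].
pose S1 := <<X>>%VS; pose S2 := (linfun (mulmx (fA2 x) : 'cV_c -> 'cV_c) @: S1)%VS.
have inS j : coefv v j \in S1.
  case: (ltnP j (psz v)) => hj; last by rewrite coefv_big ?mem0v.
  by apply: memv_span; apply: map_f; rewrite mem_iota.
have A2S w : w \in S1 -> fA2 x *m w \in S2.
  by move=> hw; apply/memv_imgP; exists w; rewrite // lfunE.
suff S10 : S1 = 0%VS by apply/eqP; rewrite -memv0 -S10 inS.
apply: (Hker (S2 := S2)).
- move=> w hw; split; last exact: A2S.
  apply: span_mul hw => _ /mapP[j _ ->].
  rewrite -coefv_mul (coefvX _ kv); case: j => [|j] /=; first exact: mem0v.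
  by rewrite memvN coefv_mul A2S.
- move=> t w /memv_imgP[u hu ->]; rewrite lfunE /= mulmxA.
  suff : fC x t *m fA2 x *m u \in 0%VS by rewrite memv0 => /eqP ->; exact: mem0v.
  apply: span_mul hu => _ /mapP[j _ ->]; rewrite memv0 -coefv_mul map_mxM -mulmxA cv.
  by apply/eqP/colP => k; rewrite !mxE coef0.
- move=> w hw; apply/eqP; rewrite -memv0; apply: span_mul hw => _ /mapP[j _ ->].
  rewrite memv0 -coefv_mul lv; by apply/eqP/colP => k; rewrite !mxE coef0.
- by rewrite /S2 -(limg_ker_dim (linfun (mulmx (fA2 x) : 'cV_c -> 'cV_c)) S1) leq_addl.
Qed.

(** Dually, S2 is the common kernel of the coefficients of u, and S1 that of the coefficients of u
    A2. If S1 contained every h_j, [Him] would give dim S1 <= dim S2; but u A2 has lower degree than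
    u, which makes S1 strictly larger. *)
Lemma pencil_cokernel (u : 'rV[{poly K}]_c) : u != 0 ->
  u *m (fA1 x)^P = - ('X *: (u *m (fA2 x)^P)) ->
  (forall q, u *m (fA2 x)^P *m (fC x q)^P = 0) ->
  exists j, u *m (fA2 x)^P *m (fh x j)^P <> 0.
Proof.
move=> u0 ku cu; apply: contrapT => /forallNP hu.
have {}hu j : u *m (fA2 x)^P *m (fh x j)^P = 0 by apply: contrapT; exact: hu.
pose N := psz u^T.
pose U : 'M[K]_(N, c) := \matrix_(i, j) (u 0 j)`_i.
have UE k (B : 'M[K]_(c, k)) i j : (U *m B) i j = ((u *m B^P) 0 j)`_i.
  rewrite !mxE coef_sum; apply: eq_bigr => a _.
  by rewrite !mxE coefMC.
pose S2 := lker (linfun (mulmx U : 'cV_c -> 'cV_N)).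
pose S1 := lker (linfun (mulmx (U *m fA2 x) : 'cV_c -> 'cV_N)).
have inS2 w : (w \in S2) = (U *m w == 0) by rewrite memv_ker lfunE.
have inS1 w : (w \in S1) = (U *m fA2 x *m w == 0) by rewrite memv_ker lfunE.
have UA0 k (B : 'M[K]_(c, k)) : u *m (fA2 x)^P *m B^P = 0 -> U *m fA2 x *m B = 0.
  move=> e; apply/matrixP => i j; rewrite -mulmxA UE map_mxM mulmxA e !mxE coef0 //.
have : (\dim S1 <= \dim S2)%N.
  apply: Him.
  - move=> w; rewrite inS1 !inS2 => /eqP e; rewrite !mulmxA e eqxx; split=> //.
    apply/eqP/colP => i; rewrite mxE [RHS]mxE.
    have e1 j : (U *m fA1 x) i j = if (i : nat) == 0%N then 0 else - ((u *m (fA2 x)^P) 0 j)`_i.-1.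
      by rewrite UE ku !mxE coefN coefXM; case: (nat_of_ord i) => [|?]; rewrite ?oppr0.
    under eq_bigr => j _ do rewrite e1.
    have e2 a : (a < N)%N -> \sum_j ((u *m (fA2 x)^P) 0 j)`_a * w j 0 = 0.
      move=> ha; have /colP/(_ (Ordinal ha)) := e; rewrite mxE [RHS]mxE => e3; rewrite -[RHS]e3.
      by apply: eq_bigr => j _; rewrite UE.
    case: i {e1} => -[|i] hi /=; first by apply: big1 => j _; rewrite mul0r.
    by under eq_bigr => j _ do rewrite mulNr; rewrite sumrN e2 ?oppr0 // ltnW.
  - by move=> t w _; rewrite inS1 mulmxA UA0 // mul0mx.
  - by move=> q; rewrite inS1 UA0.
apply/negP; rewrite -ltnNge.
have d1 := limg_ker_dim (linfun (mulmx (U *m fA2 x) : 'cV_c -> 'cV_N)) fullv.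
have d2 := limg_ker_dim (linfun (mulmx U : 'cV_c -> 'cV_N)) fullv.
rewrite !capfv in d1 d2; rewrite -(ltn_add2r (\dim (limg (linfun (mulmx U : 'cV_c -> 'cV_N))))).
rewrite d2 -d1 ltn_add2l.
have sub : (limg (linfun (mulmx (U *m fA2 x) : 'cV_c -> 'cV_N)) <= limg (linfun (mulmx U : 'cV_c -> 'cV_N)))%VS.
  apply/subvP => w /memv_imgP[z _ ->]; apply/memv_imgP; exists (fA2 x *m z); first exact: memvf.
  by rewrite !lfunE /= mulmxA.
rewrite ltn_neqAle dimvS // andbT; apply/negP => /eqP ed.
have {ed} : limg (linfun (mulmx (U *m fA2 x) : 'cV_c -> 'cV_N)) = limg (linfun (mulmx U : 'cV_c -> 'cV_N)).
  by apply/eqP; rewrite eqEdim sub ed leqnn.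
have N0 : (0 < N)%N.
  rewrite lt0n; apply: contra u0 => /eqP N0; apply/eqP/rowP => j; rewrite mxE.
  by apply/eqP; rewrite -size_poly_eq0 -leqn0 -{3}N0; have := psz_ge u^T j; rewrite mxE.
have [j hj] : exists j, size (u 0 j) = N.
  have [j0|c0] := posnP c.
    by case/eqP: u0; apply/rowP => -[j hj]; exfalso; rewrite j0 in hj.
  have [|j ej] := @bigop.eq_bigmax _ (fun i => size (u^T i 0%R)); first by apply/card_gt0P; exists (Ordinal c0).
  by exists j; rewrite /N /psz ej mxE.
have hN : (N.-1 < N)%N by rewrite prednK.
pose iN := Ordinal hN => eS.
have : U *m delta_mx j 0 \in limg (linfun (mulmx U : 'cV_c -> 'cV_N)).
  by apply/memv_imgP; exists (delta_mx j 0); rewrite ?memvf // lfunE.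
rewrite -eS => /memv_imgP[z _ ez].
have /colP/(_ iN) := ez; rewrite lfunE /= -colE mxE mxE.
have -> : (u 0 j)`_iN = lead_coef (u 0 j) by rewrite lead_coefE hj.
(* The top coefficient of u A2 vanishes, because X (u A2) = - u A1 has degree at most that of u. *)
have z0 a : (U *m fA2 x) iN a = 0.
  rewrite UE /=; have := congr1 (fun r : 'rV[{poly K}]_c => (r 0 a)`_N) ku.
  rewrite [in RHS]mxE [in RHS]mxE coefN coefXM (gtn_eqF N0) => e.
  apply/eqP; rewrite -oppr_eq0 -e; apply/eqP.
  rewrite mxE coef_sum big1 // => b _; rewrite mxE coefMC nth_default ?mul0r //.
  by have := psz_ge u^T b; rewrite mxE.
rewrite mxE big1 => [/eqP|a _]; last by rewrite z0 mul0r.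
by rewrite lead_coef_eq0 -size_poly_eq0 hj -leqn0 leqNgt N0.
Qed.

(** For a singular pencil take kernel vectors v and u of minimal degree on both sides. Were l v = 0,
    minimality would kill every C_q A2 v, against [pencil_kernel]; were all u A2 h_j = 0, it would
    kill every u A2 C_q, against [pencil_cokernel]. So l v and some u A2 h_j are nonzero, yet their
    product vanishes by the relation containing h_j. *)
Lemma pencil_neq0 : \det ((fA1 x)^P + 'X *: (fA2 x)^P) != 0.
Proof.
apply/eqP => det0.
have [v [v0 kv minv]] := minimal_kernel det0.
have det0t : \det (((fA1 x)^T)^P + 'X *: ((fA2 x)^T)^P) = 0.
  by rewrite -det0 -[RHS]det_tr linearD linearZ /= !map_trmx.
have [ut [ut0 kut minu]] := minimal_kernel det0t.
pose u := ut^T.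
have u0 : u != 0 by apply: contra ut0 => /eqP/(congr1 trmx); rewrite trmxK trmx0 => ->.
have ku : u *m (fA1 x)^P = - ('X *: (u *m (fA2 x)^P)).
  by apply: trmx_inj; rewrite linearN linearZ /= !trmx_mul !map_trmx trmxK.
have {minu} minu B : u *m (fA2 x)^P *m B^P *m (fA1 x)^P = u *m (fA1 x)^P *m B^P *m (fA2 x)^P ->
    u *m (fA2 x)^P *m B^P = 0.
  move=> e; apply: trmx_inj; rewrite trmx0 !trmx_mul !map_trmx trmxK; apply: minu.
  by apply: trmx_inj; rewrite -!map_trmx !trmx_mul !trmxK.
have lv : (fl x)^P *m v <> 0.
  move=> lv0; apply: (pencil_kernel v0 kv _ lv0) => q; apply: minv.
  have e : (fA1 x *m fC x q *m fA2 x)^P *m v = (fA2 x *m fC x q *m fA1 x)^P *m v.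
    case: (relation_commute q) => [->//|[j [e [_ ->]]]].
    by rewrite map_mxD mulmxDl (map_mxM _ e) -(mulmxA e^P) lv0 mulmx0 addr0.
  by move: e; rewrite !map_mxM -!mulmxA.
have [j uh] : exists j, u *m (fA2 x)^P *m (fh x j)^P <> 0.
  apply: contrapT => /forallNP hu.
  have {}hu j : u *m (fA2 x)^P *m (fh x j)^P = 0 by apply: contrapT; exact: hu.
  have hu1 j : u *m (fA1 x)^P *m (fh x j)^P = 0.
    by rewrite ku mulNmx -scalemxAl hu scaler0 oppr0.
  have [|j] := pencil_cokernel u0 ku; last by rewrite hu.
  move=> q; apply: minu.
  have e : u *m (fA1 x *m fC x q *m fA2 x)^P = u *m (fA2 x *m fC x q *m fA1 x)^P.
    case: (relation_commute q) => [->//|[j [e [he ->]]]].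
    rewrite map_mxD mulmxDr (map_mxM _ e) mulmxA.
    by case: he => ->; rewrite map_mxM mulmxA ?hu ?hu1 mul0mx addr0.
  by move: e; rewrite !map_mxM !mulmxA.
have n2 : (1 < n)%N by case: (n) j {uh} => [|[|n']] // [].
have [q [q' [e1 e2]]] := relation_h n2 j.
(* Here h_j l = C_q' A2 - C_q A1 and u A2 C_q' = u A1 C_q; the two kernel equations make the terms
   cancel. *)
have e0 : u *m (fA2 x)^P *m (fh x j)^P *m ((fl x)^P *m v) = 0.
  have {e2} -> : u *m (fA2 x)^P *m (fh x j)^P *m ((fl x)^P *m v) =
     u *m (fA2 x)^P *m (fC x q')^P *m (fA2 x)^P *m v - u *m (fA2 x)^P *m (fC x q)^P *m (fA1 x)^P *m v.
    have := congr1 (fun M => u *m (fA2 x)^P *m M^P *m v) e2.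
    by rewrite map_mxD !map_mxM mulmxDr mulmxDl !mulmxA => <-; rewrite addrC addKr.
  have -> : u *m (fA2 x)^P *m (fC x q')^P = u *m (fA1 x)^P *m (fC x q)^P.
    by rewrite -!mulmxA -!map_mxM e1.
  rewrite ku -(mulmxA _ (fA1 x)^P) kv !mulNmx mulmxN -!scalemxAl -!scalemxAr.
  by rewrite !mulmxA opprK addNr.
have := congr1 (fun M : 'M_1 => M 0 0) e0; rewrite mxE big_ord1 [RHS]mxE => /eqP; rewrite mulf_eq0.
case/orP => /eqP e; [apply: uh|apply: lv]; apply/matrixP => a b; rewrite !ord1 e mxE //.
Qed.

Lemma pencil_unit : exists2 q : {poly K}, q != 0 & forall k, q.[k] != 0 ->
  fA1 x + k *: fA2 x \in unitmx.
Proof.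
exists (\det ((fA1 x)^P + 'X *: (fA2 x)^P)); first exact: pencil_neq0.
move=> k; rewrite unitmxE unitfE -[_.[k]]/(horner_eval k _) -det_map_mx.
suff -> : map_mx (horner_eval k) ((fA1 x)^P + 'X *: (fA2 x)^P) = fA1 x + k *: fA2 x by [].
by apply/matrixP => i j; rewrite !mxE /horner_eval hornerD hornerM hornerX !hornerC.
Qed.
End Pencil.

(** * The normal form of a stable representation *)

Section RankOneCommutator.
Context (A : comPzRingType) (m : nat) (D Y : 'M[A]_m) (l : 'rV[A]_m) (h : 'cV[A]_m)
  (hl : Y *m D - D *m Y = h *m l)
  (torsionfree : forall k (a : A), a *+ k.+1 = 0 -> a = 0).

Definition wmx (w : seq bool) : 'M[A]_m :=
  foldr (fun b M => (if b then Y else D) *m M) 1%:M w.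

Lemma wmx_cat v w : wmx (v ++ w) = wmx v *m wmx w.
Proof. by elim: v => [|b v IH] /=; rewrite ?mul1mx // IH mulmxA. Qed.

Lemma wmx_nseq b k : wmx (nseq k b) = (if b then Y else D) ^+ k.
Proof. by elim: k => [|k /= IH]; rewrite ?expr0 // IH exprS. Qed.

Definition wval (w : seq bool) : A := (l *m wmx w *m h) 0 0.

Lemma wval_tr w : wval w = \tr (wmx w *m (h *m l)).
Proof. by rewrite mulmxA mxtrace_mulC mulmxA /mxtrace big_ord1. Qed.

(** Exchanging two adjacent letters changes the value by (l x h)(l z h), a product of values of
    shorter words. *)
Lemma wval_swap k x z : (forall w, (size w < k)%N -> wval w = 0) -> size (x ++ z) = k.-2 -> (1 < k)%N ->
  wval (x ++ [:: true, false & z]) = wval (x ++ [:: false, true & z]).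
Proof.
move=> IH sk k1; have sxz : (size x + size z < k.-1)%N by rewrite -size_cat sk; case: (k) k1 => [|[|]].
apply/eqP; rewrite -subr_eq0 /wval !wmx_cat /=.
have -> : (l *m (wmx x *m (Y *m (D *m wmx z))) *m h) 0 0 - (l *m (wmx x *m (D *m (Y *m wmx z))) *m h) 0 0
   = ((l *m wmx x *m h) *m (l *m wmx z *m h)) 0 0.
  transitivity ((l *m wmx x *m (Y *m D - D *m Y) *m wmx z *m h) 0 0).
    by rewrite mulmxBr !mulmxBl [in RHS]mxE [in X in _ = _ + X]mxE !mulmxA.
  by rewrite hl !mulmxA.
rewrite mxE big_ord1; have -> : (l *m wmx x *m h) 0 0 = 0; last by rewrite mul0r.
by apply: IH; apply: leq_ltn_trans (leq_addr (size z) _) _; rewrite (leq_trans sxz) // leq_pred.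
Qed.

Lemma wval_sort k x w : (forall w, (size w < k)%N -> wval w = 0) -> size (x ++ w) = k ->
  wval (x ++ w) = wval (x ++ nseq (count negb w) false ++ nseq (count id w) true).
Proof.
move=> IH; elim: w x => [|b w IHw] x; first by [].
move=> sk; have -> : x ++ b :: w = rcons x b ++ w by rewrite cat_rcons.
rewrite IHw ?cat_rcons //; case: b {IHw} sk => sk //=.
have {sk} : size (x ++ true :: nseq (count negb w) false ++ nseq (count id w) true) = k.
  rewrite -sk !size_cat /= size_cat !size_nseq; congr (_ + _.+1)%N.
  by rewrite addnC; exact: count_predC.
rewrite add0n; elim: (count negb w) x => [|p IHp] x //= sk.
have k1 : (1 < k)%N by rewrite -sk size_cat /= addnS ltnS addnS.
have := @wval_swap k x (nseq p false ++ nseq (count id w) true) IH _ k1; rewrite /= => ->; last first.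
  by rewrite -sk !size_cat /= !size_cat !addnS.
by rewrite -(cat_rcons false) IHp ?cat_rcons // -sk !size_cat.
Qed.

(* Nakajima's trace argument: the value depends only on the numbers a and b of
   letters D and Y, and expanding tr (D^a Y^(b+1) D) = tr (D^(a+1) Y^(b+1))
   shows that b + 1 times it vanishes. *)
Lemma wval0 w : wval w = 0.
Proof.
move: {2}(size w) (erefl (size w)) => k; elim/ltn_ind: k w => k IH w sw.
have {}IH v : (size v < k)%N -> wval v = 0 by move=> sv; exact: IH erefl.
have := @wval_sort k [::] w IH sw; rewrite cat0s /= => ->.
set a := count negb w; set b := count id w.
have ab : (a + b = k)%N by rewrite -sw addnC; exact: count_predC.
set f0 := wval _.
pose g j := \tr (D ^+ a *m (Y ^+ j *m D *m Y ^+ (b.+1 - j))).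
have step j : (j <= b)%N -> g j.+1 = g j + f0.
  move=> jb; have fj : f0 = wval (nseq (b - j) true ++ nseq a false ++ nseq j true).
    have := @wval_sort k [::] (nseq (b - j) true ++ nseq a false ++ nseq j true) IH.
    rewrite !cat0s /= => ->; rewrite ?size_cat ?size_nseq -?ab; last by rewrite addnCA subnK.
    rewrite /f0 !count_cat !count_nseq /= !mul0n !mul1n add0n addn0 subnK //.
  rewrite fj wval_tr !wmx_cat !wmx_nseq -mulmxA mxtrace_mulC -hl.
  rewrite /g (subSn jb) (subSS j b).
  have e1 : Y ^+ j.+1 *m D *m Y ^+ (b - j) - Y ^+ j *m D *m Y ^+ (b - j).+1 =
     Y ^+ j *m (Y *m D - D *m Y) *m Y ^+ (b - j).
    by rewrite exprSr exprS mulmxBr mulmxBl -[_ * Y]/(_ *m Y) -[Y * _]/(Y *m _) !mulmxA.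
  apply/eqP; rewrite -subr_eq0 opprD addrA -raddfB -mulmxBr e1 subr_eq0 !mulmxA.
  by [].
have gj j : (j <= b.+1)%N -> g j = g 0%N + f0 *+ j.
  elim: j => [|j IHj] jb; first by rewrite mulr0n addr0.
  by rewrite step // IHj ?(leqW jb) // 1?ltnW // mulrSr addrA.
apply: (torsionfree (k := b)).
have := gj b.+1 (leqnn _).
have -> : g b.+1 = g 0%N.
  rewrite /g subnn subn0 expr0 mul1mx mulmx1 !mulmxA mxtrace_mulC.
  by rewrite !mulmxA -[D *m D ^+ a]/(D * D ^+ a) commrX.
by rewrite -[in X in X = _](addr0 (g 0%N)) => /addrI <-.
Qed.
End RankOneCommutator.

Section CyclicCommutator.
Context (A : comPzRingType) (m : nat) (D Y : 'M[A]_m) (l : 'rV[A]_m)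
  (torsionfree : forall k (a : A), a *+ k.+1 = 0 -> a = 0).

(** Polynomial expressions are linear combinations of words, even when D and Y do not commute. *)
Lemma bmx_words (P : 'M[A]_m -> Prop) t : P 0 -> (forall X Z, P X -> P Z -> P (X + Z)) ->
  (forall a X, P X -> P (a *: X)) -> (forall w, P (wmx D Y w)) -> P (bmx D Y t).
Proof.
elim: t P => [a| | |s IHs t IHt|s IHs t IHt] P P0 PD PZ Pw /=.
- by rewrite -scalemx1; apply: PZ; apply: (Pw [::]).
- by have := Pw [:: false]; rewrite /= mulmx1.
- by have := Pw [:: true]; rewrite /= mulmx1.
- by apply: (@PD _ _); [exact: (IHs P)|exact: (IHt P)].
apply: (IHs (fun X => P (X *m bmx D Y t))).
- by rewrite mul0mx.
- by move=> X Z hX hZ; rewrite mulmxDl; apply: (@PD _ _).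
- by move=> a X hX; rewrite -scalemxAl; apply: (@PZ _ _).
move=> w; apply: (IHt (fun X => P (wmx D Y w *m X))).
- by rewrite mulmx0.
- by move=> X Z hX hZ; rewrite mulmxDr; apply: (@PD _ _).
- by move=> a X hX; rewrite -scalemxAr; apply: (@PZ _ _).
by move=> w'; rewrite -wmx_cat.
Qed.

(** By [wval0], l t h = 0 for every expression t, and the rows l t include the standard basis. *)
Lemma cyclic_commute (h : 'cV[A]_m) : Y *m D - D *m Y = h *m l ->
  (forall j, exists t, l *m bmx D Y t = delta_mx 0 j) -> h = 0.
Proof.
move=> e cyc; apply/colP => j; rewrite mxE; have [t ht] := cyc j.
have {ht} -> : h j 0 = (l *m bmx D Y t *m h) 0 0 by rewrite ht -rowE mxE.
apply: (bmx_words (P := fun X => (l *m X *m h) 0 0 = 0)).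
- by rewrite mulmx0 mul0mx mxE.
- by move=> X Z hX hZ; rewrite mulmxDr mulmxDl mxE hX hZ addr0.
- by move=> a X hX; rewrite -scalemxAr -scalemxAl mxE hX mulr0.
exact: wval0.
Qed.
End CyclicCommutator.

Section NormalForm.
Context (n : nat) (A : comPzRingType) (m : nat) (k : A) (D : 'M[A]_m) (C : 'I_n -> 'M[A]_m).
Let P := 1%:M - k *: D.
Context (hC : forall i j : 'I_n, j = i.+1 :> nat -> P *m C i = D *m C j).

(** The operator E of the normal form: applied to C_j = (1 - k D)^j D^(n-1-j) E, the binomial
    expansion of (k D + (1 - k D))^(n-1) = 1 returns E. *)
Definition fibre_op := \sum_(j < n) (k ^+ (n.-1 - j) *+ 'C(n.-1, j)) *: C j.

Lemma pencil_shift i (q q' : 'I_n) : q' = (q + i)%N :> nat -> D ^+ i *m C q' = P ^+ i *m C q.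
Proof.
elim: i q' => [|i IH] q' e; first by rewrite !expr0 !mul1mx; congr (C _); apply: ord_inj; rewrite e addn0.
have hq : (q + i < n)%N by rewrite -ltnS -addnS -e (leqW (ltn_ord q')).
rewrite exprSr -[D ^+ i * D]/(D ^+ i *m D) -mulmxA -(@hC (Ordinal hq)) ?e ?addnS //.
rewrite mulmxA -(intertwineX i (commPD k D)) -mulmxA (IH (Ordinal hq) erefl) mulmxA.
by rewrite exprS.
Qed.

(** Iterating [hC] trades each factor P in front of C_q for a factor D in front of C_(q+1). *)
Lemma pencil_cross (q j : 'I_n) :
  P ^+ q *m D ^+ (n.-1 - q) *m C j = P ^+ j *m D ^+ (n.-1 - j) *m C q.
Proof.
wlog qj : q j / (q <= j)%N.
  by move=> H; case/orP: (leq_total q j) => [/H //|/H ->].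
have jn : (j <= n.-1)%N by rewrite -ltnS (leq_trans (ltn_ord j)) ?leqSpred.
have {1}-> : (n.-1 - q = (n.-1 - j) + (j - q))%N by rewrite addnBA // subnK.
have e := @pencil_shift (j - q) q j; rewrite exprD -[_ * D ^+ (j - q)]/(_ *m D ^+ (j - q)).
rewrite -!mulmxA e ?subnKC // (mulmxA (D ^+ _)).
rewrite -(intertwineX (n.-1 - j) (esym (intertwineX (j - q) (esym (commPD k D))))) -/P.
by rewrite !mulmxA -[P ^+ q *m _]/(P ^+ q * _) -exprD subnKC.
Qed.

Lemma fibre_opE q : mxC k D fibre_op q = C q.
Proof.
rewrite /mxC /fibre_op mulmx_sumr -/P; case: (posnP n) => [n0|n_gt0].
  by case: q => q hq; exfalso; rewrite n0 in hq.
rewrite -[RHS](sum_mxC n_gt0 k D); apply: eq_bigr => j _.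
by rewrite -scalemxAr pencil_cross.
Qed.

(** In a representation the left side is h_i l; the identity factors it through the commutator
    [Y, D]. *)
Lemma fibre_op_bracket (Y := fibre_op) (i j : 'I_n) : j = i.+1 :> nat ->
  C j *m D - C i *m P = P ^+ i *m D ^+ (n.-2 - i) *m (Y *m D - D *m Y).
Proof.
move=> e; rewrite -(fibre_opE j) -(fibre_opE i) -/Y /mxC -/P.
have hi : (n.-1 - i = (n.-1 - j).+1)%N by rewrite e subnSK // ltn_predRL -e.
have -> : (n.-2 - i = n.-1 - j)%N by rewrite e -subn1 -subn1 -subnDA add1n.
rewrite hi e; set X := P ^+ i; set Z := D ^+ (n.-1 - i.+1).
have XD : X *m D = D *m X by rewrite /X (intertwineX i (esym (commPD k D))).
have XP : P ^+ i.+1 = X *m P by rewrite exprSr.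
have ZD : D ^+ (n.-1 - i.+1).+1 = Z *m D by rewrite exprSr.
have PZ : P *m Z = Z *m P by rewrite /Z (intertwineX _ (commPD k D)).
rewrite ZD XP -!(mulmxA X) -mulmxBr; congr (X *m _).
rewrite PZ -!(mulmxA Z) -mulmxBr; congr (Z *m _).
rewrite /P !mulmxBl !mulmxBr !mul1mx !mulmx1 -!scalemxAl -!scalemxAr.
by rewrite opprB addrA subrK.
Qed.

(* The case n = 1 has its own form of the relation. *)
Lemma fibre_op_commutator (l : 'rV[A]_m) : (0 < n)%N ->
  (n = 1%N -> forall q, P *m C q *m D = D *m C q *m P) ->
  (forall i j : 'I_n, j = i.+1 :> nat -> exists h : 'cV_m, C j *m D - C i *m P = h *m l) ->
  exists h : 'cV_m, fibre_op *m D - D *m fibre_op = h *m l.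
Proof.
move=> n_gt0 h1 h2; case: (ltnP 1 n) => n2.
  have /ex_choice[h hh] (i : 'I_n.-1) : exists h : 'cV_m,
     mxC k D (fibre_op *m D - D *m fibre_op) i = h *m l.
    have hi : (i < n)%N by rewrite (leq_trans (ltn_ord i)) ?leq_pred.
    have hj : (i.+1 < n)%N by rewrite -ltn_predRL.
    have [h e] := h2 (Ordinal hi) (Ordinal hj) erefl; exists h.
    by rewrite -e fibre_op_bracket.
  (* The binomial identity in degree n - 2 recovers [Y, D] from the products P^i D^(n-2-i)
     [Y, D]. *)
  exists (\sum_(i < n.-1) (k ^+ (n.-2 - i) *+ 'C(n.-2, i)) *: h i).
  rewrite -[LHS](@sum_mxC n.-1 _ _ _ k D) ?ltn_predRL //.
  by rewrite [RHS]mulmx_suml; apply: eq_bigr => i _; rewrite -scalemxAl hh.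
have n1 : n = 1%N by apply/eqP; rewrite eqn_leq n2.
pose q : 'I_n := Ordinal n_gt0.
have e := fibre_opE q; rewrite /mxC /= expr0 mul1mx n1 expr0 mul1mx in e.
exists 0; rewrite mul0mx; apply/eqP; rewrite subr_eq0; apply/eqP.
have := h1 n1 q; rewrite -e /P !mulmxBl !mulmxBr !mul1mx !mulmx1 -!scalemxAl -!scalemxAr.
by move/addIr.
Qed.
End NormalForm.

Section NormalFormRing.
Context (A : comPzRingType) (n c d c' : nat) (n_gt0 : (0 < n)%N) (c_gt0 : (0 < c)%N).
Context (torsionfree : forall k (a : A), a *+ k.+1 = 0 -> a = 0).
Context (x : frep n c d A) (rx : relations x) (k : A) (gi : 'M[A]_c).
Let g := fA1 x + k *: fA2 x.
Context (ggi : g *m gi = 1%:M).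
Let D := gi *m fA2 x.
Let Y := fibre_op k (fun q => fC x q *m g).

Lemma normal_pencil : [/\ gi *m fA1 x = 1%:M - k *: D, fA1 x = g *m (1%:M - k *: D) & fA2 x = g *m D].
Proof.
have gP : gi *m fA1 x = 1%:M - k *: D.
  by rewrite -(mulmx1C ggi) /g mulmxDr -scalemxAr addrK.
by split=> //; rewrite -?gP mulmxA ggi mul1mx.
Qed.

Lemma normal_rel (i j : 'I_n) : j = i.+1 :> nat ->
  (1%:M - k *: D) *m (fC x i *m g) = D *m (fC x j *m g).
Proof.
have [gP _ _] := normal_pencil.
move=> e; rewrite -gP !mulmxA -!(mulmxA gi); congr (_ *m (_ *m _)).
move: rx; rewrite /relations; case: eqP => [n1|n1 [h _ _ _]].
  by have := ltn_ord j; rewrite [X in (_ < X)%N]n1 e.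
have hi : (i < n.-1)%N by rewrite ltn_predRL -e.
by have [] := h (Ordinal hi) i j erefl e.
Qed.

Lemma normal_fibre q : fC x q *m g = mxC k D Y q.
Proof. by rewrite (fibre_opE normal_rel). Qed.

Context (cyc : forall j, exists t, fl x *m bmx D Y t = delta_mx 0 j).
Context (R2 : 'M[A]_(c, d)) (hR2 : fF2 x *m R2 = 1%:M).
Context (hsplit : exists R N P, @split_by c d c' A (fF1 x) R N P).

(** The pencil g identifies V2 with V1, and [fibre_opE] puts the C_q in the form [mxC]. The
    commutator of D and Y is h' l, so h' = 0 by cyclicity, and then every h_q is 0. The primed half
    follows by transport along F1 and F2, since F1 can be cancelled on the right. *)
Lemma normal_form : exists al : adhm c d A, good c' al /\ same_orbit x (Phi n k al).
Proof.
have gig : gi *m g = 1%:M := mulmx1C ggi.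
have [gP gA1 gA2] := normal_pencil.
have [F21 F22 F1C] : [/\ fF2 x *m fA1 x = fA1' x *m fF1 x, fF2 x *m fA2 x = fA2' x *m fF1 x &
    forall t, fF1 x *m fC x t = fC' x t *m fF2 x].
  move: rx; rewrite /relations; case: eqP => [_ [h [e1 e2]]|_ [_ _ [e1 e2] h]]; split=> // t.
  by have [] := h t.
have hC := normal_rel; have CE := normal_fibre.
have [h' hh'] : exists h : 'cV_c, Y *m D - D *m Y = h *m fl x.
  apply: (fibre_op_commutator hC) => //.
    move=> n1 q; rewrite -gP -[LHS]mulmxA -[RHS]mulmxA -!(mulmxA gi) -!(mulmxA (fC x q)) !(mulmxA g) ggi !mul1mx.
    congr (gi *m _); rewrite !mulmxA; move: rx; rewrite /relations; case: eqP => [_ [h _]|//].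
    by have [] := h q.
  move=> i j e; have hi : (i < n.-1)%N by rewrite ltn_predRL -e.
  exists (fh x (Ordinal hi)); rewrite -gP -!mulmxA !(mulmxA g) ggi !mul1mx.
  move: rx; rewrite /relations; case: eqP => [n1|n1 [h _ _ _]].
    by exfalso; have := hi; rewrite [X in (_ < X.-1)%N]n1.
  by have [_ e2 _ _] := h (Ordinal hi) i j erefl e; rewrite -e2 addrC addKr.
have h0 := cyclic_commute torsionfree hh' cyc.
have YD : D *m Y = Y *m D by apply/esym/eqP; rewrite -subr_eq0 hh' h0 mul0mx.
(* With D and Y commuting, the relation leaves h_q l = 0; some t carries l to a standard row, which
   leaves h_q = 0. *)
have hx0 q : fh x q = 0.
  have n2 : (1 < n)%N by case: (n) q => [|[|]] // [].
  have hl : fh x q *m fl x = 0.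
    move: rx; rewrite /relations; case: eqP => [n1|n1 [h _ _ _]]; first by rewrite n1 in n2.
    have hi : (q < n)%N by rewrite (leq_trans (ltn_ord q)) ?leq_pred.
    have hj : (q.+1 < n)%N by rewrite -ltn_predRL.
    have [_ e2 _ _] := h q (Ordinal hi) (Ordinal hj) erefl erefl.
    have e3 := fibre_op_bracket hC (i := Ordinal hi) (j := Ordinal hj) erefl.
    rewrite -/Y hh' h0 mul0mx mulmx0 -gP -!mulmxA !(mulmxA g) ggi !mul1mx -e2 in e3.
    by rewrite -e3 addrC addKr.
  have [t ht] := cyc (Ordinal c_gt0).
  apply/colP => i; rewrite mxE; have := congr1 (fun M => M *m bmx D Y t) hl.
  rewrite mul0mx -mulmxA ht => /matrixP/(_ i (Ordinal c_gt0)).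
  by rewrite !mxE big_ord1 mxE !eqxx mulr1.
pose g' := fA1' x + k *: fA2' x.
have F2g : fF2 x *m g = g' *m fF1 x.
  by rewrite /g /g' mulmxDr mulmxDl F21 -scalemxAr -scalemxAl F22.
(* Since g' F1 = F2 g and R2 is a right inverse of F2, this inverts the primed pencil. *)
pose gi' := fF1 x *m gi *m R2.
have ggi' : g' *m gi' = 1%:M.
  by rewrite /gi' !mulmxA -F2g -(mulmxA _ g) ggi mulmx1.
have gig' : gi' *m g' = 1%:M := mulmx1C ggi'.
have F1gi : fF1 x *m gi = gi' *m fF2 x.
  by rewrite -[LHS]mul1mx -gig' -!mulmxA (mulmxA g') -F2g -mulmxA ggi mulmx1.
pose D' := gi' *m fA2' x; pose Y' := fibre_op k (fun q => fC' x q *m g').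
have FD : fF1 x *m D = D' *m fF1 x by rewrite /D /D' mulmxA F1gi -!mulmxA F22.
have FC q : fF1 x *m (fC x q *m g) = fC' x q *m g' *m fF1 x by rewrite mulmxA F1C -!mulmxA F2g.
have FY : fF1 x *m Y = Y' *m fF1 x.
  by rewrite mulmx_sumr mulmx_suml; apply: eq_bigr => q _; rewrite -scalemxAr -scalemxAl FC.
have [R [N [P sp]]] := hsplit; have FR : fF1 x *m R = 1%:M by case: sp.
have F1inj (X X' : 'M[A]_d) : X *m fF1 x = X' *m fF1 x -> X = X'.
  by move=> /(congr1 (fun M => M *m R)); rewrite -!mulmxA FR !mulmx1.
have CE' q : fC' x q *m g' = mxC k D' Y' q.
  by apply: F1inj; rewrite -FC CE (intertwine_mxC _ _ FD FY).
have gP' : gi' *m fA1' x = 1%:M - k *: D'.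
  by rewrite -gig' /g' mulmxDr -scalemxAr addrK.
exists {| aT := {| tD := D; tE := Y; tl := fl x |}; aF := fF1 x; aD := D'; aE := Y' |}; split.
  by split=> //=; exists R, N, P.
have gl m (u v : 'M[A]_m) : u *m v = 1%:M -> is_GL u /\ is_GL v.
  by move=> e; have e' := mulmx1C e; split; [exists v|exists u].
(* V1 and V3 are left alone; V2 and V4 are identified with them through the two pencils. *)
exists 1%:M, gi, 1%:M, gi'; split.
  by split; [exact: (gl _ 1%:M 1%:M (mulmx1 _)).1|exact: (gl _ _ _ gig).1|
    exact: (gl _ 1%:M 1%:M (mulmx1 _)).1|exact: (gl _ _ _ gig').1].
split; last split; last split => /=; rewrite ?mul1mx ?mulmx1 //.
- split=> [||t] /=; rewrite ?mulmx1 ?mul1mx //.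
  by rewrite -CE -mulmxA ggi mulmx1.
- split=> [||t] /=; rewrite ?mulmx1 ?mul1mx //.
  by rewrite -CE' -mulmxA ggi' mulmx1.
by move=> q; rewrite hx0 mulmx0.
Qed.
End NormalFormRing.

Section CyclicField.
Context (K : fieldType) (m : nat) (D Y : 'M[K]_m) (l : 'rV[K]_m).
Context (hst : forall S : {vspace 'cV[K]_m}, (forall v, v \in S -> D *m v \in S) ->
  (forall v, v \in S -> Y *m v \in S) -> (forall v, v \in S -> l *m v = 0) -> S = 0%VS).

(** Take rows l t_i of maximal rank: they span all rows l t. Their common kernel is invariant under
    D and Y and killed by l, hence zero, so the rows span everything. *)
Lemma cyclic_of_stable j : exists t, l *m bmx D Y t = delta_mx 0 j.
Proof.
pose rows N (f : 'I_N -> bterm K) : 'M[K]_(N, m) := \matrix_i (l *m bmx D Y (f i)).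
have rowE N f i : row i (@rows N f) = l *m bmx D Y (f i) by rewrite rowK.
pose P r := `[< exists N f, \rank (@rows N f) = r >].
have exP : exists r, P r.
  by exists (\rank (@rows 0%N (fun=> BX))); apply/asboolP; exists 0%N, (fun=> BX).
have ubP r : P r -> (r <= m)%N by move=> /asboolP[N [f <-]]; exact: rank_leq_col.
case: (ex_maxnP exP ubP) => r /asboolP[N [f rf]] rmax.
have inM t : (l *m bmx D Y t <= rows N f)%MS.
  pose f' (i : 'I_(N + 1)) := match split i with inl a => f a | inr _ => t end.
  have sub : (rows N f <= rows _ f')%MS.
    apply/row_subP => i; rewrite rowE.
    by have := row_sub (lshift 1 i) (rows _ f'); rewrite rowE /f' (unsplitK (inl i)).
  have sub' : (l *m bmx D Y t <= rows _ f')%MS.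
    by have := row_sub (rshift N 0) (rows _ f'); rewrite rowE /f' (unsplitK (inr 0)).
  apply: submx_trans sub' _; rewrite -(geq_leqif (mxrank_leqif_sup sub)) rf.
  by apply: rmax; apply/asboolP; exists _, f'.
pose S := lker (linfun (mulmx (rows N f) : 'cV_m -> 'cV_N)).
have inS v : (v \in S) = (rows N f *m v == 0) by rewrite memv_ker lfunE.
have kill v t : v \in S -> l *m bmx D Y t *m v = 0.
  by rewrite inS => /eqP e; have /submxP[X ->] := inM t; rewrite -mulmxA e mulmx0.
have rows0 v : (forall i, l *m bmx D Y (f i) *m v = 0) -> v \in S.
  move=> h; rewrite inS; apply/eqP/row_matrixP => i.
  by rewrite row_mul rowE h row0.
have S0 : S = 0%VS.
  apply: hst => v hv.
  - by apply: rows0 => i; rewrite mulmxA; have := kill v (BM (f i) (BX)) hv; rewrite /= !mulmxA.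
  - by apply: rows0 => i; rewrite mulmxA; have := kill v (BM (f i) (BY)) hv; rewrite /= !mulmxA.
  - by have := kill v (BC 1) hv; rewrite /= mulmx1.
have full : row_full (rows N f).
  rewrite -[row_full _]/(_ == _) -mxrank_tr -[_ == _]/(row_free _) -kermx_eq0.
  apply/eqP/row_matrixP => i; rewrite row0; apply: trmx_inj; rewrite trmx0; apply/eqP.
  rewrite -memv0 -S0 inS; apply/eqP; apply: trmx_inj; rewrite trmx_mul trmxK trmx0.
  by rewrite -row_mul mulmx_ker row0.
have /submxP[X hX] : ((delta_mx 0 j : 'rV[K]_m) <= rows N f)%MS by exact: submx_full.
exists (bcomb (fun i => X 0 i) f).
rewrite -[bmx D Y _]/(tmx {| tD := D; tE := Y; tl := l |} _) tmx_bcomb mulmx_sumr hX; apply/rowP => a; rewrite summxE mxE; apply: eq_bigr => i _.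
by rewrite -scalemxAr mxE; congr (_ * _); rewrite [RHS]mxE.
Qed.
End CyclicField.

(** * Matrix conditions spread from a closed point to a neighbourhood *)

Section NearPoint.
Context (R : realType).
Local Notation K := R[i].
Context (A : calg K) (p : hom A (base K)).

Lemma map_str k l (M : 'M[K]_(k, l)) : map_mx p (map_mx (calg_str A) M) = M.
Proof. by apply/matrixP => i j; rewrite !mxE homK. Qed.

Lemma nbhd_unitmx m (M : 'M[A]_m) (M' : 'M[K]_m) : map_mx p M *m M' = 1%:M ->
  nbhd p (fun B u => exists M', map_mx u M *m M' = 1%:M).
Proof.
move=> e; have /nbhd_neq0 : p (\det M) != 0.
  have := congr1 determinant e; rewrite det_mulmx det1 det_map_mx => e1.
  by apply: invertible_neq0; exists (\det M').
apply: nbhd_sub => B u [t ht]; exists (t *: \adj (map_mx u M)).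
by rewrite -scalemxAr mul_mx_adj det_map_mx scale_scalar_mx mulrC ht.
Qed.

Lemma nbhd_right_inverse k l (F : 'M[A]_(k, l)) (G : 'M[K]_(l, k)) :
  map_mx p F *m G = 1%:M -> nbhd p (fun B u => exists G, map_mx u F *m G = 1%:M).
Proof.
move=> e; have /nbhd_unitmx : map_mx p (F *m map_mx (calg_str A) G) *m 1%:M = 1%:M.
  by rewrite map_mxM map_str e mulmx1.
apply: nbhd_sub => B u [M' e']; exists (map_mx u (map_mx (calg_str A) G) *m M').
by rewrite mulmxA -map_mxM.
Qed.

(** At the point, F is completed by constant rows [P0] to an invertible matrix. The completed matrix
    stays invertible nearby, and the blocks of its inverse are R and N. *)
Lemma nbhd_split c d c' (F : 'M[A]_(d, c)) (G : 'M[K]_(c, d)) : c = (d + c')%N ->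
  map_mx p F *m G = 1%:M ->
  nbhd p (fun B u => exists R N P, @split_by c d c' B (map_mx u F) R N P).
Proof.
move=> ec; subst c; set F0 := map_mx p F => e.
have ff : row_free F0.
  by apply/row_freeP; exists G.
pose P0 : 'M[K]_(c', d + c') := dsubmx (row_ebase F0).
have e1 : F0 = col_ebase F0 *m usubmx (row_ebase F0).
  rewrite -{1}(mulmx_ebase F0) -mulmxA; congr (_ *m _).
  rewrite (eqP ff) -{1}(vsubmxK (row_ebase F0)) pid_mx_row mul_row_col.
  by rewrite mul0mx addr0 mul1mx.
have e2 : col_mx F0 P0 = block_mx (col_ebase F0) 0 0 1%:M *m row_ebase F0.
  rewrite -[in RHS](vsubmxK (row_ebase F0)) mul_block_col !mul0mx addr0 add0r mul1mx.
  by rewrite -e1.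
have u2 : col_mx F0 P0 \in unitmx.
  rewrite e2 unitmx_mul row_ebase_unit andbT unitmxE det_ublock det1 mulr1 -unitmxE.
  exact: col_ebase_unit.
have /nbhd_unitmx : map_mx p (col_mx F (map_mx (calg_str A) P0)) *m invmx (col_mx F0 P0) = 1%:M.
  by rewrite map_col_mx map_str mulmxV.
apply: nbhd_sub => B u [V' e3]; have e4 := mulmx1C e3.
set P1 := map_mx u (map_mx (calg_str A) P0).
exists (lsubmx V'), (rsubmx V'), P1.
have e5 : col_mx (map_mx u F) P1 *m row_mx (lsubmx V') (rsubmx V') = block_mx 1%:M 0 0 1%:M.
  by rewrite hsubmxK -scalar_mx_block -e3 map_col_mx.
rewrite mul_col_row in e5; have [a1 a2 _ a4] := eq_block_mx e5; split=> //.
by rewrite -mul_row_col hsubmxK -e4 map_col_mx.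
Qed.

Lemma nbhd_cyclic m (D Y : 'M[A]_m) (l : 'rV[A]_m) :
  (forall j, exists t, map_mx p l *m bmx (map_mx p D) (map_mx p Y) t = delta_mx 0 j) ->
  nbhd p (fun B u =>
    forall j, exists t, map_mx u l *m bmx (map_mx u D) (map_mx u Y) t = delta_mx 0 j).
Proof.
move=> /ex_choice[t ht]; pose t' j := bmap (calg_str A) (t j).
have bmapK (s : bterm K) : bmap p (bmap (calg_str A) s) = s.
  by elim: s => //= [a|s -> s' ->|s -> s' ->] //; rewrite homK.
have /nbhd_unitmx : map_mx p (\matrix_i (l *m bmx D Y (t' i))) *m 1%:M = 1%:M.
  rewrite mulmx1; apply/row_matrixP => i; rewrite -map_row rowK map_mxM -bmx_map bmapK ht.
  by rewrite row1.
apply: nbhd_sub => B u [M' /mulmx1C e] j.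
pose T : triple m B := {| tD := map_mx u D; tE := map_mx u Y; tl := map_mx u l |}.
exists (bcomb (fun i => M' j i) (fun i => bmap u (t' i))).
rewrite -[bmx _ _ _]/(tmx T _) tmx_bcomb mulmx_sumr -row1 -e row_mul [RHS]mulmx_sum_row.
apply: eq_bigr => i _; rewrite -scalemxAr mxE -map_row rowK map_mxM.
by rewrite /tmx bmx_map.
Qed.
End NearPoint.

Lemma torsionfree_calg (R : realType) (A : calg R[i]) k (a : A) : a *+ k.+1 = 0 -> a = 0.
Proof.
move=> e; have : calg_str A (k.+1%:R^-1) * (a *+ k.+1) = 0 by rewrite e mulr0.
rewrite mulrnAr -mulrnAl -rmorphMn -mulr_natr mulVf ?rmorph1 ?mul1r //.
by rewrite pnatr_eq0.
Qed.

Section NormalFormNear.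
Context (R : realType).
Local Notation K := R[i].
Context (th1 th2 th3 th4 : R) (n c d c' : nat) (n_gt0 : (0 < n)%N) (c_gt0 : (0 < c)%N)
  (ec : c = (d + c')%N) (h1 : 0 < th1) (h2 : - th1 < th2)
  (h2' : th2 < - ((c%:R - 1) / c%:R) * th1) (h3 : th3 < 0) (h4 : th4 < 0)
  (h5 : 0 < th1 + th2 + (th3 + th4) * d%:R).

Lemma stable_pencil (x : frep n c d K) : relations x -> stable th1 th2 th3 th4 x ->
  exists2 q : {poly K}, q != 0 & forall k, q.[k] != 0 ->
    fA1 x + k *: fA2 x \in unitmx.
Proof.
move=> rx [ss _]; apply: pencil_unit => // S1 S2 a b e.
  exact: (semistable_ker c_gt0 h1 h2 h2' h5 ss).
exact: (semistable_im c_gt0 h1 h2 h2' ss).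
Qed.

(** A subspace S invariant under D and Y and killed by l gives the pair (S, g S), which has equal
    dimensions and is excluded by [semistable_ker]. *)
Lemma stable_cyclic (x : frep n c d K) (rx : relations x) k gi :
  stable th1 th2 th3 th4 x -> (fA1 x + k *: fA2 x) *m gi = 1%:M ->
  forall j, exists t, fl x *m bmx (gi *m fA2 x)
     (fibre_op k (fun q => fC x q *m (fA1 x + k *: fA2 x))) t = delta_mx 0 j.
Proof.
move=> [ss _] e; apply: cyclic_of_stable => S sD sY sl.
set g := fA1 x + k *: fA2 x in e sY *.
have [gP A1 A2] := normal_pencil e.
pose S2 := (linfun (mulmx g : 'cV_c -> 'cV_c) @: S)%VS.
have inS2 v : v \in S -> g *m v \in S2.
  by move=> hv; apply/memv_imgP; exists v; rewrite // lfunE.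
have sP v : v \in S -> (1%:M - k *: (gi *m fA2 x)) *m v \in S.
  by move=> hv; rewrite mulmxBl mul1mx -scalemxAl memvB ?memvZ ?sD.
have sX (X : 'M[K]_c) i v : (forall v, v \in S -> X *m v \in S) -> v \in S -> X ^+ i *m v \in S.
  move=> h; elim: i v => [|i IH] v hv; first by rewrite expr0 mul1mx.
  by rewrite exprS -[X * _]/(X *m _) -mulmxA h // IH.
apply: (semistable_ker c_gt0 h1 h2 h2' h5 ss (S2 := S2)) => //.
- move=> v hv; split; first by rewrite A1 -mulmxA; apply: inS2; exact: sP.
  by rewrite A2 -mulmxA; apply: inS2; exact: sD.
- move=> t v /memv_imgP[w hw ->]; rewrite lfunE /= mulmxA (normal_fibre rx e) /mxC.
  rewrite -!mulmxA; apply: (sX _ _ _ sP); apply: (sX _ _ _ sD); exact: sY.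
- by rewrite /S2 -(limg_ker_dim (linfun (mulmx g : 'cV_c -> 'cV_c)) S) leq_addl.
Qed.

(** Invertibility of the pencil, cyclicity of l and surjectivity of F1 and F2 hold at the point by
    stability and are open, so [normal_form] applies over a neighbourhood. *)
Lemma normal_form_near (A : calg K) (x : frep n c d A) (p : hom A (base K)) (k : K) :
  relations x -> stable th1 th2 th3 th4 (frep_map p x : frep n c d K) ->
  (fA1 (frep_map p x) + k *: fA2 (frep_map p x) : 'M[K]_c) \in unitmx ->
  nbhd p (fun B u => exists al : adhm c d B,
    good c' al /\ same_orbit (frep_map u x) (Phi n (calg_str B k) al)).
Proof.
move=> rx st kp.
have : map_mx p (fA1 x + calg_str A k *: fA2 x) *m
    invmx (fA1 (frep_map p x) + k *: fA2 (frep_map p x) : 'M[K]_c) = 1%:M.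
  by rewrite map_mxD map_mxZ homK mulmxV.
move=> /nbhd_unitmx hg; apply: nbhd_trans; apply: nbhd_sub hg => B u [gi].
rewrite map_mxD map_mxZ homK => egi q eq.
have fq : frep_map q (frep_map u x) = frep_map p x by rewrite -frep_map_comp eq.
pose y := frep_map u x; have ry : relations y := relations_map u rx.
have rq : relations (frep_map q y : frep n c d K) := relations_map q ry.
have stq : stable th1 th2 th3 th4 (frep_map q y : frep n c d K) by rewrite fq.
pose g := fA1 y + calg_str B k *: fA2 y.
have eq' : (fA1 (frep_map q y) + k *: fA2 (frep_map q y) : 'M[K]_c) *m map_mx q gi = 1%:M.
  have := congr1 (map_mx q) egi; rewrite map_mxM map_mx1 map_mxD map_mxZ homK.
  by move=> e; exact: e.
have cy := stable_cyclic rq stq eq'.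
have [F21 F22 F1C] : [/\ fF2 (frep_map q y) *m fA1 (frep_map q y) = fA1' (frep_map q y) *m fF1 (frep_map q y),
    fF2 (frep_map q y) *m fA2 (frep_map q y) = fA2' (frep_map q y) *m fF1 (frep_map q y) &
    forall t, fF1 (frep_map q y) *m fC (frep_map q y) t = fC' (frep_map q y) t *m fF2 (frep_map q y)].
  move: rq; rewrite /relations; case: eqP => [_ [h [e1 e2]]|_ [_ _ [e1 e2] h]]; split=> // t.
  by have [] := h t.
have [[G1 hG1] [G2 hG2]] := semistable_surj h3 h4 stq.1 F21 F22 F1C.
have n1 := nbhd_right_inverse (F := fF2 y) hG2.
have n2 := nbhd_split (F := fF1 y) ec hG1.
have n3 : nbhd q (fun D v => forall j, exists t, map_mx v (fl y) *m
    bmx (map_mx v (gi *m fA2 y)) (map_mx v (fibre_op (calg_str B k) (fun q => fC y q *m g))) t = delta_mx 0 j).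
  apply: nbhd_cyclic => j; have [t ht] := cy j; exists t; rewrite -ht.
  congr (_ *m bmx _ _ _); first by rewrite map_mxM.
  rewrite /fibre_op raddf_sum; apply: eq_bigr => i _ /=.
  by rewrite map_mxZ rmorphMn rmorphXn homK map_mxM map_mxD map_mxZ homK.
apply: nbhd_sub (nbhd_and n1 (nbhd_and n2 n3)) => D v [[R2 hR2] [sp cyc]].
rewrite frep_map_comp -/y.
apply: (@normal_form _ _ _ _ _ n_gt0 c_gt0 (@torsionfree_calg _ D) (frep_map v y) (relations_map v ry)
  (calg_str D k) (map_mx v gi) _ _ R2) => //.
  have := congr1 (map_mx v) egi; rewrite map_mxM map_mx1 map_mxD map_mxZ homK.
  by move=> e; exact: e.
move=> j; have [t ht] := cyc j; exists t; rewrite -ht.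
congr (_ *m bmx _ _ _); first by rewrite map_mxM.
rewrite /fibre_op raddf_sum; apply: eq_bigr => i _ /=.
by rewrite map_mxZ rmorphMn rmorphXn homK map_mxM map_mxD map_mxZ homK.
Qed.
End NormalFormNear.

(** * Stability of the normal form *)

Section PhiStable.
Context (R : realType) (K : fieldType) (th1 th2 th3 th4 : R) (n c d : nat)
  (n_gt0 : (0 < n)%N) (c_gt0 : (0 < c)%N) (h1 : 0 < th1) (h2 : - th1 < th2)
  (h2' : th2 < - ((c%:R - 1) / c%:R) * th1) (h3 : th3 < 0) (h4 : th4 < 0)
  (h5 : 0 < th1 + th2 + (th3 + th4) * d%:R).

(** A1 + k A2 = 1 puts S1 inside S2, and E maps S2 to S1. If the dimensions are equal, S1 is
    invariant under D and E, so it is zero once l kills it; if S1 is everything, surjectivity of F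
    fills S1' and S2'. All other cases are covered by the slope estimates. *)
Lemma Phi_stable (al : adhm c d K) (k : K) : pregood al ->
  stable th1 th2 th3 th4 (Phi n k al).
Proof.
case=> hT hD hE [Rm FR].
have key (S1 S2 : {vspace 'cV[K]_c}) (S1' S2' : {vspace 'cV[K]_d}) :
    preserved (Phi n k al) S1 S2 S1' S2' ->
  ((forall v, v \in S1 -> fl (Phi n k al) *m v = 0) ->
   slope th1 th2 th3 th4 (\dim S1) (\dim S2) (\dim S1') (\dim S2') < 0 \/
   [/\ S1 = 0%VS, S2 = 0%VS, S1' = 0%VS & S2' = 0%VS]) /\
  (slope th1 th2 th3 th4 (\dim S1) (\dim S2) (\dim S1') (\dim S2')
     < slope th1 th2 th3 th4 c c d d \/
   [/\ S1 = fullv, S2 = fullv, S1' = fullv & S2' = fullv]).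
  move=> [pA pC _ _ [pF1 pF2]]; rewrite /= in pA pC pF1 pF2.
  have s12 : (S1 <= S2)%VS.
    apply/subvP => v hv; have [a1 a2] := pA v hv.
    rewrite -[v]mul1mx -(subrK (k *: tD (aT al)) 1%:M) mulmxDl memvD //.
    by rewrite -scalemxAl memvZ.
  have sE v : v \in S2 -> tE (aT al) *m v \in S1.
    move=> hv; rewrite -(sum_mxC n_gt0 k (tD (aT al)) (tE (aT al))) mulmx_suml.
    by apply: memv_suml => i _; rewrite -scalemxAl memvZ // pC.
  split.
    move=> hl; case: (ltnP (\dim S1) (\dim S2)) => [lt|le].
      by left; apply: (slope_kerE c_gt0) => //; exact: dim_cV.
    have e12 : S1 = S2 by apply/eqP; rewrite eqEdim s12.
    have st t v : v \in S1 -> tmx (aT al) t *m v \in S1.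
      elim: t v => [a| | |s IHs t IHt|s IHs t IHt] v hv; rewrite /tmx /=.
      - by rewrite mul_scalar_mx memvZ.
      - by rewrite e12; have [] := pA v hv.
      - by apply: sE; rewrite -e12.
      - by rewrite mulmxDl memvD ?IHs ?IHt.
      - by rewrite -mulmxA; apply: IHs; apply: IHt.
    have S10 : S1 = 0%VS.
      apply/eqP; rewrite -subv0; apply/subvP => v hv; rewrite memv0; apply/eqP/colP => j.
      have [_ /(_ j)[t ht]] := hT; have := hl _ (st t v hv); rewrite mulmxA ht -rowE.
      by move=> /matrixP/(_ 0 0); rewrite !mxE.
    have S20 : S2 = 0%VS by rewrite -e12.
    rewrite S10 S20 /slope !dimv0 !mulr0 !add0r.
    case: (posnP (\dim S1')) => [/eqP|s3].
      rewrite dimv_eq0 => /eqP S30; case: (posnP (\dim S2')) => [/eqP|s4].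
        by rewrite dimv_eq0 => /eqP S40; right.
      by left; rewrite S30 dimv0 mulr0 add0r nmulr_rlt0 // ltr0n.
    left; apply: ltr_wnDr; first by rewrite mulr_le0_ge0 ?(ltW h4) ?ler0n.
    by rewrite nmulr_rlt0 // ltr0n.
  case: (ltnP (\dim S1) c) => lt.
    by left; apply: slope_imE; rewrite ?dimvS ?dim_cV.
  have full m (S : {vspace 'cV[K]_m}) : (forall v, v \in S) -> S = fullv.
    by move=> h; apply/eqP; rewrite eqEsubv subvf; apply/subvP => v _; exact: h.
  have f1 : S1 = fullv by apply/eqP; rewrite eqEdim subvf dim_fullcV.
  have f2 : S2 = fullv by apply/eqP; rewrite eqEsubv subvf -{1}f1.
  right; split=> //; apply: full => v.
    by rewrite -[v]mul1mx -FR -mulmxA pF1 // f1 memvf.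
  by rewrite -[v]mul1mx -FR -mulmxA pF2 // f2 memvf.
split=> S1 S2 S1' S2' /key[a b]; split=> hl.
- by case: (a hl) => [/ltW//|[-> -> -> ->]]; rewrite /slope !dimv0 !mulr0 !addr0.
- by case: b => [/ltW//|[-> -> -> ->]]; rewrite !dim_fullcV.
- by move=> h; case: (a hl).
- by move=> h; case: b.
Qed.
End PhiStable.

(** * Representations with the same subschemes lie in the same orbit *)

Section TripleMaps.
Context (K : closedFieldType) (n : nat).

(* A morphism of triples is dual to a surjection of the quotient algebras. *)
Definition intertwines m m' (A : comPzRingType) (T : triple m A) (U : triple m' A)
    (g : 'M[A]_(m', m)) : Prop :=
  [/\ tl U *m g = tl T, tD U *m g = g *m tD T & tE U *m g = g *m tE T].

Lemma intertwines_tmx m m' (A : comPzRingType) (T : triple m A) (U : triple m' A) g t :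
  intertwines T U g -> tmx U t *m g = g *m tmx T t.
Proof.
case=> _ hD hE; elim: t => [a| | |s hs t ht|s hs t ht]; rewrite /tmx //=.
- by rewrite mul_scalar_mx mul_mx_scalar.
- by rewrite mulmxDl mulmxDr -!/(tmx _ _) hs ht.
- by rewrite -mulmxA -!/(tmx _ _) ht mulmxA hs -mulmxA.
Qed.

Lemma intertwines_uniq m m' (A : comPzRingType) (T : triple m A) (U : triple m' A) g g' :
  cocyclic U -> intertwines T U g -> intertwines T U g' -> g = g'.
Proof.
move=> hU hg hg'; apply/row_matrixP => j; have [t ht] := hU.2 j.
rewrite [LHS]rowE [RHS]rowE -ht -!mulmxA (intertwines_tmx t hg) (intertwines_tmx t hg') !mulmxA.
by case: hg => -> _ _; case: hg' => -> _ _.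
Qed.

Lemma intertwines_comp m m' m'' (A : comPzRingType) (T : triple m A) (U : triple m' A)
    (V : triple m'' A) g h : intertwines T U g -> intertwines U V h -> intertwines T V (h *m g).
Proof.
case=> a1 a2 a3 [b1 b2 b3]; split; first by rewrite mulmxA b1.
  by rewrite mulmxA b2 -mulmxA a2 mulmxA.
by rewrite mulmxA b3 -mulmxA a3 mulmxA.
Qed.

Lemma intertwines_id m (A : comPzRingType) (T : triple m A) : intertwines T T 1%:M.
Proof. by split; rewrite ?mulmx1 ?mul1mx. Qed.

Lemma alg_mx_free m (A : calg K) (T : triple m A) (hT : cocyclic T) p (M : 'M[A]_(p, m)) :
  map_mx (alg_in hT) M *m (\col_j alg_basis hT j) = 0 -> M = 0.
Proof.
move=> e; apply/matrixP => i j; rewrite [RHS]mxE.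
have := congr1 (fun v : 'cV_p => v i 0) e; rewrite mxE [RHS]mxE => ei.
apply: (@alg_lin_free _ _ _ _ hT (fun j => M i j)); rewrite -[RHS]ei.
by apply: eq_bigr => a _; rewrite !mxE.
Qed.

(** The universal point of T is a point of U; its U-eigenvector, expanded in the basis of [alg hT],
    gives the rows of g. *)
Lemma Zt_sub_intertwines m m' (A : calg K) (k : K) (T : triple m A) (U : triple m' A) :
  cocyclic T -> cocyclic U -> (forall B z, Zt n k T B z -> Zt n k U B z) ->
  exists g, intertwines T U g.
Proof.
move=> hT hU sub; set w := (\col_j alg_basis hT j); have ew := alg_eig hT.
have : Zt n k T (alg hT) (alg_in hT, mkXi n (hk k (algX hT) (algY hT))).
  by exists (algX hT), (algY hT), w.
move=> /sub[a [b [w' [e hw']]]].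
have {}e : mkXi n (hk k (algX hT) (algY hT)) = mkXi n (hk k a b) := e.
have [ea eb] := mkXi_hk_inj e; rewrite -{}ea -{}eb in hw' => {a b e}.
have /ex_choice[G hG] (j : 'I_m') : exists r : 'I_m -> A,
    w' j 0 = \sum_i alg_in hT (r i) * alg_basis hT i.
  by elim/alg_ind: (w' j 0) => t; rewrite alg_basisE; eexists.
pose g : 'M[A]_(m', m) := \matrix_(i, j) G i j; exists g.
have ew' : w' = map_mx (alg_in hT) g *m w.
  by apply/colP => i; rewrite !mxE hG; apply: eq_bigr => j _; rewrite !mxE.
have [u1 u2 u3] := hw'; have [t1 t2 t3] := ew; rewrite -/w in t1 t2 t3.
rewrite /= in u1 u2 u3 t1 t2 t3.
split; apply/eqP; rewrite -subr_eq0; apply/eqP; apply: (alg_mx_free (hT := hT));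
  rewrite map_mxB mulmxBl !map_mxM -/w -?mulmxA -ew' ?t1 ?t2 ?t3 ?u1 ?u2 ?u3 ?subrr //.
- by rewrite -scalemxAr -ew' subrr.
- by rewrite -scalemxAr -ew' subrr.
Qed.
End TripleMaps.

Section PhiOrbit.
Context (K : closedFieldType) (n c d c' : nat) (A : calg K) (k : K) (x y : adhm c d A)
  (gx : good c' x) (gy : good c' y) (Rx Ry : 'M[A]_(c, d)) (Nx Ny : 'M[A]_(c, c'))
  (Px Py : 'M[A]_(c', c)) (sx : split_by (aF x) Rx Nx Px) (sy : split_by (aF y) Ry Ny Py).

Lemma kerN_intertwines (z : adhm c d A) R N P : good c' z -> @split_by c d c' A (aF z) R N P ->
  intertwines (ker_triple z N P) (aT z) N.
Proof.
move=> [_ hD hE _] s; split=> //=; [exact: (kerN s hD)|exact: (kerN s hE)].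
Qed.

(** By uniqueness of intertwiners, g restricted to the kernel of F is h, so F' g kills N and factors
    through F. *)
Lemma kernel_map (z z' : adhm c d A) R N P R' N' P' g h :
  good c' z -> good c' z' -> @split_by c d c' A (aF z) R N P -> @split_by c d c' A (aF z') R' N' P' ->
  intertwines (aT z) (aT z') g -> intertwines (ker_triple z N P) (ker_triple z' N' P') h ->
  aF z' *m g = aF z' *m g *m R *m aF z.
Proof.
move=> gz gz' s s' hg hh.
have e : g *m N = N' *m h.
  apply: intertwines_uniq (intertwines_comp (kerN_intertwines gz s) hg)
    (intertwines_comp hh (kerN_intertwines gz' s')); by case: gz'.
case: s => _ _ _ s4; case: s' => _ s2 _ _.
rewrite -[LHS]mulmx1 -s4 mulmxDr !mulmxA -[X in _ + X *m P]mulmxA e.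
by rewrite (mulmxA (aF z')) s2 !mul0mx addr0.
Qed.

(** Equal larger subschemes give mutually inverse intertwiners, by uniqueness; equal smaller ones
    make these respect the kernels of F, hence induce isomorphisms on the targets of F. *)
Lemma Phi_orbit :
  (forall B z, Zt n k (aT x) B z <-> Zt n k (aT y) B z) ->
  (forall B z, Zt n k (ker_triple x Nx Px) B z <-> Zt n k (ker_triple y Ny Py) B z) ->
  same_orbit (Phi n (calg_str A k) x) (Phi n (calg_str A k) y).
Proof.
move=> eT eK; have [hTx hDx hEx _] := gx; have [hTy hDy hEy _] := gy.
have kcx := ker_cocyclic sx hTx hDx hEx; have kcy := ker_cocyclic sy hTy hDy hEy.
have [g1 hg] := Zt_sub_intertwines hTx hTy (fun B z => (eT B z).1).
have [g1' hg'] := Zt_sub_intertwines hTy hTx (fun B z => (eT B z).2).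
have [h hh] := Zt_sub_intertwines kcx kcy (fun B z => (eK B z).1).
have [h' hh'] := Zt_sub_intertwines kcy kcx (fun B z => (eK B z).2).
have e1 : g1' *m g1 = 1%:M.
  exact: intertwines_uniq hTx (intertwines_comp hg hg') (intertwines_id _).
have e2 : g1 *m g1' = 1%:M := mulmx1C e1.
have [g3 f1] : exists g3, aF y *m g1 = g3 *m aF x.
  by exists (aF y *m g1 *m Rx); exact: (kernel_map gx gy sx sy hg hh).
have [g3' f2] : exists g3', aF x *m g1' = g3' *m aF y.
  by exists (aF x *m g1' *m Ry); exact: (kernel_map gy gx sy sx hg' hh').
have Fx (X X' : 'M[A]_d) : X *m aF x = X' *m aF x -> X = X'.
  by case: sx => FR _ _ _ /(congr1 (mulmx^~ Rx)); rewrite -!mulmxA FR !mulmx1.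
have e3 : g3' *m g3 = 1%:M.
  by apply: Fx; rewrite -mulmxA -f1 mulmxA -f2 -mulmxA e1 mulmx1 mul1mx.
have e4 : g3 *m g3' = 1%:M := mulmx1C e3.
case: hg => l1 d1 E1.
have d3 : aD y *m g3 = g3 *m aD x.
  by apply: Fx; rewrite -!mulmxA -f1 -hDx !mulmxA -f1 -hDy -!mulmxA d1.
have E3 : aE y *m g3 = g3 *m aE x.
  by apply: Fx; rewrite -!mulmxA -f1 -hEx !mulmxA -f1 -hEy -!mulmxA E1.
exists g1, g1, g3, g3; split.
  by split; [exists g1'|exists g1'|exists g3'|exists g3'].
split; last split; last split => //=.
- split=> [||t] //=; apply/esym; first exact/intertwine_one_sub/esym.
  by apply: intertwine_mxC.
- split=> [||t] //=; apply/esym; first exact/intertwine_one_sub/esym.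
  by apply: intertwine_mxC.
- by move=> q; rewrite mulmx0.
Qed.
End PhiOrbit.

Lemma poly_nonroot (R : realType) (q : {poly R[i]}) : q != 0 -> exists k, q.[k] != 0.
Proof.
move=> q0; apply: contrapT => /forallNP h.
have ur : uniq [seq (i%:R : R[i]) | i <- iota 0 (size q)].
  by rewrite map_inj_uniq ?iota_uniq // => i j /eqP; rewrite eqr_nat => /eqP.
have := max_poly_roots q0 _ ur; rewrite size_map size_iota ltnn => /(_ _)/notF; apply.
by apply/allP => a _; apply/rootP; apply: contrapT => /eqP; exact: h.
Qed.

Section Orbits.
Context (R : realType).
Local Notation K := R[i].
Context (th1 th2 th3 th4 : R) (n c d c' : nat) (n_gt0 : (0 < n)%N) (c_gt0 : (0 < c)%N)
  (ec : c = (d + c')%N) (h1 : 0 < th1) (h2 : - th1 < th2)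
  (h2' : th2 < - ((c%:R - 1) / c%:R) * th1) (h3 : th3 < 0) (h4 : th4 < 0)
  (h5 : 0 < th1 + th2 + (th3 + th4) * d%:R).

(** A non-root of the product of the two pencil polynomials gives one k for both representations;
    their normal forms near p are compared by [Phi_orbit]. *)
Lemma stable_orbit (A : calg K) (x y : frep n c d A) (p : hom A (base K)) :
  relations x -> relations y ->
  stable th1 th2 th3 th4 (frep_map p x : frep n c d K) ->
  stable th1 th2 th3 th4 (frep_map p y : frep n c d K) ->
  (forall b B z, Zr b x B z <-> Zr b y B z) ->
  nbhd p (fun B u => same_orbit (frep_map u x) (frep_map u y)).
Proof.
move=> rx ry sx sy e.
have [q q0 hq] := stable_pencil c_gt0 h1 h2 h2' h5 (relations_map p rx) sx.
have [r r0 hr] := stable_pencil c_gt0 h1 h2 h2' h5 (relations_map p ry) sy.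
have [k] := poly_nonroot (mulf_neq0 q0 r0); rewrite hornerM mulf_eq0 negb_or => /andP[kq kr].
have nx := normal_form_near n_gt0 c_gt0 ec h1 h2 h2' h3 h4 h5 rx sx (hq k kq).
have ny := normal_form_near n_gt0 c_gt0 ec h1 h2 h2' h3 h4 h5 ry sy (hr k kr).
apply: nbhd_sub (nbhd_and nx ny) => B u [[al [ga oa]] [be [gb ob]]].
have eZ b D z : Zr b (Phi n (calg_str B k) al) D z <-> Zr b (Phi n (calg_str B k) be) D z.
  case: z => v z; rewrite -(Zr_orbit b oa) -(Zr_orbit b ob).
  by split=> /Zr_base hz; apply/Zr_base/e.
apply: same_orbit_trans oa _; apply: same_orbit_trans (same_orbit_sym ob).
have [_ _ _ [Ra [Na [Pa sa]]]] := ga; have [_ _ _ [Rb [Nb [Pb sb]]]] := gb.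
apply: (Phi_orbit ga gb sa sb) => D z.
  by rewrite -(Zr_Phi_false n_gt0 k ga) -(Zr_Phi_false n_gt0 k gb).
by rewrite -(Zr_Phi_true n_gt0 k ga sa) -(Zr_Phi_true n_gt0 k gb sb).
Qed.
End Orbits.

(** * A criterion for geometric quotients *)

Section LocalQuotient.
Context (R : realType).
Local Notation K := R[i].
Context (X M : functor K) (E : forall A : calg K, X A -> X A -> Prop) (pi : mor X M)
  (inv : forall A (x y : X A), E A x y -> pi A x = pi A y)
  (lift : forall (A : calg K) (m : M A) (p : hom A (base K)),
     nbhd p (fun B u => exists x, pi B x = res u m))
  (orb : forall (A : calg K) (x y : X A) (p : hom A (base K)), pi A x = pi A y ->
     nbhd p (fun B u => E B (res u x) (res u y))).

Lemma quotient_lift_base (m : M (base K)) : exists x, pi _ x = m.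
Proof. by have [x hx] := nbhd_pt (lift m (hom_id (base K))); exists x; rewrite hx res_id. Qed.

(** Openness at a closed point of M is tested on a local lift to X. *)
Lemma quotient_submersive (V : M (base K) -> Prop) :
  zariski_open V <-> zariski_open (fun x => V (pi (base K) x)).
Proof.
split=> -[U oU hU].
  by exists (preim pi U); [exact: is_open_preim|move=> x; rewrite hU].
pose W : sub M := @Sub K M (fun A m => forall p : hom A (base K), V (res p m))
  (fun A B u m h p => eq_ind _ V (h (hom_comp p u)) _ (res_comp p u m)).
have WK m : W _ m <-> V m.
  split=> [h|h p]; first by rewrite -(res_id m); exact: h.
  have -> : p = hom_id (base K); last by rewrite res_id.
  by apply: hom_ext => a; exact: (homK p a).
exists W => [|x]; last by rewrite WK.
apply: open_crit.
  move=> A m h p; apply/WK; exact: (nbhd_pt (nbhd_locally p h)).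
move=> A m p /WK hp; apply: nbhd_trans; apply: nbhd_sub (lift m p) => B u [x hx] q eq.
have /(open_nbhd oU) : U _ (res q x).
  by apply/hU; rewrite mor_nat hx -res_comp eq.
apply: nbhd_sub => D v hv r.
have /hU : U _ (res r (res v x)) by exact: mem_res.
by rewrite !mor_nat hx -!res_comp hom_compA.
Qed.

(** The function on M is obtained by evaluating f on local lifts. Two lifts are locally in one
    orbit, so the values agree and glue. *)
Lemma quotient_functions (V : sub M) (f : mor (sub_functor (preim pi V)) (affine_line K)) :
  (forall (A : calg K) (x y : sub_functor (preim pi V) A),
       E (proj1_sig x) (proj1_sig y) -> f A x = f A y) ->
  exists! g : mor (sub_functor V) (affine_line K),
    forall (A : calg K) (x : X A) (hx : V A (pi A x)),
      f A (exist _ x hx) = g A (exist _ (pi A x) hx).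
Proof.
move=> finv.
have fE (A : calg K) (x y : X A) hx hy : pi A x = pi A y ->
    f A (exist _ x hx) = f A (exist _ y hy).
  move=> e; apply: eq_locally; apply: locally_nbhd => p.
  apply: nbhd_sub (orb p e) => B u hE.
  change (res u (f A (exist _ x hx)) = res u (f A (exist _ y hy))).
  by rewrite -!mor_nat; apply: finv.
pose S (A : calg K) (m : sub_functor V A) (B : calg K) (u : hom A B) :=
  exists x, pi B x = res u (sval m).
have SV (A : calg K) (m : sub_functor V A) (B : calg K) (u : hom A B) x :
    pi B x = res u (sval m) -> V B (pi B x).
  by move=> ->; apply: mem_res; exact: (svalP m).
pose s A m B u (h : @S A m B u) : B :=
  f B (exist _ (sval (cid h)) (SV A m B u _ (svalP (cid h)))).
have sE A m B u (h : @S A m B u) x hx : pi B x = res u (sval m) -> s A m B u h = f B (exist _ x hx).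
  by move=> e; apply: fE; rewrite (svalP (cid h)) e.
have glue (A : calg K) (m : sub_functor V A) : exists! a : A, forall B (u : hom A B) (hu : @S A m B u), u a = s A m B u hu.
  apply: glue_elements.
  - by move=> B D v u [x hx]; exists (res v x); rewrite mor_nat hx -res_comp.
  - by apply: locally_nbhd => p; exact: lift.
  - move=> B D v u hu hvu; have [x hx] := hu.
    rewrite (sE _ _ _ _ hu x (SV _ _ _ _ _ hx) hx) -[v _]/(res v _) -mor_nat.
    by apply: fE => /=; rewrite mor_nat hx (svalP (cid hvu)) res_comp.
pose g0 (A : calg K) (m : sub_functor V A) : affine_line K A := sval (cid (glue A m)).
have g0E (A : calg K) (m : sub_functor V A) (B : calg K) (u : hom A B) x hx : pi B x = res u (sval m) -> u (g0 A m) = f B (exist _ x hx).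
  move=> e; have h : @S A m B u by exists x.
  by rewrite ((svalP (cid (glue A m))).1 B u h) (sE _ _ _ _ h x hx e).
have g0_nat (A B : calg K) (u : hom A B) (m : sub_functor V A) : g0 B (res u m) = res u (g0 A m).
  apply: eq_locally; apply: locally_nbhd => p; apply: nbhd_sub (lift (sval (res u m)) p) => D v [x hx].
  have hV := SV _ _ _ _ _ hx.
  rewrite (g0E _ _ _ _ _ hV hx) -[v _]/((hom_comp v u) (g0 A m)).
  by rewrite (g0E _ _ _ _ _ hV) // hx /= res_comp.
exists (Mor g0_nat); split.
  move=> A x hx; apply/esym.
  by apply: (g0E A (exist _ (pi A x) hx) A (hom_id A) x hx); rewrite res_id.
move=> g hg; apply: mor_ext => A m; apply: eq_locally; apply: locally_nbhd => p.
apply: nbhd_sub (lift (sval m) p) => B u [x hx].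
have hV := SV _ _ _ _ _ hx; rewrite (g0E _ _ _ _ _ hV hx) hg.
rewrite -[u _]/(res u _) -mor_nat; congr (g B _); apply: exist_eq => /=.
by rewrite hx.
Qed.

Lemma quotient_of_local : geometric_quotient E pi.
Proof.
split=> // [||V|V _]; [exact: quotient_lift_base| |exact: quotient_submersive|exact: quotient_functions].
move=> x y /(orb (hom_id (base K)))/nbhd_pt.
by rewrite !res_id.
Qed.
End LocalQuotient.

(** * The quotient map *)

Section QuotientMap.
Context (R : realType).
Local Notation K := R[i].
Context (th1 th2 th3 th4 : R) (n c d c' : nat) (n_gt0 : (0 < n)%N) (c_gt0 : (0 < c)%N)
  (ec : c = (d + c')%N) (h1 : 0 < th1) (h2 : - th1 < th2)
  (h2' : th2 < - ((c%:R - 1) / c%:R) * th1) (h3 : th3 < 0) (h4 : th4 < 0)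
  (h5 : 0 < th1 + th2 + (th3 + th4) * d%:R).
Local Notation X := (stable_reps th1 th2 th3 th4 n c d).
Local Notation H := (nested_Hilb (Xi K n) c' c).

Lemma rep_triple (A : calg K) (x : X A) :
  locally (fun B (u : hom A B) =>
    is_triple c (Zr false (sval (sval x))) u /\ is_triple c' (Zr true (sval (sval x))) u).
Proof.
case: x => -[x rx] /= sx; apply: locally_nbhd => p.
have [q q0 hq] := stable_pencil c_gt0 h1 h2 h2' h5 (relations_map p rx) (sx p).
have [k kq] := poly_nonroot q0.
have := normal_form_near n_gt0 c_gt0 ec h1 h2 h2' h3 h4 h5 rx (sx p) (hq k kq).
apply: nbhd_sub => B u [al [ga oa]].
have [hT hD hE [Ra [Na [Pa sa]]]] := ga; split.
  exists k, (aT al); split=> // D v y.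
  by rewrite Zr_base (Zr_orbit _ oa) (Zr_Phi_false n_gt0 k ga).
exists k, (ker_triple al Na Pa); split; first exact: (ker_cocyclic sa hT hD hE).
by move=> D v y; rewrite Zr_base (Zr_orbit _ oa) (Zr_Phi_true n_gt0 k ga sa).
Qed.

Lemma rep_family (A : calg K) (x : X A) :
  nested_family c' c (Zr true (sval (sval x))) (Zr false (sval (sval x))).
Proof.
have l1 : locally (is_triple c (Zr false (sval (sval x)))).
  by apply: locally_sub (rep_triple x) => B u [].
have l2 : locally (is_triple c' (Zr true (sval (sval x)))).
  by apply: locally_sub (rep_triple x) => B u [].
have zl b : is_local (Zr b (sval (sval x))) := @Zr_local _ _ _ _ b _ _.
split; [exact: (@loc_triple_closed _ _ _ _ _ (zl true) l2)|
  exact: (@loc_triple_closed _ _ _ _ _ (zl false) l1)| |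
  exact: (loc_triple_finite_flat (zl true) l2)|exact: (loc_triple_finite_flat (zl false) l1)].
by move=> B z; exact: Zr_sub.
Qed.

Definition hilb_pt (A : calg K) (x : X A) : H A :=
  exist (fun Z => nested_family c' c Z.1 Z.2) (_, _) (rep_family x).

Lemma hilb_pt_nat (A B : calg K) (u : hom A B) (x : X A) :
  hilb_pt (res u x) = res u (hilb_pt x).
Proof.
by apply: exist_eq; congr pair; apply: sub_ext => D [v y]; apply: iff_sym; exact: Zr_base.
Qed.

Definition hilb_map : mor X H := Mor hilb_pt_nat.

Lemma hilb_map_eq (A : calg K) (x : X A) (Z : H A) :
  (forall B z, Zr false (sval (sval x)) B z <-> (sval Z).2 B z) ->
  (forall B z, Zr true (sval (sval x)) B z <-> (sval Z).1 B z) -> hilb_map A x = Z.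
Proof.
by move=> e1 e2; apply: exist_eq; rewrite (surjective_pairing (sval Z)); congr pair; apply: sub_ext.
Qed.

Lemma hilb_map_Zr (A : calg K) (x y : X A) b : hilb_map A x = hilb_map A y ->
  forall B z, Zr b (sval (sval x)) B z <-> Zr b (sval (sval y)) B z.
Proof.
move=> e B z; have e1 : Zr true (sval (sval x)) = Zr true (sval (sval y)) := congr1 (fun Z => (sval Z).1) e.
have e2 : Zr false (sval (sval x)) = Zr false (sval (sval y)) := congr1 (fun Z => (sval Z).2) e.
by case: b; rewrite ?e1 ?e2.
Qed.

Lemma Phi_stable_locus (A : calg K) (k : K) (al : adhm c d A) : pregood al ->
  forall p : hom A (base K),
  stable th1 th2 th3 th4 (frep_map p (Phi n (calg_str A k) al) : frep n c d K).
Proof.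
move=> gal p; rewrite Phi_map homK; apply: Phi_stable => //; exact: pregood_map.
Qed.

Definition Phi_pt (A : calg K) (k : K) (al : adhm c d A) (g : pregood al) : X A :=
  exist _ (exist _ (Phi n (calg_str A k) al) (Phi_relations _ _ g)) (Phi_stable_locus k g).

Lemma Phi_pt_res (A B : calg K) (u : hom A B) (k : K) (al : adhm c d A) (g : pregood al) :
  res u (Phi_pt k g) = Phi_pt k (pregood_map u g).
Proof. by apply: exist_eq; apply: exist_eq; rewrite /= Phi_map homK. Qed.

Lemma hilb_orbit (A : calg K) (x y : X A) (p : hom A (base K)) :
  hilb_map A x = hilb_map A y ->
  nbhd p (fun B u => same_orbit (sval (sval (res u x))) (sval (sval (res u y)))).
Proof.
move=> e; apply: (stable_orbit n_gt0 c_gt0 ec h1 h2 h2' h3 h4 h5 (svalP (sval x)) (svalP (sval y))).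
- exact: (svalP x p).
- exact: (svalP y p).
- by move=> b B z; exact: hilb_map_Zr.
Qed.

Lemma hilb_invariant (A : calg K) (x y : X A) :
  same_orbit (sval (sval x)) (sval (sval y)) -> hilb_map A x = hilb_map A y.
Proof. by move=> o; apply: hilb_map_eq => B z; exact: Zr_orbit. Qed.

(** The inclusion gives an intertwiner g of T' into T; the rows l t_j, with t_j from cocyclicity of
    T', form a left inverse of g. Splitting the transpose of g near p yields a cokernel F of g with
    free target of rank d, to which D and E descend. *)
Lemma nested_triples_lift (A : calg K) (k : K) (T : triple c A) (T' : triple c' A)
    (p : hom A (base K)) : cocyclic T -> cocyclic T' ->
  (forall B z, Zt n k T' B z -> Zt n k T B z) ->
  nbhd p (fun B u => exists al : adhm c d B, exists R N P,
    [/\ good c' al, split_by (aF al) R N P, aT al = tmap u T & ker_triple al N P = tmap u T']).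
Proof.
move=> hT hT' sub; have [g hg] := Zt_sub_intertwines hT' hT sub.
have /ex_choice[t ht] := hT'.2.
pose P0 : 'M[A]_(c', c) := \matrix_j (tl T *m tmx T (t j)).
have P0g : P0 *m g = 1%:M.
  apply/row_matrixP => j; rewrite row_mul rowK -mulmxA (intertwines_tmx _ hg) mulmxA.
  by case: hg => -> _ _; rewrite ht row1.
have e0 : map_mx p g^T *m (map_mx p P0)^T = 1%:M.
  by rewrite -map_trmx -trmx_mul -map_mxM P0g map_mx1 trmx1.
have ec' : c = (c' + d)%N by rewrite addnC.
apply: nbhd_sub (nbhd_split ec' e0) => B u [R1 [N1 [P1 [a1 a2 a3 a4]]]].
set gu := map_mx u g.
have b1 : R1^T *m gu = 1%:M by apply: trmx_inj; rewrite trmx_mul trmxK trmx1 map_trmx.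
have b2 : N1^T *m gu = 0 by apply: trmx_inj; rewrite trmx_mul trmxK trmx0 map_trmx.
have b3 : N1^T *m P1^T = 1%:M by apply: trmx_inj; rewrite trmx_mul !trmxK trmx1.
have b4 : P1^T *m N1^T + gu *m R1^T = 1%:M.
  by apply: trmx_inj; rewrite linearD /= !trmx_mul !trmxK trmx1 map_trmx addrC.
have hu : intertwines (tmap u T') (tmap u T) gu.
  by case: hg => i1 i2 i3; split; rewrite /= -!map_mxM ?i1 ?i2 ?i3.
pose al : adhm c d B := {| aT := tmap u T; aF := N1^T;
  aD := N1^T *m tD (tmap u T) *m P1^T; aE := N1^T *m tE (tmap u T) *m P1^T |}.
have sp : split_by (aF al) P1^T gu R1^T by split.
have hF (V : 'M[B]_c) (V' : 'M[B]_c') : V *m gu = gu *m V' ->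
    N1^T *m V = N1^T *m V *m P1^T *m N1^T.
  move=> e; rewrite -[LHS]mulmx1 -b4 mulmxDr !mulmxA -[X in _ + X *m _]mulmxA e.
  by rewrite (mulmxA _ gu) b2 !mul0mx addr0.
case: (hu) => i1 i2 i3; exists al, P1^T, gu, R1^T; split=> //.
  split; [exact: cocyclic_map|exact: hF i2|exact: hF i3|by exists P1^T, gu, R1^T].
rewrite /ker_triple /= -!mulmxA i1 i2 i3 !mulmxA b1 !mul1mx.
by case: (tmap u T').
Qed.

(** The chart containing the fibre of the larger family also contains that of the smaller one, so
    both are triples for the same k. *)
Lemma hilb_lift_chart (A : calg K) (Z : H A) (p : hom A (base K)) :
  exists k : 'I_c.+1, nbhd p (fun B u => exists (al : adhm c d B) (g : good c' al),
    hilb_map B (Phi_pt (k : nat)%:R (good_pregood g)) = res u Z).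
Proof.
case: Z => -[Z' Z] hZ; case: (hZ) => /= cZ' cZ sub fZ' fZ.
have [k hk] := chart_near p fZ; exists k.
have n1 := triple_near cZ fZ hk.
have n2 : nbhd p (triple_at c' Z' (k : nat)%:R).
  by apply: triple_near => // y /sub; exact: hk.
apply: nbhd_trans; apply: nbhd_sub (nbhd_and n1 n2) => B u [[T [hT eT]] [T' [hT' eT']]] q _.
have sT D (z : prod_functor (Spec B) (Xi K n) D) : Zt n (k : nat)%:R T' D z -> Zt n (k : nat)%:R T D z.
  by case: z => v y hz; apply/eT/sub/eT'.
apply: nbhd_sub (nested_triples_lift q hT hT' sT) => D v [al [Rm [N [P [ga sa ea ek]]]]].
have e1 E (w : hom D E) (y : Xi K n E) :
    Zr false (Phi n (calg_str D (k : nat)%:R) al) E (w, y) <-> Z E (hom_comp w (hom_comp v u), y).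
  by rewrite (Zr_Phi_false n_gt0 _ ga) ea -Zt_base -eT -hom_compA.
have e2 E (w : hom D E) (y : Xi K n E) :
    Zr true (Phi n (calg_str D (k : nat)%:R) al) E (w, y) <-> Z' E (hom_comp w (hom_comp v u), y).
  by rewrite (Zr_Phi_true n_gt0 _ ga sa) ek -Zt_base -eT' -hom_compA.
exists al, ga; apply: hilb_map_eq => E [w y]; [exact: e1|exact: e2].
Qed.

Lemma hilb_quotient : geometric_quotient
  (fun (A : calg K) (x y : X A) => same_orbit (sval (sval x)) (sval (sval y))) hilb_map.
Proof.
apply: quotient_of_local; [exact: hilb_invariant| |exact: hilb_orbit].
move=> A Z p; have [k] := hilb_lift_chart Z p.
by apply: nbhd_sub => B u [al [g e]]; eexists; exact: e.
Qed.
End QuotientMap.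

(** * The nested Hilbert functor is a sheaf *)

Section HilbSheaf.
Context (R : realType) (n c c' : nat).
Local Notation K := R[i].
Local Notation H := (nested_Hilb (Xi K n) c' c).
Local Notation subX A := (sub (prod_functor (Spec A) (Xi K n))).

Lemma hilb_pt_ext (A : calg K) (Z W : H A) :
  locally (fun B (u : hom A B) => res u Z = res u W) -> Z = W.
Proof.
case: Z => -[Z' Z] hZ; case: W => -[W' W] hW e.
have sub (V V' : subX A) : is_closed V' ->
    locally (fun B (u : hom A B) => forall D (v : hom B D) y,
       V D (hom_comp v u, y) -> V' D (hom_comp v u, y)) -> forall B z, V B z -> V' B z.
  move=> cV' h B [u y] hy; apply: (closed_local cV').
  apply: locally_sub (locally_res u h) => D v hv.
  have := hv D (hom_id D) (res v y); rewrite spec_res_id; apply.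
  exact: (mem_res v hy).
have e' : locally (fun B (u : hom A B) => forall D (v : hom B D) y,
    (Z' D (hom_comp v u, y) <-> W' D (hom_comp v u, y)) /\
    (Z D (hom_comp v u, y) <-> W D (hom_comp v u, y))).
  apply: locally_sub e => B u /(congr1 sval) e D v y.
  have e1 : Z' D (hom_comp v u, y) = W' D (hom_comp v u, y) :=
    congr1 (fun V : subX B * subX B => V.1 D (v, y)) e.
  have e2 : Z D (hom_comp v u, y) = W D (hom_comp v u, y) :=
    congr1 (fun V : subX B * subX B => V.2 D (v, y)) e.
  by rewrite e1 e2.
have [/= a1 a2 _ _ _] := hZ; have [/= b1 b2 _ _ _] := hW.
apply: exist_eq; congr pair; apply: sub_ext => B z; split; apply: sub => //;
  apply: locally_sub e' => D v h E w y; have [[? ?] [? ?]] := h E w y; auto.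
Qed.

Section Glue.
Context (A : calg K) (S : forall B : calg K, hom A B -> Prop)
  (s : forall (B : calg K) (u : hom A B), S B u -> H B)
  (Scomp : forall B D (v : hom B D) (u : hom A B), S B u -> S D (hom_comp v u))
  (Sloc : locally S)
  (scomp : forall B D (v : hom B D) (u : hom A B) (hu : S B u)
     (hvu : S D (hom_comp v u)), s D (hom_comp v u) hvu = res v (s B u hu)).
Context (pr : forall B, H B -> subX B)
  (pr_res : forall B D (v : hom B D) (Z : H B) E (w : hom D E) y,
     pr D (res v Z) E (w, y) <-> pr B Z E (hom_comp w v, y))
  (pr_local : forall B (Z : H B), is_local (pr B Z)).

Definition glue_sub : subX A.
Proof.
refine (@Sub K (prod_functor (Spec A) (Xi K n)) (fun B z =>
  locally (fun D (v : hom B D) => exists h : S (hom_comp v z.1),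
    pr (s h) D (hom_id D, res v z.2))) _).
move=> B D w [u y] h; apply: locally_sub (locally_res w h) => E v.
move=> [hs hy]; move: hs hy; rewrite /= -(hom_compA v w u) => hs hy; exists hs.
exact: (eq_ind _ (fun z => pr (s hs) E (hom_id E, z)) hy _ (res_comp v w y)).
Defined.

Lemma glue_sub_local : is_local glue_sub.
Proof.
move=> B [u y] h; apply: locally_trans; apply: locally_sub h => D v.
apply: locally_sub => E w [hs hy]; move: hs hy; rewrite /= (hom_compA w v u) => hs hy; exists hs.
exact: (eq_ind _ (fun z => pr (s hs) E (hom_id E, z)) hy _ (esym (res_comp w v y))).
Qed.

Lemma glue_subE B (u : hom A B) (hu : S u) D (w : hom B D) y :
  glue_sub D (hom_comp w u, y) <-> pr (s hu) D (w, y).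
Proof.
split=> h.
  apply: (@pr_local _ (s hu)); apply: locally_sub h => E v [hs hy].
  move: hs hy; rewrite /= (hom_compA v w u) => hs.
  by rewrite (scomp hu hs) pr_res hom_compA spec_res_id.
apply: locallyT => E v; rewrite /= (hom_compA v w u); exists (Scomp _ hu).
rewrite (scomp hu) pr_res spec_res_id.
exact: (mem_res v h).
Qed.
End Glue.

(** The subfunctors glue formally. The result is locally given by triples because its local pieces
    are, and this makes it closed, finite and flat of the right degree. *)
Lemma hilb_sheaf : is_sheaf H.
Proof.
move=> A S s Scomp Sloc scomp.
pose pr (b : bool) B (Z : H B) : subX B := if b then (sval Z).1 else (sval Z).2.
have pr_res b B D (v : hom B D) (Z : H B) E (w : hom D E) y :
    pr b D (res v Z) E (w, y) <-> pr b B Z E (hom_comp w v, y) by case: b.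
have pr_closed b B (Z : H B) : is_closed (pr b B Z).
  by case: b; case: (svalP Z).
have pr_local b B (Z : H B) : is_local (pr b B Z) by exact/closed_local/pr_closed.
pose G b := glue_sub s (pr b).
have GE b B (u : hom A B) (hu : S B u) D (w : hom B D) y :
    G b D (hom_comp w u, y) <-> pr b B (s B u hu) D (w, y).
  exact: (glue_subE Scomp scomp (pr_res b) (pr_local b)).
have GZ b : is_local (G b) by exact: (@glue_sub_local _ _ s (pr b)).
pose m b := if b then c' else c.
have Gtr b : locally (is_triple (m b) (G b)).
  apply: locally_trans; apply: locally_sub Sloc => B u hu.
  have ff : finite_flat_of_degree (m b) (pr b B (s B u hu)).
    by rewrite /m /pr; case: (b); case: (svalP (s B u hu)).
  apply: locally_nbhd => p; have [k hk] := chart_near p ff.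
  apply: nbhd_sub (triple_near (pr_closed b B (s B u hu)) ff hk) => D v [T [hT eT]].
  exists (k : nat)%:R, T; split=> // E w y.
  by rewrite (hom_compA w v u); exact: iff_trans (GE b B u hu E (hom_comp w v) y) (eT E w y).
have fam : nested_family c' c (G true) (G false).
  split; [exact: (@loc_triple_closed _ _ _ _ _ (GZ true) (Gtr true))|
    exact: (@loc_triple_closed _ _ _ _ _ (GZ false) (Gtr false))| |
    exact: (loc_triple_finite_flat (GZ true) (Gtr true))|
    exact: (loc_triple_finite_flat (GZ false) (Gtr false))].
  move=> B z; apply: locally_sub => D v [hs hy]; exists hs.
  by case: (svalP (s _ _ hs)) => _ _ sub _ _; exact: sub.
have GR B (u : hom A B) (hu : S B u) :
    res u (exist (fun Z => nested_family c' c Z.1 Z.2) (G true, G false) fam : H A) = s B u hu.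
  apply: exist_eq; rewrite (surjective_pairing (sval (s B u hu))); congr pair;
    apply: sub_ext => D [w y]; [exact: (GE true)|exact: (GE false)].
exists (exist _ (G true, G false) fam); split=> [|W hW]; first exact: GR.
by apply: hilb_pt_ext; apply: locally_sub Sloc => B u hu; rewrite (hW _ _ hu); exact: GR.
Qed.
End HilbSheaf.

(** * Representability of jointly detected conditions *)

Section Represent.
Context (K : closedFieldType) (p q : nat) (S : forall B : calg K, 'M[B]_(p, q) -> Prop).

Inductive eterm : Type :=
  | EC of K | EV of 'I_p & 'I_q | ED of eterm & eterm | EM of eterm & eterm.

Fixpoint eeval (B : calg K) (M : 'M[B]_(p, q)) (t : eterm) : B :=
  match t with
  | EC a => calg_str B a | EV i j => M i j
  | ED s t => eeval M s + eeval M t | EM s t => eeval M s * eeval M t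
  end.

Lemma eeval_map (B D : calg K) (u : hom B D) M t : eeval (map_mx u M) t = u (eeval M t).
Proof.
elim: t => /= [a|i j|s -> t ->|s -> t ->]; rewrite ?homK ?mxE //.
  by rewrite rmorphD.
by rewrite rmorphM.
Qed.

(** The coordinate ring is built without listing equations: polynomial expressions in the entries
    are identified when they agree at every matrix satisfying S. *)
Definition model := {B : calg K & {M : 'M[B]_(p, q) | S M}}.
Definition mval (m : model) (t : eterm) : projT1 m := eeval (sval (projT2 m)) t.

Definition rep_pre : pre_ring.
Proof.
apply: (@family_ring eterm model (fun m => projT1 m) mval (EC 0) (EC 1)
  (EM (EC (-1))) ED EM) => //.
- by move=> m; rewrite /mval /= rmorph0.
- by move=> m; rewrite /mval /= rmorph1.
- by move=> m t; rewrite /mval /= rmorphN1 mulN1r.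
Defined.

Let Q := qring rep_pre.
Definition rep_pi (t : eterm) : Q := @qpi rep_pre t.

Lemma rep_piP s t : rep_pi s = rep_pi t <-> forall m, mval m s = mval m t.
Proof. exact: (@qpiP rep_pre). Qed.
Lemma rep_piD s t : rep_pi (ED s t) = rep_pi s + rep_pi t.
Proof. exact: (@qpiD rep_pre). Qed.
Lemma rep_piM s t : rep_pi (EM s t) = rep_pi s * rep_pi t.
Proof. exact: (@qpiM rep_pre). Qed.

Lemma rep_strB : zmod_morphism (fun a : K => rep_pi (EC a)).
Proof.
move=> x y; apply: (addIr (rep_pi (EC y))); rewrite subrK -rep_piD.
by apply/rep_piP => m; rewrite /mval /= -rmorphD subrK.
Qed.

Lemma rep_strM : monoid_morphism (fun a : K => rep_pi (EC a)).
Proof.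
split=> // x y; rewrite -rep_piM; apply/rep_piP => m.
by rewrite /mval /= rmorphM.
Qed.

Definition rep_str : {rmorphism K -> Q} := mk_rmorph rep_strB rep_strM.

Lemma rep_fg : exists s : seq Q, forall P : Q -> Prop,
  (forall a, P (rep_str a)) -> (forall x, x \in s -> P x) ->
  (forall x y, P x -> P y -> P (x + y)) ->
  (forall x y, P x -> P y -> P (x * y)) -> forall x, P x.
Proof.
exists [seq rep_pi (EV ij.1 ij.2) | ij <- enum [set: 'I_p * 'I_q]] => P hK hP hD hM.
suff h (t : eterm) : P (rep_pi t) by apply: (@qring_ind rep_pre P) => t; exact: h.
elim: t => [a|i j|t1 h1 t2 h2|t1 h1 t2 h2].
- exact: hK.
- by apply: hP; apply/mapP; exists (i, j); rewrite // mem_enum inE.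
- by rewrite rep_piD; exact: hD.
- by rewrite rep_piM; exact: hM.
Qed.

Definition rep_alg : calg K := @CAlg K Q rep_str rep_fg.

Lemma rep_ind (P : rep_alg -> Prop) : (forall t, P (rep_pi t)) -> forall x, P x.
Proof. exact: (@qring_ind rep_pre P). Qed.

Definition rep_univ : 'M[rep_alg]_(p, q) := \matrix_(i, j) rep_pi (EV i j).

Lemma eeval_univ t : eeval rep_univ t = rep_pi t.
Proof.
by elim: t => //= [i j|s -> t ->|s -> t ->]; rewrite ?mxE // (rep_piD, rep_piM).
Qed.

Section RepHom.
Context (B : calg K) (M : 'M[B]_(p, q)) (hM : S M).
Let m : model := existT _ B (exist _ M hM).

Definition rep_hom_fun (x : rep_alg) : B := eeval M (qrepr (P := rep_pre) x).

Lemma rep_hom_pi t : rep_hom_fun (rep_pi t) = eeval M t.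
Proof. exact: (qrepr_pi (P := rep_pre) t m). Qed.

Definition rep_hom : hom rep_alg B.
Proof.
apply: (@mk_hom K rep_alg B rep_hom_fun).
- elim/rep_ind => s; elim/rep_ind => t; rewrite -[rep_pi s + rep_pi t]rep_piD.
  by rewrite !rep_hom_pi.
- elim/rep_ind => s; elim/rep_ind => t; rewrite -[rep_pi s * rep_pi t]rep_piM.
  by rewrite !rep_hom_pi.
- by move=> a; exact: (rep_hom_pi (EC a)).
Defined.

Lemma rep_homE t : rep_hom (rep_pi t) = eeval M t. Proof. exact: rep_hom_pi. Qed.

Lemma rep_hom_univ : map_mx rep_hom rep_univ = M.
Proof. by apply/matrixP => i j; rewrite !mxE rep_homE. Qed.
End RepHom.

Lemma rep_hom_ext (B : calg K) (u v : hom rep_alg B) :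
  map_mx u rep_univ = map_mx v rep_univ -> u = v.
Proof.
move=> e; apply: hom_ext; elim/rep_ind => t.
by rewrite -eeval_univ -!eeval_map e.
Qed.

(** The models are jointly injective on the coordinate ring by construction, so the universal matrix
    satisfies any condition that can be checked through jointly injective families of maps. *)
Lemma rep_univ_mem :
  (forall (U : calg K) (M : 'M[U]_(p, q)),
    (forall x y : U, (forall (B : calg K) (h : hom U B), S (map_mx h M) -> h x = h y) -> x = y) ->
    S M) -> S rep_univ.
Proof.
apply; elim/rep_ind => s; elim/rep_ind => t e; apply/rep_piP => -[B [M hM]].
have := e B (rep_hom hM); rewrite rep_hom_univ => /(_ hM).
by rewrite !rep_homE.
Qed.
End Represent.

(** * Slices *)

Section Slice.
Context (c d : nat) (dl : 'I_c -> 'I_c * 'I_c) (J : 'I_d -> 'I_c).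

(** Exponents below c suffice by the Cayley-Hamilton theorem ([monomial_basis]), which keeps the
    number of charts finite. *)
Definition mono (A : comPzRingType) (T : triple c A) (e : 'I_c * 'I_c) : 'M[A]_c :=
  tD T ^+ e.1 *m tE T ^+ e.2.

Definition mono_term (A : comPzRingType) (e : 'I_c * 'I_c) : bterm A :=
  iter e.1 (BM BX) (iter e.2 (BM BY) (BC 1)).

Lemma tmx_mono (A : comPzRingType) (T : triple c A) e : tmx T (mono_term A e) = mono T e.
Proof.
have eY b : tmx T (iter b (BM BY) (BC 1)) = tE T ^+ b.
  by elim: b => [|b IH]; [rewrite expr0|rewrite exprS -IH].
rewrite /mono /mono_term; elim: (nat_of_ord e.1) => [|a IH]; first by rewrite expr0 mul1mx eY.
by rewrite exprS -[tD T * _]/(tD T *m _) -mulmxA -IH.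
Qed.

Definition colsel (A : comPzRingType) : 'M[A]_(c, d) := \matrix_(i, j) (i == J j)%:R.

Lemma mul_colsel (A : comPzRingType) m (X : 'M[A]_(m, c)) i j : (X *m colsel A) i j = X i (J j).
Proof.
rewrite mxE (bigD1 (J j)) //= mxE eqxx mulr1 big1 ?addr0 // => a /negPf ne.
by rewrite mxE ne mulr0.
Qed.

Lemma map_colsel (A B : comPzRingType) (u : {rmorphism A -> B}) : map_mx u (colsel A) = colsel B.
Proof. by apply/matrixP => i j; rewrite !mxE rmorph_nat. Qed.

(* The rows of M are those of D, E, l and F. *)
Definition slice_triple (A : comPzRingType) (M : 'M[A]_(c + (c + (1 + d)), c)) : triple c A :=
  {| tD := usubmx M; tE := usubmx (dsubmx M); tl := usubmx (dsubmx (dsubmx M)) |}.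

(** D' and E' are determined: F D = D' F and F [colsel] = 1 give D' = F D [colsel], and likewise for
    E'. *)
Definition slice_adhm (A : comPzRingType) (M : 'M[A]_(c + (c + (1 + d)), c)) : adhm c d A :=
  let F := dsubmx (dsubmx (dsubmx M)) in
  {| aT := slice_triple M; aF := F; aD := F *m usubmx M *m colsel A;
     aE := F *m usubmx (dsubmx M) *m colsel A |}.

(** A gauge fixing: c chosen monomials send l to the standard basis, which fixes the basis of V1,
    and d chosen columns of F form the identity, which fixes that of V3. *)
Definition slice (A : comPzRingType) (M : 'M[A]_(c + (c + (1 + d)), c)) : Prop :=
  let x := slice_adhm M in
  [/\ tD (aT x) *m tE (aT x) = tE (aT x) *m tD (aT x),
      forall j, tl (aT x) *m mono (aT x) (dl j) = delta_mx 0 j,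
      aF x *m colsel A = 1%:M, aF x *m tD (aT x) = aD x *m aF x &
      aF x *m tE (aT x) = aE x *m aF x].

Lemma slice_map_triple (A B : comPzRingType) (u : {rmorphism A -> B}) M :
  slice_triple (map_mx u M) = tmap u (slice_triple M).
Proof. by rewrite /slice_triple /tmap /= !map_usubmx !map_dsubmx. Qed.

Lemma slice_map_adhm (A B : comPzRingType) (u : {rmorphism A -> B}) M :
  slice_adhm (map_mx u M) = amap u (slice_adhm M).
Proof.
rewrite /slice_adhm /amap /= slice_map_triple !map_mxM !map_usubmx !map_dsubmx.
by rewrite map_colsel.
Qed.

Lemma map_mono (A B : comPzRingType) (u : {rmorphism A -> B}) T e :
  mono (tmap u T) e = map_mx u (mono T e).
Proof. by rewrite /mono map_mxM !map_mxX. Qed.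

Lemma slice_map (A B : comPzRingType) (u : {rmorphism A -> B}) M :
  slice M -> slice (map_mx u M).
Proof.
rewrite /slice slice_map_adhm => -[a1 a2 a3 a4 a5]; split=> [|j|||] /=.
- by rewrite -!map_mxM a1.
- by rewrite map_mono -map_mxM a2 map_delta_mx.
- by rewrite -(map_colsel u) -map_mxM a3 map_mx1.
- by rewrite -!map_mxM; exact: (congr1 (map_mx u) a4).
- by rewrite -!map_mxM; exact: (congr1 (map_mx u) a5).
Qed.

Lemma slice_pregood (A : comPzRingType) (M : 'M[A]_(c + (c + (1 + d)), c)) :
  slice M -> pregood (slice_adhm M).
Proof.
case=> a1 a2 a3 a4 a5; split=> //; last by exists (colsel A).
by split=> // j; exists (mono_term A (dl j)); rewrite tmx_mono a2.
Qed.

Lemma slice_joint (K : closedFieldType) (U : calg K) (M : 'M[U]_(c + (c + (1 + d)), c)) :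
  (forall x y : U, (forall (B : calg K) (h : hom U B), slice (map_mx h M) -> h x = h y) -> x = y) ->
  slice M.
Proof.
move=> sep.
have sepM a b (X Y : 'M[U]_(a, b)) :
    (forall (B : calg K) (h : hom U B), slice (map_mx h M) -> map_mx h X = map_mx h Y) -> X = Y.
  move=> e; apply/matrixP => i j; apply: sep => B h hs.
  by have /matrixP/(_ i j) := e B h hs; rewrite !mxE.
split=> [|j|||]; apply: sepM => B h; rewrite /slice slice_map_adhm => -[/= a1 a2 a3 a4 a5].
- by rewrite !map_mxM.
- by rewrite map_mxM -map_mono a2 map_delta_mx.
- by rewrite map_mxM map_colsel a3 map_mx1.
- by rewrite map_mxM [RHS]map_mxM; exact: a4.
- by rewrite map_mxM [RHS]map_mxM; exact: a5.
Qed.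
End Slice.

(** * Orbits of normal forms and their meeting with slices *)

Section OrbitPhi.
Context (n c d : nat) (n_gt0 : (0 < n)%N) (A : comPzRingType) (k : A).

Lemma orbit_pencil (x y : frep n c d A) g1 g2 : fA1 y *m g1 = g2 *m fA1 x ->
  fA2 y *m g1 = g2 *m fA2 x -> (fA1 y + k *: fA2 y) *m g1 = g2 *m (fA1 x + k *: fA2 x).
Proof. by move=> e1 e2; rewrite mulmxDl mulmxDr e1 -scalemxAl e2 scalemxAr. Qed.

(** A1 + k A2 is the identity on both sides, so g1 = g2; E is then intertwined because it is a
    combination of the C_q. *)
Lemma orbit_intertwines (x y : adhm c d A) : same_orbit (Phi n k x) (Phi n k y) ->
  exists g g3, [/\ is_GL g, is_GL g3, intertwines (aT x) (aT y) g & aF y *m g = g3 *m aF x].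
Proof.
move=> [g1 [g2 [g3 [g4 [[i1 i2 i3 i4] [[e1 e2 e3] [_ [e4 _ e6 _]]]]]]]].
have g12 : g1 = g2.
  by have := orbit_pencil e1 e2; rewrite /= !subrK mulmx1 mul1mx.
exists g1, g3; split=> //; split=> //; first by rewrite e2 g12.
rewrite -[tE (aT y)](sum_mxC n_gt0 k (tD (aT y))) -[tE (aT x)](sum_mxC n_gt0 k (tD (aT x))).
rewrite mulmx_suml mulmx_sumr; apply: eq_bigr => i _.
by rewrite -scalemxAl -scalemxAr {1}g12 e3.
Qed.

Lemma conj_orbit (x y : adhm c d A) (g : 'M[A]_c) (s : 'M[A]_d) : is_GL g -> is_GL s ->
  intertwines (aT x) (aT y) g -> aF y *m g = s *m aF x ->
  aD y *m s = s *m aD x -> aE y *m s = s *m aE x ->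
  same_orbit (Phi n k x) (Phi n k y).
Proof.
move=> gg gs [l1 d1 E1] f1 d3 E3; exists g, g, s, s; split=> //.
split; last split; last split => //=.
- split=> [||t] //=; apply/esym; first exact/intertwine_one_sub/esym.
  by apply: intertwine_mxC.
- split=> [||t] //=; apply/esym; first exact/intertwine_one_sub/esym.
  by apply: intertwine_mxC.
- by move=> q; rewrite mulmx0.
Qed.

Context (dl : 'I_c -> 'I_c * 'I_c) (J : 'I_d -> 'I_c).

(** The normalisation of M forces the j-th row of g to be l times the j-th monomial in the matrices
    of x. *)
Lemma slice_row (x : adhm c d A) (M : 'M[A]_(c + (c + (1 + d)), c)) g : slice dl J M ->
  intertwines (aT x) (slice_triple M) g -> \matrix_j (tl (aT x) *m mono (aT x) (dl j)) = g.
Proof.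
move=> [_ a2 _ _ _] hg; apply/row_matrixP => j.
have {}a2 : tl (slice_triple M) *m mono (slice_triple M) (dl j) = delta_mx 0 j := a2 j.
have := intertwines_tmx (mono_term A (dl j)) hg; rewrite !tmx_mono => e.
by rewrite rowK [RHS]rowE -a2 -mulmxA e mulmxA; case: hg => ->.
Qed.

(** Between two slice points the forced changes of basis are identities, so an orbit meets the slice
    at most once. *)
Lemma slice_orbit_eq (M M' : 'M[A]_(c + (c + (1 + d)), c)) : slice dl J M -> slice dl J M' ->
  same_orbit (Phi n k (slice_adhm J M)) (Phi n k (slice_adhm J M')) -> M = M'.
Proof.
move=> hM hM' /orbit_intertwines[g [g3 [_ _ hg f]]].
have g1 : g = 1%:M.
  rewrite -(slice_row hM' hg); apply/row_matrixP => j; rewrite rowK row1.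
  by case: hM => _ ->.
rewrite {g}g1 /= in hg f; rewrite mulmx1 in f.
have g31 : g3 = 1%:M.
  case: hM => _ _ a3 _ _; case: hM' => _ _ b3 _ _.
  by have := congr1 (mulmx^~ (colsel J A)) f; rewrite -mulmxA a3 b3 mulmx1.
rewrite g31 mul1mx in f; case: hg => /= l1 d1 E1.
rewrite ?mulmx1 ?mul1mx in l1 d1 E1.
by rewrite -[M]vsubmxK -[M']vsubmxK d1 -[dsubmx M]vsubmxK -[dsubmx M']vsubmxK E1
  -[dsubmx (dsubmx M)]vsubmxK -[dsubmx (dsubmx M')]vsubmxK l1 f.
Qed.
End OrbitPhi.

Lemma map_hom_comp (K : closedFieldType) (A B D : calg K) (v : hom B D) (u : hom A B) k l
    (M : 'M[A]_(k, l)) : map_mx (hom_comp v u) M = map_mx v (map_mx u M).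
Proof. by apply/matrixP => i j; rewrite !mxE. Qed.

Section NormalizeNear.
Context (R : realType) (n c d : nat) (n_gt0 : (0 < n)%N).
Local Notation K := R[i].
Context (dl : 'I_c -> 'I_c * 'I_c) (J : 'I_d -> 'I_c).

(** Q is the change of basis forced by [slice_row], and [s0] inverts the chosen columns of F Q^-1 at
    the point. Both stay invertible nearby, and the transformed data lie in the slice. *)
Lemma normalize_near (B : calg K) (q : hom B (base K)) (k : K) (al : adhm c d B)
    (Q' : 'M[K]_c) (s0 : 'M[K]_d) : pregood al ->
  map_mx q (\matrix_j (tl (aT al) *m mono (aT al) (dl j))) *m Q' = 1%:M ->
  map_mx q (aF al) *m Q' *m colsel J K *m s0 = 1%:M ->
  nbhd q (fun D v => exists M : 'M[D]_(c + (c + (1 + d)), c),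
    slice dl J M /\ same_orbit (Phi n (calg_str D k) (amap v al))
      (Phi n (calg_str D k) (slice_adhm J M))).
Proof.
set Q := \matrix_j _; move=> gal hQ hF.
have hg := nbhd_unitmx hQ; apply: nbhd_trans; apply: nbhd_sub hg => D v [gi egi] q' eq'.
have e1 : map_mx q' gi = Q'.
  have a1 : map_mx q Q *m map_mx q' gi = 1%:M.
    by rewrite -eq' map_hom_comp -map_mxM egi map_mx1.
  by rewrite -[LHS]mul1mx -(mulmx1C hQ) -mulmxA a1 mulmx1.
have /nbhd_unitmx : map_mx q' (map_mx v (aF al) *m gi *m colsel J D) *m s0 = 1%:M.
  by rewrite !map_mxM map_colsel e1 -map_hom_comp eq'.
apply: nbhd_sub => E w [s es]; set be := amap (hom_comp w v) al.
have gbe : pregood be := pregood_map _ gal.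
pose g := map_mx (hom_comp w v) Q; pose gj := map_mx w gi.
have ggj : g *m gj = 1%:M by rewrite /g map_hom_comp -map_mxM egi map_mx1.
have gjg : gj *m g = 1%:M := mulmx1C ggj.
have [W WE] : exists W, W = aF be *m gj *m colsel J E by eexists.
have Ws : W *m s = 1%:M.
  by rewrite -es WE /gj /be /= map_hom_comp !map_mxM map_colsel.
have sW : s *m W = 1%:M := mulmx1C Ws.
pose M : 'M[E]_(c + (c + (1 + d)), c) := col_mx (g *m tD (aT be) *m gj)
  (col_mx (g *m tE (aT be) *m gj) (col_mx (tl (aT be) *m gj) (s *m aF be *m gj))).
have MT : slice_triple M = {| tD := g *m tD (aT be) *m gj; tE := g *m tE (aT be) *m gj;
    tl := tl (aT be) *m gj |}.
  by rewrite /slice_triple /M !(col_mxKd, col_mxKu).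
have MF : dsubmx (dsubmx (dsubmx M)) = s *m aF be *m gj by rewrite /M !col_mxKd.
have MD : usubmx M = g *m tD (aT be) *m gj by rewrite /M col_mxKu.
have ME : usubmx (dsubmx M) = g *m tE (aT be) *m gj by rewrite /M col_mxKd col_mxKu.
have Ml : usubmx (dsubmx (dsubmx M)) = tl (aT be) *m gj by rewrite /M !col_mxKd col_mxKu.
have hi : intertwines (aT be) (slice_triple M) g.
  by rewrite MT; split; rewrite /= -!mulmxA gjg !mulmx1.
case: gbe => -[cDE _] fD fE [Rr hR].
have FDJ (X : 'M[E]_c) (X' : 'M[E]_d) : aF be *m X = X' *m aF be ->
    s *m aF be *m gj *m (g *m X *m gj) *m colsel J E = s *m X' *m W.
  move=> e; rewrite -!mulmxA (mulmxA gj) gjg mul1mx !mulmxA -(mulmxA s (aF be) X) e.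
  by rewrite WE !mulmxA.
have FD (X : 'M[E]_c) (X' : 'M[E]_d) : aF be *m X = X' *m aF be ->
    s *m aF be *m gj *m (g *m X *m gj) =
    s *m aF be *m gj *m (g *m X *m gj) *m colsel J E *m (s *m aF be *m gj).
  move=> e; rewrite (FDJ _ _ e) -!mulmxA (mulmxA W) Ws mul1mx !mulmxA.
  by rewrite -(mulmxA (s *m aF be) gj) !mulmxA -(mulmxA _ gj g) gjg mulmx1 -(mulmxA s _ X) e !mulmxA.
have row_g j : tl (aT be) *m mono (aT be) (dl j) = row j g.
  by rewrite /g -map_row rowK map_mxM -map_mono.
have hsl : slice dl J M.
  have monoE t : mono (slice_triple M) t = g *m mono (aT be) t *m gj.
    have := intertwines_tmx (mono_term E t) hi; rewrite !tmx_mono => e.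
    by rewrite -e -mulmxA ggj mulmx1.
  split; rewrite /slice_adhm /= ?MF.
  - rewrite MD ME -!mulmxA !(mulmxA gj) gjg !mul1mx !mulmxA; congr (_ *m gj).
    by rewrite -!mulmxA cDE.
  - move=> j; rewrite monoE Ml (mulmxA _ (g *m _) gj) (mulmxA _ g) -(mulmxA _ gj g) gjg mulmx1 row_g.
    by rewrite -row_mul ggj row1.
  - by rewrite -sW WE !mulmxA.
  - by rewrite MD; exact: FD fD.
  - by rewrite ME; exact: FD fE.
exists M; split=> //.
have gl m (u u' : 'M[E]_m) : u *m u' = 1%:M -> is_GL u.
  by move=> e; exists u'; split=> //; exact: mulmx1C.
apply: (conj_orbit _ _ (gl _ _ _ ggj) (gl _ _ _ sW)) => //=.
- by rewrite MF -!mulmxA gjg mulmx1.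
- by rewrite MF MD (FDJ _ _ fD) -!mulmxA Ws mulmx1.
- by rewrite MF ME (FDJ _ _ fE) -!mulmxA Ws mulmx1.
Qed.
End NormalizeNear.

(** * Affine charts of the nested Hilbert functor *)

Section MonomialBasis.
Context (K : fieldType).

Lemma pow_span m (D : 'M[K]_m) a : exists f : 'I_m -> K, D ^+ a = \sum_i f i *: D ^+ i.
Proof.
case: m D => [|m] D.
  by exists (fun=> 0); apply/matrixP => -[].
pose p := 'X^a %% char_poly D.
have sp : (size p <= m.+1)%N.
  by rewrite -ltnS -(size_char_poly D) ltn_modp monic_neq0 ?char_poly_monic.
exists (fun i => p`_i).
have -> : D ^+ a = horner_mx D p.
  have := congr1 (horner_mx D) (divp_eq 'X^a (char_poly D)).
  by rewrite rmorphXn /= horner_mx_X rmorphD rmorphM /= Cayley_Hamilton mulr0 add0r.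
have {1}-> : p = \sum_(i < m.+1) p`_i *: 'X^i.
  rewrite -poly_def; apply/polyP => i; rewrite coef_poly; case: ltnP => // h.
  by rewrite nth_default // (leq_trans sp).
rewrite raddf_sum; apply: eq_bigr => i _ /=.
by rewrite linearZ /= rmorphXn /= horner_mx_X.
Qed.

Context (c : nat) (T : triple c K).

(** The span of the rows l D^a E^b with exponents below c contains l and is stable under D and E by
    Cayley-Hamilton, hence is everything; c independent rows are selected from it. *)
Lemma monomial_basis : (0 < c)%N -> cocyclic T -> exists dl : {ffun 'I_c -> 'I_c * 'I_c},
  (\matrix_j (tl T *m mono T (dl j)) : 'M_c) \in unitmx.
Proof.
move=> c0 [hDE hT].
pose V : 'M[K]_(#|{: 'I_c * 'I_c}|, c) := \matrix_i (tl T *m mono T (enum_val i)).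
have inV e : (tl T *m mono T e <= V)%MS.
  by have := row_sub (enum_rank e) V; rewrite rowK enum_rankK.
have pV a b : (tl T *m (tD T ^+ a *m tE T ^+ b) <= V)%MS.
  have [f ->] := pow_span (tD T) a; have [g ->] := pow_span (tE T) b.
  rewrite mulmx_suml mulmx_sumr summx_sub // => i _.
  rewrite mulmx_sumr mulmx_sumr summx_sub // => j _.
  by rewrite -scalemxAl -!scalemxAr !scalemx_sub // (inV (i, j)).
have VV (X : 'M[K]_c) : (forall i j : 'I_c, (tl T *m mono T (i, j) *m X <= V)%MS) ->
    forall r : 'rV_c, (r <= V)%MS -> (r *m X <= V)%MS.
  move=> h r hr; apply: submx_trans (submxMr X hr) _; apply/row_subP => i.
  by rewrite row_mul rowK; case: (enum_val i) => a b; exact: h.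
have VD := VV (tD T) _; have VE := VV (tE T) _.
have tV t : forall r : 'rV_c, (r <= V)%MS -> (r *m tmx T t <= V)%MS.
  elim: t => [a| | |s hs t ht|s hs t ht] r hr; rewrite /tmx /=.
  - by rewrite mul_mx_scalar scalemx_sub.
  - apply: VD => // i j; rewrite /mono /= -!mulmxA -(intertwineX j hDE) (mulmxA (_ ^+ i)).
    by rewrite -[_ *m tD T]/(_ * tD T) -exprSr pV.
  - apply: VE => // i j; rewrite /mono /= -!mulmxA.
    by rewrite -[_ *m tE T]/(_ * tE T) -exprSr pV.
  - by rewrite mulmxDr addmx_sub ?hs ?ht.
  - by rewrite mulmxA; apply: ht; apply: hs.
have lV : (tl T <= V)%MS.
  by have := pV 0%N 0%N; rewrite !expr0 !mulmx1.
have full : row_full V.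
  rewrite -sub1mx; apply/row_subP => j; rewrite row1.
  by have [t <-] := hT j; exact: tV.
exists [ffun j => enum_val (fullrankfun full j)].
have := fullrowsub_unit full; congr (_ \in unitmx); apply/row_matrixP => j.
by rewrite row_rowsub rowK [RHS]rowK [in RHS](ffunE _ j).
Qed.

Lemma column_basis d (F : 'M[K]_(d, c)) (G : 'M[K]_(c, d)) : F *m G = 1%:M ->
  exists J : {ffun 'I_d -> 'I_c}, F *m colsel J K \in unitmx.
Proof.
move=> e; have full : row_full F^T.
  by apply/row_fullP; exists G^T; rewrite -trmx_mul e trmx1.
exists [ffun j => fullrankfun full j]; have := fullrowsub_unit full.
rewrite -unitmx_tr; congr (_ \in unitmx); apply/matrixP => i j.
by rewrite mul_colsel !mxE [in RHS](ffunE _ j).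
Qed.
End MonomialBasis.

Section Charts.
Context (R : realType).
Local Notation K := R[i].
Context (th1 th2 th3 th4 : R) (n c d c' : nat) (n_gt0 : (0 < n)%N) (c_gt0 : (0 < c)%N)
  (ec : c = (d + c')%N) (h1 : 0 < th1) (h2 : - th1 < th2)
  (h2' : th2 < - ((c%:R - 1) / c%:R) * th1) (h3 : th3 < 0) (h4 : th4 < 0)
  (h5 : 0 < th1 + th2 + (th3 + th4) * d%:R).
Local Notation X := (stable_reps th1 th2 th3 th4 n c d).
Local Notation H := (nested_Hilb (Xi K n) c' c).
Local Notation pi := (hilb_map n_gt0 c_gt0 ec h1 h2 h2' h3 h4 h5).
Local Notation Ppt := (Phi_pt n_gt0 c_gt0 h1 h2 h2' h3 h4 h5).

Section OneChart.
Context (k : K) (dl : 'I_c -> 'I_c * 'I_c) (J : 'I_d -> 'I_c).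
Local Notation SL A := ('M[calg_ring A]_(c + (c + (1 + d)), c)).

Definition slice_pt (A : calg K) (M : SL A) (h : slice dl J M) : X A := Ppt k (slice_pregood h).

Lemma slice_pt_res (A B : calg K) (u : hom A B) (M : SL A) (h : slice dl J M) h' :
  res u (slice_pt h) = @slice_pt B (map_mx u M) h'.
Proof.
rewrite Phi_pt_res; apply: exist_eq; apply: exist_eq => /=.
by rewrite slice_map_adhm.
Qed.

(** Equal families come from locally conjugate representations, and matrix entries may be compared
    locally. *)
Lemma slice_pt_eq (A : calg K) (M M' : SL A) (h : slice dl J M) (h' : slice dl J M') :
  pi A (slice_pt h) = pi A (slice_pt h') -> M = M'.
Proof.
move=> e; apply/matrixP => i j; apply: eq_locally; apply: locally_nbhd => p.
apply: nbhd_sub (hilb_orbit p e) => B u; rewrite /= !Phi_map !homK -!(slice_map_adhm J u) => o.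
have := slice_orbit_eq n_gt0 (slice_map u h) (slice_map u h') o.
by move=> /matrixP/(_ i j); rewrite !mxE.
Qed.

Definition chart_sub : sub H.
Proof.
refine (@Sub K H (fun A Z => exists M (h : slice dl J (M : SL A)), pi A (slice_pt h) = Z) _).
move=> A B u Z [M [h <-]]; exists (map_mx u M), (slice_map u h).
by rewrite -(slice_pt_res h (slice_map u h)) mor_nat.
Defined.

Definition chart_alg : calg K :=
  @rep_alg K _ _ (fun (A : calg K) (M : SL A) => slice dl J M).

Definition chart_univ : SL chart_alg := rep_univ _.

Lemma chart_univ_slice : slice dl J chart_univ.
Proof.
apply: (@rep_univ_mem K _ _ (fun (A : calg K) (M : SL A) => slice dl J M)) => U M.
exact: slice_joint.
Qed.

Lemma chart_hom (A : calg K) (Z : H A) : chart_sub A Z ->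
  exists! t : hom chart_alg A, exists h : slice dl J (map_mx t chart_univ), pi A (slice_pt h) = Z.
Proof.
case=> M [h e]; have e0 : map_mx (rep_hom h) chart_univ = M := rep_hom_univ h.
exists (rep_hom h); split.
  by move: h e e0; move=> h e e0; move: (rep_hom h) e0 => t e0; subst M; exists h.
move=> t [h' e']; apply: rep_hom_ext; rewrite -/chart_univ e0.
by apply: (slice_pt_eq (h := h) (h' := h')); rewrite e e'.
Qed.

Lemma chart_of_hom (A : calg K) (t : hom chart_alg A) : chart_sub A
  (pi A (slice_pt (slice_map t chart_univ_slice))).
Proof. by exists (map_mx t chart_univ), (slice_map t chart_univ_slice). Qed.

Definition chart_from (A : calg K) (t : hom chart_alg A) : H A :=
  pi A (slice_pt (slice_map t chart_univ_slice)).

Lemma chart_from_res (A B : calg K) (u : hom A B) (t : hom chart_alg A) :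
  chart_from (hom_comp u t) = res u (chart_from t).
Proof.
rewrite -mor_nat; congr (pi B _); apply: exist_eq; apply: exist_eq => /=.
rewrite Phi_map homK -slice_map_adhm; congr (Phi _ _ (slice_adhm _ _)).
by apply/matrixP => i j; rewrite [LHS]mxE [RHS]mxE [in RHS]mxE.
Qed.

Lemma chart_from_inj (A : calg K) (t t' : hom chart_alg A) :
  chart_from t = chart_from t' -> t = t'.
Proof. by move=> e; apply: rep_hom_ext; exact: slice_pt_eq e. Qed.

Lemma chart_from_surj (A : calg K) (Z : H A) : chart_sub A Z -> exists t, chart_from t = Z.
Proof.
move=> /chart_hom[t [[h e] _]]; exists t; rewrite -e; congr (pi A _).
by apply: exist_eq; apply: exist_eq.
Qed.

Lemma chart_iso : iso (sub_functor chart_sub) (Spec chart_alg).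
Proof.
pose to (A : calg K) (Z : sub_functor chart_sub A) : Spec chart_alg A :=
  sval (cid (chart_from_surj (svalP Z))).
have toE A (Z : sub_functor chart_sub A) : chart_from (to A Z) = sval Z.
  exact: (svalP (cid (chart_from_surj (svalP Z)))).
have to_nat A B (u : hom A B) (Z : sub_functor chart_sub A) : to B (res u Z) = res u (to A Z).
  by apply: chart_from_inj; rewrite toE chart_from_res toE.
pose from (A : calg K) (t : Spec chart_alg A) : sub_functor chart_sub A :=
  exist _ (chart_from t) (chart_of_hom t).
have from_nat A B (u : hom A B) (t : Spec chart_alg A) : from B (res u t) = res u (from A t).
  by apply: exist_eq; exact: chart_from_res.
exists (Mor to_nat), (Mor from_nat); split=> A.
  by move=> Z; apply: exist_eq; exact: toE.
by move=> t; apply: chart_from_inj; exact: toE.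
Qed.

(** Slice points are unique, so those found on a cover glue. *)
Lemma chart_sub_local : is_local chart_sub.
Proof.
move=> A Z hZ.
pose S (B : calg K) (u : hom A B) := chart_sub B (res u Z).
pose s (B : calg K) (u : hom A B) (h : S B u) : Spec chart_alg B :=
  sval (cid (chart_from_surj h)).
have sE B (u : hom A B) (h : S B u) : chart_from (s B u h) = res u Z.
  exact: (svalP (cid (chart_from_surj h))).
have [||t [ht _]] := @Spec_sheaf K chart_alg A S s _ hZ.
- by move=> B D v u h; rewrite /S res_comp; exact: mem_res.
- by move=> B D v u h h'; apply: chart_from_inj; rewrite sE chart_from_res sE res_comp.
suff <- : chart_from t = Z by exact: chart_of_hom.
apply: hilb_pt_ext; apply: locally_sub hZ => B u h.
rewrite -chart_from_res -(sE B u h); congr chart_from; exact: (ht B u h).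
Qed.

Lemma chart_near_good (B : calg K) (q : hom B (base K)) (al : adhm c d B) (g : pregood al)
    (Q' : 'M[K]_c) (s0 : 'M[K]_d) :
  map_mx q (\matrix_j (tl (aT al) *m mono (aT al) (dl j))) *m Q' = 1%:M ->
  map_mx q (aF al) *m Q' *m colsel J K *m s0 = 1%:M ->
  nbhd q (fun D v => chart_sub D (res v (pi B (Ppt k g)))).
Proof.
move=> e1 e2; have nn := normalize_near n k g e1 e2.
apply: nbhd_sub nn => D v [M [hM o]].
exists M, hM; rewrite -mor_nat; apply: hilb_invariant; apply: same_orbit_sym.
by rewrite Phi_pt_res.
Qed.

Lemma map_minors (A B : calg K) (r : hom A B) (be : adhm c d A) :
  map_mx r (\matrix_j (tl (aT be) *m mono (aT be) (dl j))) =
  \matrix_j (tl (aT (amap r be)) *m mono (aT (amap r be)) (dl j)).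
Proof. by apply/row_matrixP => j; rewrite -map_row !rowK map_mxM -map_mono. Qed.

(** The local lift may belong to another constant than k. At the given point it is conjugate to a
    slice representation, so its pencil at k and the required minors are invertible there, hence
    nearby, and [normalize_near] applies to the normal form for k. *)
Lemma chart_open : is_open chart_sub.
Proof.
apply: (open_crit chart_sub_local) => A Z p [M0 [hM0 e0]].
have [k1 lift] := hilb_lift_chart n_gt0 c_gt0 ec h1 h2 h2' h3 h4 h5 Z p.
apply: nbhd_trans; apply: nbhd_sub lift => B u [al [g e]] q eq.
set x := Phi_pt _ _ _ _ _ _ _ _ _ _ in e.
have o : same_orbit (sval (sval (res q x)) : frep n c d K) (Phi n k (slice_adhm J M0)).
  have e1 : pi _ (res q x) = pi _ (slice_pt hM0) by rewrite mor_nat e e0 -res_comp eq.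
  by have := nbhd_pt (hilb_orbit (hom_id (base K)) e1); rewrite !res_id.
have rx : relations (sval (sval x)) := svalP (sval x).
have sx : stable th1 th2 th3 th4 (frep_map q (sval (sval x)) : frep n c d K) := svalP x q.
(* Invertibility of A1 + k A2 is invariant under the group, and for a slice representation this sum
   is the identity. *)
have pen : (fA1 (frep_map q (sval (sval x))) + k *: fA2 (frep_map q (sval (sval x))) : 'M[K]_c) \in unitmx.
  have [g1 [g2 [g3 [g4 [[[g1' [_ i1]] _ _ _] [[o1 o2 _] _]]]]]] := o.
  have op := orbit_pencil k o1 o2; rewrite [X in X *m _]subrK mul1mx in op.
  have : (g1' *m g2) *m (fA1 (frep_map q (sval (sval x))) + k *: fA2 (frep_map q (sval (sval x))) : 'M[K]_c) = 1%:M.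
    by rewrite -mulmxA -[g2 *m _]op.
  by case/mulmx1_unit.
have nf := normal_form_near n_gt0 c_gt0 ec h1 h2 h2' h3 h4 h5 rx sx pen.
apply: nbhd_trans; apply: nbhd_sub nf => D v [be [gb ob]] r er.
have eZ : pi D (Ppt k (good_pregood gb)) = res (hom_comp v u) Z.
  rewrite res_comp -e -mor_nat; apply: hilb_invariant; exact: same_orbit_sym ob.
have o' : same_orbit (Phi n k (amap r be)) (Phi n k (slice_adhm J M0)).
  apply: same_orbit_trans (same_orbit_sym _) o.
  have e3 : frep_map r (Phi n (calg_str D k) be) = Phi n k (amap r be) by rewrite Phi_map homK.
  have e4 : frep_map r (frep_map v (sval (sval x))) = frep_map q (sval (sval x)).
    by rewrite -frep_map_comp er.
  by have := same_orbit_map r ob; rewrite e3 e4 => h; exact: h.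
have [g' [g3 [[gi [ggi _]] [g3i [_ _]] hg f]]] := orbit_intertwines n_gt0 o'.
have := @chart_near_good D r be (good_pregood gb) gi g3; rewrite eZ => cn.
apply: nbhd_sub (cn _ _) => [E w||]; first by rewrite !res_comp.
  rewrite map_minors (_ : (\matrix_j _) = g') //.
  exact: slice_row hM0 hg.
have f' : map_mx r (aF be) = aF (amap r be) by [].
apply: mulmx1C; rewrite f' !mulmxA -f -(mulmxA _ g') ggi mulmx1.
by have [_ _ a3 _ _] := hM0.
Qed.
End OneChart.

(** At a closed point of a local lift, suitable monomials and columns exist by [monomial_basis] and
    [column_basis]; the corresponding chart contains a neighbourhood. *)
Lemma chart_cover (B : calg K) (Z : H B) : locally (fun D (u : hom B D) =>
  exists (k : 'I_c.+1) (dl : {ffun 'I_c -> 'I_c * 'I_c}) (J : {ffun 'I_d -> 'I_c}),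
    chart_sub (k : nat)%:R dl J D (res u Z)).
Proof.
apply: locally_nbhd => p; have [k lift] := hilb_lift_chart n_gt0 c_gt0 ec h1 h2 h2' h3 h4 h5 Z p.
apply: nbhd_trans; apply: nbhd_sub lift => A u [al [g e]] q _.
have [cq _ _ [Rq hR]] := pregood_map q (good_pregood g).
have [dl hdl] := monomial_basis c_gt0 cq.
set Q := (\matrix_j _ : 'M_c) in hdl.
have hF : map_mx q (aF al) *m invmx Q *m (Q *m Rq) = 1%:M.
  by rewrite mulmxA mulmxKV.
have [J hJ] := column_basis hF.
have cn := @chart_near_good (k : nat)%:R dl J A q al (good_pregood g) (invmx Q)
  (invmx (map_mx q (aF al) *m invmx Q *m colsel J K)).
apply: nbhd_sub (cn _ _) => [E w hw||].
- by exists k, dl, J; move: hw; rewrite e -res_comp.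
- by rewrite map_minors mulmxV.
- by rewrite mulmxV.
Qed.

Lemma hilb_scheme : is_scheme H.
Proof.
split; first exact: hilb_sheaf.
pose I := ('I_c.+1 * {ffun 'I_c -> 'I_c * 'I_c} * {ffun 'I_d -> 'I_c})%type.
pose ch (i : I) := chart_sub (i.1.1 : nat)%:R i.1.2 i.2.
pose al (i : I) := chart_alg i.1.2 i.2.
exists #|{: I}|, (fun j => ch (enum_val j)), (fun j => al (enum_val j)).
split=> [j|j|B Z]; [exact: chart_open|exact: chart_iso|].
apply: locally_sub (chart_cover Z) => D u [k [dl [J h]]].
by exists (enum_rank ((k, dl, J) : I)); rewrite enum_rankK.
Qed.
End Charts.

Theorem theorem16 (R : realType) (n c c' : nat)
    (hn : (1 <= n)%N) (hc : (1 <= c)%N) (hc' : (c' <= c)%N)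
    (th1 th2 th3 th4 : R)
    (h1 : 0 < th1) (h2 : - th1 < th2)
    (h2' : th2 < - ((c%:R - 1) / c%:R) * th1)
    (h3 : th3 < 0) (h4 : th4 < 0)
    (h5 : 0 < th1 + th2 + (th3 + th4) * (c - c')%:R) :
  (exists (M : functor R[i]) (pi : mor (stable_reps th1 th2 th3 th4 n c (c - c')) M),
     is_moduli_space pi) /\
  (forall (M : functor R[i]) (pi : mor (stable_reps th1 th2 th3 th4 n c (c - c')) M),
     is_moduli_space pi -> iso M (nested_Hilb (Xi R[i] n) c' c)).
Proof.
have ec : c = (c - c' + c')%N by rewrite subnK.
have sch := hilb_scheme hn hc ec h1 h2 h2' h3 h4 h5.
have quo := hilb_quotient hn hc ec h1 h2 h2' h3 h4 h5.
(* Existence: the nested Hilbert scheme is itself a moduli space. Uniqueness of geometric quotients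
   then handles an arbitrary M. *)
split=> [|M pi [schM quoM]].
  by exists (nested_Hilb (Xi R[i] n) c' c), (hilb_map hn hc ec h1 h2 h2' h3 h4 h5).
exact: gq_unique schM sch quoM quo.
Qed.
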